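(* Assume the setting and Conditions (C1)–(C4) of the context, and in addition Conditions (C6) and (C7); fix $D\ge1$, $M>0$. Then for every $d=1,\ldots,D$, $$\sup_{\mathbf{v}=(\mathbf{t},\mathbf{x})\in\mathcal{V}_d'}\Big|\hat W_n(\mathbf{v})-W_n(\mathbf{v})+\sum_{j=1}^d\dot R_{\mathbf{t},j}(\mathbf{x})\,W_n(t_j,x_j)\Big|\xrightarrow{p}0,\qquad n\to\infty.$$ Consequently $\hat W_n\rightsquigarrow\hat W$ in $\ell^\infty(\mathcal{V}')$, where $\hat W(\mathbf{t},\mathbf{x})=W(\mathbf{t},\mathbf{x})-\sum_{j=1}^d\dot R_{\mathbf{t},j}(\mathbf{x})W(t_j,x_j)$ for $(\mathbf{t},\mathbf{x})\in\mathcal{V}_d'$, with $W$ the centered Gaussian process of the context. Almost all trajectories of $\hat W$ are uniformly $\hat\rho_2$-continuous on $\mathcal{V}'$, where $\hat\rho_2(\mathbf{v}_1,\mathbf{v}_2)=(\mathbb{E}[\{\hat W(\mathbf{v}_1)-\hat W(\mathbf{v}_2)\}^2])^{1/2}$.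
   Context: $(T,\rho)$ compact metric space; $\xi_1,\xi_2,\ldots$ i.i.d. random elements of $C(T)$ (sup norm, Borel $\sigma$-field); $F_t(x)=\mathbb{P}\{\xi_1(t)\le x\}$. (C1) Each $F_t$ continuous; $U_i(t)=1-F_t(\xi_i(t))$. (C2) $k=k_n\in(0,n]$, $k\to\infty$, $k/n\to0$. (C3) For $m=2,\ldots,2D$, $\mathbf{t}\in T^m$, $\mathbf{x}\in[0,\infty)^m$: $R_{\mathbf{t}}(\mathbf{x})=\lim_{s\downarrow0}s^{-1}\mathbb{P}\{U_1(t_1)\le sx_1,\ldots,U_1(t_m)\le sx_m\}$ exists; $R_t(x)=x$. (C4) There exist positive $c_1,c_2,u_0,\varepsilon_0$ and for every $\varepsilon\in(0,\varepsilon_0]$ a covering $T=\bigcup_{j=1}^{N_{T,\varepsilon}}T_{\varepsilon,j}$ with $\mathbb{P}[\sup_{t\in T_{\varepsilon,j}}U_1(t)>ue^{c_1\varepsilon^2}\mid\inf_{t\in T_{\varepsilon,j}}U_1(t)\le u]\le c_2\varepsilon^2$ for all $u\in(0,u_0]$, $\varepsilon\in(0,\varepsilon_0]$, $j$, and $\int_0^1\sqrt{\log N_{T,\varepsilon}}\,d\varepsilon<\infty$. Notation: $\mathcal{V}_d=T^d\times[0,M]^d$, $\mathcal{V}=\bigcup_{d\le D}\mathcal{V}_d$; $\mathcal{V}_d'$ is the set of $(\mathbf{t},\mathbf{x})\in\mathcal{V}_d$ whose $d$ coordinates of $\mathbf{t}$ are pairwise distinct, $\mathcal{V}'=\bigcup_{d\le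 D}\mathcal{V}_d'$. $G_{n,\mathbf{t}}(\mathbf{x})=\frac1k\sum_{i=1}^n\mathbb{1}\{\forall j:U_i(t_j)<\frac knx_j\}$; $E_{n,\mathbf{t}}(\mathbf{x})=\frac nk\mathbb{P}\{\forall j:U_1(t_j)<\frac knx_j\}$ for $\mathbf{x}\in[0,\infty)^d$; $W_n(\mathbf{v})=\sqrt k\{G_{n,\mathbf{t}}(\mathbf{x})-E_{n,\mathbf{t}}(\mathbf{x})\}$. $W$ is the centered Gaussian process on $\mathcal{V}$ with covariance $\mathbb{E}[W(\mathbf{t}_1,\mathbf{x}_1)W(\mathbf{t}_2,\mathbf{x}_2)]=R_{\mathbf{t}_1,\mathbf{t}_2}(\mathbf{x}_1,\mathbf{x}_2)$ (concatenated arguments), taken in its version with uniformly $\rho_2$-continuous paths, $\rho_2$ its standard deviation semimetric. For $(t,x)\in T\times[0,M]$, $W_n(t,x)$ and $W(t,x)$ refer to the $d=1$ index. Ranks: $\operatorname{rank}_{n,i}(t)=\sum_{\alpha=1}^n\mathbb{1}\{\xi_\alpha(t)\le\xi_i(t)\}$. Empirical tail copula: $\hat R_{n,\mathbf{t}}(\mathbf{x})=\frac1k\sum_{i=1}^n\mathbb{1}\{\forall j=1,\ldots,d:\operatorname{rank}_{n,i}(t_j)>n-kx_j+1\}$; $\hat W_n(\mathbf{v})=\sqrt k\{\hat R_{n,\mathbf{t}}(\mathbf{x})-E_{n,\mathbf{t}}(\mathbf{x})\}$. $\dot R_{\mathbf{t},j}(\mathbf{x})$ denotes the partial derivative of $R_{\mathbf{t}}$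 with respect to $x_j$ (the right-hand partial derivative if $x_j=0$). $\rho_{2,T}(s,t)=[2\{1-R_{s,t}(1,1)\}]^{1/2}$ on $T$. (C6) (R1) $R_{s,t}(1,1)<1$ whenever $s\ne t$; (R2) the metric space $(T,\rho_{2,T})$ is complete; (R3) for all $d\le D$, $j\le d$ and $\mathbf{t}\in T^d$ with pairwise distinct coordinates, $\dot R_{\mathbf{t},j}$ exists and is continuous on $\{\mathbf{x}\in[0,\infty)^d:x_j>0\}$. (C7) Setting $E_{n,\mathbf{t}}(\mathbf{x})=R_{\mathbf{t}}(\mathbf{x})=0$ if some coordinate of $\mathbf{x}$ is negative: for all $d\le D$ and all $K,M>0$, $\sup_{\mathbf{t}\in T^d,\mathbf{x}\in[0,M]^d,\mathbf{h}\in[-K,K]^d}|\sqrt k\{E_{n,\mathbf{t}}(\mathbf{x}+\mathbf{h}/\sqrt k)-E_{n,\mathbf{t}}(\mathbf{x})\}-\sqrt k\{R_{\mathbf{t}}(\mathbf{x}+\mathbf{h}/\sqrt k)-R_{\mathbf{t}}(\mathbf{x})\}|\to0$. *)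

(* Defs.v *)
From HB Require Import structures.
From mathcomp Require Import all_boot all_order all_algebra.
From mathcomp Require Import all_classical all_reals all_analysis.
Set Implicit Arguments. Unset Strict Implicit. Unset Printing Implicit Defensive.
Import Order.TTheory GRing.Theory Num.Theory.
Import numFieldNormedType.Exports.
Local Open Scope classical_set_scope.
Local Open Scope ring_scope.

Section Defs.
Context {R : realType}.

(* A subset of C(T) (represented by sets of functions T -> R, intersected
   with the continuous ones) open for the sup-norm topology. For T compact,
   sup_t |f t - g t| < e iff |f t - g t| < e for all t, f, g continuous. *)
Definition sup_open {T : topologicalType} (A : set (T -> R)) : Prop :=
  forall f, A f -> continuous f -> exists2 e : R, 0 < e &
    forall g, continuous g -> (forall t, `|f t - g t| < e) -> A g.

Definition CBorel {T : topologicalType} : set (set (T -> R)) :=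
  <<s [set A | sup_open A] >>.

Definition rand_elem {T : topologicalType} {d} {Om : measurableType d}
  (X : Om -> T -> R) : Prop :=
  (forall w, continuous (X w)) /\
  forall A, CBorel A -> measurable (X @^-1` A).

(* xi_1, xi_2, ... (indexed here from 0) i.i.d. random elements of C(T) *)
Definition iid {T : topologicalType} {d} {Om : measurableType d}
  (P : probability Om R) (xi : nat -> Om -> T -> R) : Prop :=
  (forall i, rand_elem (xi i)) /\
  (forall n (B : 'I_n -> set (T -> R)), (forall i, CBorel (B i)) ->
     P (\big[setI/setT]_(i < n) (xi i @^-1` B i)) =
     (\prod_(i < n) P (xi i @^-1` B i))%E) /\
  (forall i B, CBorel B -> P (xi i @^-1` B) = P (xi 0%N @^-1` B)).

Definition cdfF {T : topologicalType} {d} {Om : measurableType d}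
  (P : probability Om R) (xi : nat -> Om -> T -> R) (t : T) (x : R) : R :=
  fine (P [set w | xi 0%N w t <= x]).

Definition Uf {T : topologicalType} {d} {Om : measurableType d}
  (P : probability Om R) (xi : nat -> Om -> T -> R) (i : nat) (w : Om) (t : T)
  : R := 1 - cdfF P xi t (xi i w t).

Definition Rquot {T : topologicalType} {d} {Om : measurableType d}
  (P : probability Om R) (xi : nat -> Om -> T -> R) (m : nat)
  (t : 'I_m -> T) (x : 'I_m -> R) (s : R) : R :=
  s^-1 * fine (P [set w | forall j, Uf P xi 0 w (t j) <= s * x j]).

Definition Rtc {T : topologicalType} {d} {Om : measurableType d}
  (P : probability Om R) (xi : nat -> Om -> T -> R) (m : nat)
  (t : 'I_m -> T) (x : 'I_m -> R) : R :=
  lim (Rquot P xi t x s @[s --> 0^'+]).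

Definition catf {A : Type} (m1 m2 : nat) (f : 'I_m1 -> A) (g : 'I_m2 -> A)
  : 'I_(m1 + m2) -> A :=
  fun i => match fintype.split i with inl a => f a | inr b => g b end.

Definition upd (m : nat) (x : 'I_m -> R) (j : 'I_m) (h : R) : 'I_m -> R :=
  fun i => if i == j then x i + h else x i.

Definition Rdiffq {T : topologicalType} {d} {Om : measurableType d}
  (P : probability Om R) (xi : nat -> Om -> T -> R) (m : nat)
  (t : 'I_m -> T) (j : 'I_m) (x : 'I_m -> R) (h : R) : R :=
  (Rtc P xi t (upd x j h) - Rtc P xi t x) / h.

Definition Rdot {T : topologicalType} {d} {Om : measurableType d}
  (P : probability Om R) (xi : nat -> Om -> T -> R) (m : nat)
  (t : 'I_m -> T) (j : 'I_m) (x : 'I_m -> R) : R :=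
  if 0 < x j then lim (Rdiffq P xi t j x h @[h --> 0^'])
  else lim (Rdiffq P xi t j x h @[h --> 0^'+]).

Definition Eemp {T : topologicalType} {d} {Om : measurableType d}
  (P : probability Om R) (xi : nat -> Om -> T -> R) (k : nat -> R) (n : nat)
  (m : nat) (t : 'I_m -> T) (x : 'I_m -> R) : R :=
  n%:R / k n *
  fine (P [set w | forall j, Uf P xi 0 w (t j) < k n / n%:R * x j]).

Definition Gemp {T : topologicalType} {d} {Om : measurableType d}
  (P : probability Om R) (xi : nat -> Om -> T -> R) (k : nat -> R) (n : nat)
  (m : nat) (t : 'I_m -> T) (x : 'I_m -> R) (w : Om) : R :=
  (k n)^-1 * \sum_(i < n)
     (if `[< forall j, Uf P xi i w (t j) < k n / n%:R * x j >] then 1 else 0).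

Definition Wemp {T : topologicalType} {d} {Om : measurableType d}
  (P : probability Om R) (xi : nat -> Om -> T -> R) (k : nat -> R) (n : nat)
  (m : nat) (t : 'I_m -> T) (x : 'I_m -> R) (w : Om) : R :=
  Num.sqrt (k n) * (Gemp P xi k n t x w - Eemp P xi k n t x).

Definition rankn {T : Type} {Om : Type} (xi : nat -> Om -> T -> R) (n i : nat)
  (t : T) (w : Om) : nat :=
  (\sum_(a < n) ((xi a w t <= xi i w t)%R : nat))%N.

Definition Rhat {T : Type} {Om : Type} (xi : nat -> Om -> T -> R)
  (k : nat -> R) (n : nat) (m : nat) (t : 'I_m -> T) (x : 'I_m -> R) (w : Om)
  : R :=
  (k n)^-1 * \sum_(i < n)
     (if `[< forall j, (rankn xi n i (t j) w)%:R > n%:R - k n * x j + 1 >]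
      then 1 else 0).

Definition What {T : topologicalType} {d} {Om : measurableType d}
  (P : probability Om R) (xi : nat -> Om -> T -> R) (k : nat -> R) (n : nat)
  (m : nat) (t : 'I_m -> T) (x : 'I_m -> R) (w : Om) : R :=
  Num.sqrt (k n) * (Rhat xi k n t x w - Eemp P xi k n t x).

Definition outerP {d} {Om : measurableType d} (P : probability Om R)
  (A : set Om) : \bar R :=
  ereal_inf [set P B | B in [set B | measurable B /\ A `<=` B]].

Definition outerE {d} {Om : measurableType d} (P : probability Om R)
  (f : Om -> R) : \bar R :=
  ereal_inf [set ('E_P[g])%E | g in [set g : Om -> R | measurable_fun setT g /\
      (exists C : R, forall w, `|g w| <= C) /\ forall w, f w <= g w]].

Definition Vidx (T : Type) := {m : nat & (('I_m -> T) * ('I_m -> R))%type}.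

Definition mkV {T : Type} (m : nat) (t : 'I_m -> T) (x : 'I_m -> R)
  : Vidx T := existT _ m (t, x).

Definition inV {T : Type} (D : nat) (M : R) (v : Vidx T) : Prop :=
  (0 < projT1 v <= D)%N /\ forall i, 0 <= (projT2 v).2 i <= M.

Definition inV' {T : Type} (D : nat) (M : R) (v : Vidx T) : Prop :=
  inV D M v /\ injective (projT2 v).1.

Definition WhatV {T : topologicalType} {d} {Om : measurableType d}
  (P : probability Om R) (xi : nat -> Om -> T -> R) (k : nat -> R) (n : nat)
  (w : Om) (v : Vidx T) : R :=
  match v with existT m (t, x) => What P xi k n t x w end.

Definition CovR {T : topologicalType} {d} {Om : measurableType d}
  (P : probability Om R) (xi : nat -> Om -> T -> R) (v1 v2 : Vidx T) : R :=
  match v1, v2 with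
  | existT m1 (t1, x1), existT m2 (t2, x2) =>
      Rtc P xi (catf t1 t2) (catf x1 x2)
  end.

(* centered Gaussian process on the index set S with covariance Cov,
   via characteristic functions of all finite linear combinations *)
Definition gaussian_process {I : Type} {d} {Om : measurableType d}
  (P : probability Om R) (W : Om -> I -> R) (Cov : I -> I -> R) (S : set I)
  : Prop :=
  (forall v, S v -> measurable_fun setT (fun w => W w v)) /\
  forall m (v : 'I_m -> I) (a : 'I_m -> R), (forall i, S (v i)) ->
    ('E_P[fun w => cos (\sum_(i < m) a i * W w (v i))%R])%E =
      (expR (- (\sum_(i < m) \sum_(j < m) a i * a j * Cov (v i) (v j)) / 2))%:E
    /\ ('E_P[fun w => sin (\sum_(i < m) a i * W w (v i))%R])%E = 0%E.

Definition sd_semimetric {I : Type} {d} {Om : measurableType d}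
  (P : probability Om R) (W : Om -> I -> R) (v1 v2 : I) : R :=
  Num.sqrt (fine ('E_P[fun w => ((W w v1 - W w v2) ^+ 2)%R])%E).

Definition unif_cont {I : Type} (S : set I) (rho : I -> I -> R) (f : I -> R)
  : Prop :=
  forall e : R, 0 < e -> exists2 dl : R, 0 < dl &
    forall v1 v2, S v1 -> S v2 -> rho v1 v2 < dl -> `|f v1 - f v2| < e.

Definition WhatLim {T : topologicalType} {d} {Om : measurableType d}
  (P : probability Om R) (xi : nat -> Om -> T -> R)
  {d'} {Om' : measurableType d'} (W : Om' -> Vidx T -> R)
  (w : Om') (v : Vidx T) : R :=
  match v with existT m (t, x) =>
    W w (mkV t x) -
    \sum_(j < m) Rdot P xi t j x * W w (mkV (fun _ : 'I_1 => t j) (fun _ => x j))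
  end.

Definition bnd {I : Type} (S : set I) (f : I -> R) : Prop :=
  exists C : R, forall v, S v -> `|f v| <= C.

Definition supd {I : Type} (S : set I) (f g : I -> R) : \bar R :=
  ereal_sup [set (`|f v - g v|)%:E | v in S].

Definition linf_open {I : Type} (S : set I) (A : set (I -> R)) : Prop :=
  forall f, A f -> bnd S f -> exists2 dl : R, 0 < dl &
    forall g, bnd S g -> (supd S f g < dl%:E)%E -> A g.

Definition linf_borel {I : Type} {d} {Om : measurableType d} (S : set I)
  (X : Om -> I -> R) : Prop :=
  forall A, linf_open S A -> measurable [set w | bnd S (X w) /\ A (X w)].

Definition bcont {I : Type} (S : set I) (h : (I -> R) -> R) : Prop :=
  (exists C : R, forall f, `|h f| <= C) /\
  forall f, bnd S f -> forall e : R, 0 < e -> exists2 dl : R, 0 < dl &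
    forall g, bnd S g -> (supd S f g < dl%:E)%E -> `|h f - h g| < e.

Definition weak_conv {I : Type} {d} {Om : measurableType d}
  (P : probability Om R) (Xn : nat -> Om -> I -> R)
  {d'} {Om' : measurableType d'} (P' : probability Om' R) (X : Om' -> I -> R)
  (S : set I) : Prop :=
  linf_borel S X /\
  forall h, bcont S h ->
    outerE P (fun w => h (Xn n w)) @[n --> \oo] --> ('E_P'[fun w => h (X w)])%E.

Definition C1 {T : topologicalType} {d} {Om : measurableType d}
  (P : probability Om R) (xi : nat -> Om -> T -> R) : Prop :=
  forall t, continuous (cdfF P xi t).

Definition C2 (k : nat -> R) : Prop :=
  (forall n, (0 < n)%N -> 0 < k n <= n%:R) /\
  k n @[n --> \oo] --> +oo /\
  k n / n%:R @[n --> \oo] --> 0.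

Definition C3 {T : topologicalType} {d} {Om : measurableType d}
  (P : probability Om R) (xi : nat -> Om -> T -> R) (D : nat) : Prop :=
  forall m, (2 <= m <= 2 * D)%N -> forall (t : 'I_m -> T) (x : 'I_m -> R),
    (forall j, 0 <= x j) -> exists l : R, Rquot P xi t x s @[s --> 0^'+] --> l.

Definition C4 {T : topologicalType} {d} {Om : measurableType d}
  (P : probability Om R) (xi : nat -> Om -> T -> R) : Prop :=
  exists c1 c2 u0 e0 : R, [/\ 0 < c1, 0 < c2, 0 < u0 & 0 < e0] /\
  exists (N : R -> nat) (Tc : R -> nat -> set T),
    (forall e, 0 < e -> \bigcup_(j in `I_(N e)) Tc e j = setT) /\
    (forall e u j, 0 < e <= e0 -> 0 < u <= u0 -> (j < N e)%N ->
       let Sw := fun w => [set Uf P xi 0 w t | t in Tc e j] in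
       let Asup := [set w | u * expR (c1 * e ^+ 2) < sup (Sw w)] in
       let Binf := [set w | inf (Sw w) <= u] in
       (P (Asup `&` Binf) <= (c2 * e ^+ 2)%:E * P Binf)%E)
    /\ (\int[lebesgue_measure]_(e in `]0%R, 1%R]%classic) (Num.sqrt (ln (N e)%:R))%:E < +oo)%E.

Definition rho2T {T : topologicalType} {d} {Om : measurableType d}
  (P : probability Om R) (xi : nat -> Om -> T -> R) (s t : T) : R :=
  Num.sqrt (2 * (1 - Rtc P xi (catf (fun _ : 'I_1 => s) (fun _ : 'I_1 => t))
                                  (fun _ => 1))).

Definition C6 {T : topologicalType} {d} {Om : measurableType d}
  (P : probability Om R) (xi : nat -> Om -> T -> R) (D : nat) : Prop :=
  (forall s t : T, s <> t ->
     Rtc P xi (catf (fun _ : 'I_1 => s) (fun _ : 'I_1 => t)) (fun _ => 1) < 1)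
  /\
  (forall u : nat -> T,
     (forall e : R, 0 < e -> exists N : nat, forall m n, (N <= m)%N -> (N <= n)%N ->
        rho2T P xi (u m) (u n) < e) ->
     exists t : T, rho2T P xi (u n) t @[n --> \oo] --> 0)
  /\
  (forall m, (0 < m <= D)%N -> forall (t : 'I_m -> T) (j : 'I_m), injective t ->
     let S := [set x : 'I_m -> R | (forall i, 0 <= x i) /\ 0 < x j] in
     (forall x, S x -> exists l : R, Rdiffq P xi t j x h @[h --> 0^'] --> l) /\
     (forall x, S x -> forall e : R, 0 < e -> exists2 dl : R, 0 < dl &
        forall y, S y -> (forall i, `|x i - y i| < dl) ->
          `|Rdot P xi t j y - Rdot P xi t j x| < e)).

Definition Eext {T : topologicalType} {d} {Om : measurableType d}
  (P : probability Om R) (xi : nat -> Om -> T -> R) (k : nat -> R) (n : nat)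
  (m : nat) (t : 'I_m -> T) (x : 'I_m -> R) : R :=
  if `[< forall i, 0 <= x i >] then Eemp P xi k n t x else 0.

Definition Rext {T : topologicalType} {d} {Om : measurableType d}
  (P : probability Om R) (xi : nat -> Om -> T -> R)
  (m : nat) (t : 'I_m -> T) (x : 'I_m -> R) : R :=
  if `[< forall i, 0 <= x i >] then Rtc P xi t x else 0.

Definition C7 {T : topologicalType} {d} {Om : measurableType d}
  (P : probability Om R) (xi : nat -> Om -> T -> R) (k : nat -> R) (D : nat)
  : Prop :=
  forall m, (0 < m <= D)%N -> forall K M : R, 0 < K -> 0 < M ->
  forall e : R, 0 < e -> \forall n \near \oo,
    forall (t : 'I_m -> T) (x h : 'I_m -> R),
      (forall i, 0 <= x i <= M) -> (forall i, - K <= h i <= K) ->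
      let xh := fun i => x i + h i / Num.sqrt (k n) in
      `| Num.sqrt (k n) * (Eext P xi k n t xh - Eext P xi k n t x)
         - Num.sqrt (k n) * (Rext P xi t xh - Rext P xi t x) | <= e.

End Defs.

(* Main.v *)
(* The expansion rests on the sandwich G_n(x + h^-/sqrt k) <= R^_n(x) <= G_n(x + h^+/sqrt k),
   where h^+- _j = - W_n(t_j, x_j) +- eta: up to the asymptotic equicontinuity of W_n, a rank exceeds
   n - k x_j + 1 iff U falls below (k/n)(x_j - W_n(t_j, x_j)/sqrt k).  Condition (C7) replaces
   E_n by R, and the difference quotients of R converge to the directional derivative uniformly over
   all t with distinct coordinates: R is concave, and coordinates t_i, t_j that are close
   can be merged since h_i and h_j are then close as well.

   Equicontinuity comes from chaining along brackets.  By homogeneity a bracket for the single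
   variable U(t) at level u costs c u eps^2, so the entropy condition in (C4) is the one for
   brackets of size eps^2, and the Bernstein inequality controls each link as long as its typical
   size exceeds k^(-1/2).

   W is only known through the characteristic functions of its finite-dimensional laws, so
   convergence of E F(W_n) for bounded Lipschitz F is obtained by approximating F by trigonometric
   polynomials, with an error that grows quadratically and is thus controlled by second moments.
   Bounded continuous functionals on l^infty are monotone limits of Lipschitz ones by
   inf-convolution, and Lipschitz ones depend, up to small errors, on finitely many coordinates. *)
Require Import Defs.
From HB Require Import structures.
From mathcomp Require Import all_boot all_order all_algebra.
From mathcomp Require Import all_classical all_reals all_analysis.
From mathcomp Require Import measurable_realfun.
From mathcomp Require Import ring lra zify.
Import Order.TTheory GRing.Theory Num.Theory.
Import numFieldNormedType.Exports.
Local Open Scope classical_set_scope.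
Local Open Scope ring_scope.

Set Implicit Arguments.
Unset Strict Implicit.
Unset Printing Implicit Defensive.

(** * Bounded expectations *)

(** The difference quotients of R must converge uniformly over all t with distinct coordinates, but
    the derivatives need not extend continuously when coordinates merge: R_{t,t}(x,y) = min(x,y) is
    not differentiable on the diagonal. The compactness used is that of rho_{2,T}, totally bounded
    by (C4) and complete by (R2), and its limit points may have coinciding coordinates. So the
    compactness argument is run on the symmetric second difference of R, which makes sense at every
    t and, for a concave function, dominates the error of the linear approximation. Concavity is not
    read off a spectral measure: cutting events {U <= s y} into geometric shells turns homogeneity
    into the supergradient inequality R(y) - R(x) <= sum_j g_j (y_j - x_j) wherever the partial
    derivatives exist. For the same reason the coefficients of hat W are bounded by 1 but may fail
    to be uniformly continuous in the index. The map from W to hat W enters only as a Lipschitz map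
    for the sup norm, and continuity of hat W in its own semimetric is obtained from partitions into
    finitely many cells. *)

Section Indicators.
Context {R : realType} {T : Type}.
Implicit Types A B : set T.

Lemma ind1 A x : A x -> \1_A x = 1 :> R.
Proof. by move=> Ax; rewrite indicE mem_set. Qed.

Lemma ind0 A x : ~ A x -> \1_A x = 0 :> R.
Proof. by move=> Ax; rewrite indicE memNset. Qed.

Lemma ind_ge0 A x : 0 <= \1_A x :> R.
Proof. by rewrite indicE. Qed.

Lemma ind_le1 A x : \1_A x <= 1 :> R.
Proof. by rewrite indicE; case: (_ \in _). Qed.

Lemma ind_le A B x : (A x -> B x) -> \1_A x <= \1_B x :> R.
Proof.
move=> AB; have [Ax|nAx] := pselect (A x); last by rewrite ind0 ?ind_ge0.
by rewrite !ind1//; exact: AB.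
Qed.

Lemma ifE A x : (if `[< A x >] then 1 else 0 : R) = \1_A x.
Proof. by case: asboolP => Ax; [rewrite ind1|rewrite ind0]. Qed.

End Indicators.

Section BoundedExpectation.
Context {R : realType} {d : measure_display} {Om : measurableType d}.
Variable P : probability Om R.
Implicit Types (f g : Om -> R) (A B : set Om).

Definition ig f := P.-integrable setT (EFin \o f).
(** Bounded measurable functions are stable under all operations applied to the sample, so
    integrability follows from [bm_ig]; integrability alone matters only for squares of the limit
    variables, which are unbounded. *)
Definition bm f := measurable_fun setT f /\ exists C, forall w, `|f w| <= C.
Definition Ex f : R := (\int[P]_w f w)%R.
Definition pr A : R := fine (P A).

Lemma bm_ig f : bm f -> ig f.
Proof.
move=> [mf [C Cf]]; apply: measurable_bounded_integrable => //.
  by apply: le_lt_trans (probability_le1 P measurableT) _; exact: ltry.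
exists C; split; first exact: num_real.
by move=> x Cx w _; exact: le_trans (Cf w) (ltW Cx).
Qed.

Lemma EP_Ex f : ig f -> ('E_P[f] = (Ex f)%:E)%E.
Proof. by move=> fi; rewrite unlock /Ex /Rintegral fineK// integrable_fin_num. Qed.

Lemma bm_cst c : bm (fun=> c).
Proof. by split; [exact: measurable_cst|exists `|c|]. Qed.

Lemma bm_ind A : measurable A -> bm (\1_A).
Proof.
move=> mA; split; first exact: measurable_indic.
by exists 1 => w; rewrite ger0_norm ?ind_ge0 ?ind_le1.
Qed.

Lemma bmD f g : bm f -> bm g -> bm (fun w => f w + g w).
Proof.
move=> [mf [C Cf]] [mg [D Dg]]; split; first exact: measurable_funD.
by exists (C + D) => w; rewrite (le_trans (ler_normD _ _))// lerD.
Qed.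

Lemma bmM f g : bm f -> bm g -> bm (fun w => f w * g w).
Proof.
move=> [mf [C Cf]] [mg [D Dg]]; split; first exact: measurable_funM.
by exists (C * D) => w; rewrite normrM ler_pM.
Qed.

Lemma bmZ c f : bm f -> bm (fun w => c * f w).
Proof. by move=> bf; apply: bmM => //; exact: bm_cst. Qed.

Lemma bmN f : bm f -> bm (fun w => - f w).
Proof.
by move=> bf; under eq_fun do rewrite -mulN1r; exact: bmZ.
Qed.

Lemma bmB f g : bm f -> bm g -> bm (fun w => f w - g w).
Proof. by move=> bf bg; apply: bmD => //; exact: bmN. Qed.

Lemma bm_sum (I : Type) (r : seq I) (p : pred I) (f : I -> Om -> R) :
  (forall i, p i -> bm (f i)) -> bm (fun w => \sum_(i <- r | p i) f i w).
Proof.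
move=> bf; elim: r => [|i r IH].
  by under eq_fun do rewrite big_nil; exact: bm_cst.
have [pi|npi] := boolP (p i).
  by under eq_fun do rewrite big_cons pi; apply: bmD => //; exact: bf.
by under eq_fun do rewrite big_cons (negbTE npi).
Qed.

Lemma bm_comp (h : R -> R) f : measurable_fun setT h ->
  (forall C, exists D, forall x, `|x| <= C -> `|h x| <= D) -> bm f ->
  bm (fun w => h (f w)).
Proof.
move=> mh bh [mf [C Cf]]; split; first exact: measurableT_comp.
by have [D hD] := bh C; exists D => w; exact: hD.
Qed.

Lemma bm_norm f : bm f -> bm (fun w => `|f w|).
Proof.
move=> [mf [C Cf]]; split; first exact: measurableT_comp.
by exists C => w; rewrite normr_id.
Qed.

Lemma bm_cos f : measurable_fun setT f -> bm (fun w => cos (f w)).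
Proof.
move=> mf; split.
  by apply: measurableT_comp => //; apply: continuous_measurable_fun; exact: continuous_cos.
by exists 1 => w; rewrite ler_norml cos_geN1 cos_le1.
Qed.

Lemma bm_sin f : measurable_fun setT f -> bm (fun w => sin (f w)).
Proof.
move=> mf; split.
  by apply: measurableT_comp => //; apply: continuous_measurable_fun; exact: continuous_sin.
by exists 1 => w; rewrite ler_norml sin_geN1 sin_le1.
Qed.

Lemma bm_expR f : bm f -> bm (fun w => expR (f w)).
Proof.
apply: bm_comp; first by apply: continuous_measurable_fun; exact: continuous_expR.
move=> C; exists (expR C) => x xC; rewrite ger0_norm ?expR_ge0// ler_expR.
exact: le_trans (ler_norm _) xC.
Qed.

Lemma eq_Ex f g : f =1 g -> Ex f = Ex g.
Proof. by move=> fg; congr Ex; exact/funext. Qed.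

Lemma ExD f g : ig f -> ig g -> Ex (fun w => f w + g w) = Ex f + Ex g.
Proof. by move=> fi gi; rewrite /Ex RintegralD. Qed.

Lemma ExB f g : ig f -> ig g -> Ex (fun w => f w - g w) = Ex f - Ex g.
Proof. by move=> fi gi; rewrite /Ex RintegralB. Qed.

Lemma ExZ c f : ig f -> Ex (fun w => c * f w) = c * Ex f.
Proof. by move=> fi; rewrite /Ex RintegralZl. Qed.

Lemma Ex_cst c : Ex (fun=> c) = c.
Proof.
rewrite /Ex Rintegral_cst//; transitivity (c * 1); last exact: mulr1.
by congr (_ * _); exact: (congr1 fine (probability_setT P)).
Qed.

Lemma Ex_sum (I : Type) (r : seq I) (p : pred I) (f : I -> Om -> R) :
  (forall i, p i -> bm (f i)) ->
  Ex (fun w => \sum_(i <- r | p i) f i w) = \sum_(i <- r | p i) Ex (f i).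
Proof.
move=> bf; elim: r => [|i r IH].
  by rewrite big_nil -[RHS](Ex_cst 0); apply: eq_Ex => w; rewrite big_nil.
rewrite big_cons; case: ifPn => pi; last first.
  by rewrite -IH; apply: eq_Ex => w; rewrite big_cons (negbTE pi).
rewrite -IH -ExD; [|exact/bm_ig/bf|exact/bm_ig/bm_sum].
by apply: eq_Ex => w; rewrite big_cons pi.
Qed.

Lemma Ex_le f g : ig f -> ig g -> (forall w, f w <= g w) -> Ex f <= Ex g.
Proof. by move=> fi gi fg; apply: le_Rintegral. Qed.

Lemma Ex_ge0 f : (forall w, 0 <= f w) -> 0 <= Ex f.
Proof. by move=> f0; apply: Rintegral_ge0. Qed.

Lemma Ex_norm f : bm f -> `|Ex f| <= Ex (fun w => `|f w|).
Proof. by move=> bf; apply: le_normr_Rintegral => //; exact: bm_ig. Qed.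

Lemma Ex_normB f g : bm f -> bm g -> `|Ex f - Ex g| <= Ex (fun w => `|f w - g w|).
Proof.
move=> bf bg; rewrite -ExB; [|exact: bm_ig..].
by apply: Ex_norm; exact: bmB.
Qed.

Lemma Ex_norm_le f C : bm f -> (forall w, `|f w| <= C) -> `|Ex f| <= C.
Proof.
move=> bf Cf; apply: le_trans (Ex_norm bf) _.
rewrite -[leRHS](Ex_cst C); apply: Ex_le => //; apply: bm_ig.
  exact: bm_norm.
exact: bm_cst.
Qed.

Lemma Ex_ind A : measurable A -> Ex (\1_A) = pr A.
Proof. by move=> mA; rewrite /Ex /Rintegral integral_indic// setIT. Qed.

Lemma prE A : measurable A -> P A = (pr A)%:E.
Proof. by move=> mA; rewrite /pr fineK// fin_num_measure. Qed.

Lemma pr_ge0 A : 0 <= pr A.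
Proof. by rewrite /pr fine_ge0. Qed.

Lemma prT : pr setT = 1.
Proof. exact: (congr1 fine (probability_setT P)). Qed.

Lemma pr_set0 : pr set0 = 0.
Proof. by rewrite /pr measure0. Qed.

Lemma pr_le A B : measurable A -> measurable B -> A `<=` B -> pr A <= pr B.
Proof. by move=> mA mB AB; rewrite -lee_fin -!prE// le_measure// inE. Qed.

Lemma pr_le1 A : measurable A -> pr A <= 1.
Proof. by move=> mA; rewrite -prT pr_le. Qed.

Lemma prU A B : measurable A -> measurable B -> pr (A `|` B) <= pr A + pr B.
Proof.
move=> mA mB; rewrite -lee_fin EFinD -!prE//; last exact: measurableU.
by rewrite measureU2.
Qed.

Lemma pr_bigU (I : Type) (r : seq I) (p : pred I) (F : I -> set Om) :
  (forall i, measurable (F i)) ->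
  pr (\big[setU/set0]_(i <- r | p i) F i) <= \sum_(i <- r | p i) pr (F i).
Proof.
move=> mF; elim: r => [|i r IH]; first by rewrite !big_nil pr_set0.
rewrite !big_cons; case: ifP => // pi.
apply: le_trans (prU _ _) _ => //; first exact: bigsetU_measurable.
by rewrite lerD2l.
Qed.

(** Reduces a linear inequality between probabilities to one between indicators, that is, to a case
    analysis at a single point. *)
Lemma pr_lin (I : Type) (r : seq I) (c : I -> R) (F : I -> set Om) :
  (forall i, measurable (F i)) ->
  (forall w, 0 <= \sum_(i <- r) c i * \1_(F i) w) ->
  0 <= \sum_(i <- r) c i * pr (F i).
Proof.
move=> mF pos.
have -> : \sum_(i <- r) c i * pr (F i) =
          Ex (fun w => \sum_(i <- r) c i * \1_(F i) w).
  rewrite Ex_sum => [|i _]; last exact/bmZ/bm_ind.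
  by apply: eq_bigr => i _; rewrite ExZ ?Ex_ind//; exact/bm_ig/bm_ind.
exact: Ex_ge0.
Qed.

Lemma markov_bm f a : bm f -> (forall w, 0 <= f w) -> 0 < a ->
  pr [set w | a <= f w] <= Ex f / a.
Proof.
move=> bf f0 a0; rewrite ler_pdivlMr// mulrC.
have mA : measurable [set w | a <= f w].
  by have := measurable_fun_le measurableT (measurable_cst a) bf.1; rewrite setTI.
rewrite -Ex_ind// -ExZ; last exact/bm_ig/bm_ind.
apply: Ex_le; [exact/bm_ig/bmZ/bm_ind|exact: bm_ig|move=> w].
have [fw|nfw] := pselect ([set w | a <= f w] w); first by rewrite ind1 ?mulr1.
by rewrite ind0 ?mulr0.
Qed.

Lemma measurable_gt f a : measurable_fun setT f -> measurable [set w | a < f w].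
Proof.
move=> mf; have -> : [set w | a < f w] = ~` [set w | f w <= a].
  by apply/seteqP; split => w /=; rewrite ltNge => /negP.
apply: measurableC.
by have := measurable_fun_le measurableT mf (measurable_cst a); rewrite setTI.
Qed.

End BoundedExpectation.
(** * Uniform marginals *)

Section SupNormBorel.
Context {R : realType} {T : topologicalType}.
Implicit Types (A B : set (T -> R)).

Lemma CBorel_open A : sup_open A -> CBorel A.
Proof. by move=> oA; apply: sub_sigma_algebra. Qed.

Lemma CBorelC A : CBorel A -> CBorel (~` A).
Proof. exact: sigma_algebraC. Qed.

Lemma CBorel0 : CBorel (set0 : set (T -> R)).
Proof. exact: sigma_algebra0. Qed.

Lemma CBorelT : CBorel (setT : set (T -> R)).
Proof. by rewrite -setC0; apply: CBorelC; exact: CBorel0. Qed.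

Lemma CBorel_bigcup (F : nat -> set (T -> R)) :
  (forall i, CBorel (F i)) -> CBorel (\bigcup_i F i).
Proof. exact: sigma_algebra_bigcup. Qed.

Lemma CBorel_bigcap (F : nat -> set (T -> R)) :
  (forall i, CBorel (F i)) -> CBorel (\bigcap_i F i).
Proof.
move=> FB; rewrite -[\bigcap_i _]setCK setC_bigcap.
by apply: CBorelC; apply: CBorel_bigcup => i; exact: CBorelC.
Qed.

Lemma CBorelU A B : CBorel A -> CBorel B -> CBorel (A `|` B).
Proof.
move=> cA cB; rewrite -bigcup2E; apply: CBorel_bigcup => i; rewrite /bigcup2.
by case: ifP => // _; case: ifP => // _; exact: CBorel0.
Qed.

Lemma CBorelI A B : CBorel A -> CBorel B -> CBorel (A `&` B).
Proof.
move=> cA cB; rewrite -[_ `&` _]setCK setCI.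
by apply: CBorelC; apply: CBorelU; exact: CBorelC.
Qed.

Lemma CBorelD A B : CBorel A -> CBorel B -> CBorel (A `\` B).
Proof. by move=> cA cB; rewrite setDE; apply: CBorelI => //; exact: CBorelC. Qed.

Lemma CBorel_fin_forall (I : finType) (p : pred I) (F : I -> set (T -> R)) :
  (forall i, CBorel (F i)) -> CBorel [set f | forall i, p i -> F i f].
Proof.
move=> FB; have -> : [set f | forall i, p i -> F i f] =
    \big[setI/setT]_(i | p i) F i.
  apply/seteqP; split => f /= Ff.
    by elim/big_ind: _ => // A B.
  move=> i pi; move: Ff; rewrite (bigD1 i)//=; by case.
elim/big_ind: _ => //; [exact: CBorelT|exact: CBorelI].
Qed.

Lemma CBorel_fin_forallT (I : finType) (F : I -> set (T -> R)) :
  (forall i, CBorel (F i)) -> CBorel [set f | forall i, F i f].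
Proof.
move=> FB; have := CBorel_fin_forall predT FB; congr CBorel.
by apply/seteqP; split => f /= Ff i; [exact: Ff|move=> _; exact: Ff].
Qed.

(** The index set may be uncountable: events such as U(t) < y for some t of a cell are open for the
    sup norm, hence measurable, for every cell of a covering. *)
Lemma sup_open_union (I : Type) (S : set I) (F : I -> set (T -> R)) :
  (forall i, sup_open (F i)) -> sup_open [set f | exists2 i, S i & F i f].
Proof.
move=> oF f [i Si Fif] cf; have [e e0 He] := oF _ _ Fif cf.
by exists e => // g cg fg; exists i => //; exact: He.
Qed.

Lemma sup_open_eval (t : T) (h : R -> R) (O : set R) : continuous h -> open O ->
  sup_open [set f : T -> R | O (h (f t))].
Proof.
move=> ch oO f /= Of cf.
have : nbhs (h (f t)) O by exact: open_nbhs_nbhs.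
move=> /ch /nbhs_ballP[e /= e0 He]; exists e => // g cg fg.
by apply: He; rewrite /ball /=; exact: fg.
Qed.

End SupNormBorel.

Section Marginals.
Context {R : realType} {T : topologicalType} {dO : measure_display}
  {Om : measurableType dO}.
Variables (P : probability Om R) (xi : nat -> Om -> T -> R).

(** [uf] is U as a functional on paths and [mu] the law of one observation on path space. Events
    about different observations are then preimages of one and the same set of paths. *)
Definition uf (t : T) (f : T -> R) : R := 1 - cdfF P xi t (f t).
Definition mu (B : set (T -> R)) : R := pr P (xi 0%N @^-1` B).

Lemma UfE i w t : Uf P xi i w t = uf t (xi i w).
Proof. by []. Qed.

Lemma cdfF_ge0 t x : 0 <= cdfF P xi t x.
Proof. exact: pr_ge0. Qed.

Hypothesis Hiid : iid P xi.

Lemma measurable_xi i B : CBorel B -> measurable (xi i @^-1` B).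
Proof. by case: Hiid => /(_ i)[_ +] _; exact. Qed.

Lemma pr_xi i B : CBorel B -> pr P (xi i @^-1` B) = mu B.
Proof. by case: Hiid => _ [_ H] cB; rewrite /mu /pr (H i). Qed.

Lemma CBorel_eval t (h : R -> R) (O : set R) : continuous h -> open O ->
  CBorel [set f : T -> R | O (h (f t))].
Proof. by move=> ch oO; apply: CBorel_open; exact: (@sup_open_eval R T t h O). Qed.

Lemma measurable_xi_eval i t : measurable_fun setT (fun w => xi i w t).
Proof.
move=> _; apply: (measurability _ (RGenOInfty.measurableE R)) => //.
move=> /= _ [_ [x ->]] <-; rewrite setTI.
have ci : continuous (@id R) by move=> y; exact: cvg_id.
have := measurable_xi i (@CBorel_eval t id _ ci (@open_gt R x)).
by congr measurable; apply/seteqP; split => w /=; rewrite in_itv/= andbT.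
Qed.

Hypothesis HC1 : C1 P xi.

Lemma uf_continuous t : continuous (fun y => 1 - cdfF P xi t y).
Proof. by move=> y; apply: cvgB; [exact: cvg_cst|exact: HC1]. Qed.

Lemma sup_open_uf_lt t y : sup_open [set f | uf t f < y].
Proof.
have := @sup_open_eval R T t _ _ (@uf_continuous t) (@open_lt R y).
by [].
Qed.

Lemma sup_open_uf_gt t y : sup_open [set f | y < uf t f].
Proof.
have := @sup_open_eval R T t _ _ (@uf_continuous t) (@open_gt R y).
by [].
Qed.

Lemma CBorel_uf_lt t y : CBorel [set f | uf t f < y].
Proof. by apply: CBorel_open; exact: sup_open_uf_lt. Qed.

Lemma CBorel_uf_le t y : CBorel [set f | uf t f <= y].
Proof.
have -> : [set f | uf t f <= y] = ~` [set f | y < uf t f].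
  apply/seteqP; split => f /=; first by move=> h; rewrite ltNge h.
  by move/negP; rewrite -leNgt.
by apply: CBorelC; apply: CBorel_open; exact: sup_open_uf_gt.
Qed.

Lemma CBorel_ex_lt (S : set T) y : CBorel [set f | exists2 t, S t & uf t f < y].
Proof.
by apply: CBorel_open; apply: sup_open_union => t; exact: sup_open_uf_lt.
Qed.

Lemma CBorel_ex_gt (S : set T) y : CBorel [set f | exists2 t, S t & y < uf t f].
Proof.
by apply: CBorel_open; apply: sup_open_union => t; exact: sup_open_uf_gt.
Qed.

Lemma CBorel_all_le (S : set T) y : CBorel [set f | forall t, S t -> uf t f <= y].
Proof.
have -> : [set f | forall t, S t -> uf t f <= y] =
    ~` [set f | exists2 t, S t & y < uf t f].
  apply/seteqP; split => f /= Hf.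
    by move=> [t St]; rewrite ltNge Hf.
  by move=> t St; rewrite leNgt; apply/negP => yt; apply: Hf; exists t.
by apply: CBorelC; exact: CBorel_ex_gt.
Qed.

Lemma mu_ge0 B : 0 <= mu B.
Proof. exact: pr_ge0. Qed.

Lemma mu_le A B : CBorel A -> CBorel B -> A `<=` B -> mu A <= mu B.
Proof.
move=> cA cB AB; apply: pr_le; [exact: measurable_xi..|].
by move=> w; exact: AB.
Qed.

Lemma mu_le1 B : CBorel B -> mu B <= 1.
Proof. by move=> cB; apply: pr_le1; exact: measurable_xi. Qed.

Lemma mu_lin (I : Type) (r : seq I) (c : I -> R) (F : I -> set (T -> R)) :
  (forall i, CBorel (F i)) ->
  (forall f, 0 <= \sum_(i <- r) c i * \1_(F i) f) ->
  0 <= \sum_(i <- r) c i * mu (F i).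
Proof.
move=> mF pos; apply: pr_lin => [i|w]; first exact: measurable_xi.
apply: le_trans (pos (xi 0%N w)) _; apply: ler_sum => i _.
by rewrite !indicE.
Qed.

Lemma cdfF_le1 t x : cdfF P xi t x <= 1.
Proof.
apply: pr_le1.
have := measurable_fun_le measurableT (measurable_xi_eval 0 t) (measurable_cst x).
by rewrite setTI.
Qed.

Lemma uf_ge0 t f : 0 <= uf t f.
Proof. by rewrite subr_ge0 cdfF_le1. Qed.

Lemma uf_le1 t f : uf t f <= 1.
Proof. by rewrite gerBl cdfF_ge0. Qed.

Lemma cdfF_mono t x y : x <= y -> cdfF P xi t x <= cdfF P xi t y.
Proof.
move=> xy; have mF z := measurable_fun_le measurableT
  (measurable_xi_eval 0 t) (measurable_cst z).
apply: pr_le => [||w /=]; first by have := mF x; rewrite setTI.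
  by have := mF y; rewrite setTI.
by move=> /le_trans; exact.
Qed.

Lemma cdfF_cvg t :
  cdfF P xi t x @[x --> +oo] --> (1 : R) /\ cdfF P xi t x @[x --> -oo] --> (0 : R).
Proof.
pose X : {RV P >-> R} := HB.pack (fun w => xi 0%N w t)
  (isMeasurableFun.Build _ _ _ _ (fun w => xi 0%N w t) (measurable_xi_eval 0 t)).
have XE x : cdfF P xi t x = fine (cdf X x).
  rewrite /cdfF /cdf /distribution /pushforward /=; congr (fine (P _)).
split.
  under eq_fun do rewrite XE; apply: fine_cvg; exact: cvg_cdfy1.
under eq_fun do rewrite XE; apply: fine_cvg; exact: cvg_cdfNy0.
Qed.

(* With x0 = sup {x | F x <= c}, continuity gives F x0 = c and F(xi) > c iff xi > x0. *)
Lemma mu_uf_lt_in t y : 0 < y < 1 -> mu [set f | uf t f < y] = y.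
Proof.
move=> /andP[y0 y1]; set F := cdfF P xi t; set c := 1 - y.
have [F1 F0] := cdfF_cvg t.
have [a Fa] : exists a, F a < c.
  have : \forall x \near -oo, F x < c by apply: (cvgr_lt _ F0); rewrite /c; lra.
  by move=> [M [_ HM]]; exists (M - 1); apply: HM; lra.
have [b Fb] : exists b, c < F b.
  have : \forall x \near +oo, c < F x by apply: (cvgr_gt _ F1); rewrite /c; lra.
  by move=> [M [_ HM]]; exists (M + 1); apply: HM; lra.
pose S := [set x | F x <= c]; pose x0 := sup S.
have Sb : ubound S b.
  move=> x /= Fx; rewrite leNgt; apply/negP => /ltW /(cdfF_mono t) h.
  by have := lt_le_trans Fb (le_trans h Fx); rewrite ltxx.
have hS : has_sup S by split; [exists a; rewrite /S/=; lra|exists b].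
have Fle x : x < x0 -> F x <= c.
  move=> xx0; have [z Sz xz] := sup_adherent (eqbRL (subr_gt0 _ _) xx0) hS.
  have {}xz : x < z by move: xz; rewrite -/x0; lra.
  by apply: le_trans (cdfF_mono t (ltW xz)) Sz.
have Fgt x : x0 < x -> c < F x.
  move=> x0x; rewrite ltNge; apply/negP => Fx.
  by have := ub_le_sup hS.2 (Fx : S x); rewrite -/x0; lra.
have Fx0 : F x0 = c.
  apply/eqP; rewrite eq_le; apply/andP; split.
  - rewrite leNgt; apply/negP => cF.
    have : \forall x \near x0, c < F x by apply: (cvgr_gt _ (HC1 (t:=t) (x:=x0))).
    move=> /nbhs_ballP[e /= e0 He]; have := He (x0 - e / 2).
    rewrite /ball /= opprB addrC subrK ger0_norm; last by lra.
    have h : e / 2 < e by lra.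
    move=> /(_ h); rewrite ltNge => /negP; apply; apply: Fle; lra.
  - rewrite leNgt; apply/negP => cF.
    have : \forall x \near x0, F x < c by apply: (cvgr_lt _ (HC1 (t:=t) (x:=x0))).
    move=> /nbhs_ballP[e /= e0 He]; have := He (x0 + e / 2).
    rewrite /ball /= opprD addNKr normrN ger0_norm; last by lra.
    have h : e / 2 < e by lra.
    move=> /(_ h); rewrite ltNge => /negP; apply; apply/ltW/Fgt; lra.
have mA : measurable [set w | xi 0%N w t <= x0].
  have := measurable_fun_le measurableT (measurable_xi_eval 0 t)
    (measurable_cst x0).
  by rewrite setTI.
have -> : mu [set f | uf t f < y] = pr P (~` [set w | xi 0%N w t <= x0]).
  rewrite /mu; congr pr; apply/seteqP; split => w /=; rewrite /uf -/F.
    by move=> h /(cdfF_mono t); rewrite -/F Fx0 /c => h2; lra.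
  move=> /negP; rewrite -ltNge => /Fgt; rewrite /c; lra.
by rewrite /pr probability_setC// prE// /= -[pr _ _]/(F x0) Fx0 /c; lra.
Qed.

(** The quantile argument gives strict sublevels inside (0,1). Non-strict sublevels and the end
    points follow by squeezing; averaging with 1 or halving keeps the auxiliary level [z] inside
    (0,1). *)
Lemma mu_uf_le t y : 0 <= y <= 1 -> mu [set f | uf t f <= y] = y.
Proof.
move=> /andP[y0 y1]; apply/eqP; rewrite eq_le; apply/andP; split.
  have [->|y1'] := eqVneq y 1; first by apply: mu_le1; exact: CBorel_uf_le.
  apply/ler_addgt0Pr => e e0; pose z := Num.min (y + e) ((y + 1) / 2).
  have yz : y < z by rewrite lt_min; apply/andP; split; lra.
  have z1 : 0 < z < 1 by apply/andP; split; [lra|rewrite gt_min; lra].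
  apply: (@le_trans _ _ z); last by rewrite ge_min lexx.
  rewrite -[leRHS](mu_uf_lt_in t z1).
  apply: mu_le; [exact: CBorel_uf_le|exact: CBorel_uf_lt|move=> f /=; lra].
have [->|y0'] := eqVneq y 0; first exact: mu_ge0.
apply/ler_addgt0Pr => e e0; pose z := Num.max (y - e) (y / 2).
have yz : z < y by rewrite gt_max; apply/andP; split; lra.
have z1 : 0 < z < 1 by apply/andP; split; [rewrite lt_max; lra|lra].
apply: (@le_trans _ _ (z + e)); first by rewrite -lerBlDr le_max lexx.
rewrite lerD2r -[leLHS](mu_uf_lt_in t z1).
apply: mu_le; [exact: CBorel_uf_lt|exact: CBorel_uf_le|move=> f /=; lra].
Qed.

Lemma mu_uf_lt t y : 0 <= y <= 1 -> mu [set f | uf t f < y] = y.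
Proof.
move=> y01; apply/eqP; rewrite eq_le; apply/andP; split.
  rewrite -[leRHS](mu_uf_le t y01); apply: mu_le; [exact: CBorel_uf_lt|
    exact: CBorel_uf_le|move=> f /=; exact: ltW].
have [->|y0] := eqVneq y 0; first exact: mu_ge0.
apply/ler_addgt0Pr => e e0; pose z := Num.max (y - e) (y / 2).
have yz : z < y by rewrite gt_max; apply/andP; split; lra.
have z1 : 0 < z < 1 by apply/andP; split; [rewrite lt_max; lra|lra].
apply: (@le_trans _ _ (z + e)); first by rewrite -lerBlDr le_max lexx.
rewrite lerD2r -[leLHS](mu_uf_lt_in t z1).
apply: mu_le; [exact: CBorel_uf_lt|exact: CBorel_uf_lt|move=> f /=; lra].
Qed.

End Marginals.

(** * Elementary bounds for exp, sin and cos *)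

Section RealBounds.
Context {R : realType}.
Implicit Types x y z : R.

(** Multiplication by a lower bound of exp(-z), either 1 - z or (1 - z/2)^2, leaves a polynomial
    inequality. *)
Lemma expR_le_quad z : z <= 2^-1 -> expR z <= 1 + z + 2 * z ^+ 2.
Proof.
move=> z2; have [z0|z0] := leP 0 z.
  have h : expR z * (1 - z) <= 1.
    rewrite -[leRHS](expRxMexpNx_1 z) ler_wpM2l ?expR_ge0//.
    exact: expR_ge1Dx.
  have h1 : 1 <= (1 + z + 2 * z ^+ 2) * (1 - z).
    have : 0 <= z ^+ 2 * (1 - 2 * z) by rewrite mulr_ge0 ?sqr_ge0//; lra.
    by lra.
  have z1 : 0 < 1 - z by lra.
  by rewrite -(ler_pM2r z1) (le_trans h).
have h : expR z * (1 - z / 2) ^+ 2 <= 1.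
  rewrite -[leRHS](expRxMexpNx_1 z) ler_wpM2l ?expR_ge0//.
  have -> : - z = - z / 2 + - z / 2 by lra.
  rewrite expRD -expr2; apply: lerXn2r; rewrite ?nnegrE ?expR_ge0//; first lra.
  by have := expR_ge1Dx (- z / 2); lra.
have h1 : 1 <= (1 + z + 2 * z ^+ 2) * (1 - z / 2) ^+ 2.
  have zz : 0 <= z ^+ 2 by exact: sqr_ge0.
  have : 0 <= z ^+ 2 * (5 / 4 - 7 / 4 * z + z ^+ 2 / 2).
    by rewrite mulr_ge0//; lra.
  by lra.
have z1 : 0 < (1 - z / 2) ^+ 2 by rewrite exprn_gt0//; lra.
by rewrite -(ler_pM2r z1) (le_trans h).
Qed.

Lemma expRN_quad x : 0 <= x -> `|expR (- x) - (1 - x)| <= 2 * x ^+ 2.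
Proof.
move=> x0; have h1 := expR_ge1Dx (- x).
have h2 : expR (- x) <= 1 + - x + 2 * (- x) ^+ 2 by apply: expR_le_quad; lra.
rewrite ger0_norm; last by lra.
by move: h2; rewrite sqrrN; lra.
Qed.

(** Mean value theorem for y - sin y, whose derivative is 1 - cos c = 2 sin^2 (c/2) <= c^2 / 2. *)
Lemma sin_bounds x : 0 <= x -> 0 <= x - sin x <= x ^+ 3.
Proof.
rewrite le_eqVlt => /predU1P[<-|x0]; first by rewrite sin0 subrr expr0n lexx.
have D z : is_derive z 1 (fun y : R => y - sin y) (1 - cos z).
  by apply: is_deriveB.
have C a b : {within `[a, b], continuous (fun y : R => y - sin y)}.
  by apply: derivable_within_continuous => z _; have Dz := D z; exact: ex_derive.
have S1 y : 0 < y -> 0 <= y - sin y.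
  move=> y0; have [c cy] := MVT y0 (fun z _ => D z) (@C 0 y).
  rewrite sin0 !subr0 => ->; rewrite mulr_ge0 ?(ltW y0)//subr_ge0 ?cos_le1.
have Sab y : 0 < y -> sin y ^+ 2 <= y ^+ 2.
  move=> y0; rewrite -subr_ge0 subr_sqr; apply: mulr_ge0; first exact: S1.
  have [y1|y1] := leP y 1; last by have := sin_geN1 y; lra.
  have : 0 <= sin y by rewrite sin_ge0_pi//; have := pi_ge2 R; lra.
  by lra.
apply/andP; split; first exact: S1.
have [c /[!in_itv]/= /andP[c0 cx]] := MVT x0 (fun z _ => D z) (@C 0 x).
rewrite sin0 !subr0 => ->; rewrite exprSr ler_wpM2r ?(ltW x0)//.
have -> : 1 - cos c = 2 * sin (c / 2) ^+ 2.
  by rewrite {1}(splitr c) cosD -!expr2 cos2sin2; lra.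
have c20 : 0 < c / 2 by lra.
have := Sab _ c20.
have : c ^+ 2 <= x ^+ 2 by apply: lerXn2r; rewrite ?nnegrE; lra.
have -> : (c / 2) ^+ 2 = c ^+ 2 / 4 by rewrite expr_div_n; congr (_ / _); lra.
have := sqr_ge0 c; lra.
Qed.

Lemma sin_cube x : `|sin x - x| <= `|x| ^+ 3.
Proof.
have [x0|x0] := leP 0 x.
  have /andP[h1 h2] := sin_bounds x0.
  by rewrite distrC ger0_norm// (ger0_norm x0).
have x0' : 0 <= - x by lra.
have /andP[] := sin_bounds x0'; rewrite sinN => h1 h2.
rewrite ger0_norm; last by lra.
by rewrite (ler0_norm (ltW x0)); lra.
Qed.

Lemma sin_norm_le x : `|sin x| <= `|x|.
Proof.
have H y : 0 <= y -> `|sin y| <= y.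
  move=> y0; have /andP[h1 _] := sin_bounds y0; rewrite ler_norml.
  have [y1|y1] := leP y 1; last by have := sin_geN1 y; lra.
  have : 0 <= sin y by rewrite sin_ge0_pi//; have := pi_ge2 R; lra.
  by lra.
have [x0|x0] := leP 0 x; first by rewrite (ger0_norm x0) H.
by rewrite (ltr0_norm x0) -normrN -sinN H//; lra.
Qed.

(** For |x| <= 1 the cubic bound is stronger, for |x| >= 2 linear growth suffices, and in between
    sin x has the sign of x. *)
Lemma sin_sqr x : `|sin x - x| <= x ^+ 2.
Proof.
have [x1|x1] := leP `|x| 1.
  apply: le_trans (sin_cube x) _; rewrite exprS -(real_normK (num_real x)).
  by rewrite -[leRHS]mul1r ler_wpM2r// sqr_ge0.
have [x2|x2] := leP 2 `|x|.
  apply: le_trans (ler_normB _ _) _; rewrite -(real_normK (num_real x)).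
  have := sin_norm_le x.
  have : 2 * `|x| <= `|x| ^+ 2 by rewrite expr2 ler_wpM2r.
  by lra.
have : `|sin x - x| <= `|sin x - x| by [].
have H y : 1 < y -> y < 2 -> `|sin y - y| <= y ^+ 2.
  move=> y1 y2; have y0 : 0 <= y by lra.
  have /andP[h1 _] := sin_bounds y0; rewrite distrC ger0_norm//.
  have : 0 <= sin y by rewrite sin_ge0_pi//; have := pi_ge2 R; lra.
  have : 0 <= (y - 1) * y by apply: mulr_ge0; lra.
  by rewrite mulrBl -expr2; lra.
move=> _; have [x0|x0] := leP 0 x.
  by move: x1 x2; rewrite (ger0_norm x0); exact: H.
move: x1 x2; rewrite (ltr0_norm x0) => x1 x2.
by have := H _ x1 x2; rewrite sinN sqrrN opprK distrC addrC.
Qed.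

Lemma cos_quad x : `|cos x - (1 - x ^+ 2 / 2)| <= `|x| ^+ 4.
Proof.
have -> : cos x - (1 - x ^+ 2 / 2) =
    2 * ((x / 2 - sin (x / 2)) * (x / 2 + sin (x / 2))).
  rewrite -subr_sqr {1}(splitr x) cosD -!expr2 cos2sin2.
  have -> : (x / 2) ^+ 2 = x ^+ 2 / 4 by rewrite expr_div_n; congr (_ / _); lra.
  lra.
have -> : `|x| ^+ 4 = 2 * ((8 * `|x / 2| ^+ 3) * (2 * `|x / 2|) / 2).
  by rewrite normrM [ `|2^-1| ]ger0_norm//; lra.
rewrite normrM [ `|2| ]ger0_norm// ler_wpM2l// normrM.
have h1 : `|x / 2 - sin (x / 2)| <= `|x / 2| ^+ 3 by rewrite distrC sin_cube.
have h2 : `|x / 2 + sin (x / 2)| <= 2 * `|x / 2|.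
  apply: le_trans (ler_normD _ _) _; have := sin_norm_le (x / 2); lra.
apply: (@le_trans _ _ (`|x / 2| ^+ 3 * (2 * `|x / 2|))).
  by apply: ler_pM.
have : 0 <= `|x / 2| ^+ 3 * (2 * `|x / 2|).
  by rewrite mulr_ge0 ?exprn_ge0// mulr_ge0.
lra.
Qed.

End RealBounds.
(** * Bernstein bound and central limit theorem for W_n *)

Section IidFunctionals.
Context {R : realType} {T : topologicalType} {dO : measure_display}
  {Om : measurableType dO}.
Variables (P : probability Om R) (xi : nat -> Om -> T -> R).
Hypothesis Hiid : iid P xi.
Local Notation mu := (mu P xi).

Lemma mu_set0 : mu set0 = 0.
Proof. exact: pr_set0. Qed.

Lemma big_setIP (U : Type) (I : finType) (A : I -> set U) w :
  (\big[setI/setT]_i A i) w <-> forall i, A i w.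
Proof.
split=> [|Aw]; last by elim/big_ind: _ => //.
by move=> + i; rewrite (bigD1 i)//= => -[].
Qed.

Lemma pr_cap n (B : nat -> set (T -> R)) : (forall i, CBorel (B i)) ->
  pr P (\big[setI/setT]_(i < n) (xi i @^-1` B i)) = \prod_(i < n) mu (B i).
Proof.
move=> cB; have [_ [+ _]] := Hiid.
move=> /(_ n (fun i => B i) (fun i => cB i)) H; rewrite /pr H.
have -> : (\prod_(i < n) P (xi i @^-1` B i) = (\prod_(i < n) mu (B i))%:E)%E.
  elim/big_rec2: _ => // i x y _ ->; rewrite EFinM; congr (_ * _)%E.
  by rewrite prE ?(pr_xi Hiid)//; exact: (measurable_xi Hiid).
by [].
Qed.

Section Family.
Variables (I : finType) (Bs : I -> set (T -> R)).
Hypothesis cBs : forall i, CBorel (Bs i).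
Let F := {ffun I -> bool}.
(** Independence is given for events only. A statistic built from finitely many sets of paths
    depends on each observation through this pattern of indicators, which takes finitely many
    values; expectations become finite sums over atoms and factorise there, without product
    measures. *)
Definition pat f : {ffun I -> bool} := [ffun i => `[< Bs i f >]].

Lemma CBorel_pat a : CBorel (pat @^-1` [set a]).
Proof.
have -> : pat @^-1` [set a] =
    [set f | forall i, (if a i then Bs i else ~` Bs i) f].
  apply/seteqP; split => f /=.
    by move=> <- i; rewrite ffunE; case: asboolP.
  move=> H; apply/ffunP => i; rewrite ffunE; have := H i.
  by case: (a i) => /= h; [exact/asboolP|exact/asboolPn].
apply: CBorel_fin_forallT => i; case: ifP => // _; exact: CBorelC.
Qed.

Definition sam n w : {ffun 'I_n -> F} := [ffun i : 'I_n => pat (xi i w)].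

Lemma samE n a : [set w | sam n w = a] =
  \big[setI/setT]_(i < n) (xi i @^-1` (pat @^-1` [set a i])).
Proof.
apply/seteqP; split => w; rewrite big_setIP /=.
  by move=> <- i; rewrite ffunE.
by move=> H; apply/ffunP => i; rewrite ffunE.
Qed.

Lemma measurable_sam n a : measurable [set w | sam n w = a].
Proof.
rewrite samE; apply: bigsetI_measurable => i _.
by apply: (measurable_xi Hiid); exact: CBorel_pat.
Qed.

Lemma fin_decomp (G : finType) (X : Om -> G) (phi : G -> R) w :
  phi (X w) = \sum_a phi a * \1_[set w | X w = a] w.
Proof.
rewrite (bigD1 (X w))//= ind1// mulr1 big1 ?addr0// => b nb.
by rewrite ind0 ?mulr0//= => Xb; rewrite Xb eqxx in nb.
Qed.

Lemma bm_fin (G : finType) (X : Om -> G) (phi : G -> R) :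
  (forall a, measurable [set w | X w = a]) -> bm (fun w => phi (X w)).
Proof.
move=> mX; under eq_fun do rewrite fin_decomp.
by apply: bm_sum => a _; exact/bmZ/bm_ind.
Qed.

Lemma bm_sam n (phi : {ffun 'I_n -> F} -> R) : bm (fun w => phi (sam n w)).
Proof. by apply: bm_fin => a; exact: measurable_sam. Qed.

Lemma measurable_pat i b : measurable [set w | pat (xi i w) = b].
Proof. exact: (measurable_xi Hiid i (CBorel_pat b)). Qed.

Lemma bm_pat i (psi : F -> R) : bm (fun w => psi (pat (xi i w))).
Proof. by apply: (bm_fin (X := fun w => pat (xi i w))) => a; exact: measurable_pat. Qed.

Lemma Ex_fin (G : finType) (X : Om -> G) (phi : G -> R) :
  (forall a, measurable [set w | X w = a]) ->
  Ex P (fun w => phi (X w)) = \sum_a phi a * pr P [set w | X w = a].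
Proof.
move=> mX; under eq_Ex do rewrite fin_decomp.
rewrite Ex_sum => [|a _]; last exact/bmZ/bm_ind.
by apply: eq_bigr => a _; rewrite ExZ ?Ex_ind//; exact/bm_ig/bm_ind.
Qed.

Lemma pr_sam_pat n a b :
  pr P [set w | (sam n w, pat (xi n w)) = (a, b)] =
  pr P [set w | sam n w = a] * mu (pat @^-1` [set b]).
Proof.
pose B i := if insub i is Some j then pat @^-1` [set a j] else pat @^-1` [set b].
have cB i : CBorel (B i) by rewrite /B; case: insub => *; exact: CBorel_pat.
have BE (i : 'I_n) : B i = pat @^-1` [set a i] by rewrite /B valK.
have Bn : B n = pat @^-1` [set b] by rewrite /B insubF// ltnn.
have sE : [set w | sam n w = a] = \big[setI/setT]_(i < n) (xi i @^-1` B i).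
  by rewrite samE; apply: eq_bigr => i _; rewrite BE.
have -> : [set w | (sam n w, pat (xi n w)) = (a, b)] =
    \big[setI/setT]_(i < n.+1) (xi i @^-1` B i).
  rewrite big_ord_recr /= -sE Bn; apply/seteqP; split => w /=.
    by case=> -> ->.
  by move=> [-> ->].
by rewrite sE !pr_cap// big_ord_recr /= Bn.
Qed.

Lemma Ex_indep n (phi : {ffun 'I_n -> F} -> R) (psi : F -> R) :
  Ex P (fun w => phi (sam n w) * psi (pat (xi n w))) =
  Ex P (fun w => phi (sam n w)) * Ex P (fun w => psi (pat (xi 0%N w))).
Proof.
have mp a : measurable [set w | (sam n w, pat (xi n w)) = a].
  have -> : [set w | (sam n w, pat (xi n w)) = a] =
      [set w | sam n w = a.1] `&` [set w | pat (xi n w) = a.2].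
    by case: a => a b; apply/seteqP; split => w /=; case=> -> ->.
  by apply: measurableI; [exact: measurable_sam|exact: measurable_pat].
rewrite (Ex_fin (fun p => phi p.1 * psi p.2) mp).
rewrite (Ex_fin phi (@measurable_sam n)) (Ex_fin psi (measurable_pat 0)).
rewrite big_distrlr pair_bigA /=; apply: eq_bigr => -[a b] _ /=.
by rewrite pr_sam_pat mulrACA.
Qed.

Lemma sam_sum n (h : F -> R) w :
  \sum_(i < n) h (pat (xi i w)) = \sum_(i < n) h (sam n w i).
Proof. by apply: eq_bigr => i _; rewrite ffunE. Qed.

Lemma Ex_expR_sum n (h : F -> R) :
  Ex P (fun w => expR (\sum_(i < n) h (pat (xi i w)))) =
  Ex P (fun w => expR (h (pat (xi 0%N w)))) ^+ n.
Proof.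
elim: n => [|n IH].
  by rewrite expr0 -[RHS](Ex_cst P 1); apply: eq_Ex => w; rewrite big_ord0 expR0.
rewrite exprSr -IH.
under [in RHS]eq_Ex do rewrite sam_sum.
rewrite -(Ex_indep (fun a => expR (\sum_(i < n) h (a i))) (fun b => expR (h b))).
by apply: eq_Ex => w; rewrite big_ord_recr expRD sam_sum.
Qed.

(** [a n] and [b n] are the real and imaginary parts of the characteristic function of the sum, that
    is, of the n-th power of c + i s. All factors have modulus at most 1, so each multiplication
    adds at most |c - v| + |s| to the distance from [v ^+ n]. *)
Lemma Ex_trig_sum n (h : F -> R) (v : R) : 0 <= v <= 1 ->
  let c := Ex P (fun w => cos (h (pat (xi 0%N w)))) in
  let s := Ex P (fun w => sin (h (pat (xi 0%N w)))) in
  `|Ex P (fun w => cos (\sum_(i < n) h (pat (xi i w)))) - v ^+ n| <=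
     n%:R * (`|c - v| + `|s|) /\
  `|Ex P (fun w => sin (\sum_(i < n) h (pat (xi i w))))| <= n%:R * `|s|.
Proof.
move=> /andP[v0 v1] c s.
pose a n := Ex P (fun w => cos (\sum_(i < n) h (pat (xi i w)))).
pose b n := Ex P (fun w => sin (\sum_(i < n) h (pat (xi i w)))).
have bc m := @bm_sam m (fun a => cos (\sum_(i < m) h (a i))).
have bs m := @bm_sam m (fun a => sin (\sum_(i < m) h (a i))).
have aE m : a m = Ex P (fun w => cos (\sum_(i < m) h (sam m w i))).
  by apply: eq_Ex => w; rewrite sam_sum.
have bE m : b m = Ex P (fun w => sin (\sum_(i < m) h (sam m w i))).
  by apply: eq_Ex => w; rewrite sam_sum.
have cos1 (x : R) : `|cos x| <= 1 by rewrite ler_norml cos_geN1 cos_le1.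
have sin1 (x : R) : `|sin x| <= 1 by rewrite ler_norml sin_geN1 sin_le1.
have b1 m : `|b m| <= 1 by rewrite bE; apply: Ex_norm_le => //; exact: bs.
have c1 : `|c| <= 1.
  by apply: Ex_norm_le => //; exact: (@bm_pat 0 (fun b => cos (h b))).
have bcM m : bm (fun w => cos (\sum_(i < m) h (sam m w i)) * cos (h (pat (xi m w)))).
  by apply: bmM; [exact: bc|exact: (@bm_pat m (fun b => cos (h b)))].
have bsM m : bm (fun w => sin (\sum_(i < m) h (sam m w i)) * sin (h (pat (xi m w)))).
  by apply: bmM; [exact: bs|exact: (@bm_pat m (fun b => sin (h b)))].
have bcsM m : bm (fun w => cos (\sum_(i < m) h (sam m w i)) * sin (h (pat (xi m w)))).
  by apply: bmM; [exact: bc|exact: (@bm_pat m (fun b => sin (h b)))].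
have bscM m : bm (fun w => sin (\sum_(i < m) h (sam m w i)) * cos (h (pat (xi m w)))).
  by apply: bmM; [exact: bs|exact: (@bm_pat m (fun b => cos (h b)))].
have aS m : a m.+1 = a m * c - b m * s.
  rewrite (aE m) (bE m).
  rewrite -(Ex_indep (fun a => cos (\sum_(i < m) h (a i))) (fun b => cos (h b))).
  rewrite -(Ex_indep (fun a => sin (\sum_(i < m) h (a i))) (fun b => sin (h b))).
  rewrite -ExB; [|exact/bm_ig/bcM|exact/bm_ig/bsM].
  by apply: eq_Ex => w; rewrite big_ord_recr cosD /= -sam_sum.
have bS m : b m.+1 = b m * c + a m * s.
  rewrite (aE m) (bE m).
  rewrite -(Ex_indep (fun a => sin (\sum_(i < m) h (a i))) (fun b => cos (h b))).
  rewrite -(Ex_indep (fun a => cos (\sum_(i < m) h (a i))) (fun b => sin (h b))).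
  rewrite -ExD; [|exact/bm_ig/bscM|exact/bm_ig/bcsM].
  by apply: eq_Ex => w; rewrite big_ord_recr sinD /= -sam_sum.
have a1 m : `|a m| <= 1 by rewrite aE; apply: Ex_norm_le => //; exact: bc.
rewrite -/(a n) -/(b n); elim: n => [|n [IHa IHb]].
  rewrite !mul0r /a /b; split.
    under eq_Ex do rewrite big_ord0 cos0.
    by rewrite Ex_cst expr0 subrr normr0.
  under eq_Ex do rewrite big_ord0 sin0.
  by rewrite Ex_cst normr0.
have nS : n.+1%:R = n%:R + 1 :> R by rewrite -natr1.
rewrite nS; split.
  have -> : a n.+1 - v ^+ n.+1 = (a n - v ^+ n) * c + v ^+ n * (c - v) - b n * s.
    by rewrite aS exprSr; ring.
  apply: le_trans (ler_normB _ _) _; apply: le_trans (lerD (ler_normD _ _) (lexx _)) _.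
  rewrite !normrM mulrDl mul1r -addrA; apply: lerD.
    by apply: le_trans IHa; rewrite ler_piMr.
  apply: lerD; last by rewrite ler_piMl.
  by rewrite ler_piMl// normrX (ger0_norm v0) exprn_ile1.
rewrite bS mulrDl mul1r; apply: le_trans (ler_normD _ _) _; rewrite !normrM.
apply: lerD; last by rewrite ler_piMl.
by apply: le_trans IHb; rewrite ler_piMr.
Qed.

End Family.

Section NormalizedSums.
Variables (k : R) (n : nat).
Hypotheses (k0 : 0 < k) (n0 : (0 < n)%N).

(** W_n as a process indexed by sets of paths: the bracketing sets of the chaining argument do not
    belong to any index (t, x). *)
Definition Ws (B : set (T -> R)) (w : Om) : R :=
  (Num.sqrt k)^-1 * \sum_(i < n) (\1_B (xi i w) - mu B).

Let n0' : 0 < n%:R :> R. Proof. by rewrite ltr0n. Qed.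
Let sk0 : 0 < Num.sqrt k. Proof. by rewrite sqrtr_gt0. Qed.
Let skk : Num.sqrt k ^+ 2 = k. Proof. by rewrite sqr_sqrtr// ltW. Qed.

Lemma bm_ind_xi i B : CBorel B -> bm (fun w => \1_B (xi i w) : R).
Proof.
move=> cB.
have -> : (fun w => \1_B (xi i w) : R) = \1_(xi i @^-1` B).
  by apply/funext => w; rewrite !indicE.
by apply: bm_ind; exact: (measurable_xi Hiid).
Qed.

Lemma Ex_ind_xi i B : CBorel B -> Ex P (fun w => \1_B (xi i w)) = mu B.
Proof.
move=> cB; rewrite -(pr_xi Hiid i cB) -Ex_ind; last exact: (measurable_xi Hiid).
by apply: eq_Ex => w; rewrite !indicE.
Qed.

Lemma bm_Ws B : CBorel B -> bm (Ws B).
Proof.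
move=> cB; apply: bmZ; apply: bm_sum => i _; apply: bmB; last exact: bm_cst.
exact: bm_ind_xi.
Qed.

Definition sdiff (B B' : set (T -> R)) : R := mu (B `\` B') + mu (B' `\` B).

(* For |l| <= sqrt k / 2 each summand z = l (1_B - 1_B') / sqrt k is at most 1/2,
   so E exp z <= 1 + E z + 2 E z^2. *)
Lemma Ws_mgf B B' (l s2 : R) : CBorel B -> CBorel B' ->
  `|l| <= Num.sqrt k / 2 -> n%:R / k * sdiff B B' <= s2 ->
  Ex P (fun w => expR (l * (Ws B w - Ws B' w))) <= expR (2 * l ^+ 2 * s2).
Proof.
move=> cB cB' lk ds.
pose Bs (b : bool) := if b then B else B'.
have cBs b : CBorel (Bs b) by case: b.
pose u := l / Num.sqrt k; pose m := mu B - mu B'.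
pose h (a : {ffun bool -> bool}) : R :=
  u * ((a true)%:R - (a false)%:R - m).
have hE f : h (pat Bs f) = u * (\1_B f - \1_B' f - m).
  by rewrite /h !ffunE !indicE.
have -> : Ex P (fun w => expR (l * (Ws B w - Ws B' w))) =
          Ex P (fun w => expR (\sum_(i < n) h (pat Bs (xi i w)))).
  apply: eq_Ex => w; congr expR; rewrite /Ws -mulrBr mulrA -/u -sumrB mulr_sumr.
  by apply: eq_bigr => i _; rewrite hE /m; congr (_ * _); ring.
rewrite (Ex_expR_sum cBs).
have u1 : `|u| <= 2^-1.
  rewrite normrM normfV (gtr0_norm sk0) ler_pdivrMr//.
  by rewrite mulrC.
set d := sdiff B B'.
have d0 : 0 <= d by rewrite addr_ge0// mu_ge0.
have E1 : Ex P (fun w => expR (h (pat Bs (xi 0%N w)))) <= expR (2 * u ^+ 2 * d).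
  pose q (f : T -> R) : R := 1 + u * (\1_B f - \1_B' f) +
     2 * u ^+ 2 * (\1_(B `\` B') f + \1_(B' `\` B) f).
  have bq : bm (fun w => q (xi 0%N w)).
    apply: bmD; first apply: bmD; first exact: bm_cst.
      by apply: bmZ; apply: bmB; exact: bm_ind_xi.
    by apply: bmZ; apply: bmD; apply: bm_ind_xi; exact: CBorelD.
  have Eq : Ex P (fun w => q (xi 0%N w)) = 1 + u * m + 2 * u ^+ 2 * d.
    have b1 : bm (fun w => \1_B (xi 0%N w) - \1_B' (xi 0%N w) : R).
      by apply: bmB; exact: bm_ind_xi.
    have b2 : bm (fun w => \1_(B `\` B') (xi 0%N w) + \1_(B' `\` B) (xi 0%N w) : R).
      by apply: bmD; apply: bm_ind_xi; exact: CBorelD.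
    rewrite ExD; [|apply/bm_ig/bmD/bmZ/b1/bm_cst|exact/bm_ig/bmZ].
    rewrite ExD; [|exact/bm_ig/bm_cst|exact/bm_ig/bmZ].
    rewrite Ex_cst !ExZ; [|exact: bm_ig..].
    rewrite ExB; [|exact/bm_ig/bm_ind_xi..].
    rewrite ExD; [|apply/bm_ig/bm_ind_xi; exact: CBorelD..].
    by rewrite !Ex_ind_xi//; exact: CBorelD.
  have le1 f : expR (h (pat Bs f)) <= expR (- (u * m)) * q f.
    rewrite hE mulrBr addrC expRD ler_pM2l ?expR_gt0//.
    have zu : u * (\1_B f - \1_B' f) <= 2^-1.
      apply: le_trans (ler_norm _) _; rewrite normrM.
      apply: le_trans u1; rewrite ler_piMr//.
      by rewrite !indicE; case: (_ \in _); case: (_ \in _) => /=; rewrite ler_norml ?mulr1n ?mulr0n; lra.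
    apply: le_trans (expR_le_quad zu) _; rewrite /q lerD2l exprMn -mulrA.
    rewrite ler_wpM2l// ler_wpM2l ?sqr_ge0//.
    have [Bf|Bf] := pselect (B f); have [Bf'|Bf'] := pselect (B' f).
    - by rewrite !(ind1 (A := B)) ?(ind1 (A := B')) ?subrr ?expr0n//= addr_ge0 ?ind_ge0.
    - rewrite (ind1 (A := B))// (ind0 (A := B'))// (ind1 (A := B `\` B'))//.
      by rewrite subr0 expr1n lerDl ind_ge0.
    - rewrite (ind0 (A := B))// (ind1 (A := B'))// (ind1 (A := B' `\` B))//.
      by rewrite sub0r sqrrN expr1n lerDr ind_ge0.
    - rewrite (ind0 (A := B))// (ind0 (A := B'))// subrr expr0n/=.
      by rewrite addr_ge0 ?ind_ge0.
  have bL := @bm_pat _ _ cBs 0 (fun a => expR (h a)).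
  have bR : bm (fun w => expR (- (u * m)) * q (xi 0%N w)) by exact: bmZ.
  apply: le_trans (Ex_le (bm_ig P bL) (bm_ig P bR) (fun w => le1 _)) _.
  rewrite ExZ ?Eq; last exact: bm_ig.
  apply: (@le_trans _ _ (expR (- (u * m)) * expR (u * m + 2 * u ^+ 2 * d))).
    by rewrite ler_pM2l ?expR_gt0// -addrA expR_ge1Dx.
  by rewrite -expRD addrA addNr add0r.
apply: le_trans (lerXn2r _ _ _ E1) _; rewrite ?nnegrE ?expR_ge0//.
  by apply: Ex_ge0 => w; exact: expR_ge0.
rewrite -expRM_natr ler_expR.
have -> : 2 * u ^+ 2 * d * n%:R = 2 * l ^+ 2 * (n%:R / k * d).
  by rewrite /u exprMn exprVn skk; ring.
by rewrite ler_wpM2l// mulr_ge0// sqr_ge0.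
Qed.

Lemma Ws_bernstein1 B B' (a s2 : R) : CBorel B -> CBorel B' -> 0 < s2 ->
  0 < a -> a <= 2 * s2 * Num.sqrt k -> n%:R / k * sdiff B B' <= s2 ->
  pr P [set w | a < Ws B w - Ws B' w] <= expR (- (a ^+ 2 / (8 * s2))).
Proof.
(* [l] minimises 2 l^2 s2 - l a, and the bound on [a] says exactly that |l| <= sqrt k / 2, the range
   of [Ws_mgf]. *)
move=> cB cB' s0 a0 ak ds; pose l := a / (4 * s2).
have l0 : 0 < l by rewrite divr_gt0// mulr_gt0.
have lk : `|l| <= Num.sqrt k / 2.
  by rewrite gtr0_norm// /l ler_pdivrMr ?mulr_gt0//; lra.
have bW : bm (fun w => Ws B w - Ws B' w) by apply: bmB; exact: bm_Ws.
have bE : bm (fun w => expR (l * (Ws B w - Ws B' w))) by exact/bm_expR/bmZ.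
have := markov_bm (a := expR (l * a)) P bE (fun=> expR_ge0 _) (expR_gt0 _).
move=> /(fun h => le_trans h _); move=> /(_ (expR (- (a ^+ 2 / (8 * s2))))).
move=> H; apply: le_trans (H _); last first.
  rewrite ler_pdivrMr ?expR_gt0// -expRD.
  apply: le_trans (Ws_mgf cB cB' lk ds) _; rewrite ler_expR.
  have -> : 2 * l ^+ 2 * s2 = a ^+ 2 / (8 * s2).
    by rewrite /l; field; rewrite gt_eqF.
  have -> : l * a = 2 * (a ^+ 2 / (8 * s2)).
    by rewrite /l; field; rewrite gt_eqF.
  lra.
apply: pr_le; [exact: measurable_gt bW.1| |].
  have := measurable_fun_le measurableT (measurable_cst (expR (l * a))) bE.1.
  by rewrite setTI.
by move=> w /= aw; rewrite ler_expR ler_pM2l// ltW.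
Qed.

Lemma Ws_bernstein B B' (a s2 : R) : CBorel B -> CBorel B' -> 0 < s2 ->
  0 < a -> a <= 2 * s2 * Num.sqrt k -> n%:R / k * sdiff B B' <= s2 ->
  pr P [set w | a < `|Ws B w - Ws B' w|] <= 2 * expR (- (a ^+ 2 / (8 * s2))).
Proof.
move=> cB cB' s0 a0 ak ds.
have ds' : n%:R / k * sdiff B' B <= s2 by rewrite /sdiff addrC.
have b1 : bm (fun w => Ws B w - Ws B' w) by apply: bmB; exact: bm_Ws.
have b2 : bm (fun w => Ws B' w - Ws B w) by apply: bmB; exact: bm_Ws.
apply: le_trans (_ : pr P ([set w | a < Ws B w - Ws B' w] `|`
    [set w | a < Ws B' w - Ws B w]) <= _).
  apply: pr_le.
  - exact: measurable_gt (bm_norm b1).1.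
  - by apply: measurableU; [exact: measurable_gt b1.1|exact: measurable_gt b2.1].
  - by move=> w /=; rewrite ltr_normr opprB => /orP.
apply: le_trans (prU P (measurable_gt a b1.1) (measurable_gt a b2.1)) _.
by rewrite mulr2n mulrDl mul1r lerD// Ws_bernstein1.
Qed.

(** Exponential moments at l = 1 and l = -1, admissible because 4 <= k, dominate the square through
    y^2 <= 4 (e^y + e^-y). The bound is uniform in n, as the trigonometric approximation with its
    quadratic error requires. *)
Lemma Ws_sqr B (s2 : R) : CBorel B -> 4 <= k -> n%:R / k * mu B <= s2 ->
  Ex P (fun w => Ws B w ^+ 2) <= 8 * expR (2 * s2).
Proof.
move=> cB k4 ds.
have W0 w : Ws set0 w = 0.
  rewrite /Ws big1 ?mulr0// => i _; rewrite ind0//.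
  by rewrite mu_set0 subrr.
have ds' : n%:R / k * sdiff B set0 <= s2.
  by rewrite /sdiff setD0 set0D mu_set0 addr0.
have k2 : 2 <= Num.sqrt k.
  by rewrite -(ler_pXn2r (ltn0Sn 1)) ?nnegrE ?(ltW sk0)// skk; lra.
have l1 : `|1 : R| <= Num.sqrt k / 2 by rewrite normr1; lra.
have l2 : `|-1 : R| <= Num.sqrt k / 2 by rewrite normrN1; lra.
have bW := bm_Ws cB.
have b1 : bm (fun w => expR (1 * (Ws B w - Ws set0 w))).
  by apply: bm_expR; apply: bmZ; apply: bmB => //; apply: bm_Ws; exact: CBorel0.
have b2 : bm (fun w => expR (-1 * (Ws B w - Ws set0 w))).
  by apply: bm_expR; apply: bmZ; apply: bmB => //; apply: bm_Ws; exact: CBorel0.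
have h1 := Ws_mgf cB (@CBorel0 R T) l1 ds'.
have h2 := Ws_mgf cB (@CBorel0 R T) l2 ds'.
apply: (@le_trans _ _ (Ex P (fun w => 4 * (expR (1 * (Ws B w - Ws set0 w)) +
    expR (-1 * (Ws B w - Ws set0 w)))))).
  apply: Ex_le => [||w]; [| exact/bm_ig/bmZ/bmD|].
    by apply: bm_ig; under eq_fun do rewrite expr2; exact: bmM.
  rewrite W0 subr0 mul1r mulN1r; set x := Ws B w.
  have H (y : R) : 0 <= y -> y ^+ 2 <= 4 * (expR y + expR (- y)).
    move=> y0; have e1 := expR_ge1Dx (y / 2).
    have : (1 + y / 2) ^+ 2 <= expR (y / 2) ^+ 2.
      by apply: lerXn2r; rewrite ?nnegrE ?expR_ge0//; lra.
    rewrite -expRM_natr; have -> : y / 2 * 2%:R = y by lra.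
    have := expR_ge0 (- y).
    have -> : (1 + y / 2) ^+ 2 = 1 + y + y ^+ 2 / 4 by field.
    by lra.
  have [x0|x0] := leP 0 x; first exact: H.
  by have := H (- x); rewrite sqrrN opprK addrC; apply; lra.
rewrite ExZ; last exact/bm_ig/bmD.
rewrite ExD; [|exact: bm_ig..].
by move: h1 h2; rewrite sqrrN expr1n mulr1; lra.
Qed.

End NormalizedSums.

Section CentralLimit.
Variables (p : nat) (Bs : 'I_p -> set (T -> R)) (c : 'I_p -> R) (k : R) (n : nat).
Hypotheses (cBs : forall i, CBorel (Bs i)) (k0 : 0 < k) (n0 : (0 < n)%N).

Definition covn : R := n%:R / k *
  \sum_(i < p) \sum_(j < p) c i * c j *
     (mu (Bs i `&` Bs j) - mu (Bs i) * mu (Bs j)).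

Let Ga := \sum_(i < p) `|c i|.
Let h (a : {ffun 'I_p -> bool}) : R :=
  (Num.sqrt k)^-1 * \sum_(i < p) c i * ((a i)%:R - mu (Bs i)).
Let n0' : 0 < n%:R :> R. Proof. by rewrite ltr0n. Qed.
Let sk0 : 0 < Num.sqrt k. Proof. by rewrite sqrtr_gt0. Qed.
Let skk : Num.sqrt k ^+ 2 = k. Proof. by rewrite sqr_sqrtr// ltW. Qed.
Let Ga0 : 0 <= Ga. Proof. exact: sumr_ge0. Qed.

Let h_le a : `|h a| <= Ga / Num.sqrt k.
Proof.
rewrite /h normrM normfV (gtr0_norm sk0) mulrC ler_wpM2r ?invr_ge0//.
apply: le_trans (ler_norm_sum _ _ _) _; apply: ler_sum => i _.
rewrite normrM ler_piMr//.
have := mu_ge0 P xi (Bs i); have := mu_le1 Hiid (cBs i).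
by case: (a i) => /= h1 h2; rewrite ler_norml; lra.
Qed.

Let eh w := h (pat Bs (xi 0%N w)).
Let beh : bm eh. Proof. exact: (bm_pat cBs). Qed.

Let eh_lin w :
  eh w = (Num.sqrt k)^-1 * \sum_(i < p) c i * (\1_(Bs i) (xi 0%N w) - mu (Bs i)).
Proof. by congr (_ * _); apply: eq_bigr => i _; rewrite ffunE indicE. Qed.

Let bterm i : bm (fun w => \1_(Bs i) (xi 0%N w) - mu (Bs i) : R).
Proof. by apply: bmB; [exact: bm_ind_xi|exact: bm_cst]. Qed.

Let Eh0 : Ex P eh = 0.
Proof.
under eq_Ex do rewrite eh_lin.
rewrite ExZ; last by apply: bm_ig; apply: bm_sum => i _; exact/bmZ.
rewrite Ex_sum => [|i _]; last exact/bmZ.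
rewrite big1 ?mulr0// => i _; rewrite ExZ; last exact: bm_ig.
rewrite ExB; [|exact/bm_ig/bm_ind_xi|exact/bm_ig/bm_cst].
by rewrite Ex_ind_xi// Ex_cst subrr mulr0.
Qed.

Let Eh2 : Ex P (fun w => eh w ^+ 2) = covn / n%:R.
Proof.
have -> : covn / n%:R = k^-1 * \sum_(i < p) \sum_(j < p) c i * c j *
     (mu (Bs i `&` Bs j) - mu (Bs i) * mu (Bs j)).
  by rewrite /covn; field; rewrite !gt_eqF.
pose t i w : R := \1_(Bs i) (xi 0%N w) - mu (Bs i).
have bt2 i j : bm (fun w => t i w * t j w) by apply: bmM; exact: bterm.
transitivity (Ex P (fun w => k^-1 * \sum_(i < p) \sum_(j < p) c i * c j *
     (t i w * t j w))).
  apply: eq_Ex => w; rewrite eh_lin exprMn exprVn skk; congr (_ * _).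
  rewrite expr2 big_distrlr /=; apply: eq_bigr => i _; apply: eq_bigr => j _.
  by rewrite mulrACA.
rewrite ExZ; last first.
  by apply: bm_ig; apply: bm_sum => i _; apply: bm_sum => j _; exact: bmZ.
congr (_ * _); rewrite Ex_sum => [|i _]; last by apply: bm_sum => j _; exact: bmZ.
apply: eq_bigr => i _; rewrite Ex_sum => [|j _]; last exact: bmZ.
apply: eq_bigr => j _; rewrite ExZ; last exact: bm_ig.
congr (_ * _).
transitivity (Ex P (fun w => \1_(Bs i `&` Bs j) (xi 0%N w) +
   ((- mu (Bs j)) * \1_(Bs i) (xi 0%N w) + ((- mu (Bs i)) * \1_(Bs j) (xi 0%N w)
   + mu (Bs i) * mu (Bs j)))) ).
  apply: eq_Ex => w; rewrite /t !indicE in_setI.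
  by case: (_ \in _); case: (_ \in _) => /=; ring.
have bI l : bm (fun w => \1_(Bs l) (xi 0%N w) : R) by exact: bm_ind_xi.
have cI : CBorel (Bs i `&` Bs j) by exact: CBorelI.
rewrite ExD; [|exact/bm_ig/bm_ind_xi|]; last first.
  by apply: bm_ig; apply: bmD; [exact: bmZ|apply: bmD; [exact: bmZ|exact: bm_cst]].
rewrite ExD; [|exact/bm_ig/bmZ|]; last first.
  by apply: bm_ig; apply: bmD; [exact: bmZ|exact: bm_cst].
rewrite ExD; [|exact/bm_ig/bmZ|exact/bm_ig/bm_cst].
rewrite Ex_cst !ExZ; [|exact: (bm_ig P (bI _))..].
by rewrite !Ex_ind_xi//; ring.
Qed.

Lemma covn_ge0 : 0 <= covn.
Proof.
have : 0 <= Ex P (fun w => eh w ^+ 2) by apply: Ex_ge0 => w; exact: sqr_ge0.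
by rewrite Eh2 pmulr_lge0 ?invr_gt0.
Qed.

Lemma Ws_clt : let v := covn in
  `|Ex P (fun w => cos (\sum_(i < p) c i * Ws k n (Bs i) w)) - expR (- v / 2)| <=
     v ^+ 2 / n%:R + Ga ^+ 2 * v / k + Ga * v / Num.sqrt k /\
  `|Ex P (fun w => sin (\sum_(i < p) c i * Ws k n (Bs i) w))| <=
     Ga ^+ 2 * v / k + Ga * v / Num.sqrt k.
Proof.
move=> v; have v0 : 0 <= v := covn_ge0.
have SE w : \sum_(i < p) c i * Ws k n (Bs i) w = \sum_(i < n) h (pat Bs (xi i w)).
  rewrite /Ws; under eq_bigr do rewrite mulrCA mulr_sumr.
  rewrite -mulr_sumr exchange_big mulr_sumr; apply: eq_bigr => i _.
  by congr (_ * _); apply: eq_bigr => j _; rewrite ffunE indicE.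
have vn0 : 0 <= v / (2 * n%:R) by rewrite divr_ge0// mulr_ge0// ltW.
have e01 : 0 <= expR (- (v / (2 * n%:R))) <= 1.
  by rewrite expR_ge0 -[leRHS]expR0 ler_expR oppr_le0.
have [H1 H2] := Ex_trig_sum cBs n h e01.
have beh2 : bm (fun w => eh w ^+ 2) by under eq_fun do rewrite expr2; exact: bmM.
have vE := Eh2; rewrite -/v in vE.
set s := Ex P (fun w => sin (h _)) in H1 H2.
set cc := Ex P (fun w => cos (h _)) in H1.
have sle : `|s| <= Ga / Num.sqrt k * (v / n%:R).
  have bs : bm (fun w => sin (eh w)) by apply: bm_sin; exact: beh.1.
  have -> : s = Ex P (fun w => sin (eh w) - eh w).
    by rewrite ExB; [rewrite Eh0 subr0|exact: bm_ig..].
  apply: le_trans (Ex_norm P (bmB bs beh)) _; rewrite -vE -ExZ; last exact: bm_ig.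
  apply: Ex_le => [||w]; [exact/bm_ig/bm_norm/bmB|exact/bm_ig/bmZ|].
  apply: le_trans (sin_cube _) _.
  rewrite exprS (real_normK (num_real _)) ler_wpM2r ?sqr_ge0//.
  exact: h_le.
have cle : `|cc - (1 - v / (2 * n%:R))| <= Ga ^+ 2 / k * (v / n%:R).
  have bc : bm (fun w => cos (eh w)) by apply: bm_cos; exact: beh.1.
  have b2 : bm (fun w => 1 - eh w ^+ 2 / 2).
    apply: bmB; first exact: bm_cst.
    by under eq_fun do rewrite mulrC; exact: bmZ.
  have -> : cc - (1 - v / (2 * n%:R)) =
      Ex P (fun w => cos (eh w) - (1 - eh w ^+ 2 / 2)).
    rewrite ExB; [|exact: bm_ig..]; congr (_ - _).
    transitivity (Ex P (fun w => 1 - 2^-1 * eh w ^+ 2)); last first.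
      by apply: eq_Ex => w; rewrite [in RHS]mulrC.
    rewrite ExB; [|exact/bm_ig/bm_cst|exact/bm_ig/bmZ].
    rewrite Ex_cst ExZ ?vE; last exact: bm_ig.
    by field; rewrite gt_eqF.
  apply: le_trans (Ex_norm P (bmB bc b2)) _; rewrite -vE -ExZ; last exact: bm_ig.
  apply: Ex_le => [||w]; [exact/bm_ig/bm_norm/bmB|exact/bm_ig/bmZ|].
  apply: le_trans (cos_quad _) _.
  rewrite (_ : 4 = 2 + 2)%N// exprD !(real_normK (num_real _)) ler_wpM2r ?sqr_ge0//.
  rewrite -(real_normK (num_real _)).
  have -> : Ga ^+ 2 / k = (Ga / Num.sqrt k) ^+ 2 by rewrite expr_div_n skk.
  by apply: lerXn2r; rewrite ?nnegrE ?h_le// divr_ge0// ltW.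
have wle : `|expR (- (v / (2 * n%:R))) - (1 - v / (2 * n%:R))| <=
    v ^+ 2 / n%:R / n%:R.
  apply: le_trans (expRN_quad vn0) _.
  have -> : 2 * (v / (2 * n%:R)) ^+ 2 = v ^+ 2 / n%:R / n%:R / 2.
    by field; rewrite gt_eqF.
  have : 0 <= v ^+ 2 / n%:R / n%:R by rewrite !divr_ge0 ?sqr_ge0 ?ltW.
  lra.
have sn : n%:R * `|s| <= Ga * v / Num.sqrt k.
  have -> : Ga * v / Num.sqrt k = n%:R * (Ga / Num.sqrt k * (v / n%:R)).
    by field; rewrite !gt_eqF.
  by rewrite ler_pM2l.
have Gk : 0 <= Ga ^+ 2 * v / k.
  by rewrite divr_ge0 ?(ltW k0)// mulr_ge0// sqr_ge0.
split.
  under eq_Ex do rewrite SE.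
  have -> : - v / 2 = - (v / (2 * n%:R)) * n%:R by field; rewrite gt_eqF.
  rewrite expRM_natr.
  apply: le_trans H1 _; rewrite mulrDr; apply: lerD => //.
  apply: (@le_trans _ _ (n%:R * (v ^+ 2 / n%:R / n%:R + Ga ^+ 2 / k * (v / n%:R)))).
    rewrite ler_pM2l//.
    have -> : cc - expR (- (v / (2 * n%:R))) = (cc - (1 - v / (2 * n%:R))) -
        (expR (- (v / (2 * n%:R))) - (1 - v / (2 * n%:R))) by ring.
    by apply: le_trans (ler_normB _ _) _; rewrite addrC lerD.
  by rewrite le_eqVlt; apply/orP; left; apply/eqP; field; rewrite !gt_eqF.
under eq_Ex do rewrite SE.
by apply: le_trans H2 _; apply: le_trans sn _; rewrite lerDr.
Qed.

End CentralLimit.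
End IidFunctionals.
(** * Tail copulas *)

Section TailCopula.
Context {R : realType} {T : topologicalType} {dO : measure_display}
  {Om : measurableType dO}.
Variables (P : probability Om R) (xi : nat -> Om -> T -> R) (D : nat).
Hypotheses (Hiid : iid P xi) (HC1 : C1 P xi) (HC3 : C3 P xi D) (D0 : (0 < D)%N).
Local Notation mu := (mu P xi).
Local Notation uf := (uf P xi).
Local Notation Rt := (Rtc P xi).

Definition At m (t : 'I_m -> T) (x : 'I_m -> R) (s : R) : set (T -> R) :=
  [set f | forall j, uf (t j) f <= s * x j].

Lemma CBorel_At m (t : 'I_m -> T) (x : 'I_m -> R) (s : R) : CBorel (At t x s).
Proof. by apply: CBorel_fin_forallT => j; exact: (CBorel_uf_le HC1). Qed.

(** Plays the part of integration against the exponent measure: [L] is the limit of s^-1 E g_s. The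
    limit is linear and monotone, so an inequality between combinations of indicators that holds at
    every scale s becomes an inequality between values of R. *)
Definition tE (g : R -> (T -> R) -> R) (L : R) :=
  (forall s, bm (fun w => g s (xi 0%N w))) /\
  (s^-1 * Ex P (fun w => g s (xi 0%N w)) @[s --> 0^'+] --> L).

Lemma tE_le g h L M : tE g L -> tE h M ->
  (forall s, 0 < s -> forall f, g s f <= h s f) -> L <= M.
Proof.
move=> [bg cg] [bh ch] gh; apply: ler_cvg_to cg ch _.
near=> s; have s0 : 0 < s by near: s; exact: nbhs_right_gt.
rewrite ler_wpM2l ?invr_ge0 ?(ltW s0)//.
by apply: Ex_le => [||w]; [exact: bm_ig..|exact: gh].
Unshelve. all: by end_near. Qed.

Lemma tED g h L M : tE g L -> tE h M -> tE (fun s f => g s f + h s f) (L + M).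
Proof.
move=> [bg cg] [bh ch]; split=> [s|]; first exact: bmD.
have -> : (fun s => s^-1 * Ex P (fun w => g s (xi 0%N w) + h s (xi 0%N w))) =
    (fun s => s^-1 * Ex P (fun w => g s (xi 0%N w)) +
              s^-1 * Ex P (fun w => h s (xi 0%N w))).
  by apply/funext => s; rewrite ExD ?mulrDr//; exact: bm_ig.
exact: cvgD.
Qed.

Lemma tEZ c g L : tE g L -> tE (fun s f => c * g s f) (c * L).
Proof.
move=> [bg cg]; split=> [s|]; first exact: bmZ.
have -> : (fun s => s^-1 * Ex P (fun w => c * g s (xi 0%N w))) =
    (fun s => c * (s^-1 * Ex P (fun w => g s (xi 0%N w)))).
  by apply/funext => s; rewrite ExZ 1?mulrCA//; exact: bm_ig.
by apply: cvgM => //; exact: cvg_cst.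
Qed.

Lemma tEB g h L M : tE g L -> tE h M -> tE (fun s f => g s f - h s f) (L - M).
Proof.
move=> tg /(tEZ (-1)) th; have := tED tg th; rewrite mulN1r.
by congr tE; apply/funext => s; apply/funext => f; rewrite mulN1r.
Qed.

Lemma tE0 : tE (fun _ _ => 0) 0.
Proof.
split=> [s|]; first exact: bm_cst.
under eq_fun do rewrite Ex_cst mulr0.
exact: cvg_cst.
Qed.

Lemma tE_sum (I : Type) (r : seq I) (p : pred I) g L :
  (forall i, p i -> tE (g i) (L i)) ->
  tE (fun s f => \sum_(i <- r | p i) g i s f) (\sum_(i <- r | p i) L i).
Proof.
move=> H; elim: r => [|i r IH].
  rewrite big_nil; have := tE0; congr tE.
  by apply/funext => s; apply/funext => f; rewrite big_nil.
rewrite big_cons; case: ifPn => pi.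
  have := tED (H i pi) IH; congr tE.
  by apply/funext => s; apply/funext => f; rewrite big_cons pi.
move: IH; congr tE.
by apply/funext => s; apply/funext => f; rewrite big_cons (negbTE pi).
Qed.

Lemma tE_ind (B : R -> set (T -> R)) L : (forall s, CBorel (B s)) ->
  (s^-1 * mu (B s) @[s --> 0^'+] --> L) -> tE (fun s f => \1_(B s) f) L.
Proof.
move=> cB cL; split=> [s|]; first exact: (bm_ind_xi Hiid).
have -> // : (fun s => s^-1 * Ex P (fun w => \1_(B s) (xi 0%N w))) =
    (fun s => s^-1 * mu (B s)) by apply/funext => s; rewrite (Ex_ind_xi Hiid).
Qed.

Lemma near_scale_le1 (x : R) : \forall s \near 0^'+, s * x <= 1 :> R.
Proof.
have [x0|x0] := leP x 0.
  near=> s; have s0 : 0 < s.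
    near: s; exact: nbhs_right_gt.
  by apply: (@le_trans _ _ 0); rewrite ?pmulr_rle0.
near=> s; rewrite -ler_pdivlMr// mul1r ltW//; near: s.
by apply: nbhs_right_lt; rewrite invr_gt0.
Unshelve. all: by end_near. Qed.

Lemma mu_At0 m (t : 'I_m -> T) (x : 'I_m -> R) (s : R) j : 0 < s -> x j <= 0 -> mu (At t x s) = 0.
Proof.
move=> s0 xj; apply/eqP; rewrite eq_le mu_ge0 andbT.
have h0 := mu_uf_le Hiid HC1 (t j) (y := 0); rewrite lexx ler01 in h0.
rewrite -[leRHS](h0 isT).
apply: (mu_le Hiid) => [||f /(_ j)]; [exact: CBorel_At|exact: (CBorel_uf_le HC1)|].
by move=> /= /le_trans; apply; rewrite pmulr_rle0.
Qed.

(** {U <= 0} is a null event, so the limit defining R is 0 as soon as one coordinate is nonpositive.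
    This agrees with the convention R = 0 for negative coordinates, and clipped and unclipped
    arguments give the same value. *)
Lemma Rtc_npos m (t : 'I_m -> T) (x : 'I_m -> R) j : x j <= 0 ->
  (Rquot P xi t x s @[s --> 0^'+] --> (0 : R)) /\ Rt t x = 0.
Proof.
move=> xj; have H : Rquot P xi t x s @[s --> 0^'+] --> (0 : R).
  apply: cvg_near_cst; near=> s; apply/eqP.
  have s0 : 0 < s by near: s; exact: nbhs_right_gt.
  by rewrite /Rquot -[fine _]/(mu (At t x s)) (mu_At0 _ s0 xj) mulr0.
by split => //; exact/cvg_lim.
Unshelve. all: by end_near. Qed.

Lemma Rtc1_cvg (t : 'I_1 -> T) (x : 'I_1 -> R) :
  (Rquot P xi t x s @[s --> 0^'+] --> Num.max (x ord0) 0) /\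
  Rt t x = Num.max (x ord0) 0.
Proof.
have [x0|x0] := leP (x ord0) 0; first exact: Rtc_npos x0.
suff H : Rquot P xi t x s @[s --> 0^'+] --> x ord0 by split => //; exact/cvg_lim.
apply: cvg_near_cst; near=> s.
have s0 : 0 < s by near: s; exact: nbhs_right_gt.
apply/eqP; rewrite /Rquot -[fine _]/(mu (At t x s)).
have -> : At t x s = [set f | uf (t ord0) f <= s * x ord0].
  by apply/seteqP; split => f /=; [exact|move=> h j; rewrite (ord1 j)].
have sx1 : s * x ord0 <= 1 by near: s; exact: near_scale_le1.
have sx : 0 <= s * x ord0 <= 1 by rewrite sx1 andbT mulr_ge0 ?(ltW s0) ?(ltW x0).
by rewrite (mu_uf_le Hiid HC1 _ sx) mulKf// gt_eqF.
Unshelve. all: by end_near. Qed.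

(** Condition (C3) starts at m = 2; the case m = 1 comes from the uniform marginals and nonpositive
    coordinates from the null event above. *)
Lemma tE_At m (t : 'I_m -> T) (x : 'I_m -> R) : (0 < m <= 2 * D)%N ->
  tE (fun s f => \1_(At t x s) f) (Rt t x).
Proof.
move=> /andP[m0 mD]; apply: tE_ind => [s|]; first exact: CBorel_At.
change (Rquot P xi t x s @[s --> 0^'+] --> Rt t x).
have [[j xj]|npos] := pselect (exists j, x j <= 0).
  by have [c ->] := Rtc_npos t xj.
have [m1|m1] := eqVneq m 1%N.
  by subst m; have [+ ->] := Rtc1_cvg t x.
have m2 : (2 <= m <= 2 * D)%N by rewrite mD andbT; lia.
have [j|l cl] := HC3 m2 t (x := x).
  by rewrite leNgt; apply/negP => xj; apply: npos; exists j; exact: ltW.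
by rewrite /Rtc (cvg_lim _ cl).
Qed.

Definition At1 (t : T) (a : R) (s : R) : set (T -> R) := [set f | uf t f <= s * a].

Lemma tE_At1 (t : T) (a : R) : tE (fun s f => \1_(At1 t a s) f) (Num.max a 0).
Proof.
have m1 : (0 < 1 <= 2 * D)%N by lia.
have := tE_At (fun _ : 'I_1 => t) (fun=> a) m1; rewrite (Rtc1_cvg _ _).2.
congr tE; apply/funext => s; congr (\1__).
by apply/seteqP; split => f /=; [move=> /(_ ord0)|move=> h j].
Qed.

Lemma catf_l (U : Type) m1 m2 (f : 'I_m1 -> U) (g : 'I_m2 -> U) i :
  catf f g (lshift m2 i) = f i.
Proof. by rewrite /catf -[lshift _ _]/(unsplit (inl i)) unsplitK. Qed.

Lemma catf_r (U : Type) m1 m2 (f : 'I_m1 -> U) (g : 'I_m2 -> U) i :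
  catf f g (rshift m1 i) = g i.
Proof. by rewrite /catf -[rshift _ _]/(unsplit (inr i)) unsplitK. Qed.

Lemma catf_cst (U : Type) m1 m2 (c : U) :
  catf (fun _ : 'I_m1 => c) (fun _ : 'I_m2 => c) = fun=> c.
Proof. by apply/funext => i; rewrite /catf; case: (fintype.split i). Qed.

Lemma catf_forall (m1 m2 : nat) (U V : Type) (f : 'I_m1 -> U) (g : 'I_m2 -> U)
    (f' : 'I_m1 -> V) (g' : 'I_m2 -> V) (Q : U -> V -> Prop) :
  (forall i, Q (catf f g i) (catf f' g' i)) <->
  (forall i, Q (f i) (f' i)) /\ (forall i, Q (g i) (g' i)).
Proof.
split=> [H|[H1 H2] i].
  by split=> i; [have := H (lshift m2 i)|have := H (rshift m1 i)];
    rewrite ?catf_l ?catf_r.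
by rewrite /catf; case: (fintype.split i).
Qed.

Lemma At_cat m1 m2 (t1 : 'I_m1 -> T) (t2 : 'I_m2 -> T) x1 x2 s :
  At (catf t1 t2) (catf x1 x2) s = At t1 x1 s `&` At t2 x2 s.
Proof.
apply/seteqP; split => f /=;
  by rewrite /At /= (catf_forall _ _ _ _ (fun t x => uf t f <= s * x)).
Qed.

Lemma R_ge0 m (t : 'I_m -> T) (x : 'I_m -> R) : (0 < m <= 2 * D)%N -> 0 <= Rt t x.
Proof. by move=> mD; apply: tE_le tE0 (tE_At t x mD) _ => s _ f; exact: ind_ge0. Qed.

Lemma R_mono m (t : 'I_m -> T) (x y : 'I_m -> R) : (0 < m <= 2 * D)%N ->
  (forall j, x j <= y j) -> Rt t x <= Rt t y.
Proof.
move=> mD xy; apply: tE_le (tE_At t x mD) (tE_At t y mD) _ => s s0 f.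
by apply: ind_le => /= H j; apply: le_trans (H j) _; rewrite ler_pM2l.
Qed.

Lemma R_le1 m (t : 'I_m -> T) (x : 'I_m -> R) j : (0 < m <= 2 * D)%N -> Rt t x <= Num.max (x j) 0.
Proof.
move=> mD; apply: tE_le (tE_At t x mD) (tE_At1 (t j) (x j)) _ => s s0 f.
by apply: ind_le => /= /(_ j).
Qed.

Lemma indB_sub (U : Type) (A B : set U) f : \1_(A `\` B) f = \1_A f - \1_(A `&` B) f :> R.
Proof.
rewrite !indicE in_setD in_setI.
by case: (f \in A); case: (f \in B) => /=; rewrite ?subr0 ?subrr.
Qed.

Lemma ind_bigD (U : Type) (I : finType) (A B : set U) (C : I -> set U) f :
  (A f -> ~ B f -> exists i, C i f) -> \1_A f <= \1_B f + \sum_i \1_(C i) f :> R.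
Proof.
move=> H; have s0 : 0 <= \sum_i \1_(C i) f :> R by apply: sumr_ge0 => i _; exact: ind_ge0.
have [Af|Af] := pselect (A f); last by rewrite ind0// addr_ge0 ?ind_ge0.
rewrite ind1//; have [Bf|Bf] := pselect (B f); first by rewrite ind1// lerDl.
rewrite ind0// add0r; have [i Ci] := H Af Bf.
rewrite (bigD1 i)//= ind1// lerDl; apply: sumr_ge0 => j _; exact: ind_ge0.
Qed.

(** On {U <= s x} outside {U <= s y}, some U_j lies between s min(x_j, y_j) and s x_j. *)
Lemma R_lip m (t : 'I_m -> T) (x y : 'I_m -> R) : (0 < m <= 2 * D)%N ->
  Rt t x <= Rt t y + \sum_j `|x j - y j|.
Proof.
move=> mD.
have H := tED (tE_At t y mD) (tE_sum (index_enum 'I_m) (fun j (_ : predT j) =>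
   tEB (tE_At1 (t j) (x j)) (tE_At1 (t j) (Num.min (x j) (y j))))).
apply: le_trans (tE_le (tE_At t x mD) H _) _ => [s s0 f|].
  apply: le_trans (ind_bigD (B := At t y s)
    (C := fun j => At1 (t j) (x j) s `\` At1 (t j) (Num.min (x j) (y j)) s) _) _.
    move=> /= xf /existsNP[j /negP]; rewrite -ltNge => yj; exists j; split => /=.
      exact: xf.
    apply/negP; rewrite -ltNge; apply: le_lt_trans yj.
    by rewrite ler_pM2l// ge_min lexx orbT.
  rewrite lerD2l; apply: ler_sum => j _; rewrite indB_sub lerD2l lerN2.
  apply: ind_le => /= h; split => //; apply: le_trans h _.
  by rewrite ler_pM2l// ge_min lexx.
rewrite lerD2l; apply: ler_sum => j _; have := ler_norm (x j - y j).
have := normr_ge0 (x j - y j).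
by case: (leP (x j) (y j)); case: (leP (x j) 0); case: (leP (y j) 0); lra.
Qed.

Lemma R_hom m (t : 'I_m -> T) (x : 'I_m -> R) (a : R) : (0 < m <= 2 * D)%N -> 0 <= a ->
  Rt t (fun j => a * x j) = a * Rt t x.
Proof.
move=> mD; rewrite le_eqVlt => /predU1P[<-|a0].
  case: m mD t x => [//|m] mD t x.
  have xj : (fun j : 'I_m.+1 => 0 * x j) ord0 <= 0 by rewrite mul0r.
  by rewrite (Rtc_npos t xj).2 mul0r.
have [_ cx] := tE_At t x mD.
have [_ cax] := tE_At t (fun j => a * x j) mD.
apply: (cvg_unique _ cax) => //.
have sc : (fun s => a * s) s @[s --> 0^'+] --> (0 : R)^'+.
  move=> A [e /= e0 He]; exists (e / a); rewrite /= ?divr_gt0// => s /= se s0.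
  apply: He; last by rewrite mulr_gt0.
  move: se; rewrite /= !sub0r !normrN normrM (gtr0_norm a0).
  by rewrite ltr_pdivlMr// [_ * a]mulrC.
have := cvg_comp _ _ sc cx => /(cvgM (cvg_cst a)); apply: cvg_trans.
apply: near_eq_cvg; near=> s => /=.
have s0 : 0 < s by near: s; exact: nbhs_right_gt.
have -> : At t (fun j => a * x j) s = At t x (a * s).
  by apply/seteqP; split => f /= H j; have := H j; rewrite mulrCA mulrA.
by rewrite invfM mulrA mulrA mulfV ?gt_eqF// mul1r.
Unshelve. all: by end_near. Qed.

(** Half the square of [rho2T]. It is the limiting mass of the event where U(s) is below and U(t)
    above the level, so it satisfies the triangle inequality itself ([rT_tri]), and the estimates on
    R are linear in it. *)
Definition rT (s t : T) : R :=
  1 - Rt (catf (fun _ : 'I_1 => s) (fun _ : 'I_1 => t)) (fun=> 1).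

Let m2 : (0 < 1 + 1 <= 2 * D)%N. Proof. by lia. Qed.

Lemma tE_pair (t t' : T) (a : R) : 0 <= a ->
  tE (fun s f => \1_(At1 t a s `\` At1 t' a s) f) (a * rT t t').
Proof.
move=> a0; pose tt' := catf (fun _ : 'I_1 => t) (fun _ : 'I_1 => t').
have Ra : Rt tt' (fun=> a) = a * Rt tt' (fun=> 1).
  by rewrite -R_hom//; congr (Rt _ _); apply/funext => j; rewrite mulr1.
have := tEB (tE_At1 t a) (tE_At tt' (fun=> a) m2).
have e : a - a * Rt tt' (fun=> 1) = a * rT t t' by rewrite /rT mulrBr mulr1.
rewrite max_l// Ra e; congr tE.
apply/funext => s; apply/funext => f.
rewrite indB_sub -(@catf_cst R 1 1 a) At_cat; congr (_ - \1_(_ `&` _) _).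
  by apply/seteqP; split => g /=; [move=> /(_ ord0)|move=> h j].
by apply/seteqP; split => g /=; [move=> /(_ ord0)|move=> h j].
Qed.

Lemma rT_ge0 s t : 0 <= rT s t.
Proof. by rewrite subr_ge0; have := R_le1 _ (fun=> 1) ord0 m2; rewrite max_l. Qed.

Lemma rT_sym s t : rT s t = rT t s.
Proof.
suff H a b : rT a b <= rT b a by apply/eqP; rewrite eq_le !H.
rewrite lerD2l lerN2; apply: tE_le (tE_At _ _ m2) (tE_At _ _ m2) _ => e e0 f.
apply: ind_le; rewrite -(@catf_cst R 1 1 1) !At_cat /= => -[h1 h2].
by split.
Qed.

Lemma rT_tri s t u : rT s t <= rT s u + rT u t.
Proof.
have H a b : tE (fun s f => \1_(At1 a 1 s `\` At1 b 1 s) f) (rT a b).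
  by have := tE_pair a b (@ler01 R); rewrite mul1r.
apply: tE_le (H s t) (tED (H s u) (H u t)) _ => e e0 f.
rewrite !indB_sub !indicE !in_setI.
by case: (_ \in _); case: (_ \in _); case: (_ \in _) => /=; lra.
Qed.

Lemma R_sub_le_t m (t t' : 'I_m -> T) (x : 'I_m -> R) : (0 < m <= 2 * D)%N ->
  (forall j, 0 <= x j) -> Rt t x <= Rt t' x + \sum_j x j * rT (t j) (t' j).
Proof.
move=> mD x0.
have H := tED (tE_At t' x mD) (tE_sum (index_enum 'I_m) (fun j (_ : predT j) =>
   tE_pair (t j) (t' j) (x0 j))).
apply: tE_le (tE_At t x mD) H _ => s s0 f.
apply: (ind_bigD (B := At t' x s)
    (C := fun j => At1 (t j) (x j) s `\` At1 (t' j) (x j) s)) => /= xf.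
by move=> /existsNP[j yj]; exists j; split => //; exact: xf.
Qed.

Lemma rho2T_rT s t : rho2T P xi s t = Num.sqrt (2 * rT s t).
Proof. by []. Qed.

Definition r2 m1 m2 (t1 : 'I_m1 -> T) (x1 : 'I_m1 -> R)
    (t2 : 'I_m2 -> T) (x2 : 'I_m2 -> R) : R :=
  Rt t1 x1 + Rt t2 x2 - 2 * Rt (catf t1 t2) (catf x1 x2).

(* Every point of {U <= s y} lies, for j = argmax U_j / x_j, in the dilated set {U <= s tau x}
   with U_j > s tau theta x_j for exactly one tau = (y_j / x_j) theta^l. *)
Lemma R_slices_upper m (t : 'I_m -> T) (x y : 'I_m -> R) (th : R) L :
  (0 < m <= 2 * D)%N -> (forall j, 0 < x j) -> (forall j, 0 <= y j) -> 0 < th < 1 ->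
  Rt t y <= \sum_j (\sum_(l < L) (y j / x j * th ^+ l) *
       (Rt t x - Rt t (fun i => if i == j then th * x i else x i)) + th ^+ L * y j).
Proof.
move=> mD x0 y0 /andP[th0 th1].
pose tau j l := y j / x j * th ^+ l.
have tau0 j l : 0 <= tau j l by rewrite mulr_ge0 ?exprn_ge0 ?(ltW th0)// divr_ge0// ltW.
pose xt j i := if i == j then th * x i else x i.
have Ht j l := tE_At t (fun i => tau j l * x i) mD.
have Htt j l := tE_At t (fun i => tau j l * xt j i) mD.
have H : tE (fun s f => \sum_j (\sum_(l < L) (\1_(At t (fun i => tau j l * x i) s) f -
   \1_(At t (fun i => tau j l * xt j i) s) f) + \1_(At1 (t j) (th ^+ L * y j) s) f))
   (\sum_j (\sum_(l < L) (tau j l * (Rt t x - Rt t (xt j))) + th ^+ L * y j)).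
  apply: tE_sum => j _; apply: tED; last first.
    have := tE_At1 (t j) (th ^+ L * y j); rewrite max_l//.
    by rewrite mulr_ge0// exprn_ge0// ltW.
  apply: tE_sum => l _; rewrite mulrBr -!(R_hom t _ mD (tau0 j l)).
  exact: tEB.
apply: tE_le (tE_At t y mD) H _ => s s0 f.
have pos j (l : 'I_L) : 0 <= \1_(At t (fun i => tau j l * x i) s) f -
   \1_(At t (fun i => tau j l * xt j i) s) f :> R.
  rewrite subr_ge0; apply: ind_le => /= h i; apply: le_trans (h i) _.
  rewrite ler_pM2l// ler_wpM2l// /xt; case: ifP => // _.
  by rewrite ler_piMl// ?(ltW (x0 i))// ltW.
have pos1 j : 0 <= \sum_(l < L) (\1_(At t (fun i => tau j l * x i) s) f -
   \1_(At t (fun i => tau j l * xt j i) s) f) :> R by apply: sumr_ge0.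
have pos2 j : 0 <= \sum_(l < L) (\1_(At t (fun i => tau j l * x i) s) f -
   \1_(At t (fun i => tau j l * xt j i) s) f) + \1_(At1 (t j) (th ^+ L * y j) s) f :> R.
  by rewrite addr_ge0 ?ind_ge0.
have [Af|Af] := pselect (At t y s f); last by rewrite ind0//; exact: sumr_ge0.
rewrite ind1//.
case: m mD t x y x0 y0 @tau tau0 @xt Ht Htt pos pos1 pos2 Af => [//|m].
move=> mD t x y x0 y0 tau tau0 xt Ht Htt pos pos1 pos2 Af.
pose c i := uf (t i) f / x i.
pose j := [arg max_(i > ord0) c i]%O.
have cj i : c i <= c j by rewrite /j; case: (arg_maxP _ (i0 := ord0)) => //= a _; exact.
rewrite (bigD1 j)//= -[leLHS]addr0; apply: lerD; last exact: sumr_ge0.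
have ui i : uf (t i) f <= c j * x i by rewrite -ler_pdivrMr// cj.
have uj : uf (t j) f = c j * x j by rewrite /c divfK// gt_eqF.
have [rem|rem] := leP (c j) (s * tau j L).
  rewrite (ind1 (A := At1 _ _ _)) ?lerDr; first exact: pos1.
  rewrite /At1 /= uj.
  have -> : s * (th ^+ L * y j) = s * tau j L * x j.
    by rewrite /tau; field; rewrite gt_eqF.
  by rewrite ler_pM2r.
rewrite -[leLHS]addr0; apply: lerD; last exact: ind_ge0.
have ctop : c j <= s * tau j 0%N.
  have Afj : uf (t j) f <= s * y j := Af j.
  rewrite /tau expr0 mulr1 /c ler_pdivrMr//.
  by have -> : s * (y j / x j) * x j = s * y j by field; rewrite gt_eqF.
have [l lL /andP[l1 l2]] : exists2 l, (l < L)%N & s * tau j l.+1 < c j <= s * tau j l.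
  elim: {pos pos1 pos2} L rem => [|L IH] rem; first by rewrite leNgt rem in ctop.
  have [h|h] := leP (c j) (s * tau j L); first by exists L => //; rewrite rem.
  by have [l lL lh] := IH h; exists l => //; exact: ltnW.
rewrite (bigD1 (Ordinal lL))//= ind1 ?ind0 ?subr0 ?lerDl//.
- by apply: sumr_ge0 => i _; exact: pos.
- move=> /= /(_ j); rewrite /xt eqxx uj => h.
  move: l1; rewrite -(ltr_pM2r (x0 j)) ltNge => /negP; apply.
  by move: h; rewrite /tau exprSr !mulrA.
- move=> i; apply: le_trans (ui i) _; rewrite mulrA ler_pM2r//.
Qed.

(** In the shell [A j l], coordinate j lies in (th^(l+1) x_j, th^l x_j] and every other coordinate
    is at most th^(l+1) x_i, up to the factor s. Two shells with different j would force
    contradictory inequalities between their exponents, so the shells are disjoint parts of {U <= s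
    x}. *)
Lemma R_slices_lower m (t : 'I_m -> T) (x : 'I_m -> R) (th : R) L :
  (0 < m <= 2 * D)%N -> (forall j, 0 < x j) -> 0 < th < 1 ->
  \sum_j \sum_(l < L) th ^+ l.+1 *
       (Rt t (fun i => if i == j then th^-1 * x i else x i) - Rt t x) <= Rt t x.
Proof.
move=> mD x0 /andP[th0 th1].
pose xt j i := if i == j then th^-1 * x i else x i.
have th0' l : 0 <= th ^+ l by rewrite exprn_ge0// ltW.
have Ht l := tE_At t (fun i => th ^+ l * x i) mD.
have Htt j l := tE_At t (fun i => th ^+ l * xt j i) mD.
have H : tE (fun s f => \sum_j \sum_(l < L) (\1_(At t (fun i => th ^+ l.+1 * xt j i) s) f -
   \1_(At t (fun i => th ^+ l.+1 * x i) s) f))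
   (\sum_j \sum_(l < L) th ^+ l.+1 * (Rt t (xt j) - Rt t x)).
  apply: tE_sum => j _; apply: tE_sum => l _.
  rewrite mulrBr -!(R_hom t _ mD (th0' l.+1)); exact: tEB.
apply: tE_le H (tE_At t x mD) _ => s s0 f.
pose A j (l : 'I_L) := At t (fun i => th ^+ l.+1 * xt j i) s `\`
   At t (fun i => th ^+ l.+1 * x i) s.
have xxt j i : x i <= xt j i.
  rewrite /xt; case: ifP => // _; rewrite ler_peMl ?(ltW (x0 i))//.
  by rewrite invf_ge1// ltW.
have -> : \sum_j \sum_(l < L) (\1_(At t (fun i => th ^+ l.+1 * xt j i) s) f -
   \1_(At t (fun i => th ^+ l.+1 * x i) s) f) = \sum_j \sum_(l < L) \1_(A j l) f :> R.
  apply: eq_bigr => j _; apply: eq_bigr => l _; rewrite /A indB_sub.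
  congr (_ - \1__ _); apply/seteqP; split => g /= h; last by case: h.
  split => // i; apply: le_trans (h i) _.
  by rewrite ler_pM2l// ler_wpM2l.
have AP j l : A j l f -> s * (th ^+ l.+1 * x j) < uf (t j) f <= s * (th ^+ l * x j) /\
    (forall i, i != j -> uf (t i) f <= s * (th ^+ l.+1 * x i)).
  move=> [h1 /existsNP[i0 /negP]]; rewrite -ltNge => h2.
  have h3 i : i != j -> uf (t i) f <= s * (th ^+ l.+1 * x i).
    by move=> ij; have := h1 i; rewrite /xt (negbTE ij).
  have i0j : i0 = j.
    by apply/eqP/negP => /negP /h3; rewrite leNgt h2.
  subst i0; split => //; rewrite h2 /=; have := h1 j; rewrite /xt eqxx.
  by rewrite exprSr !mulrA -(mulrA _ th) mulfV ?gt_eqF// mulr1.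
have [[j [l Ajl]]|none] := pselect (exists j l, A j l f); last first.
  rewrite big1 ?ind_ge0// => j _; apply: big1 => l _; rewrite ind0// => h.
  by apply: none; exists j, l.
have [/andP[a1 a2] a3] := AP _ _ Ajl.
have lt_th a b : th ^+ a < th ^+ b -> (b < a)%N.
  move=> h; rewrite ltnNge; apply/negP => ab; move: h; rewrite ltNge => /negP; apply.
  by apply: ler_wiXn2l => //; exact: ltW.
have uniq j' l' : A j' l' f -> j' = j /\ l' = l.
  move=> /AP[/andP[b1 b2] b3].
  have jj : j' = j.
    apply/eqP/negP => /negP jj.
    have := lt_le_trans b1 (a3 _ jj); rewrite ltr_pM2l// ltr_pM2r// => /lt_th h1.
    rewrite eq_sym in jj.
    have := lt_le_trans a1 (b3 _ jj); rewrite ltr_pM2l// ltr_pM2r// => /lt_th h2.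
    by lia.
  subst j'; split => //.
  have := lt_le_trans b1 a2; rewrite ltr_pM2l// ltr_pM2r// => /lt_th h1.
  have := lt_le_trans a1 b2; rewrite ltr_pM2l// ltr_pM2r// => /lt_th h2.
  by apply: val_inj => /=; lia.
rewrite (bigD1 j)//= [X in _ + X]big1 ?addr0; last first.
  move=> j' jj; apply: big1 => l' _; rewrite ind0// => /uniq[jj' _].
  by rewrite jj' eqxx in jj.
rewrite (bigD1 l)//= [X in _ + X]big1 ?addr0; last first.
  by move=> l' ll; rewrite ind0// => /uniq[_ ll']; rewrite ll' eqxx in ll.
rewrite !ind1// => i; have [->|ij] := eqVneq i j.
  apply: le_trans a2 _; rewrite ler_pM2l// ler_piMl ?(ltW (x0 _))//.
  by rewrite exprn_ile1// ltW.
apply: le_trans (a3 _ ij) _; rewrite ler_pM2l// ler_piMl ?(ltW (x0 _))//.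
by rewrite exprn_ile1// ltW.
Qed.

End TailCopula.
(** * Partial derivatives of tail copulas *)

Lemma cvg_sumr {R : realType} (X : Type) (F : set_system X) (FF : Filter F)
    (I : Type) (r : seq I) (f : I -> X -> R) (a : I -> R) :
  (forall i, f i x @[x --> F] --> a i) ->
  \sum_(i <- r) f i x @[x --> F] --> \sum_(i <- r) a i.
Proof.
move=> fa; elim: r => [|i r IH].
  under eq_fun do rewrite big_nil.
  by rewrite big_nil; exact: cvg_cst.
under eq_fun do rewrite big_cons.
by rewrite big_cons; exact: cvgD.
Qed.

(** * Limits along ultrafilters *)

Section UltrafilterLimits.
Variables (U : set_system nat) (UU : UltraFilter U).

(** Ultrafilters replace nested extractions of subsequences: locations, arguments and directions all
    converge along the same filter. *)
Lemma ultra_finite (N : nat) (c : nat -> nat) : (forall n, (c n < N)%N) ->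
  exists v, U [set n | c n = v].
Proof.
have PU : ProperFilter U by exact: ultra_proper.
have H M : U [set n | (c n < M)%N] -> exists v, U [set n | c n = v].
  elim: M => [|M IH] UM.
    have := @filter_ex _ _ PU _ UM.
    by move=> [n].
  have [h|h] := in_ultra_setVsetC [set n | c n = M] UU; first by exists M.
  apply: IH; apply: filterS (filterI UM h) => n /= [].
  by rewrite ltnS leq_eqVlt => /orP[/eqP|].
move=> cN; apply: (H N); apply: filterS (@filterT _ U _) => n _; exact: cN.
Qed.

Lemma ultra_real {R : realType} (a b : R) (u : nat -> R) :
  (forall n, a <= u n <= b) -> exists2 p, a <= p <= b &
    forall e, 0 < e -> U [set n | `|u n - p| <= e].
Proof.
have PU : ProperFilter U by exact: ultra_proper.
move=> ab; have cab := @segment_compact R a b.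
have PuU : ProperFilter (u @ U) := fmap_proper_filter _ PU.
have uab : (u @ U) `[a, b]%classic.
  apply: (@filterS _ U _ setT); last exact: filterT.
  by move=> n _; rewrite /= in_itv /=; exact: ab.
have [p [pab clp]] := cab _ PuU uab.
exists p; first by move: pab; rewrite /= in_itv.
move=> e e0.
have [//|h] := in_ultra_setVsetC [set n | `|u n - p| <= e] UU.
have nb : nbhs p [set x | `|x - p| <= e].
  by apply/nbhs_ballP; exists e => //= x; rewrite /ball /= distrC => /ltW.
have [x [/= x1 x2]] := clp [set x | ~ (`|x - p| <= e)] _ h nb.
by [].
Qed.

End UltrafilterLimits.

Section Derivatives.
Context {R : realType} {T : topologicalType} {dO : measure_display}
  {Om : measurableType dO}.
Variables (P : probability Om R) (xi : nat -> Om -> T -> R) (D : nat).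
Hypotheses (Hiid : iid P xi) (HC1 : C1 P xi) (HC3 : C3 P xi D) (D0 : (0 < D)%N).
Local Notation Rt := (Rtc P xi).
Local Notation rT := (rT P xi).

Let mD2 m : (0 < m <= D)%N -> (0 < m <= 2 * D)%N. Proof. by lia. Qed.

Lemma R_pos m (t : 'I_m -> T) (x : 'I_m -> R) :
  Rt t (fun j => Num.max (x j) 0) = Rt t x.
Proof.
have [[j xj]|npos] := pselect (exists j, x j <= 0).
  rewrite (Rtc_npos Hiid HC1 t xj).2 (@Rtc_npos _ _ _ _ _ _ Hiid HC1 _ _ _ j _).2 //.
  by rewrite max_r.
congr (Rt _ _); apply/funext => j; rewrite max_l// leNgt.
by apply/negP => xj; apply: npos; exists j; exact: ltW.
Qed.

Lemma cvg_scale_at_right (c : R) : c != 0 -> c * e @[e --> (0 : R)^'+] --> (0 : R)^'.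
Proof.
move=> c0 A [e /= e0 He]; have c0' : 0 < `|c| by rewrite normr_gt0.
exists (e / `|c|); rewrite /= ?divr_gt0// => s /= se s0.
apply: He; last by rewrite mulf_neq0// gt_eqF.
by move: se; rewrite /= !sub0r !normrN normrM ltr_pdivlMr// [_ * `|c|]mulrC.
Qed.

Lemma sum_geom (th : R) L : \sum_(l < L) th ^+ l * (1 - th) = 1 - th ^+ L.
Proof.
elim: L => [|L IH]; first by rewrite big_ord0 expr0 subrr.
by rewrite big_ord_recr /= IH exprSr; ring.
Qed.

(** The slices are difference quotients with geometric weights. Ratio th = 1 - e, with weights
    summing to at most 1/e, gives R(y) <= sum_j y_j g_j; ratio th = 1/(1+e) gives sum_j x_j g_j <=
    R(x). Their difference is the supergradient inequality. *)
Lemma R_supergrad m (t : 'I_m -> T) (x y : 'I_m -> R) (g : 'I_m -> R) :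
  (0 < m <= 2 * D)%N -> (forall j, 0 < x j) -> (forall j, 0 <= y j) ->
  (forall j, Rdiffq P xi t j x h @[h --> 0^'] --> g j) ->
  Rt t y - Rt t x <= \sum_j g j * (y j - x j).
Proof.
move=> mD x0 y0 dg.
have up : Rt t y <= \sum_j y j * g j.
  have c1 : \sum_j y j * Rdiffq P xi t j x (- x j * e) @[e --> (0 : R)^'+] -->
      \sum_j y j * g j.
    apply: cvg_sumr => j; apply: cvgM; first exact: cvg_cst.
    apply: cvg_comp (dg j); apply: cvg_scale_at_right.
    by rewrite oppr_eq0 gt_eqF.
  apply: ler_cvg_to (cvg_cst (Rt t y)) c1 _.
  near=> e.
  have e0 : 0 < e by near: e; exact: nbhs_right_gt.
  have e1 : e < 1 by near: e; apply: nbhs_right_lt; exact: ltr01.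
  pose th := 1 - e.
  have th01 : 0 < th < 1 by rewrite /th; apply/andP; split; lra.
  have cL : \sum_j y j * Rdiffq P xi t j x (- x j * e) + th ^+ L * (\sum_j y j)
      @[L --> \oo] --> \sum_j y j * Rdiffq P xi t j x (- x j * e) + 0 * (\sum_j y j).
    apply: cvgD; first exact: cvg_cst.
    apply: cvgM; last exact: cvg_cst.
    by apply: cvg_expr; rewrite gtr0_norm; case/andP: th01.
  rewrite mul0r addr0 in cL.
  apply: ler_cvg_to (cvg_cst (Rt t y)) cL _.
  near=> L.
  apply: le_trans (R_slices_upper Hiid HC1 HC3 D0 t L mD x0 y0 th01) _.
  rewrite mulr_sumr -big_split /=; apply: ler_sum => j _; rewrite lerD2r.
  have -> : (fun i => if i == j then th * x i else x i) = upd x j (- x j * e).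
    apply/funext => i; rewrite /upd; case: ifP => // /eqP ->.
    by rewrite /th; ring.
  rewrite /Rdiffq; set a := Rt t x; set b := Rt t (upd _ _ _).
  have ba : b <= a.
    apply: (R_mono Hiid HC1 HC3 D0) => // i; rewrite /upd; case: ifP => // _.
    by rewrite gerDl mulNr oppr_le0 mulr_ge0// ltW.
  have -> : y j * ((b - a) / (- x j * e)) = (y j / x j) * (a - b) / e.
    by field; rewrite !gt_eqF.
  have sg : \sum_(l < L) th ^+ l <= e^-1.
    rewrite -(ler_pM2r e0) mulVf ?gt_eqF// mulr_suml.
    have := sum_geom th L; have -> : 1 - th = e by rewrite /th; ring.
    by move=> ->; rewrite gerBl exprn_ge0//; case/andP: th01 => /ltW.
  rewrite (eq_bigr (fun l : 'I_L => (y j / x j * (a - b)) * th ^+ l)).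
    rewrite -mulr_sumr ler_wpM2l// mulr_ge0 ?subr_ge0//.
    by rewrite divr_ge0// ltW.
  by move=> l _; ring.
have lo : \sum_j x j * g j <= Rt t x.
  have c1 : \sum_j x j * Rdiffq P xi t j x (x j * e) @[e --> (0 : R)^'+] -->
      \sum_j x j * g j.
    apply: cvg_sumr => j; apply: cvgM; first exact: cvg_cst.
    apply: cvg_comp (dg j); apply: cvg_scale_at_right.
    by rewrite gt_eqF.
  apply: ler_cvg_to c1 (cvg_cst (Rt t x)) _.
  near=> e.
  have e0 : 0 < e by near: e; exact: nbhs_right_gt.
  pose th := (1 + e)^-1.
  have e10 : 0 < 1 + e by lra.
  have th01 : 0 < th < 1 by rewrite /th invr_gt0 e10 invf_lt1//; lra.
  set S := \sum_j _.
  have cL : (1 - th ^+ L) * S @[L --> \oo] --> (1 - 0) * S.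
    apply: cvgM; last exact: cvg_cst.
    apply: cvgB; first exact: cvg_cst.
    by apply: cvg_expr; rewrite gtr0_norm; case/andP: th01.
  rewrite subr0 mul1r in cL.
  apply: ler_cvg_to cL (cvg_cst (Rt t x)) _.
  near=> L.
  apply: le_trans (R_slices_lower Hiid HC1 HC3 D0 t L mD x0 th01).
  rewrite /S mulr_sumr; apply: ler_sum => j _.
  have -> : (fun i => if i == j then th^-1 * x i else x i) = upd x j (x j * e).
    apply/funext => i; rewrite /upd; case: ifP => // /eqP ->.
    by rewrite /th invrK; ring.
  rewrite -mulr_suml /Rdiffq.
  have -> : x j * ((Rt t (upd x j (x j * e)) - Rt t x) / (x j * e)) =
      (Rt t (upd x j (x j * e)) - Rt t x) / e by field; rewrite !gt_eqF.
  rewrite mulrCA mulrC le_eqVlt; apply/orP; left; apply/eqP.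
  congr (_ * _); rewrite -(sum_geom th L) mulr_suml; apply: eq_bigr => l _.
  by rewrite exprS /th; field; rewrite !gt_eqF.
rewrite (eq_bigr (fun j => y j * g j - x j * g j)) => [|j _]; last by ring.
by rewrite sumrB; apply: lerB.
Unshelve. all: by end_near. Qed.

Lemma Rdiffq_bound m (t : 'I_m -> T) j (x : 'I_m -> R) (h : R) :
  (0 < m <= 2 * D)%N -> `|Rdiffq P xi t j x h| <= 1.
Proof.
move=> mD; rewrite /Rdiffq.
have [->|h0] := eqVneq h 0; first by rewrite invr0 mulr0 normr0.
rewrite normrM normfV ler_pdivrMr ?normr_gt0// mul1r.
have H a b : (forall i, i != j -> a i = b i) -> Rt t a - Rt t b <= `|a j - b j|.
  move=> ab; have := R_lip Hiid HC1 HC3 D0 t a b mD.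
  rewrite (bigD1 j)//= [X in _ + (_ + X)]big1 ?addr0; first by lra.
  by move=> i /ab ->; rewrite subrr normr0.
have e1 i : i != j -> upd x j h i = x i by rewrite /upd => /negbTE ->.
have e2 : upd x j h j - x j = h by rewrite /upd eqxx addrAC subrr add0r.
rewrite ler_norml; have := H _ _ e1; rewrite e2.
have := H _ _ (fun i ij => esym (e1 i ij)); rewrite distrC e2.
by lra.
Qed.

Lemma lim_bound1 (F : set_system R) (FF : ProperFilter F) (f : R -> R) :
  (forall h, `|f h| <= 1) -> `|lim (f h @[h --> F])| <= 1.
Proof.
(* A limit that does not exist takes the default value 0, which obeys the bound as well. *)
move=> f1; have [cf|/dvgP ->] := pselect (cvg (f h @[h --> F])); last first.
  by rewrite /point /= normr0.
set l := lim _; have cl : f h @[h --> F] --> l := cf.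
rewrite ler_norml; apply/andP; split.
  apply: (ler_cvg_to (cvg_cst (-1 : R)) cl); apply: nearW => h.
  by have := f1 h; rewrite ler_norml => /andP[].
apply: (ler_cvg_to cl (cvg_cst (1 : R))); apply: nearW => h.
by have := f1 h; rewrite ler_norml => /andP[].
Qed.

Lemma Rdot_bound m (t : 'I_m -> T) j (x : 'I_m -> R) :
  (0 < m <= 2 * D)%N -> `|Rdot P xi t j x| <= 1.
Proof.
move=> mD; rewrite /Rdot; case: ifP => _; apply: lim_bound1 => h;
  exact: Rdiffq_bound.
Qed.

Lemma Rdot0 m (t : 'I_m -> T) i j (x : 'I_m -> R) : i != j -> x i <= 0 ->
  Rdot P xi t j x = 0.
Proof.
move=> ij xi0.
have q0 h : Rdiffq P xi t j x h = 0.
  rewrite /Rdiffq (Rtc_npos Hiid HC1 t xi0).2.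
  rewrite (@Rtc_npos _ _ _ _ _ _ Hiid HC1 _ _ _ i _).2 ?subrr ?mul0r//.
  by rewrite /upd (negbTE ij).
by rewrite /Rdot; case: ifP => _; apply/cvg_lim => //;
  apply: cvg_near_cst; apply: nearW => h; rewrite q0.
Qed.

Hypothesis HC6 : C6 P xi D.

Lemma Rdot_cvg m (t : 'I_m -> T) j (x : 'I_m -> R) : (0 < m <= D)%N -> injective t ->
  (forall i, 0 < x i) -> Rdiffq P xi t j x h @[h --> 0^'] --> Rdot P xi t j x.
Proof.
move=> mD it x0; have [_ [_ H]] := HC6.
have [+ _] := H m mD t j it.
move=> /(_ x (conj (fun i => ltW (x0 i)) (x0 j)))[l cl].
by rewrite /Rdot x0 (cvg_lim _ cl).
Qed.

Lemma R_grad m (t : 'I_m -> T) (x y : 'I_m -> R) : (0 < m <= D)%N -> injective t ->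
  (forall i, 0 < x i) -> (forall i, 0 <= y i) ->
  Rt t y - Rt t x <= \sum_j Rdot P xi t j x * (y j - x j).
Proof.
move=> mD it x0 y0; apply: R_supergrad => //; first exact: mD2.
by move=> j; exact: Rdot_cvg.
Qed.

Section Chords.
Variables (m : nat) (t : 'I_m -> T) (x h : 'I_m -> R) (K dl dl1 : R).
Hypotheses (mD : (0 < m <= D)%N) (it : injective t) (x0 : forall i, 0 < x i).
Hypotheses (hK : forall i, `|h i| <= K) (dl0 : 0 <= dl).
Hypothesis H1 : forall i, x i <= dl1 -> `|h i| <= dl.

Definition sh (s : R) i := x i + s * h i.

(** Leaving the orthant in coordinate i forces x_i <= s K <= dl1, and there |h_i| <= dl; hence the
    overshoot is at most s dl. *)
Let clip s i : 0 <= s -> s * K <= dl1 ->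
  0 <= Num.max (sh s i) 0 - sh s i <= s * dl.
Proof.
move=> s0 sK; have [p|p] := leP (sh s i) 0; last by rewrite subrr lexx mulr_ge0.
have e : `|s * h i| = s * `|h i| by rewrite normrM ger0_norm.
have n1 : - (s * h i) <= s * `|h i| by rewrite -e; have := ler_norm (- (s * h i)); rewrite normrN.
have n2 : s * `|h i| <= s * K by rewrite ler_wpM2l.
have n3 : s * `|h i| <= s * dl.
  rewrite ler_wpM2l//; apply: H1; move: p; rewrite /sh; lra.
by have := x0 i; move: p; rewrite /sh; lra.
Qed.

Lemma R_grad_sh s : 0 <= s -> s * K <= dl1 ->
  Rt t (sh s) - Rt t x <= s * \sum_j Rdot P xi t j x * h j + s * (m%:R * dl).
Proof.
move=> s0 sK; rewrite -R_pos.
have y0 i : 0 <= Num.max (sh s i) 0 by rewrite le_max lexx orbT.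
apply: le_trans (R_grad mD it x0 y0) _.
have -> : m%:R * dl = \sum_(j < m) dl by rewrite sumr_const card_ord mulr_natl.
rewrite !mulr_sumr -big_split /=; apply: ler_sum => j _.
have /andP[c1 c2] := clip j s0 sK.
have -> : Num.max (sh s j) 0 - x j = s * h j + (Num.max (sh s j) 0 - sh s j).
  by rewrite /sh; ring.
rewrite mulrDr mulrCA lerD2l; apply: le_trans (ler_norm _) _.
rewrite normrM (ger0_norm c1); apply: le_trans c2.
by rewrite ler_piMl//; apply: Rdot_bound; exact: mD2.
Qed.

(* Concavity along the segment from x to (x + s' h)^+, with the clipping error. *)
Lemma R_chord s s' : 0 < s <= s' -> s' * K <= dl1 ->
  s * (Rt t (sh s') - Rt t x) <= s' * (Rt t (sh s) - Rt t x) + s * s' * (m%:R * dl).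
Proof.
move=> /andP[s0 ss'] sK; have s0' : 0 < s' by exact: lt_le_trans ss'.
have ee : 0 <= s * s' * (m%:R * dl) by rewrite !mulr_ge0// ltW.
have [->|neq] := eqVneq s s'; first by rewrite lerDl !mulr_ge0// ltW.
have lt : s < s' by rewrite lt_neqAle neq.
pose y i := Num.max (sh s' i) 0; pose a := s / s'.
have a01 : 0 < a < 1 by rewrite divr_gt0// ltr_pdivrMr// mul1r.
case/andP: a01 => a0 a1.
have y0 i : 0 <= y i by rewrite le_max lexx orbT.
(* [z] is interior even where [y] vanishes, so the supergradient inequality is available at [z] for
   both end points. *)
pose z i := (1 - a) * x i + a * y i.
have z0 i : 0 < z i.
  by apply: ltr_wpDr; [apply: mulr_ge0 => //; exact: ltW|apply: mulr_gt0 => //; lra].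
have g1 := R_grad mD it z0 (fun i => ltW (x0 i)).
have g2 := R_grad mD it z0 y0.
have conc : (1 - a) * Rt t x + a * Rt t y <= Rt t z.
  have e : (1 - a) * (\sum_j Rdot P xi t j z * (x j - z j)) +
      a * (\sum_j Rdot P xi t j z * (y j - z j)) = 0.
    rewrite !mulr_sumr -big_split /=; apply: big1 => j _.
    by rewrite /z; ring.
  have a1' : 0 <= 1 - a by lra.
  have := ler_wpM2l a1' g1; have := ler_wpM2l (ltW a0) g2.
  by move: e; lra.
have lipz : Rt t z <= Rt t (sh s) + s * (m%:R * dl).
  apply: le_trans (R_lip Hiid HC1 HC3 D0 t z (sh s) (mD2 mD)) _.
  rewrite lerD2l.
  have -> : s * (m%:R * dl) = \sum_(j < m) s * dl.
    by rewrite sumr_const card_ord -mulr_natl; ring.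
  apply: ler_sum => j _.
  have /andP[c1 c2] := clip j (ltW s0') sK.
  have -> : z j - sh s j = a * (y j - sh s' j).
    by rewrite /z /sh /a /y; field; rewrite gt_eqF.
  rewrite ger0_norm; last by apply: mulr_ge0 => //; exact: ltW.
  have -> : s * dl = a * (s' * dl) by rewrite /a; field; rewrite gt_eqF.
  by rewrite ler_wpM2l// ltW.
have Ry : Rt t y = Rt t (sh s') by exact: R_pos.
have sa : s = a * s' by rewrite /a divfK// gt_eqF.
rewrite -Ry; have := ler_wpM2l (ltW s0') (le_trans conc lipz).
by rewrite sa; lra.
Qed.

End Chords.

(** For a concave function the linearisation errors at s and at -s are nonnegative and add up to
    [S2], so a small [S2] bounds both. No derivative occurs in it, which lets it pass to limits
    where coordinates of t coincide. *)
Definition S2 m (t : 'I_m -> T) (x h : 'I_m -> R) s :=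
  2 * Rt t x - Rt t (sh x h s) - Rt t (sh x h (- s)).

Lemma R_coord_deriv m (t : 'I_m -> T) (x : 'I_m -> R) j (c e : R) : (0 < m <= D)%N ->
  injective t -> (forall i, 0 < x i) -> 0 < e ->
  \forall s \near 0^'+, `|s * c| < x j /\
    `|Rt t (upd x j (s * c)) - Rt t x - s * c * Rdot P xi t j x| <= e * `|s * c|.
Proof.
move=> mD it x0 e0.
have /cvgrPdist_le/(_ _ e0)[d /= dp Hd] := @Rdot_cvg _ t j x mD it x0.
have c1 : 0 < `|c| + 1 by rewrite ltr_wpDl.
near=> s.
have s0 : 0 < s by near: s; exact: nbhs_right_gt.
have sd : s < Num.min d (x j) / (`|c| + 1).
  by near: s; apply: nbhs_right_lt; rewrite divr_gt0// lt_min dp x0.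
have ud : `|s * c| < Num.min d (x j).
  rewrite normrM (gtr0_norm s0); move: sd; rewrite ltr_pdivlMr//.
  by apply: le_lt_trans; rewrite ler_wpM2l ?(ltW s0)// lerDl.
move: ud; rewrite lt_min => /andP[ud ->]; split => //.
set u := s * c in ud *.
have [->|u0] := eqVneq u 0.
  have -> : upd x j 0 = x by apply/funext => i; rewrite /upd addr0 if_same.
  by rewrite subrr mul0r subr0 normr0 mulr0.
have := Hd u; rewrite /= sub0r normrN => /(_ ud u0).
rewrite distrC /Rdiffq -(ler_pM2r (_ : 0 < `|u|)) ?normr_gt0// -normrM mulrBl.
by rewrite divfK// [_ * u]mulrC.
Unshelve. all: by end_near. Qed.

(* A concave function with partial derivatives is differentiable: compare x + s h with the
   average of the points x + s m h_j e_j. *)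
Lemma R_sh_lower m (t : 'I_m -> T) (x h : 'I_m -> R) e : (0 < m <= D)%N ->
  injective t -> (forall i, 0 < x i) -> 0 < e ->
  \forall s \near 0^'+, Rt t x + s * (\sum_j Rdot P xi t j x * h j) -
     e * s * (\sum_j `|h j|) <= Rt t (sh x h s).
Proof.
move=> mD it x0 e0.
have m0 : 0 < m%:R :> R by rewrite ltr0n; case/andP: mD.
have m1 : 1 <= m%:R :> R by rewrite ler1n; case/andP: mD.
have near_j : \forall s \near (0 : R)^'+, forall j, `|s * (m%:R * h j)| < x j /\
    `|Rt t (upd x j (s * (m%:R * h j))) - Rt t x -
      s * (m%:R * h j) * Rdot P xi t j x| <= e * `|s * (m%:R * h j)|.
  by apply: filter_forall => j; exact: (@R_coord_deriv _ t x j _ e).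
near=> s.
have s0 : 0 < s by near: s; exact: nbhs_right_gt.
have Hj : forall j, `|s * (m%:R * h j)| < x j /\
    `|Rt t (upd x j (s * (m%:R * h j))) - Rt t x -
      s * (m%:R * h j) * Rdot P xi t j x| <= e * `|s * (m%:R * h j)|.
  by near: s.
pose z := sh x h s.
have z0 i : 0 < z i.
  have [+ _] := Hj i; rewrite /z /sh mulrCA normrM (gtr0_norm m0) => hi.
  have : `|s * h i| < x i.
    by apply: le_lt_trans hi; rewrite ler_peMl.
  have := ler_norm (- (s * h i)); rewrite normrN; lra.
pose p j := upd x j (s * (m%:R * h j)).
have p0 j i : 0 <= p j i.
  rewrite /p /upd; case: ifP => [/eqP ->|_]; last exact: ltW.
  have [+ _] := Hj j; have := ler_norm (- (s * (m%:R * h j))); rewrite normrN; lra.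
have H : \sum_j Rt t (p j) <= m%:R * Rt t z.
  have : \sum_j (Rt t (p j) - Rt t z) <= 0.
    apply: le_trans (ler_sum _ (fun j _ => R_grad mD it z0 (p0 j))) _.
    rewrite exchange_big /= le_eqVlt; apply/orP; left; apply/eqP.
    apply: big1 => i _; rewrite -mulr_sumr.
    suff -> : \sum_j (p j i - z i) = 0 by rewrite mulr0.
    rewrite (bigD1 i)//= (eq_bigr (fun=> - (s * h i))) => [|j ji]; last first.
      by rewrite /p /upd eq_sym (negbTE ji) /z /sh; ring.
    rewrite sumr_const cardC1 card_ord /p /upd eqxx /z /sh -mulr_natl.
    have -> : m%:R = m.-1%:R + 1 :> R.
      by rewrite natr1 prednK//; case/andP: mD.
    by ring.
  by rewrite sumrB sumr_const card_ord -[Rt t z *+ _]mulr_natl subr_le0.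
have low j : Rt t x + s * (m%:R * h j) * Rdot P xi t j x - e * (s * m%:R * `|h j|)
    <= Rt t (p j).
  have [_ +] := Hj j; rewrite !normrM (gtr0_norm s0) (gtr0_norm m0).
  by rewrite ler_norml => /andP[+ _]; rewrite -/(p j) => h1; lra.
have := le_trans (ler_sum _ (fun j _ => low j)) H.
rewrite sumrB big_split /= sumr_const card_ord -[Rt t x *+ _]mulr_natl.
have -> : \sum_(i < m) s * (m%:R * h i) * Rdot P xi t i x =
    m%:R * (s * \sum_i Rdot P xi t i x * h i).
  by rewrite !mulr_sumr; apply: eq_bigr => i _; ring.
have -> : \sum_(i < m) e * (s * m%:R * `|h i|) = m%:R * (e * s * \sum_i `|h i|).
  by rewrite !mulr_sumr; apply: eq_bigr => i _; ring.
by rewrite -mulrDr -mulrBr ler_pM2l.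
Unshelve. all: by end_near. Qed.

Lemma sh_opp m (x h : 'I_m -> R) s : sh x (fun i => - h i) s = sh x h (- s).
Proof. by apply/funext => i; rewrite /sh mulrN mulNr. Qed.

Lemma S2_small_inj m (t : 'I_m -> T) (x h : 'I_m -> R) dl : (0 < m <= D)%N ->
  injective t -> (forall i, 0 < x i) -> 0 < dl ->
  \forall s \near 0^'+, S2 t x h s <= dl * s.
Proof.
move=> mD it x0 dl0; pose H := 1 + \sum_j `|h j|.
have H0 : 0 < H by rewrite ltr_wpDr// sumr_ge0.
have e0 : 0 < dl / (2 * H) by rewrite divr_gt0// mulr_gt0.
near=> s.
have s0 : 0 < s by near: s; exact: nbhs_right_gt.
have h1 : Rt t x + s * (\sum_j Rdot P xi t j x * h j) -
     dl / (2 * H) * s * (\sum_j `|h j|) <= Rt t (sh x h s).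
  by near: s; exact: R_sh_lower.
have h2 : Rt t x + s * (\sum_j Rdot P xi t j x * (- h j)) -
     dl / (2 * H) * s * (\sum_j `|- h j|) <= Rt t (sh x (fun i => - h i) s).
  by near: s; exact: (R_sh_lower (fun i => - h i)).
have e1 : \sum_j Rdot P xi t j x * (- h j) = - (\sum_j Rdot P xi t j x * h j).
  by rewrite -sumrN; apply: eq_bigr => j _; rewrite mulrN.
have e2 : \sum_j `|- h j| = \sum_j `|h j| by apply: eq_bigr => j _; rewrite normrN.
rewrite e1 e2 sh_opp in h2.
have h3 : dl / (2 * H) * s * (\sum_j `|h j|) <= dl * s / 2.
  have -> : dl * s / 2 = dl / (2 * H) * s * H by field; rewrite gt_eqF.
  by apply: ler_wpM2l; [apply: mulr_ge0; exact: ltW|rewrite /H lerDr].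
by rewrite /S2; lra.
Unshelve. all: by end_near. Qed.

Lemma R_lift_le m (t : 'I_m.+1 -> T) (x : 'I_m.+1 -> R) j : (0 < m < D)%N ->
  Rt t x <= Rt (t \o lift j) (x \o lift j).
Proof.
move=> mD; have m1 : (0 < m.+1 <= 2 * D)%N by lia.
have m2 : (0 < m <= 2 * D)%N by lia.
apply: tE_le (tE_At Hiid HC1 HC3 D0 t x m1)
  (tE_At Hiid HC1 HC3 D0 (t \o lift j) (x \o lift j) m2) _ => s s0 f.
by apply: ind_le => /= H i; exact: H.
Qed.

(** With t_i = t_j the constraint on coordinate i implies the one on j once the level of j is raised
    by [c]. *)
Lemma R_lift_ge m (t : 'I_m.+1 -> T) (y : 'I_m.+1 -> R) i j c : (0 < m < D)%N ->
  i != j -> t i = t j -> 0 <= c -> y i <= y j + c ->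
  Rt (t \o lift j) (y \o lift j) <= Rt t y + c.
Proof.
move=> mD ij tij c0 yij; have m1 : (0 < m.+1 <= 2 * D)%N by lia.
have m2 : (0 < m <= 2 * D)%N by lia.
apply: (@le_trans _ _ (Rt t (upd y j c))).
  apply: tE_le (tE_At Hiid HC1 HC3 D0 (t \o lift j) (y \o lift j) m2)
    (tE_At Hiid HC1 HC3 D0 t (upd y j c) m1) _ => s s0 f.
  apply: ind_le => /= H l; rewrite /upd; have [->|lj] := eqVneq l j.
    have [i' Ei] : exists i', i = lift j i'.
      by case: (unliftP j i) => [i' ->|ij']; [exists i'|rewrite ij' eqxx in ij].
    have := H i'; rewrite /= -Ei tij => /le_trans; apply.
    by rewrite ler_pM2l.
  case: (unliftP j l) => [l' El|lj']; last by rewrite lj' eqxx in lj.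
  by have := H l'; rewrite /= -El.
apply: le_trans (R_lip Hiid HC1 HC3 D0 t _ y m1) _; rewrite lerD2l.
rewrite (bigD1 j)//= [X in _ + X]big1 ?addr0.
  by rewrite /upd eqxx addrAC subrr add0r ger0_norm.
by move=> l lj; rewrite /upd (negbTE lj) subrr normr0.
Qed.

(** Induction on the dimension. If t_i = t_j with x_i <= x_j, coordinate j is dropped: for x_i < x_j
    its constraint stays redundant at small s, and for x_i = x_j it is redundant up to s dl since
    h_i and h_j are close. The two shifted points pay s dl each, whence 2 dl s per dropped
    coordinate. *)
Lemma S2_small m (t : 'I_m -> T) (x h : 'I_m -> R) dl : (0 < m <= D)%N ->
  (forall i, 0 < x i) -> 0 < dl ->
  (forall i j, t i = t j -> x i = x j -> `|h i - h j| <= dl) ->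
  \forall s \near 0^'+, S2 t x h s <= (1 + 2 * m%:R) * dl * s.
Proof.
move=> + + dl0; elim: m t x h => [//|m IH] t x h mD x0 H2.
have [it|] := pselect (injective t).
  near=> s; have s0 : 0 < s by near: s; exact: nbhs_right_gt.
  apply: (@le_trans _ _ (dl * s)); first by near: s; exact: S2_small_inj.
  by rewrite ler_pM2r// ler_peMl ?(ltW dl0)// lerDl.
move=> /existsNP[i0 /existsNP[j0 /not_implyP[t0 ij0]]].
have [i [j [ij tij xij]]] : exists i j, [/\ i != j, t i = t j & x i <= x j].
  have [h1|h1] := leP (x i0) (x j0); [exists i0, j0|exists j0, i0]; split => //.
  - exact/eqP.
  - by rewrite eq_sym; exact/eqP.
  - exact: ltW.
have mD' : (0 < m < D)%N.
  case/andP: mD => _ ->; rewrite andbT lt0n; apply: contra_neqN ij => /eqP m0.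
  by apply: val_inj; have := ltn_ord i; have := ltn_ord j; rewrite /=; lia.
have ycmp (k : 'I_m.+1 -> R) : (x i = x j -> `|k i - k j| <= dl) ->
    \forall s \near 0^'+, sh x k s i <= sh x k s j + s * dl.
  move=> Hk; have [eqx|neqx] := eqVneq (x i) (x j).
    near=> s; have s0 : 0 < s by near: s; exact: nbhs_right_gt.
    rewrite /sh eqx -addrA lerD2l -mulrDr ler_pM2l//.
    by have := Hk eqx; rewrite ler_norml => /andP[_]; lra.
  have ltx : x i < x j by rewrite lt_neqAle neqx.
  pose k1 := `|k i| + `|k j| + 1.
  have k10 : 0 < k1 by rewrite ltr_wpDl// addr_ge0.
  near=> s; have s0 : 0 < s by near: s; exact: nbhs_right_gt.
  have : s < (x j - x i) / k1.
    by near: s; apply: nbhs_right_lt; rewrite divr_gt0// subr_gt0.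
  rewrite ltr_pdivlMr// /k1 /sh => h1.
  have h2 : s * k i <= s * `|k i| by rewrite ler_pM2l// ler_norm.
  have h3 : - (s * k j) <= s * `|k j|.
    by rewrite -mulrN ler_pM2l// -normrN ler_norm.
  have h4 : 0 <= s * dl by apply: mulr_ge0; exact: ltW.
  by lra.
have mD'' : (0 < m <= D)%N by lia.
have IHs := IH (t \o lift j) (x \o lift j) (h \o lift j) mD''
  (fun i => x0 _) (fun a b ta xa => H2 _ _ ta xa).
near=> s; have s0 : 0 < s by near: s; exact: nbhs_right_gt.
have c1 : sh x h s i <= sh x h s j + s * dl.
  by near: s; apply: ycmp => xx; exact: H2.
have c2 : sh x (fun l => - h l) s i <= sh x (fun l => - h l) s j + s * dl.
  near: s; apply: ycmp => xx.
  by rewrite (_ : - h i - - h j = - (h i - h j)) ?normrN ?H2//; ring.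
have IH1 : S2 (t \o lift j) (x \o lift j) (h \o lift j) s <=
   (1 + 2 * m%:R) * dl * s by near: s.
rewrite sh_opp in c2.
have sd0 : 0 <= s * dl by apply: mulr_ge0; exact: ltW.
have g1 := R_lift_ge mD' ij tij sd0 c1.
have g2 := R_lift_ge mD' ij tij sd0 c2.
have g3 := R_lift_le t x j mD'.
move: IH1; rewrite /S2 -natr1.
have -> a : sh (x \o lift j) (h \o lift j) a = sh x h a \o lift j by [].
lra.
Unshelve. all: by end_near. Qed.

Hypothesis HTB : forall e : R, 0 < e -> exists (N : nat) (c : T -> nat),
  (forall t, (c t < N)%N) /\ forall s t, c s = c t -> rT s t <= e.

(** Total boundedness puts a set of rT-diameter at most 1/(q+1) into the ultrafilter for every q. An
    index [a q] common to the first q+1 of these sets yields a Cauchy sequence; (R2) gives its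
    limit, and the ultrafilter converges to it. *)
Lemma rT_ultra (U : set_system nat) (UU : UltraFilter U) (u : nat -> T) :
  exists t, forall e : R, 0 < e -> U [set n | rT (u n) t <= e].
Proof.
have PU : ProperFilter U by exact: ultra_proper.
have Hq q : exists A : set nat, U A /\
    forall a b, A a -> A b -> rT (u a) (u b) <= q.+1%:R^-1.
  have q0 : 0 < q.+1%:R^-1 :> R by rewrite invr_gt0.
  have [N [c [cN cT]]] := HTB q0.
  have [v Uv] := ultra_finite UU (fun n => cN (u n)).
  by exists [set n | c (u n) = v]; split => // a b /= av bv; apply: cT; rewrite av.
have [A HA] := choice Hq.
have UB q : U [set n | forall i : 'I_q.+1, A i n].
  by apply: filter_forall => i; exact: (HA i).1.
have [a Ha] := choice (fun q => @filter_ex _ _ PU _ (UB q)).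
have close p q r : (p <= q)%N -> (p <= r)%N -> rT (u (a q)) (u (a r)) <= p.+1%:R^-1.
  move=> pq pr; apply: (HA p).2.
    by have := Ha q (inord p); rewrite inordK// ltnS.
  by have := Ha r (inord p); rewrite inordK// ltnS.
have small (e : R) : 0 < e -> exists p, p.+1%:R^-1 < e.
  move=> e0; have [p] := ltr_add_invr e0.
  by rewrite add0r => pe; exists p.
have [_ [complete _]] := HC6.
have [|t ct] := complete (u \o a).
  move=> e e0; have e20 : 0 < e ^+ 2 / 2 by rewrite divr_gt0// exprn_gt0.
  have [p pe] := small _ e20; exists p => m n pm pn.
  rewrite rho2T_rT -[ltRHS](ger0_norm (ltW e0)) -sqrtr_sqr ltr_sqrt ?exprn_gt0//.
  have h := le_lt_trans (close _ _ _ pm pn) pe.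
  by have : 2 * rT (u (a m)) (u (a n)) < e ^+ 2 by lra.
exists t => e e0.
have e20 : 0 < e / 2 by rewrite divr_gt0.
have [p pe] := small _ e20.
have /(cvgr_lt _)/(_ (Num.sqrt e)) := ct; rewrite sqrtr_gt0 => /(_ e0)[q _ Hq'].
pose b := maxn p q.
have h : 2 * rT (u (a b)) t < e.
  by have := Hq' b (leq_maxr _ _); rewrite /= rho2T_rT ltr_sqrt.
apply: filterS (HA p).1 => n An.
have h1 : rT (u n) (u (a b)) < e / 2.
  apply: le_lt_trans pe; apply: (HA p).2 => //.
  by have := Ha b (inord p); rewrite inordK// ltnS leq_maxl.
have tri := rT_tri Hiid HC1 HC3 D0 (u n) t (u (a b)).
suff G : rT (u n) t <= e by exact: G.
by lra.
Qed.

Lemma R_close m (t t' : 'I_m -> T) (y y' : 'I_m -> R) (e1 e2 : R) : (0 < m <= D)%N ->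
  (forall j, `|y j - y' j| <= e1) -> (forall j, rT (t j) (t' j) <= e2) ->
  `|Rt t y - Rt t' y'| <= m%:R * e1 + (\sum_j `|y' j|) * e2.
Proof.
move=> mD he1 he2; pose yp i := Num.max (y' i) 0.
have yp0 i : 0 <= yp i by rewrite le_max lexx orbT.
have A : m%:R * e1 = \sum_(j < m) e1 by rewrite sumr_const card_ord mulr_natl.
have B1 : \sum_j yp j * rT (t j) (t' j) <= (\sum_j `|y' j|) * e2.
  rewrite mulr_suml; apply: ler_sum => j _; apply: ler_pM => //.
    exact: (rT_ge0 Hiid HC1 HC3).
  by rewrite /yp ge_max ler_norm normr_ge0.
have B2 : \sum_j yp j * rT (t' j) (t j) <= (\sum_j `|y' j|) * e2.
  apply: le_trans B1; rewrite le_eqVlt; apply/orP; left; apply/eqP.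
  by apply: eq_bigr => j _; rewrite (rT_sym Hiid HC1 HC3 D0).
have C1 : \sum_j `|y j - y' j| <= m%:R * e1 by rewrite A; apply: ler_sum.
have C2 : \sum_j `|y' j - y j| <= m%:R * e1.
  by apply: le_trans C1; apply: ler_sum => j _; rewrite distrC.
have l1 := R_lip Hiid HC1 HC3 D0 t y y' (mD2 mD).
have l2 := R_lip Hiid HC1 HC3 D0 t y' y (mD2 mD).
have s1 := R_sub_le_t Hiid HC1 HC3 D0 t t' (mD2 mD) yp0.
have s2 := R_sub_le_t Hiid HC1 HC3 D0 t' t (mD2 mD) yp0.
rewrite !R_pos in s1 s2; rewrite ler_norml; apply/andP; split; lra.
Qed.

(** By contradiction. Counterexamples at scales [sn n] tending to 0 converge along an ultrafilter to
    (ts, xs, hs), where closeness of h for coinciding coordinates survives, and [S2_small] applies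
    at some fixed s. At that s the second difference is continuous, while concavity bounds S2 / s at
    the smaller scale [sn n] by its value at s up to clipping. The constant is (1 + 2m) + 1 for the
    limit and its approximation, plus 2m for clipping. *)
Lemma S2_uniform m (K M dl dl1 sbar : R) : (0 < m <= D)%N -> 0 <= K -> 0 < dl ->
  0 < dl1 -> 0 < sbar -> sbar * K <= dl1 ->
  exists2 s0, 0 < s0 <= sbar & forall (t : 'I_m -> T) (x h : 'I_m -> R), injective t ->
    (forall i, 0 < x i <= M) -> (forall i, `|h i| <= K) ->
    (forall i, x i <= dl1 -> `|h i| <= dl) ->
    (forall i j, rT (t i) (t j) <= dl1 -> `|x i - x j| <= dl1 -> `|h i - h j| <= dl) ->
    S2 t x h s0 <= (2 + 4 * m%:R) * dl * s0.
Proof.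
move=> mD K0 dl0 dl10 sb0 sbK; apply: contrapT => noS.
pose sn (n : nat) : R := sbar / n.+1%:R.
have sn0 n : 0 < sn n by rewrite divr_gt0.
have snb n : sn n <= sbar.
  by rewrite ler_pdivrMr// ler_peMr ?(ltW sb0)// ler1n.
have bad n : exists p : ('I_m -> T) * ('I_m -> R) * ('I_m -> R),
    [/\ injective p.1.1, forall i, 0 < p.1.2 i <= M, forall i, `|p.2 i| <= K,
     (forall i, p.1.2 i <= dl1 -> `|p.2 i| <= dl) /\
     (forall i j, rT (p.1.1 i) (p.1.1 j) <= dl1 -> `|p.1.2 i - p.1.2 j| <= dl1 ->
        `|p.2 i - p.2 j| <= dl) &
     (2 + 4 * m%:R) * dl * sn n < S2 p.1.1 p.1.2 p.2 (sn n)].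
  apply: contrapT => nop; apply: noS; exists (sn n); first by rewrite sn0 snb.
  move=> t x h it hx hK H1 H2; rewrite leNgt; apply/negP => lt.
  by apply: nop; exists (t, x, h).
have [p Hp] := choice bad.
pose t n := (p n).1.1; pose x n := (p n).1.2; pose h n := (p n).2.
have [U [UU sU]] := @ultraFilterLemma _ (\oo) _.
have PU : ProperFilter U by exact: ultra_proper.
have [ts Hts] := choice (fun j => rT_ultra UU (fun n => t n j)).
have Hx j : exists q, (0 <= q <= M) /\ forall e, 0 < e -> U [set n | `|x n j - q| <= e].
  have [|q qq Hq] := ultra_real UU (a := 0) (b := M) (u := fun n => x n j).
    by move=> n; have [_ /(_ j) /andP[/ltW -> ->]] := Hp n.
  by exists q.
have Hh j : exists q, (-K <= q <= K) /\ forall e, 0 < e -> U [set n | `|h n j - q| <= e].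
  have [|q qq Hq] := ultra_real UU (a := - K) (b := K) (u := fun n => h n j).
    by move=> n; have [_ _ /(_ j)] := Hp n; rewrite ler_norml.
  by exists q.
have {Hx}[xs Hxs] := choice Hx; have {Hh}[hs Hhs] := choice Hh.
have close e : 0 < e -> U [set n | forall j, [/\ rT (t n j) (ts j) <= e,
    `|x n j - xs j| <= e & `|h n j - hs j| <= e]].
  move=> e0; apply: filter_forall => j.
  have FU : Filter U := @filter_filter _ _ PU.
  have HK := @filterI _ U FU _ _ (Hts j e e0)
    (@filterI _ U FU _ _ ((Hxs j).2 e e0) ((Hhs j).2 e e0)).
  suff K' : U [set n | [/\ rT (t n j) (ts j) <= e,
    `|x n j - xs j| <= e & `|h n j - hs j| <= e]] by exact: K'.
  by apply: filterS HK => n /= [? []].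
have [s [s0 sb Ss]] : exists s, [/\ 0 < s, s <= sbar &
    S2 ts xs hs s <= (1 + 2 * m%:R) * dl * s].
  (* If a limit coordinate vanishes, R is 0 at xs and the second difference is nonpositive at every
     scale, so [sbar] itself will do. *)
  have [[j xj]|npos] := pselect (exists j, xs j <= 0).
    exists sbar; split => //.
    rewrite /S2 (Rtc_npos Hiid HC1 ts xj).2 mulr0 sub0r.
    apply: (@le_trans _ _ 0); last by rewrite !mulr_ge0 ?(ltW dl0) ?(ltW sb0)// addr_ge0// mulr_ge0.
    by have := R_ge0 Hiid HC1 HC3 D0 ts (sh xs hs sbar) (mD2 mD);
      have := R_ge0 Hiid HC1 HC3 D0 ts (sh xs hs (- sbar)) (mD2 mD); lra.
  have xs0 j : 0 < xs j.
    by rewrite ltNge; apply/negP => xj; apply: npos; exists j.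
  have H2s i j : ts i = ts j -> xs i = xs j -> `|hs i - hs j| <= dl.
    move=> tij xij; apply/ler_addgt0Pr => e e0.
    pose e' := Num.min (e / 2) (dl1 / 2).
    have e'0 : 0 < e' by rewrite lt_min; apply/andP; split; rewrite divr_gt0.
    have e'1 : e' <= e / 2 by rewrite ge_min lexx.
    have e'2 : e' <= dl1 / 2 by rewrite ge_min lexx orbT.
    have [n Hn] := @filter_ex _ _ PU _ (close _ e'0).
    have [ti xi' hi] := Hn i; have [tj xj hj] := Hn j.
    have [_ _ _ [_ H2] _] := Hp n.
    have tri := rT_tri Hiid HC1 HC3 D0 (t n i) (t n j) (ts i).
    have sym := rT_sym Hiid HC1 HC3 D0 (ts j) (t n j).
    have h0 : rT (t n i) (t n j) <= dl1 by rewrite tij in tri ti; lra.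
    have h1 : `|x n i - x n j| <= dl1.
      rewrite (_ : x n i - x n j = (x n i - xs i) - (x n j - xs j)).
        by apply: le_trans (ler_normB _ _) _; lra.
      by rewrite xij; ring.
    have h2 : `|h n i - h n j| <= dl := H2 i j h0 h1.
    rewrite (_ : hs i - hs j = (h n i - h n j) - (h n i - hs i) + (h n j - hs j)).
      by apply: le_trans (ler_normD _ _) _;
        have := ler_normB (h n i - h n j) (h n i - hs i); lra.
    by ring.
  have := S2_small mD xs0 dl0 H2s => Hs.
  near (0 : R)^'+ => s; exists s; split.
  - by near: s; exact: nbhs_right_gt.
  - by near: s; exact: nbhs_right_le.
  - by near: s.
(* [B] collects the coefficients of [e] in the three comparisons by [R_close] that make up a second
   difference. *)
pose B := 2 * m%:R * (1 + s) + \sum_j `|sh xs hs s j| + \sum_j `|sh xs hs (- s) j| +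
   (2 * m%:R + 2 * \sum_j `|xs j|).
have B0 : 0 <= B.
  rewrite /B !addr_ge0 ?sumr_ge0// ?mulr_ge0// ?addr_ge0 ?(ltW s0)//; exact: sumr_ge0.
pose e := dl * s / (B + 1).
have B1 : 0 < B + 1 by rewrite ltr_wpDl.
have e0 : 0 < e by rewrite divr_gt0// mulr_gt0.
have eB : e * B <= dl * s.
  have -> : dl * s = e * (B + 1) by rewrite /e divfK// gt_eqF.
  by rewrite ler_pM2l// lerDl.
have Un : U [set n | sn n <= s].
  apply: sU; have [N Ns] : exists N, sn N <= s.
    have [N] := ltr_add_invr (divr_gt0 s0 sb0).
    rewrite add0r ltr_pdivlMr// mulrC => Ns; exists N; exact: ltW.
  exists N => // n /= Nn; apply: le_trans Ns; rewrite /sn ler_pM2l//.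
  by rewrite lef_pV2 ?posrE// ler_nat.
have [n [Hn nsn]] := @filter_ex _ _ PU _ (filterI (close _ e0) Un).
have [it xM hK [H1 H2] Sn] := Hp n.
have x0 i : 0 < x n i by have /andP[] := xM i.
have sK : s * K <= dl1 by apply: le_trans sbK; rewrite ler_wpM2r.
have hK' i : `|- h n i| <= K by rewrite normrN; exact: hK.
have H1' i : x n i <= dl1 -> `|- h n i| <= dl by rewrite normrN; exact: H1.
have ss : 0 < sn n <= s by rewrite sn0 nsn.
have c1 := R_chord mD it x0 hK (ltW dl0) H1 ss sK.
have c2 := R_chord mD it x0 hK' (ltW dl0) H1' ss sK.
rewrite !sh_opp in c2.
have r1 : `|Rt (t n) (x n) - Rt ts xs| <= m%:R * e + (\sum_j `|xs j|) * e.
  by apply: R_close => // j; have [] := Hn j.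
have shc a (b : R) : `|a| <= b -> `|Rt (t n) (sh (x n) (h n) a) - Rt ts (sh xs hs a)| <=
    m%:R * (e + b * e) + (\sum_j `|sh xs hs a j|) * e.
  move=> ab; apply: R_close => // j; have [tj xj hj] := Hn j => //.
  rewrite /sh (_ : _ - _ = (x n j - xs j) + a * (h n j - hs j)); last by ring.
  apply: le_trans (ler_normD _ _) _; apply: lerD => //.
  by rewrite normrM; apply: ler_pM.
have r2 := shc s s; have r3 := shc (- s) s.
rewrite normrN (gtr0_norm s0) in r2 r3; have {}r2 := r2 (lexx _); have {}r3 := r3 (lexx _).
have D2 : S2 (t n) (x n) (h n) s <= S2 ts xs hs s + dl * s.
  apply: le_trans (_ : _ <= S2 ts xs hs s + e * B) _; last by rewrite lerD2l.
  rewrite /S2 /B; move: r1 r2 r3; rewrite !ler_norml => /andP[r11 r12] /andP[r21 r22].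
  by move=> /andP[r31 r32]; lra.
have Q : s * S2 (t n) (x n) (h n) (sn n) <=
    sn n * S2 (t n) (x n) (h n) s + 2 * (sn n * s * (m%:R * dl)).
  by move: c1 c2; rewrite /S2 -/(t n) -/(x n); lra.
have Q2 : sn n * S2 (t n) (x n) (h n) s <= sn n * ((2 + 2 * m%:R) * dl * s).
  by rewrite ler_pM2l//; apply: le_trans D2 _; lra.
have Q3 : s * ((2 + 4 * m%:R) * dl * sn n) < s * S2 (t n) (x n) (h n) (sn n).
  by rewrite ltr_pM2l.
by lra.
Unshelve. all: by end_near. Qed.

(** The upper bound is the supergradient inequality at x. For the lower bound, concavity makes the
    chord slope at r at least the one at the fixed scale s; the latter is bounded below by the
    second difference at s and the supergradient inequality at -s. The losses are (2 + 4m) + m + m.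
    If some x_j = 0, then R(x) = 0 and h_j is small, so both terms are small separately. *)
Lemma deriv_uniform m (K M dl dl1 : R) : (0 < m <= D)%N -> 0 <= K -> 0 < dl -> 0 < dl1 ->
  exists2 r0, 0 < r0 & forall r, 0 < r <= r0 ->
  forall (t : 'I_m -> T) (x h : 'I_m -> R), injective t ->
    (forall i, 0 <= x i <= M) -> (forall i, `|h i| <= K) ->
    (forall i, x i <= dl1 -> `|h i| <= dl) ->
    (forall i j, rT (t i) (t j) <= dl1 -> `|x i - x j| <= dl1 -> `|h i - h j| <= dl) ->
    `|r^-1 * (Rt t (sh x h r) - Rt t x) - \sum_j Rdot P xi t j x * h j| <=
      (2 + 6 * m%:R) * dl.
Proof.
move=> mD K0 dl0 dl10; pose sbar := dl1 / (K + 1).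
have K1 : 0 < K + 1 by rewrite ltr_wpDl.
have sb0 : 0 < sbar by rewrite divr_gt0.
have sbK : sbar * K <= dl1.
  by rewrite /sbar mulrAC ler_pdivrMr// ler_pM2l// lerDl.
have [s /andP[s0 ssb] Hs] := S2_uniform M mD K0 dl0 dl10 sb0 sbK.
exists s => // r /andP[r0 rs] t x h it hx hK H1 H2.
have m1 : 1 <= m%:R :> R by rewrite ler1n; case/andP: mD.
have C0 : 2 * dl <= (2 + 6 * m%:R) * dl.
  by rewrite ler_pM2r// lerDl mulr_ge0.
have ri0 : 0 < r^-1 by rewrite invr_gt0.
have [[j xj]|npos] := pselect (exists j, x j <= 0).
  have hj : `|h j| <= dl by apply: H1; exact: le_trans (ltW dl10).
  rewrite (Rtc_npos Hiid HC1 t xj).2 subr0.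
  have -> : \sum_i Rdot P xi t i x * h i = Rdot P xi t j x * h j.
    rewrite (bigD1 j)//= big1 ?addr0// => i ij.
    by rewrite (@Rdot0 _ t j i) ?mul0r// eq_sym.
  apply: le_trans C0; apply: le_trans (ler_normB _ _) _.
  rewrite mulr2n mulrDl mul1r; apply: lerD; last first.
    rewrite normrM; apply: le_trans hj; rewrite ler_piMl//.
    by apply: Rdot_bound; exact: mD2.
  have R0 := R_ge0 Hiid HC1 HC3 D0 t (sh x h r) (mD2 mD).
  rewrite ger0_norm; last by rewrite mulr_ge0// ltW.
  rewrite mulrC ler_pdivrMr//.
  apply: le_trans (R_le1 Hiid HC1 HC3 D0 t (sh x h r) j (mD2 mD)) _.
  rewrite ge_max mulr_ge0 ?(ltW dl0) ?(ltW r0)// andbT /sh [leRHS]mulrC.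
  have : r * h j <= r * dl.
    by rewrite ler_pM2l//; apply: le_trans (ler_norm _) hj.
  by lra.
have x0 j : 0 < x j by rewrite ltNge; apply/negP => xj; apply: npos; exists j.
have xM i : 0 < x i <= M by rewrite x0; case/andP: (hx i).
have sK : s * K <= dl1 by apply: le_trans sbK; rewrite ler_wpM2r.
have rK : r * K <= dl1 by apply: le_trans sK; rewrite ler_wpM2r.
have h2 := Hs t x h it xM hK H1 H2.
have u1 := R_grad_sh mD it x0 hK (ltW dl0) H1 (ltW r0) rK.
have hK' i : `|- h i| <= K by rewrite normrN; exact: hK.
have H1' i : x i <= dl1 -> `|- h i| <= dl by rewrite normrN; exact: H1.
have u2 := R_grad_sh mD it x0 hK' (ltW dl0) H1' (ltW s0) sK.
have rs' : 0 < r <= s by rewrite r0.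
have u3 := R_chord mD it x0 hK (ltW dl0) H1 rs' sK.
have e1 : \sum_j Rdot P xi t j x * (- h j) = - (\sum_j Rdot P xi t j x * h j).
  by rewrite -sumrN; apply: eq_bigr => j _; rewrite mulrN.
rewrite sh_opp e1 in u2.
set G := \sum_j _ in u1 u2 e1 *; set A := Rt t (sh x h r) in u1 u3 *.
set B := Rt t x in u1 u2 u3 *; rewrite /S2 -/B in h2.
have mdl : 0 <= m%:R * dl by rewrite mulr_ge0// ltW.
have up : r^-1 * (A - B) - G <= m%:R * dl.
  rewrite lerBlDr mulrC ler_pdivrMr//; lra.
have lo : - (r^-1 * (A - B) - G) <= (2 + 6 * m%:R) * dl.
  rewrite opprB lerBlDr -lerBlDl [leRHS]mulrC ler_pdivlMr//.
  have si : 0 < s by [].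
  rewrite -(ler_pM2l s0).
  have w1 : s * G - s * ((2 + 5 * m%:R) * dl) <= Rt t (sh x h s) - B by lra.
  have w2 := ler_wpM2l (ltW r0) w1; lra.
rewrite ler_norml; apply/andP; split; lra.
Qed.

End Derivatives.
(** * Bracketing and chaining *)

Section LocalIncrements.
Context {R : realType} {T : topologicalType} {dO : measure_display}
  {Om : measurableType dO}.
Variables (P : probability Om R) (xi : nat -> Om -> T -> R).
Hypotheses (Hiid : iid P xi) (HC1 : C1 P xi).
Local Notation mu := (mu P xi).
Local Notation uf := (uf P xi).

Definition ex_lt (S : set T) (y : R) := [set f | exists2 t, S t & uf t f < y].
Definition all_le (S : set T) (y : R) := [set f | forall t, S t -> uf t f <= y].

(** The event inf U <= y over S as a countable intersection of open events; [ex_lt] and [all_le] are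
    inf U < y and sup U <= y for nonempty S. *)
Definition inf_le (S : set T) (y : R) := \bigcap_n ex_lt S (y + n.+1%:R^-1).

Lemma CBorel_inf_le S y : CBorel (inf_le S y).
Proof. by apply: CBorel_bigcap => n; exact: (CBorel_ex_lt HC1). Qed.

Lemma mu_subU A B C : CBorel A -> CBorel B -> CBorel C ->
  A `<=` B `|` C -> mu A <= mu B + mu C.
Proof.
move=> cA cB cC ABC; apply: (@le_trans _ _ (mu (B `|` C))).
  by apply: (mu_le Hiid) => //; exact: CBorelU.
have := @prU _ _ _ P _ _ (measurable_xi Hiid 0 cB) (measurable_xi Hiid 0 cC).
by rewrite -preimage_setU.
Qed.

Lemma mu_setD A B : CBorel A -> CBorel B -> B `<=` A -> mu (A `\` B) <= mu A - mu B.
Proof.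
move=> cA cB BA.
have := @mu_lin _ _ _ _ P xi Hiid nat [:: 0%N; 1%N; 2%N]
  (fun i => if i == 0%N then 1 else -1)
  (fun i => if i == 0%N then A else if i == 1%N then B else A `\` B).
rewrite !big_cons !big_nil /= => H.
suff : 0 <= 1 * mu A + (-1 * mu B + (-1 * mu (A `\` B) + 0)) by lra.
apply: H => [i|f].
  by case: ifP => // _; case: ifP => // _; exact: CBorelD.
rewrite big_cons big_cons big_cons big_nil /= indB_sub.
have -> : A `&` B = B by apply/seteqP; split => [g []|g Bg] //; split => //; exact: BA.
lra.
Qed.

Variables (S : set T) (t0 : T) (c1 c2 q u0 : R).
Hypotheses (St0 : S t0) (c10 : 0 < c1) (c20 : 0 < c2) (q0 : 0 < q).
Hypotheses (c1q : c1 * q <= 2^-1) (c2q : c2 * q <= 2^-1).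
Hypothesis HS : forall u, 0 < u <= u0 ->
  mu ([set f | exists2 t, S t & u * expR (c1 * q) < uf t f] `&` inf_le S u) <=
  c2 * q * mu (inf_le S u).

Let E1 : expR (c1 * q) <= 1 + 2 * (c1 * q).
Proof.
have := expR_le_quad c1q; have z0 : 0 <= c1 * q by rewrite mulr_ge0 ?ltW.
have : c1 * q * (c1 * q) <= 2^-1 * (c1 * q) by rewrite ler_wpM2r.
by rewrite expr2; lra.
Qed.

(** If inf U <= u, then U(t0) <= u exp(c1 q) except on an event carrying at most the fraction c2 q
    <= 1/2 of the mass on the left; that part is absorbed. *)
Lemma mu_inf_le u : 0 < u <= u0 -> u <= 2^-1 ->
  mu (inf_le S u) <= u * (1 + (2 * c1 + 4 * c2) * q) /\ mu (inf_le S u) <= 2 * u * expR (c1 * q).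
Proof.
move=> uu uh; have /andP[u_0 _] := uu.
have z0 : 0 < c1 * q by rewrite mulr_gt0.
have z2 : 0 < c2 * q by rewrite mulr_gt0.
have ue : 0 <= u * expR (c1 * q) <= 1.
  rewrite mulr_ge0 ?expR_ge0 ?(ltW u_0)//=.
  have E2 : expR (c1 * q) <= 2.
    by have := E1; have := c1q; set z := c1 * q; set ez := expR z; lra.
  have := ler_pM (ltW u_0) (expR_ge0 _) uh E2; lra.
have cA : CBorel ([set f | exists2 t, S t & u * expR (c1 * q) < uf t f] `&` inf_le S u).
  by apply: CBorelI; [exact: (CBorel_ex_gt HC1)|exact: CBorel_inf_le].
have H : mu (inf_le S u) <= u * expR (c1 * q) + c2 * q * mu (inf_le S u).
  apply: (@le_trans _ _ (mu [set f | uf t0 f <= u * expR (c1 * q)] +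
    mu ([set f | exists2 t, S t & u * expR (c1 * q) < uf t f] `&` inf_le S u))).
    apply: mu_subU => //; [exact: CBorel_inf_le|exact: (CBorel_uf_le HC1)|].
    move=> f If; have [h|h] := leP (uf t0 f) (u * expR (c1 * q)); first by left.
    by right; split => //; exists t0.
  by rewrite (mu_uf_le Hiid HC1 t0 ue) lerD2l; exact: HS.
set L := mu (inf_le S u) in H *; have L0 : 0 <= L := mu_ge0 P xi _.
have l1 : c2 * q * L <= 2^-1 * L by rewrite ler_wpM2r.
have l2 : L <= 2 * u * expR (c1 * q) by lra.
split => //.
have l3 : u * expR (c1 * q) <= u * (1 + 2 * (c1 * q)) by rewrite ler_pM2l// E1.
have l4 : c2 * q * L <= c2 * q * (2 * (u * (1 + 2 * (c1 * q)))).
  by rewrite ler_pM2l//; lra.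
have l5 : c2 * q * u * (c1 * q) <= c2 * q * u * 2^-1.
  by rewrite ler_pM2l// mulr_gt0.
lra.
Qed.

Lemma law_bracket y y' : y < y' -> 0 < y' <= u0 -> y' <= 2^-1 ->
  mu (ex_lt S y' `\` all_le S y) <= (y' - y) + (3 * c1 + 6 * c2) * q * y'.
Proof.
move=> yy' y'u y'h; have /andP[y'0 _] := y'u.
have cE : CBorel (ex_lt S y') by exact: (CBorel_ex_lt HC1).
have cA : CBorel (all_le S y) by exact: (CBorel_all_le HC1).
have sub : all_le S y `<=` ex_lt S y'.
  by move=> f /(_ _ St0) h; exists t0 => //; exact: le_lt_trans yy'.
apply: le_trans (mu_setD cE cA sub) _.
have [l1 _] := mu_inf_le y'u y'h.
have l2 : mu (ex_lt S y') <= mu (inf_le S y').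
  apply: (mu_le Hiid) => //; first exact: CBorel_inf_le.
  move=> f [t St ut] n _; exists t => //; apply: lt_trans ut _.
  by rewrite ltrDl invr_gt0.
have c1q0 : 0 < c1 * q by rewrite mulr_gt0.
have c2q0 : 0 < c2 * q by rewrite mulr_gt0.
have p1 : 0 < c1 * q * y' by rewrite mulr_gt0.
have p2 : 0 < c2 * q * y' by rewrite mulr_gt0.
have [y0|y0] := leP y 0.
  have := mu_ge0 P xi (all_le S y); lra.
(* At this level the dilated threshold u exp(c1 q) is exactly y, so the covering condition bounds
   {U(t0) <= u} outside {sup U <= y}. *)
pose u := y * expR (- (c1 * q)).
have u_0 : 0 < u by rewrite mulr_gt0// expR_gt0.
have uy : u <= y.
  by rewrite /u ler_piMr ?(ltW y0)// -[leRHS]expR0 ler_expR oppr_le0 ltW.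
have uu : 0 < u <= u0 by rewrite u_0 /=; case/andP: y'u => _; lra.
have uh : u <= 2^-1 by lra.
have ue : u * expR (c1 * q) = y by rewrite /u -mulrA -expRD addNr expR0 mulr1.
have [_ l3] := mu_inf_le uu uh; rewrite -mulrA ue in l3.
have l4 : u <= mu (all_le S y) + c2 * q * mu (inf_le S u).
  have u01 : 0 <= u <= 1 by rewrite (ltW u_0) /=; lra.
  rewrite -[leLHS](mu_uf_le Hiid HC1 t0 u01).
  apply: (@le_trans _ _ (mu (all_le S y) +
    mu ([set f | exists2 t, S t & u * expR (c1 * q) < uf t f] `&` inf_le S u))).
    apply: mu_subU => //; [exact: (CBorel_uf_le HC1)| |].
      by apply: CBorelI; [exact: (CBorel_ex_gt HC1)|exact: CBorel_inf_le].
    move=> f /= ft0; have [h|h] := pselect (all_le S y f); first by left.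
    right; split.
      move: h => /existsNP[t /not_implyP[St /negP]]; rewrite -ltNge => yt.
      by exists t => //; rewrite ue.
    move=> n _; exists t0 => //; apply: le_lt_trans ft0 _.
    by rewrite ltrDl invr_gt0.
  by rewrite lerD2l; exact: HS.
have l5 : y * (1 - c1 * q) <= u.
  by rewrite /u ler_pM2l//; exact: expR_ge1Dx.
have l6 : c2 * q * mu (inf_le S u) <= c2 * q * (2 * y) by rewrite ler_pM2l.
have l7 : c1 * q * y <= c1 * q * y' by rewrite ler_pM2l// ltW.
have l8 : c2 * q * y <= c2 * q * y' by rewrite ler_pM2l// ltW.
lra.
Qed.

End LocalIncrements.

Section EntropyCondition.
Context {R : realType} {T : topologicalType} {dO : measure_display}
  {Om : measurableType dO}.
Variables (P : probability Om R) (xi : nat -> Om -> T -> R) (D : nat).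
Hypotheses (Hiid : iid P xi) (HC1 : C1 P xi) (HC3 : C3 P xi D) (D0 : (0 < D)%N).
Local Notation mu := (mu P xi).
Local Notation uf := (uf P xi).

Definition local_brackets (N : R -> nat) (Tc : R -> nat -> set T) (C e1 v0 : R) :=
  [/\ 0 < C, 0 < e1, 0 < v0 &
   (forall e, 0 < e -> \bigcup_(j in `I_(N e)) Tc e j = setT) /\
   forall e j, 0 < e <= e1 -> (j < N e)%N -> forall t0, Tc e j t0 ->
   forall y y', y < y' -> 0 < y' <= v0 ->
   mu (ex_lt P xi (Tc e j) y' `\` all_le P xi (Tc e j) y) <= (y' - y) + C * e ^+ 2 * y'].

Lemma C4_local_brackets : C4 P xi -> exists N Tc C e1 v0,
  local_brackets N Tc C e1 v0 /\
  (\int[lebesgue_measure]_(e in `]0%R, 1%R]%classic)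
     (Num.sqrt (ln (N e)%:R : R))%:E < +oo)%E.
Proof.
move=> [c1 [c2 [u0 [e0 [[c10 c20 u00 e00] [N [Tc [cov [H int]]]]]]]]].
(* e <= 1 gives e^2 <= e, and the last two bounds then make c1 e^2 and c2 e^2 at most 1/2, as the
   absorption step requires. *)
pose e1 := Num.min e0 (Num.min 1 (Num.min (c1^-1 / 2) (c2^-1 / 2))).
exists N, Tc, (3 * c1 + 6 * c2), e1, (Num.min u0 2^-1); split; last exact: int.
have i1 : 0 < c1^-1 / 2 by rewrite divr_gt0// invr_gt0.
have i2 : 0 < c2^-1 / 2 by rewrite divr_gt0// invr_gt0.
split; [lra|by rewrite !lt_min e00 ltr01 i1 i2|by rewrite lt_min u00 invr_gt0 ltr0n|].
split; first exact: cov.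
move=> e j /andP[ee ee1] jN t0 Tt0 y y' yy' /andP[y'0]; rewrite le_min => /andP[y'u y'h].
move: ee1; rewrite !le_min => /andP[ee0 /andP[el1 /andP[ec1 ec2]]].
have q0 : 0 < e ^+ 2 by rewrite exprn_gt0.
have qe : e ^+ 2 <= e by rewrite expr2 ler_piMr// ltW.
have cq (c : R) : 0 < c -> e <= c^-1 / 2 -> c * e ^+ 2 <= 2^-1.
  move=> c0 ec; apply: (@le_trans _ _ (c * (c^-1 / 2))).
    by rewrite ler_pM2l// (le_trans qe).
  by rewrite mulrA mulfV ?mul1r// gt_eqF.
have cq1 := cq _ c10 ec1; have cq2 := cq _ c20 ec2.
apply: (law_bracket Hiid HC1 Tt0 c10 c20 q0 cq1 cq2 (u0 := u0)) => //; last first.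
  by rewrite y'0.
move=> u uu; have eb : 0 < e <= e0 by rewrite ee.
have := H e u j eb uu jN => /=.
set A := (X in P (X `&` _)); set B := (X in P (_ `&` X)).
have bd w t : 0 <= Uf P xi 0 w t <= 1.
  by rewrite UfE (uf_ge0 Hiid) (uf_le1 P xi).
have AE : A = xi 0%N @^-1`
    [set f | exists2 t, Tc e j t & u * expR (c1 * e ^+ 2) < uf t f].
  apply/seteqP; split => w /=.
    have hs : has_sup [set Uf P xi 0 w t | t in Tc e j].
      split; first by exists (Uf P xi 0 w t0); exists t0.
      by exists 1 => _ [t _ <-]; case/andP: (bd w t).
    move=> lt; have [_ [t Tt <-] ut] := sup_adherent (eqbRL (subr_gt0 _ _) lt) hs.
    by exists t => //; move: ut; rewrite opprB addrC subrK.
  move=> [t Tt ut]; apply: lt_le_trans ut _.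
  apply: ub_le_sup; last by exists t.
  by exists 1 => _ [t' _ <-]; case/andP: (bd w t').
have BE : B = xi 0%N @^-1` inf_le P xi (Tc e j) u.
  apply/seteqP; split => w /=.
    have hi : has_inf [set Uf P xi 0 w t | t in Tc e j].
      split; first by exists (Uf P xi 0 w t0); exists t0.
      by exists 0 => _ [t _ <-]; case/andP: (bd w t).
    move=> le n _.
    have n0 : 0 < n.+1%:R^-1 :> R by rewrite invr_gt0.
    have [_ [t Tt <-] ut] := inf_adherent n0 hi.
    by exists t => //; apply: lt_le_trans ut _; rewrite lerD2r.
  move=> Hn; apply/ler_addgt0Pr => d d0.
  have [n] := ltr_add_invr d0; rewrite add0r => nd.
  have [t Tt ut] := Hn n I.
  apply: (@le_trans _ _ (uf t (xi 0%N w))); last first.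
    by apply: ltW; apply: lt_trans ut _; rewrite ltrD2l.
  apply: ge_inf; last by exists t.
  by exists 0 => _ [t' _ <-]; case/andP: (bd w t').
have cI : CBorel (inf_le P xi (Tc e j) u) by exact: CBorel_inf_le.
have cA : CBorel [set f | exists2 t, Tc e j t & u * expR (c1 * e ^+ 2) < uf t f].
  exact: (CBorel_ex_gt HC1).
rewrite -[X in (_ <= _ * P X)%E]/B AE BE -preimage_setI.
rewrite (prE P (measurable_xi Hiid 0 (CBorelI cA cI))).
rewrite (prE P (measurable_xi Hiid 0 cI)).
by rewrite -EFinM lee_fin.
Qed.

Lemma cell_exists (N : R -> nat) (Tc : R -> nat -> set T) (e : R) :
  \bigcup_(j in `I_(N e)) Tc e j = setT ->
  exists c : T -> nat, forall t, (c t < N e)%N /\ Tc e (c t) t.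
Proof.
move=> cov; suff H t : exists j, (j < N e)%N /\ Tc e j t.
  by have [c Hc] := choice H; exists c.
have : setT t by []; rewrite -cov => -[j jN Tj]; by exists j.
Qed.

(** For s, t in one cell, {U(s) <= r < U(t)} is contained in the bracket difference for the levels r
    and r (1 + d^2), of mass at most r (1 + 2C) d^2. The gap between the levels reconciles the
    strict and the non-strict inequality. *)
Lemma rT_totally_bounded N Tc C e1 v0 : local_brackets N Tc C e1 v0 ->
  forall e : R, 0 < e -> exists (M : nat) (c : T -> nat),
  (forall t, (c t < M)%N) /\ forall s t, c s = c t -> rT P xi s t <= e.
Proof.
move=> [C0 e10 v00 [cov br]] e e0.
pose d := Num.min e1 (Num.min 1 (e / (1 + 2 * C))).
have C1' : 0 < 1 + 2 * C by lra.
have d0 : 0 < d by rewrite !lt_min e10 ltr01 divr_gt0.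
have [de1 d1 dC] : [/\ d <= e1, d <= 1 & d <= e / (1 + 2 * C)].
  by split; rewrite /d !ge_min lexx ?orbT.
have [c Hc] := cell_exists (cov d d0).
exists (N d), c; split=> [t|s t cst]; first by have [] := Hc t.
have [_ Tct] := Hc t; have [cN Tcs] := Hc s.
rewrite -cst in Tct.
have [_] := tE_pair Hiid HC1 HC3 D0 s t (@ler01 R); rewrite mul1r => lim.
have dd : 0 < d <= e1 by rewrite d0.
have q0 : 0 < d ^+ 2 by rewrite exprn_gt0.
have qd : d ^+ 2 <= d by rewrite expr2 ler_piMr// ltW.
apply: (ler_cvg_to lim (cvg_cst e)); near=> r.
have r0 : 0 < r by near: r; exact: nbhs_right_gt.
have rv : r * (1 + d ^+ 2) <= v0.
  rewrite -ler_pdivlMr ?addr_gt0//; near: r; apply: nbhs_right_le.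
  by rewrite divr_gt0// addr_gt0.
have cB : CBorel (At1 P xi s 1 r `\` At1 P xi t 1 r).
  by apply: CBorelD; exact: (CBorel_uf_le HC1).
rewrite (Ex_ind_xi Hiid 0 cB) ler_pdivrMl//.
have rr : r < r * (1 + d ^+ 2) by rewrite ltr_pMr// ltrDl.
have rr0 : 0 < r * (1 + d ^+ 2) <= v0 by rewrite rv andbT mulr_gt0// addr_gt0.
apply: le_trans (le_trans _ (br d (c s) dd cN s Tcs _ _ rr rr0)) _.
  apply: (mu_le Hiid) => //.
    by apply: CBorelD; [exact: (CBorel_ex_lt HC1)|exact: (CBorel_all_le HC1)].
  move=> f [+ +]; rewrite /At1 /= mulr1 => h1 h2; split.
    by exists s => //; exact: le_lt_trans rr.
  by move=> /(_ _ Tct).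
have h1 : C * d ^+ 2 * (r * (1 + d ^+ 2)) <= C * d ^+ 2 * (r * 2).
  rewrite ler_pM2l ?mulr_gt0// ler_pM2l//; lra.
have h2 : r * ((1 + 2 * C) * d ^+ 2) <= r * e.
  rewrite ler_pM2l// mulrC -ler_pdivlMr//; exact: le_trans dC.
lra.
Unshelve. all: by end_near. Qed.

(** The entropy integrand comes without measurability, but the integral of a nonnegative function is
    a supremum over simple functions below it and is monotone as such. *)
Lemma le_integral_nonmeasurable {d} {X : measurableType d}
    (m : {measure set X -> \bar R}) (A : set X) (f g : X -> \bar R) :
  (forall x, A x -> (0 <= f x)%E) -> (forall x, A x -> (f x <= g x)%E) ->
  (\int[m]_(x in A) f x <= \int[m]_(x in A) g x)%E.
Proof.
move=> f0 fg; have g0 x : A x -> (0 <= g x)%E by move=> Ax; exact: le_trans (f0 _ Ax) (fg _ Ax).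
rewrite !ge0_integralE//; apply: le_ereal_sup => _ [h /= hf <-]; exists h => //= x.
apply: le_trans (hf x) _; rewrite /patch; case: ifPn => // xA.
by apply: fg; rewrite inE in xA.
Qed.

(* eps q minimises N over the dyadic interval (2^-(q+1), 2^-q], so the step function below is
   dominated by the integrand. *)
Lemma entropy_seq (N : R -> nat) :
  (\int[lebesgue_measure]_(e in `]0%R, 1%R]%classic)
     (Num.sqrt (ln (N e)%:R : R))%:E < +oo)%E ->
  exists eps : nat -> R, (forall q, 2 ^- q.+1 < eps q <= 2 ^- q) /\
    exists Cb : R, forall Q, \sum_(q < Q) 2 ^- q * Num.sqrt (ln (N (eps q))%:R) <= Cb.
Proof.
move=> int; pose I q := `](2 ^- q.+1 : R), (2 ^- q : R)]%classic.
have Hq q : exists e, I q e /\ forall e', I q e' -> (N e <= N e')%N.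
  have ex : exists n, `[< exists2 e, I q e & N e = n >].
    exists (N (2 ^- q)); apply/asboolP; exists (2 ^- q) => //.
    rewrite /I /= in_itv /= lexx andbT ltf_pV2 ?posrE ?exprn_gt0//.
    by rewrite exprS ltr_pMl ?exprn_gt0// ltr1n.
  have [n /asboolP[e Ie <-] min] := ex_minnP ex; exists e; split => // e' Ie'.
  by apply: min; apply/asboolP; exists e'.
have {Hq}[eps Heps] := choice Hq.
exists eps; split=> [q|]; first by have [+ _] := Heps q; rewrite /I /= in_itv.
pose s q := Num.sqrt (ln (N (eps q))%:R : R).
set J := (\int[_]_(_ in _) _)%E in int.
have J0 : (0 <= J)%E by apply: integral_ge0 => x _; rewrite lee_fin sqrtr_ge0.
exists (2 * fine J) => Q.
have mI q : measurable (I q) by exact: measurable_itv.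
have lt_pow a b : (2 ^- a : R) < 2 ^- b -> (b < a)%N.
  rewrite ltf_pV2 ?posrE ?exprn_gt0// => h; rewrite ltnNge; apply/negP => ab.
  move: h; rewrite ltNge => /negP; apply.
  by apply: ler_weXn2l => //; rewrite ler1n.
have Idisj x a b : I a x -> I b x -> a = b.
  rewrite /I /= !in_itv /= => /andP[a1 a2] /andP[b1 b2].
  have := lt_pow _ _ (lt_le_trans a1 b2); have := lt_pow _ _ (lt_le_trans b1 a2); lia.
have L : ((\sum_(q < Q) s q * 2 ^- q.+1)%:E <= J)%E.
  have -> : ((\sum_(q < Q) s q * 2 ^- q.+1)%:E =
     \int[lebesgue_measure]_(x in `]0%R, 1%R]%classic)
       \sum_(q < Q) (s q * \1_(I q) x)%:E)%E.
    rewrite ge0_integral_sum//; last 2 first.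
    - by move=> q; apply/measurable_EFinP; apply: measurable_funM;
        [exact: measurable_cst|apply: measurable_indic; exact: mI].
    - by move=> q x _; rewrite lee_fin; apply: mulr_ge0;
        [exact: sqrtr_ge0|exact: ind_ge0].
    rewrite -sumEFin; apply: eq_bigr => q _.
    transitivity (\int[lebesgue_measure]_(x in `]0%R, 1%R]%classic)
        ((s q)%:E * (\1_(I q) x)%:E))%E; last first.
      by apply: eq_integral => x _; rewrite EFinM.
    have mi : measurable_fun (`]0%R, 1%R]%classic : set R)
        (fun x : R => (\1_(I q) x)%:E : \bar R).
      by apply/measurable_EFinP; apply: measurable_indic; exact: mI.
    rewrite ge0_integralZl_EFin//; last exact: sqrtr_ge0.
    rewrite integral_indic; [|exact: measurable_itv|exact: mI].
    transitivity ((s q)%:E * (2 ^- q.+1)%:E)%E; first exact: EFinM.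
    congr (_ * _)%E.
    have -> : I q `&` `]0, 1]%classic = I q.
      apply/seteqP; split => [x []//|x Ix]; split => //.
      move: Ix; rewrite /I /= !in_itv /= => /andP[x1 x2].
      have p0 : 0 < 2 ^- q.+1 :> R by rewrite invr_gt0 exprn_gt0.
      rewrite (lt_trans p0 x1) /=; apply: le_trans x2 _.
      by rewrite invf_le1 ?exprn_gt0// exprn_ege1// ler1n.
    have h : 2 ^- q.+1 < 2 ^- q :> R.
      rewrite ltf_pV2 ?posrE ?exprn_gt0// exprS ltr_pMl ?exprn_gt0//.
      by rewrite ltr1n.
    have lm : (lebesgue_measure (`](2 ^- q.+1 : R), (2 ^- q : R)]%classic : set R) =
        (2 ^- q.+1)%:E)%E.
      rewrite lebesgue_measure_itv /= lte_fin h -EFinB; congr EFin.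
      by rewrite exprS invfM; field; rewrite expf_neq0.
    exact: (esym lm).
  apply: le_integral_nonmeasurable => x /=.
    by move=> _; rewrite sumEFin lee_fin; apply: sumr_ge0 => q _; apply: mulr_ge0;
      [exact: sqrtr_ge0|exact: ind_ge0].
  move=> _; rewrite sumEFin lee_fin.
  have [[q Iq]|none] := pselect (exists q : 'I_Q, I q x); last first.
    rewrite big1 ?sqrtr_ge0// => q _; rewrite ind0 ?mulr0// => Iq.
    by apply: none; exists q.
  rewrite (bigD1 q)//= big1 ?addr0.
    rewrite ind1// mulr1 /s; have [_ /(_ x Iq) NN] := Heps q.
    have [->|N0] := eqVneq (N (eps q)) 0%N; first by rewrite ln0// sqrtr0 sqrtr_ge0.
    rewrite ler_wsqrtr// ler_ln ?posrE ?ltr0n ?lt0n// ?ler_nat//.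
    by rewrite -lt0n (leq_trans _ NN)// lt0n.
  move=> q' qq; rewrite ind0 ?mulr0// => Iq'.
  by move: qq; rewrite (val_inj (Idisj _ _ _ Iq' Iq) : q' = q) eqxx.
have -> : \sum_(q < Q) 2 ^- q * Num.sqrt (ln (N (eps q))%:R) =
    2 * \sum_(q < Q) s q * 2 ^- q.+1.
  rewrite mulr_sumr; apply: eq_bigr => q _; rewrite -/(s q) exprS invfM.
  by field; rewrite expf_neq0.
rewrite ler_pM2l// -lee_fin fineK// ge0_fin_numE//.
Qed.

End EntropyCondition.

(** * Finite families of brackets and their entropy *)

Section Brackets.
Context {R : realType} {T : topologicalType} {dO : measure_display}
  {Om : measurableType dO}.
Variables (P : probability Om R) (xi : nat -> Om -> T -> R) (D : nat) (M : R).
Hypotheses (Hiid : iid P xi) (HC1 : C1 P xi) (HC3 : C3 P xi D) (D0 : (0 < D)%N).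
Hypothesis M0 : 0 < M.
Local Notation mu := (mu P xi).
Local Notation uf := (uf P xi).
Variables (N : R -> nat) (Tc : R -> nat -> set T) (C e1 v0 : R) (eps : nat -> R).
Hypothesis Hbr : local_brackets P xi N Tc C e1 v0.
Hypothesis Heps : forall q, 2 ^- q.+1 < eps q <= 2 ^- q.

Let eps0 q : 0 < eps q.
Proof. by have /andP[h _] := Heps q; apply: lt_trans h; rewrite invr_gt0 exprn_gt0. Qed.

Definition cell q : T -> nat :=
  sval (cid (cell_exists (let: And4 _ _ _ H := Hbr in H.1 _ (eps0 q)))).

Lemma cellP q t : (cell q t < N (eps q))%N /\ Tc (eps q) (cell q t) t.
Proof. exact: (svalP (cid (cell_exists (let: And4 _ _ _ H := Hbr in H.1 _ (eps0 q))))). Qed.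

(** The levels x are cut with mesh 4^-q, which bounds eps_q^2: level gap and oscillation over a cell
    then contribute terms of the same order to the mass of a bracket. *)
Definition gsize q := (Num.truncn (M * 4 ^+ q)).+1.

Lemma gr_exists q : exists g : R -> nat, forall x, 0 <= x <= M ->
  [/\ (g x <= gsize q)%N, ((g x)%:R - 1) * 4 ^- q < x & x <= (g x)%:R * 4 ^- q].
Proof.
suff H x : exists g : nat, 0 <= x <= M ->
    [/\ (g <= gsize q)%N, (g%:R - 1) * 4 ^- q < x & x <= g%:R * 4 ^- q].
  by have [g Hg] := choice H; exists g.
have p0 : 0 < 4 ^- q :> R by rewrite invr_gt0 exprn_gt0.
have [xM|] := boolP (0 <= x <= M); last by exists 0%N.
have /andP[x0 xM1] := xM.
have big : x <= (gsize q)%:R * 4 ^- q.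
  apply: le_trans xM1 _; rewrite ler_pdivlMr ?exprn_gt0//.
  by apply: ltW; exact: truncnS_gt.
have ex : exists g : nat, x <= g%:R * 4 ^- q by exists (gsize q).
have [g xg min] := ex_minnP ex; exists g => _; split => //; first exact: min.
case: g xg min => [|g] xg min.
  by rewrite sub0r mulN1r; apply: lt_le_trans x0; rewrite oppr_lt0.
rewrite -natr1 addrK ltNge; apply/negP => /min; by rewrite ltnn.
Qed.

Definition gr q : R -> nat := sval (cid (gr_exists q)).

Lemma grP q x : 0 <= x <= M ->
  [/\ (gr q x <= gsize q)%N, ((gr q x)%:R - 1) * 4 ^- q < x & x <= (gr q x)%:R * 4 ^- q].
Proof. exact: (svalP (cid (gr_exists q))). Qed.

(** Padding to D coordinates gives all dimensions a common finite type; the first component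
    remembers the true dimension, and the brackets ignore the padding. *)
Definition Key q : finType :=
  ('I_D.+1 * {ffun 'I_D -> 'I_(N (eps q)).+1 * 'I_(gsize q).+1})%type.

Definition key q (v : Vidx T) : Key q :=
  (inord (projT1 v), [ffun j : 'I_D =>
     if insub (j : nat) is Some i
     then (inord (cell q ((projT2 v).1 i)), inord (gr q ((projT2 v).2 i)))
     else (ord0, ord0)]).

Definition lo_br q (kap : R) (c : Key q) : set (T -> R) :=
  [set f | forall j : 'I_D, (j < c.1)%N ->
     all_le P xi (Tc (eps q) (c.2 j).1) (kap * (((c.2 j).2%:R - 1) * 4 ^- q)) f].

Definition up_br q (kap : R) (c : Key q) : set (T -> R) :=
  [set f | forall j : 'I_D, (j < c.1)%N ->
     ex_lt P xi (Tc (eps q) (c.2 j).1) (kap * ((c.2 j).2%:R * 4 ^- q)) f].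

Definition Bset (kap : R) (v : Vidx T) : set (T -> R) :=
  [set f | forall i, uf ((projT2 v).1 i) f < kap * (projT2 v).2 i].

Lemma CBorel_lo q kap c : CBorel (@lo_br q kap c).
Proof. by apply: CBorel_fin_forall => j; exact: (CBorel_all_le HC1). Qed.

Lemma CBorel_up q kap c : CBorel (@up_br q kap c).
Proof. by apply: CBorel_fin_forall => j; exact: (CBorel_ex_lt HC1). Qed.

Lemma CBorel_Bset kap v : CBorel (Bset kap v).
Proof. by apply: CBorel_fin_forallT => i; exact: (CBorel_uf_lt HC1). Qed.

Lemma key1 q v : inV D M v -> (key q v).1 = projT1 v :> nat.
Proof. by move=> [/andP[_ mD] _]; rewrite /= inordK. Qed.

Lemma key2 q v (i : 'I_(projT1 v)) (j : 'I_D) : inV D M v -> i = j :> nat ->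
  ((key q v).2 j).1 = cell q ((projT2 v).1 i) :> nat /\
  ((key q v).2 j).2 = gr q ((projT2 v).2 i) :> nat.
Proof.
move=> [mD xM] ij; rewrite /= ffunE -ij valK /=.
have [cN _] := cellP q ((projT2 v).1 i); have [gG _ _] := grP q (xM i).
by rewrite !inordK// ltnS// ltnW.
Qed.

Lemma ord_of (v : Vidx T) (i : 'I_(projT1 v)) : inV D M v -> exists j : 'I_D, i = j :> nat.
Proof.
move=> [/andP[_ mD] _]; have iD : (i < D)%N by exact: leq_trans (ltn_ord i) mD.
by exists (Ordinal iD).
Qed.

Lemma lo_sub q (kap : R) v : 0 < kap -> inV D M v -> lo_br kap (key q v) `<=` Bset kap v.
Proof.
move=> k0 Vv f Lf i; have [j ij] := ord_of i Vv.
have := Lf j; rewrite key1// -ij ltn_ord => /(_ isT).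
have [-> ->] := key2 q Vv ij; have [_ Tt] := cellP q ((projT2 v).1 i).
move=> /(_ _ Tt) /le_lt_trans; apply; rewrite ltr_pM2l//.
by have [_ ? _] := grP q (Vv.2 i).
Qed.

Lemma up_sub q (kap : R) v : 0 < kap -> inV D M v -> Bset kap v `<=` up_br kap (key q v).
Proof.
move=> k0 Vv f Bf j; rewrite key1// => jm; pose i := Ordinal jm.
have [-> ->] := @key2 q v i j Vv erefl; have [_ Tt] := cellP q ((projT2 v).1 i).
exists ((projT2 v).1 i) => //; apply: lt_le_trans (Bf i) _; rewrite ler_pM2l//.
by have [_ _ ?] := grP q (Vv.2 i).
Qed.

Definition br_const : R := D%:R * (1 + C * (M + 1)).

Lemma br_const_gt0 : 0 < br_const.
Proof.
have M0_ := M0.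
have [C0 _ _ _] := Hbr; rewrite mulr_gt0 ?ltr0n// addr_gt0// mulr_gt0//; lra.
Qed.

(** Leaving the lower set while staying in the upper one happens through a single coordinate, so the
    mass is at most the sum over the coordinates of one-dimensional bracket masses. For grid index 0
    the upper event U < 0 is empty. *)
Lemma br_law q (kap : R) v : 0 < kap -> kap * (M + 1) <= v0 -> eps q <= e1 -> inV D M v ->
  mu (up_br kap (key q v) `\` lo_br kap (key q v)) <= kap * (br_const * 4 ^- q).
Proof.
have M0_ := M0.
move=> k0 kv ee Vv; have [C0 e10 v00 [cov br]] := Hbr.
have p0 : 0 < 4 ^- q :> R by rewrite invr_gt0 exprn_gt0.
have p1 : 4 ^- q <= 1 :> R by rewrite invf_le1 ?exprn_gt0// exprn_ege1// ler1n.
have eps2 : eps q ^+ 2 <= 4 ^- q.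
  have -> : 4 ^- q = (2 ^- q) ^+ 2 :> R.
    by rewrite -exprVn -exprVn -exprM mulnC exprM; congr (_ ^+ q); field.
  have /andP[_ h] := Heps q.
  by rewrite ler_pXn2r ?nnegrE ?invr_ge0 ?exprn_ge0 ?(ltW (eps0 q)).
set c := key q v.
pose S (j : 'I_D) := ex_lt P xi (Tc (eps q) (c.2 j).1) (kap * ((c.2 j).2%:R * 4 ^- q)) `\`
   all_le P xi (Tc (eps q) (c.2 j).1) (kap * (((c.2 j).2%:R - 1) * 4 ^- q)).
have cS j : CBorel (S j).
  by apply: CBorelD; [exact: (CBorel_ex_lt HC1)|exact: (CBorel_all_le HC1)].
have cD : CBorel (up_br kap c `\` lo_br kap c).
  by apply: CBorelD; [exact: CBorel_up|exact: CBorel_lo].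
have step : mu (up_br kap c `\` lo_br kap c) <= \sum_(j < D | (j < c.1)%N) mu (S j).
  have := @mu_lin _ _ _ _ P xi Hiid (option 'I_D)
    (None :: [seq Some j | j <- [seq j : 'I_D <- index_enum 'I_D | (j < c.1)%N]])
    (fun i => if i is Some _ then 1 else -1)
    (fun i => if i is Some j then S j else up_br kap c `\` lo_br kap c).
  rewrite big_cons big_map big_filter /= => H.
  suff : 0 <= -1 * mu (up_br kap c `\` lo_br kap c) + \sum_(j < D | (j < c.1)%N) 1 * mu (S j).
    have -> : \sum_(j < D | (j < c.1)%N) 1 * mu (S j) = \sum_(j < D | (j < c.1)%N) mu (S j).
      by apply: eq_bigr => j _; rewrite mul1r.
    by set sm := \sum_(j < D | _) _; set a := mu _; lra.
  apply: H => [[j|]//|f]; rewrite big_cons big_map big_filter /=.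
  have s0 : 0 <= \sum_(j < D | (j < c.1)%N) 1 * \1_(S j) f :> R.
    by apply: sumr_ge0 => j _; rewrite mul1r ind_ge0.
  have [[Uf nLf]|nf] := pselect ((up_br kap c `\` lo_br kap c) f); last first.
    by rewrite ind0// mulr0 add0r.
  rewrite ind1//; move: nLf => /existsNP[j /not_implyP[jc nA]].
  rewrite (bigD1 j)//= mul1r ind1; last by split; [exact: Uf|].
  rewrite mulN1r addrA addNr add0r.
  by apply: sumr_ge0 => i _; rewrite mul1r ind_ge0.
apply: le_trans step _.
have bd (j : 'I_D) : (j < c.1)%N -> mu (S j) <= kap * ((1 + C * (M + 1)) * 4 ^- q).
  rewrite /c key1// => jm; pose i := Ordinal jm.
  have [e1' e2] := @key2 q v i j Vv erefl; rewrite /S -/c in e1' e2 *.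
  rewrite e1' e2; have [cN Tt] := cellP q ((projT2 v).1 i).
  have [_ g1 g2] := grP q (Vv.2 i); set g := gr q _ in g1 g2 *.
  have rhs0 : 0 <= kap * ((1 + C * (M + 1)) * 4 ^- q).
    by rewrite !mulr_ge0 ?(ltW k0) ?(ltW p0)// addr_ge0// mulr_ge0 ?(ltW C0)//; lra.
  have [g0|g0] := posnP g.
    rewrite (_ : _ `\` _ = set0) ?mu_set0//; apply/seteqP; split => f // -[[t _]].
    by rewrite g0 mul0r mulr0 ltNge (uf_ge0 Hiid).
  have gM : g%:R * 4 ^- q <= M + 1.
    have /andP[_ xM] := Vv.2 i; rewrite mulrBl mul1r in g1; lra.
  have yy : kap * ((g%:R - 1) * 4 ^- q) < kap * (g%:R * 4 ^- q).
    by rewrite ltr_pM2l// ltr_pM2r//; lra.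
  have y'0 : 0 < kap * (g%:R * 4 ^- q) <= v0.
    rewrite !mulr_gt0 ?ltr0n//=; apply: le_trans kv; by rewrite ler_pM2l.
  have ee' : 0 < eps q <= e1 by rewrite eps0.
  apply: le_trans (br _ _ ee' cN _ Tt _ _ yy y'0) _.
  have h1 : C * eps q ^+ 2 * (kap * (g%:R * 4 ^- q)) <= C * 4 ^- q * (kap * (M + 1)).
    have a1 : C * eps q ^+ 2 <= C * 4 ^- q by rewrite ler_pM2l.
    have a2 : kap * (g%:R * 4 ^- q) <= kap * (M + 1) by rewrite ler_pM2l.
    apply: ler_pM a1 a2; first by rewrite mulr_ge0 ?sqr_ge0 ?(ltW C0).
    by case/andP: y'0 => /ltW.
  by apply: le_trans (lerD (lexx _) h1) _; rewrite le_eqVlt; apply/orP; left; apply/eqP; ring.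
apply: le_trans (ler_sum _ bd) _.
rewrite big_mkcond /=; apply: (@le_trans _ _ (\sum_(j < D) kap * ((1 + C * (M + 1)) * 4 ^- q))).
  apply: ler_sum => j _; case: ifP => // _.
  by rewrite !mulr_ge0 ?(ltW k0) ?(ltW p0)// addr_ge0// mulr_ge0 ?(ltW C0)//; lra.
rewrite sumr_const card_ord -mulr_natl /br_const.
by rewrite le_eqVlt; apply/orP; left; apply/eqP; ring.
Qed.

Local Notation H q := (Num.sqrt (ln (N (eps q))%:R : R)).

Definition key_base : R := D.+1%:R * (2 * (M + 2)) ^+ D.

Lemma card_Key q :
  #|Key q|%:R <= expR (key_base + D%:R * H q ^+ 2 + 2 * D%:R * q%:R) :> R.
Proof.
have M0_ := M0.
have cK : #|Key q|%:R = D.+1%:R * ((N (eps q)).+1%:R * (gsize q).+1%:R) ^+ D :> R.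
  by rewrite card_prod card_ffun card_prod !card_ord natrM natrX natrM.
rewrite cK.
have hN : (N (eps q)).+1%:R <= 2 * expR (H q ^+ 2) :> R.
  rewrite -natr1; have [N0|N0] := posnP (N (eps q)).
    rewrite N0 ln0// sqrtr0 expr0n expR0; lra.
  have N1 : 1 <= (N (eps q))%:R :> R by rewrite ler1n.
  rewrite sqr_sqrtr ?ln_ge0// lnK ?posrE ?ltr0n//; lra.
have hG : (gsize q).+1%:R <= (M + 2) * expR (2 * q%:R) :> R.
  have p1 : 1 <= 4 ^+ q :> R by rewrite exprn_ege1// ler1n.
  have t1 : (Num.truncn (M * 4 ^+ q))%:R <= M * 4 ^+ q :> R.
    have p4 : 0 <= M * 4 ^+ q by rewrite mulr_ge0 ?(ltW M0)//; lra.
    by have /andP[] := truncn_itv p4.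
  have p2 : 4 ^+ q <= expR (2 * q%:R) :> R.
    rewrite expRM_natr; apply: lerXn2r; rewrite ?nnegrE ?expR_ge0//.
    have := expR_ge1Dx (1 : R); have -> : 2 = 1 + 1 :> R by [].
    by rewrite expRD => h; have := ler_pM _ _ h h; lra.
  apply: (@le_trans _ _ ((M + 2) * 4 ^+ q)).
    have -> : (gsize q).+1%:R = (Num.truncn (M * 4 ^+ q))%:R + 2 :> R.
      by rewrite /gsize -addn2 natrD.
    by move: t1 p1; set tr := (Num.truncn _)%:R; set pq := 4 ^+ q => t1 p1; lra.
  by rewrite ler_pM2l//; lra.
have h1 : (N (eps q)).+1%:R * (gsize q).+1%:R <=
    (2 * (M + 2)) * expR (H q ^+ 2 + 2 * q%:R) :> R.
  have := ler_pM (ler0n _ _) (ler0n _ _) hN hG; rewrite expRD => h.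
  by apply: le_trans h _; rewrite le_eqVlt; apply/orP; left; apply/eqP; ring.
apply: (@le_trans _ _ (D.+1%:R * ((2 * (M + 2)) * expR (H q ^+ 2 + 2 * q%:R)) ^+ D)).
  rewrite ler_pM2l ?ltr0n//; apply: lerXn2r => //; rewrite nnegrE mulr_ge0 ?expR_ge0//; lra.
rewrite exprMn mulrA -/key_base -expRM_natr -addrA expRD.
have -> : (H q ^+ 2 + 2 * q%:R) * D%:R = D%:R * H q ^+ 2 + 2 * D%:R * q%:R by ring.
rewrite ler_pM2r ?expR_gt0//.
by have := expR_ge1Dx key_base; lra.
Qed.

(** [wgt q] is the size allowed for a link at level q. The constant is large enough that wgt_q^2 4^q
    exceeds the logarithm of the number of pairs of keys plus q, so the union bound leaves 2^-q; the
    factor 2^-q sqrt(log N) keeps the weights summable by the entropy condition. *)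
Definition wgt_const : R := 2 * key_base + 1 + 6 * D%:R.
Definition wgt q : R := 2 ^- q * (wgt_const * (H q + H q.+1 + q.+1%:R)).

Let kb0 : 0 <= key_base.
Proof. have M0_ := M0. by rewrite mulr_ge0// exprn_ge0// mulr_ge0//; lra. Qed.

Let wc1 : 1 <= wgt_const.
Proof. by have h := mulr_ge0 (ler0n R 6) (ler0n R D); have k := kb0; rewrite /wgt_const; lra. Qed.

Let H0 q : 0 <= H q. Proof. exact: sqrtr_ge0. Qed.

Lemma wgt_ge q : 2 ^- q <= wgt q.
Proof.
have M0_ := M0.
rewrite /wgt ler_peMr ?invr_ge0 ?exprn_ge0//.
have q1 : 1 <= q.+1%:R :> R by rewrite ler1n.
have := H0 q; have := H0 q.+1 => h1 h2.
have t1 : 1 <= H q + H q.+1 + q.+1%:R by lra.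
by have := ler_pM ler01 ler01 wc1 t1; rewrite mulr1.
Qed.

Lemma wgt_card q q' : q' = q \/ q' = q.+1 ->
  #|Key q|%:R * #|Key q'|%:R * expR (- (wgt q ^+ 2 * 4 ^+ q)) <= 2 ^- q :> R.
Proof.
have M0_ := M0.
move=> qq'.
have -> : wgt q ^+ 2 * 4 ^+ q = (wgt_const * (H q + H q.+1 + q.+1%:R)) ^+ 2.
  rewrite /wgt exprMn mulrAC -exprVn -exprM mulnC exprM -exprMn.
  by rewrite (_ : 2^-1 ^+ 2 * 4 = 1 :> R) ?expr1n ?mul1r//; field.
set X := H q + H q.+1 + q.+1%:R.
have q1 : 1 <= q.+1%:R :> R by rewrite ler1n.
have h1 := H0 q; have h2 := H0 q.+1.
have q0 : 0 <= q%:R :> R by [].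
have X2 : H q ^+ 2 + H q.+1 ^+ 2 + q.+1%:R ^+ 2 <= X ^+ 2.
  have : 0 <= H q * H q.+1 + H q * q.+1%:R + H q.+1 * q.+1%:R.
    by rewrite !addr_ge0// mulr_ge0.
  by rewrite /X; lra.
have cK' : #|Key q'|%:R <= expR (key_base + D%:R * (H q ^+ 2 + H q.+1 ^+ 2) + 2 * D%:R * q.+1%:R) :> R.
  apply: le_trans (card_Key q') _; rewrite ler_expR.
  have d0 : 0 <= D%:R * H q ^+ 2 by rewrite mulr_ge0 ?sqr_ge0.
  have d1 : 0 <= D%:R * H q.+1 ^+ 2 by rewrite mulr_ge0 ?sqr_ge0.
  have d2 : 0 <= D%:R :> R by [].
  case: qq' => ->; rewrite -?natr1; lra.
have := ler_pM (ler0n _ _) (ler0n _ _) (card_Key q) cK' => hK.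
apply: le_trans (ler_wpM2r (expR_ge0 _) hK) _; rewrite -!expRD.
have e2 : expR (- q%:R) <= 2 ^- q :> R.
  rewrite expRN lef_pV2 ?posrE ?expR_gt0 ?exprn_gt0//.
  rewrite -[q%:R]mul1r expRM_natr; apply: lerXn2r; rewrite ?nnegrE ?expR_ge0//.
  by have := expR_ge1Dx (1 : R); lra.
apply: le_trans e2; rewrite ler_expR.
have wc0 : 0 <= wgt_const by exact: le_trans wc1.
have Y0 : 0 <= wgt_const * X ^+ 2 by rewrite mulr_ge0 ?sqr_ge0.
have s1 : wgt_const * X ^+ 2 <= (wgt_const * X) ^+ 2.
  by rewrite exprMn [wgt_const ^+ 2]expr2 -mulrA ler_peMl.
have s2 : wgt_const * (H q ^+ 2 + H q.+1 ^+ 2 + q.+1%:R ^+ 2) <= wgt_const * X ^+ 2.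
  by rewrite ler_wpM2l.
have s3 : q.+1%:R <= q.+1%:R ^+ 2 :> R by rewrite expr2 ler_peMl.
set a := H q ^+ 2 in s2 *; set b := H q.+1 ^+ 2 in s2 *.
have a0 : 0 <= a by exact: sqr_ge0. have b0 : 0 <= b by exact: sqr_ge0.
have d2 : 0 <= D%:R :> R by [].
have n1 : q%:R = q.+1%:R - 1 :> R by rewrite -natr1 addrK.
set z := q.+1%:R in s2 s3 q1 n1 *; set z2 := z ^+ 2 in s2 s3.
have m1 : 0 <= key_base * a by rewrite mulr_ge0.
have m2 : 0 <= key_base * b by rewrite mulr_ge0.
have m3 : 0 <= D%:R * a by rewrite mulr_ge0.
have m4 : 0 <= D%:R * b by rewrite mulr_ge0.
have m5 : key_base * z <= key_base * z2 by rewrite ler_wpM2l.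
have m6 : D%:R * z <= D%:R * z2 by rewrite ler_wpM2l.
have m7 : key_base * 1 <= key_base * z by rewrite ler_wpM2l.
have m8 : D%:R * 1 <= D%:R * z by rewrite ler_wpM2l.
rewrite n1; have s4 := le_trans s2 s1; move: s4.
set Q := (wgt_const * X) ^+ 2; rewrite /wgt_const => s4; lra.
Qed.

Lemma wgt_sum Cb : (forall Q, \sum_(q < Q) 2 ^- q * H q <= Cb) ->
  exists Cw, forall Q, \sum_(q < Q) wgt q <= Cw.
Proof.
have M0_ := M0.
move=> HCb; exists (wgt_const * (Cb + 2 * Cb + 4)) => Q.
have -> : \sum_(q < Q) wgt q = wgt_const * (\sum_(q < Q) 2 ^- q * H q +
    2 * (\sum_(q < Q) 2 ^- q.+1 * H q.+1) + \sum_(q < Q) 2 ^- q * q.+1%:R).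
  rewrite mulr_sumr -!big_split mulr_sumr /=; apply: eq_bigr => q _.
  by rewrite /wgt exprS invfM; field; rewrite expf_neq0.
have wc0 : 0 <= wgt_const by exact: le_trans wc1.
rewrite ler_wpM2l//; apply: lerD; first apply: lerD; first exact: HCb.
  rewrite ler_pM2l//; apply: le_trans (HCb Q.+1); rewrite big_ord_recl.
  by rewrite lerDr mulr_ge0// invr_ge0 exprn_ge0.
suff -> : \sum_(q < Q) 2 ^- q * q.+1%:R = 4 - 2 ^- Q * (2 * Q.+2%:R) :> R.
  by rewrite gerBl mulr_ge0 ?invr_ge0 ?exprn_ge0.
elim: Q => [|Q IH]; first by rewrite big_ord0 expr0 invr1; lra.
rewrite big_ord_recr /= IH exprS invfM -!natr1.
by field; rewrite expf_neq0.
Qed.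

Lemma eps_le_near (e : R) : 0 < e -> exists q1, forall q, (q1 <= q)%N -> eps q <= e.
Proof.
move=> e0; have : 2^-1 ^+ q @[q --> \oo] --> (0 : R).
  by apply: cvg_expr; rewrite ger0_norm ?invr_ge0// invf_lt1// ltr1n.
move=> /(cvgr_lt _)/(_ _ e0)[q1 _ Hq1]; exists q1 => q qq.
have /andP[_ h] := Heps q; apply: le_trans h _; apply: ltW.
by have := Hq1 q qq; rewrite /= exprVn.
Qed.

Lemma WempE (k : nat -> R) n m (t : 'I_m -> T) x w : (0 < n)%N -> 0 < k n ->
  Wemp P xi k n t x w = Ws P xi (k n) n (Bset (k n / n%:R) (mkV t x)) w.
Proof.
move=> n0 kn0; rewrite /Wemp /Gemp /Eemp /Ws.
have sk0 : 0 < Num.sqrt (k n) by rewrite sqrtr_gt0.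
have skk : k n = Num.sqrt (k n) * Num.sqrt (k n) by rewrite -expr2 sqr_sqrtr// ltW.
pose B := Bset (k n / n%:R) (mkV t x).
have -> : \sum_(i < n) (\1_B (xi i w) - mu B) = \sum_(i < n)
    (if `[< forall j, Uf P xi i w (t j) < k n / n%:R * x j >] then 1 else 0)
    - n%:R * mu B.
  rewrite sumrB sumr_const card_ord -[mu B *+ n]mulr_natl; congr (_ - _).
  by apply: eq_bigr => i _; rewrite -(ifE B (xi i w)).
rewrite -[fine _]/(mu B); set S := \sum_(i < n) _; set m0 := mu B.
by rewrite {2 3}skk; field; rewrite gt_eqF.
Qed.

End Brackets.

(** * Chaining along brackets for set-indexed sums *)

Section Chaining.
Context {R : realType} {T : topologicalType} {dO : measure_display}
  {Om : measurableType dO}.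
Variables (P : probability Om R) (xi : nat -> Om -> T -> R).
Hypothesis Hiid : iid P xi.
Local Notation mu := (mu P xi).

Lemma sdiff_ge0 A B : 0 <= sdiff P xi A B.
Proof. by rewrite addr_ge0// mu_ge0. Qed.

Lemma sdiffC A B : sdiff P xi A B = sdiff P xi B A.
Proof. by rewrite /sdiff addrC. Qed.

Lemma sdiff_tri A B C : CBorel A -> CBorel B -> CBorel C ->
  sdiff P xi A C <= sdiff P xi A B + sdiff P xi B C.
Proof.
move=> cA cB cC; have H X Y Z : CBorel X -> CBorel Y -> CBorel Z ->
    mu (X `\` Z) <= mu (X `\` Y) + mu (Y `\` Z).
  move=> cX cY cZ; apply: (mu_subU Hiid); try exact: CBorelD.
  by move=> f [Xf Zf]; have [Yf|Yf] := pselect (Y f); [right|left].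
by have := H _ _ _ cA cB cC; have := H _ _ _ cC cB cA; rewrite /sdiff; lra.
Qed.

Lemma sdiff_sub A B : A `<=` B -> sdiff P xi A B = mu (B `\` A).
Proof.
move=> AB; rewrite /sdiff (_ : A `\` B = set0) ?mu_set0 ?add0r//.
by apply/seteqP; split => f // -[/AB].
Qed.

(** Counts are monotone in the set, so only the centering can make W_n larger at the smaller set.
    This deterministic bound closes a chain at its last bracket. *)
Lemma Ws_sub_ge (k : R) n A A' w : 0 < k -> CBorel A -> CBorel A' -> A `<=` A' ->
  Ws P xi k n A w - Ws P xi k n A' w <= Num.sqrt k * (n%:R / k * mu (A' `\` A)).
Proof.
move=> k0 cA cA' AA'; rewrite /Ws -mulrBr -sumrB.
have sk0 : 0 < Num.sqrt k by rewrite sqrtr_gt0.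
have skk : k = Num.sqrt k * Num.sqrt k by rewrite -expr2 sqr_sqrtr// ltW.
have mD : mu A' <= mu A + mu (A' `\` A).
  apply: (mu_subU Hiid) => //; first exact: CBorelD.
  by move=> f A'f; have [Af|Af] := pselect (A f); [left|right].
have -> : Num.sqrt k * (n%:R / k * mu (A' `\` A)) =
    (Num.sqrt k)^-1 * \sum_(i < n) mu (A' `\` A).
  rewrite sumr_const card_ord -[mu _ *+ n]mulr_natl {2}skk.
  by field; rewrite gt_eqF.
rewrite ler_pM2l ?invr_gt0//; apply: ler_sum => i _.
have : \1_A (xi i w) <= \1_A' (xi i w) :> R by apply: ind_le; exact: AA'.
lra.
Qed.

Lemma sum_tail (w : nat -> R) Cw : (forall q, 0 <= w q) ->
  (forall Q, \sum_(q < Q) w q <= Cw) -> forall e, 0 < e ->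
  exists q0, forall q, (q0 <= q)%N -> forall Q, \sum_(q <= r < Q) w r <= e.
Proof.
move=> w0 wC e e0; pose S := [set \sum_(0 <= r < Q) w r | Q in setT].
have hS : has_sup S.
  split; first by exists (\sum_(0 <= r < 0) w r); exists 0%N.
  by exists Cw => _ [Q _ <-]; rewrite big_mkord.
have [_ [q0 _ <-] h] := sup_adherent e0 hS.
exists q0 => q qq Q; have [qQ|Qq] := leqP q Q; last first.
  by rewrite big_geq ?(ltW e0)// ltnW.
have e1 : \sum_(0 <= r < Q) w r = \sum_(0 <= r < q) w r + \sum_(q <= r < Q) w r.
  by rewrite -big_cat_nat.
have e2 : \sum_(0 <= r < q) w r = \sum_(0 <= r < q0) w r + \sum_(q0 <= r < q) w r.
  by rewrite -big_cat_nat.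
have h1 : \sum_(0 <= r < Q) w r <= sup S by apply: ub_le_sup; [exact: hS.2|exists Q].
have h2 : 0 <= \sum_(q0 <= r < q) w r by apply: sumr_ge0.
lra.
Qed.

Variables (I : Type) (S : set I) (k : nat -> R) (B : nat -> I -> set (T -> R)).
Variables (K : nat -> finType) (key : forall q, I -> K q).
Variables (Lo Up : forall q, nat -> K q -> set (T -> R)).
Variables (s : R) (w : nat -> R) (Cw : R) (q1 : nat).
Hypotheses (cB : forall n v, CBorel (B n v)) (cLo : forall q n c, CBorel (@Lo q n c))
  (cUp : forall q n c, CBorel (@Up q n c)).
Hypotheses (HC2 : C2 k) (s0 : 0 < s).
Hypothesis Hbr : \forall n \near \oo, forall q v, (q1 <= q)%N -> S v ->
  [/\ Lo n (key q v) `<=` B n v, B n v `<=` Up n (key q v) &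
      n%:R / k n * mu (Up n (key q v) `\` Lo n (key q v)) <= s * 4 ^- q].
Hypotheses (w_ge : forall q, 2 ^- q <= w q) (w_sum : forall Q, \sum_(q < Q) w q <= Cw).
Hypothesis w_card : forall q q', q' = q \/ q' = q.+1 ->
  #|K q|%:R * #|K q'|%:R * expR (- (w q ^+ 2 * 4 ^+ q)) <= 2 ^- q :> R.

Local Notation W n A := (Ws P xi (k n) n A).

Lemma w_gt0 q : 0 < w q.
Proof. by apply: lt_le_trans (w_ge q); rewrite invr_gt0 exprn_gt0. Qed.

Lemma near_n_pos : \forall n \near \oo, (0 < n)%N /\ 0 < k n.
Proof.
near=> n; have n0 : (0 < n)%N by near: n; exact: nbhs_infty_gt.
by split => //; case: HC2 => /(_ n n0) /andP[].
Unshelve. all: by end_near. Qed.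

Lemma near_sqrtk (x : R) : \forall n \near \oo, x <= Num.sqrt (k n).
Proof.
near=> n.
have [x0|x0] := leP x 0; first by apply: le_trans x0 _; exact: sqrtr_ge0.
have h : x ^+ 2 <= k n.
  by near: n; case: HC2 => _ [/cvgryPge + _]; apply.
by rewrite -[leLHS](ger0_norm (ltW x0)) -sqrtr_sqr ler_wsqrtr.
Unshelve. all: by end_near. Qed.

(** A union bound over related pairs of keys. With variance bound 2 sg 4^-q and deviation 4 sqrt(sg)
    w_q, the Bernstein exponent is exactly w_q^2 4^q, and the condition on w_q is its range of
    validity. *)
Lemma pair_event n q q' (A : K q -> set (T -> R)) (A' : K q' -> set (T -> R))
    (rel : K q -> K q' -> Prop) (sg : R) :
  q' = q \/ q' = q.+1 -> (0 < n)%N -> 0 < k n -> 0 < sg ->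
  (forall c, CBorel (A c)) -> (forall c, CBorel (A' c)) ->
  (forall c c', rel c c' -> n%:R / k n * sdiff P xi (A c) (A' c') <= 2 * sg * 4 ^- q) ->
  w q <= Num.sqrt sg * 4 ^- q * Num.sqrt (k n) ->
  exists E : set Om, [/\ measurable E, pr P E <= 2 * 2 ^- q &
    forall om, ~ E om -> forall c c', rel c c' ->
      `|W n (A c) om - W n (A' c') om| <= 4 * Num.sqrt sg * w q].
Proof.
move=> qq n0 k0 sg0 cA cA' Hrel val.
have p0 : 0 < 4 ^- q :> R by rewrite invr_gt0 exprn_gt0.
have ssg : 0 < Num.sqrt sg by rewrite sqrtr_gt0.
have ss : Num.sqrt sg ^+ 2 = sg by rewrite sqr_sqrtr// ltW.
pose a := 4 * Num.sqrt sg * w q.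
have a0 : 0 < a by rewrite mulr_gt0 ?w_gt0// mulr_gt0.
pose s2 := 2 * sg * 4 ^- q.
have s20 : 0 < s2 by rewrite !mulr_gt0.
have ak : a <= 2 * s2 * Num.sqrt (k n).
  have -> : 2 * s2 * Num.sqrt (k n) = 4 * Num.sqrt sg * (Num.sqrt sg * 4 ^- q * Num.sqrt (k n)).
    by rewrite /s2 -{1}ss; ring.
  by rewrite /a ler_pM2l// mulr_gt0.
have ex : a ^+ 2 / (8 * s2) = w q ^+ 2 * 4 ^+ q.
  rewrite /a /s2 !exprMn ss; field.
  by rewrite !gt_eqF ?exprn_gt0.
pose Ev (p : K q * K q') : set Om := if `[< rel p.1 p.2 >]
  then [set om | a < `|W n (A p.1) om - W n (A' p.2) om|] else set0.
have mEv p : measurable (Ev p).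
  rewrite /Ev; case: ifP => // _; apply: measurable_gt.
  have b1 := bm_Ws Hiid (k n) n (cA p.1); have b2 := bm_Ws Hiid (k n) n (cA' p.2).
  exact: (bm_norm (bmB b1 b2)).1.
have pEv p : pr P (Ev p) <= 2 * expR (- (w q ^+ 2 * 4 ^+ q)).
  rewrite /Ev; case: asboolP => [r|_]; last by rewrite pr_set0 mulr_ge0// expR_ge0.
  by rewrite -ex; apply: Ws_bernstein => //; exact: Hrel.
exists (\big[setU/set0]_(p : K q * K q') Ev p); split.
- exact: bigsetU_measurable.
- apply: le_trans (pr_bigU _ _ _ mEv) _.
  apply: le_trans (ler_sum _ (fun p _ => pEv p)) _.
  rewrite sumr_const card_prod -[_ *+ _]mulr_natl natrM.
  rewrite mulrCA ler_pM2l//; exact: w_card.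
- move=> om nE c c' r; rewrite leNgt; apply/negP => lt; apply: nE.
  rewrite (bigD1 (c, c'))//=; left; rewrite /Ev; case: asboolP => //.
Qed.

Lemma geo_half q p : (q <= p)%N -> \sum_(q <= r < p) 2 * 2 ^- r = 4 * 2 ^- q - 4 * 2 ^- p :> R.
Proof.
elim: p => [|p IH].
  by rewrite leqn0 => /eqP ->; rewrite big_geq// subrr.
rewrite leq_eqVlt => /predU1P[->|]; first by rewrite big_geq// subrr.
rewrite ltnS => qp; rewrite big_nat_recr//= (IH qp) exprS invfM.
by set x := 2 ^- q; set y := 2 ^- p; lra.
Qed.

(** The chain runs through the lower sets from level q to the last level p in the Gaussian range.
    There Bernstein controls the upper minus the lower set. The set B lies between the two, and by
    monotonicity it deviates from them in the unfavourable direction by at most sqrt(k) s 4^-p,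
    which is at most 4 sqrt(s) w_(p+1) because level p+1 is outside the range. *)
Lemma chain e : 0 < e -> exists q0, forall q, (q0 <= q)%N -> \forall n \near \oo,
  exists E : set Om, [/\ measurable E, pr P E <= e & forall om, ~ E om ->
    forall v, S v -> `|W n (B n v) om - W n (Lo n (key q v)) om| <= e].
Proof.
move=> e0; have ss0 : 0 < Num.sqrt s by rewrite sqrtr_gt0.
have ss : Num.sqrt s * Num.sqrt s = s by rewrite -expr2 sqr_sqrtr// ltW.
have ee : 0 < e / (4 * Num.sqrt s) by rewrite divr_gt0// mulr_gt0.
have [qa Hqa] := sum_tail (fun q => ltW (w_gt0 q)) w_sum ee.
have e4 : 0 < e / 4 by rewrite divr_gt0.
have [qb Hqb] : exists qb, forall q, (qb <= q)%N -> 4 * 2 ^- q <= e.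
  have : 2^-1 ^+ q @[q --> \oo] --> (0 : R).
    by apply: cvg_expr; rewrite ger0_norm ?invr_ge0// invf_lt1// ltr1n.
  move=> /(cvgr_lt _)/(_ _ e4)[qb _ Hqb]; exists qb => q /Hqb /=.
  by rewrite exprVn; lra.
exists (maxn q1 (maxn qa qb)) => q; rewrite !geq_max => /andP[qq1 /andP[qqa qqb]].
near=> n.
have [n0 k0] : (0 < n)%N /\ 0 < k n by near: n; exact: near_n_pos.
have br : forall q v, (q1 <= q)%N -> S v ->
  [/\ Lo n (key q v) `<=` B n v, B n v `<=` Up n (key q v) &
      n%:R / k n * mu (Up n (key q v) `\` Lo n (key q v)) <= s * 4 ^- q].
  by near: n.
pose val r := w r <= Num.sqrt s * 4 ^- r * Num.sqrt (k n).
have valq : val q.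
  rewrite /val mulrC -ler_pdivrMr; last by rewrite mulr_gt0// invr_gt0 exprn_gt0.
  by near: n; exact: near_sqrtk.
have sk0 : 0 < Num.sqrt (k n) by rewrite sqrtr_gt0.
(* The range ends at a finite level: w_r is at least 2^-r, whereas the admissible size decreases
   like 4^-r. *)
have exf : exists r, (q <= r)%N && ~~ val r.
  pose X := Num.sqrt s * Num.sqrt (k n).
  have X0 : 0 < X by rewrite mulr_gt0.
  have : 2^-1 ^+ r @[r --> \oo] --> (0 : R).
    by apply: cvg_expr; rewrite ger0_norm ?invr_ge0// invf_lt1// ltr1n.
  have Xi : 0 < X^-1 by rewrite invr_gt0.
  move=> /(cvgr_lt _)/(_ _ Xi)[r0 _ Hr0]; exists (maxn q r0).
  rewrite leq_maxl /= -ltNge; set r := maxn q r0.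
  apply: lt_le_trans (w_ge r).
  have hr : 2 ^- r < X^-1 by have := Hr0 r (leq_maxr _ _); rewrite /= exprVn.
  have p0 : 0 < 2 ^- r :> R by rewrite invr_gt0 exprn_gt0.
  have -> : Num.sqrt s * 4 ^- r * Num.sqrt (k n) = 2 ^- r * (2 ^- r * X).
    rewrite (_ : 4 ^- r = 2 ^- r * 2 ^- r :> R) ?/X; first by ring.
    by rewrite -invfM -exprMn; congr (_ ^- r); ring.
  by rewrite gtr_pMr// -ltr_pdivlMr// mul1r.
have [ps /andP[qps nval] minp] := ex_minnP exf.
have qltps : (q < ps)%N.
  by rewrite ltn_neqAle qps andbT; apply: contraNneq nval => <-.
pose p := ps.-1.
have psE : ps = p.+1 by rewrite /p prednK//; exact: leq_ltn_trans qltps.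
have qp : (q <= p)%N by rewrite -ltnS -psE.
have valr r : (q <= r <= p)%N -> val r.
  move=> /andP[qr rp]; apply: contraT => nv.
  by have := minp r; rewrite qr nv => /(_ isT); rewrite psE ltnNge rp.
pose rel r (c : K r) (c' : K r.+1) := exists v, [/\ S v, key r v = c & key r.+1 v = c'].
have H4S r : 4 ^- r.+1 <= 4 ^- r :> R.
  by rewrite lef_pV2 ?posrE ?exprn_gt0// exprS ler_peMl ?exprn_ge0// ler1n.
have nk0 : 0 <= n%:R / k n by rewrite divr_ge0 ?(ltW k0).
have loB r v : (q1 <= r)%N -> S v ->
    n%:R / k n * sdiff P xi (Lo n (key r v)) (B n v) <= s * 4 ^- r.
  move=> qr Sv; have [h1 h2 h3] := br r v qr Sv.
  rewrite sdiff_sub//; apply: le_trans h3; rewrite ler_wpM2l//.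
  apply: (mu_le Hiid); try exact: CBorelD.
  by move=> f [/h2].
have Hrel r : (q1 <= r)%N -> forall c c', rel r c c' ->
    n%:R / k n * sdiff P xi (Lo n c) (Lo n c') <= 2 * s * 4 ^- r.
  move=> q1r c c' [v [Sv <- <-]].
  have h1 := loB r v q1r Sv; have h2 := loB r.+1 v (leqW q1r) Sv.
  have h3 := sdiff_tri (cLo n (key r v)) (cB n v) (cLo n (key r.+1 v)).
  rewrite [sdiff _ _ (B n v) _]sdiffC in h3.
  have h4 := ler_wpM2l nk0 h3; have h5 := H4S r.
  have h6 : s * 4 ^- r.+1 <= s * 4 ^- r by rewrite ler_pM2l.
  rewrite [leRHS]mulrDr in h4; apply: le_trans h4 (le_trans (lerD h1 (le_trans h2 h6)) _).
  by rewrite -mulrA mulr2n mulrDl mul1r.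
have Ev r : exists E : set Om, measurable E /\ ((q <= r <= p)%N -> pr P E <= 2 * 2 ^- r /\
    forall om, ~ E om -> forall c c', rel r c c' ->
      `|W n (Lo n c) om - W n (Lo n c') om| <= 4 * Num.sqrt s * w r).
  have [rr|] := boolP (q <= r <= p)%N; last by exists set0.
  have q1r : (q1 <= r)%N by case/andP: rr => qr _; exact: leq_trans qr.
  have [E [mE pE HE]] := pair_event (or_intror erefl) n0 k0 s0 (@cLo r n) (@cLo r.+1 n)
    (Hrel r q1r) (valr r rr).
  by exists E.
have [E HE] := choice Ev.
have q1p : (q1 <= p)%N by exact: leq_trans qq1 qp.
have HrelF c c' : (exists v, [/\ S v, key p v = c & key p v = c']) ->
    n%:R / k n * sdiff P xi (Up n c) (Lo n c') <= 2 * s * 4 ^- p.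
  move=> [v [Sv <- <-]]; have [h1 h2 h3] := br p v q1p Sv.
  rewrite sdiffC sdiff_sub; last by move=> f /h1 /h2.
  have : 0 <= s * 4 ^- p by rewrite mulr_ge0 ?(ltW s0)// invr_ge0 exprn_ge0.
  lra.
have vp : val p by apply: valr; rewrite qp leqnn.
have [F [mF pF HF]] := pair_event (or_introl erefl) n0 k0 s0 (@cUp p n) (@cLo p n) HrelF vp.
exists (\big[setU/set0]_(q <= r < p) E r `|` F); split.
- apply: measurableU => //; apply: bigsetU_measurable => r _.
  exact: (HE r).1.
- have mE r : measurable (E r) by exact: (HE r).1.
  apply: le_trans (prU P _ mF) _; first exact: bigsetU_measurable.
  have h1 : pr P (\big[setU/set0]_(q <= r < p) E r) <= 4 * 2 ^- q - 4 * 2 ^- p.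
    rewrite -geo_half//; apply: le_trans (pr_bigU P _ _ mE) _.
    rewrite big_nat_cond [leRHS]big_nat_cond; apply: ler_sum => r.
    rewrite andbT => /andP[qr rp]; have [_] := HE r.
    by rewrite qr (ltnW rp) => /(_ isT)[].
  have h2 := Hqb q qqb.
  have h3 : 0 <= 2 ^- p :> R by rewrite invr_ge0 exprn_ge0.
  lra.
move=> om nE v Sv.
have nF : ~ F om by move=> Fo; apply: nE; right.
have nEr r : (q <= r < p)%N -> ~ E r om.
  move=> qr Er; apply: nE; left.
  by rewrite -bigcup_seq_cond; exists r => //=; rewrite mem_index_iota qr.
have tel m : (q <= m <= p)%N -> `|W n (Lo n (key q v)) om - W n (Lo n (key m v)) om| <=
    4 * Num.sqrt s * \sum_(q <= r < m) w r.
  elim: m => [|m IH].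
    rewrite leqn0 => /andP[/eqP -> _].
    by rewrite subrr normr0 big_geq// mulr0.
  move=> /andP[qm mp]; move: qm; rewrite leq_eqVlt => /predU1P[<-|].
    by rewrite subrr normr0 big_geq// mulr0.
  rewrite ltnS => qm; rewrite big_nat_recr//= mulrDr.
  have qmp : (q <= m <= p)%N by rewrite qm ltnW.
  have [_ /(_ qmp)[_ HEm]] := HE m.
  have st := HEm om (nEr m _) (key m v) (key m.+1 v).
  rewrite -(subrKA (W n (Lo n (key m v)) om)).
  apply: le_trans (ler_normD _ _) _; apply: lerD; first exact: IH.
  apply: st; first by rewrite qm.
  by exists v.
have [h1 h2 h3] := br p v q1p Sv.
have small : Num.sqrt (k n) * (s * 4 ^- p) <= 4 * Num.sqrt s * w ps.
  move: nval; rewrite /val -ltNge => /ltW nv.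
  have -> : Num.sqrt (k n) * (s * 4 ^- p) =
      4 * Num.sqrt s * (Num.sqrt s * 4 ^- ps * Num.sqrt (k n)).
    rewrite -{1}ss psE exprS invfM; field.
    by rewrite expf_neq0.
  by rewrite ler_wpM2l// mulr_ge0// ltW.
have up : W n (B n v) om - W n (Up n (key p v)) om <= Num.sqrt (k n) * (s * 4 ^- p).
  apply: le_trans (Ws_sub_ge n om k0 (cB n v) (cUp n (key p v)) h2) _.
  rewrite ler_wpM2l ?sqrtr_ge0//; apply: le_trans h3; rewrite ler_wpM2l//.
  apply: (mu_le Hiid); try exact: CBorelD.
  by move=> f [Uf nBf]; split => // /h1.
have lo : W n (Lo n (key p v)) om - W n (B n v) om <= Num.sqrt (k n) * (s * 4 ^- p).
  apply: le_trans (Ws_sub_ge n om k0 (cLo n (key p v)) (cB n v) h1) _.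
  rewrite ler_wpM2l ?sqrtr_ge0//; apply: le_trans h3; rewrite ler_wpM2l//.
  apply: (mu_le Hiid); try exact: CBorelD.
  by move=> f [Bf nLf]; split => //; exact: h2.
have ul := HF om nF _ _ (ex_intro _ v (And3 Sv erefl erefl)).
have qpp : (q <= p <= p)%N by rewrite qp leqnn.
have tp := tel p qpp.
have tot := Hqa q qqa ps.+1.
rewrite big_nat_recr ?(leq_trans qp)//= in tot; last by rewrite psE ltnW.
rewrite psE big_nat_recr//= -psE in tot.
have {}tot : 4 * Num.sqrt s * (\sum_(q <= r < p) w r + w p + w ps) <= e.
  by rewrite mulrC -ler_pdivlMr// mulr_gt0.
move: tp ul; rewrite !ler_norml => /andP[t1 t2] /andP[u1 u2].
apply/andP; split; lra.
Unshelve. all: by end_near. Qed.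

Variable r2v : I -> I -> R.
Hypothesis Hr2 : forall v v', S v -> S v' ->
  n%:R / k n * sdiff P xi (B n v) (B n v') @[n --> \oo] --> r2v v v'.

Lemma r2v_key q v v' : (q1 <= q)%N -> S v -> S v' -> key q v = key q v' ->
  r2v v v' <= 2 * s * 4 ^- q.
Proof.
move=> qq Sv Sv' kk; apply: (ler_cvg_to (Hr2 Sv Sv') (cvg_cst (2 * s * 4 ^- q))).
near=> n.
have [n0 k0] : (0 < n)%N /\ 0 < k n by near: n; exact: near_n_pos.
have br : forall q v, (q1 <= q)%N -> S v ->
  [/\ Lo n (key q v) `<=` B n v, B n v `<=` Up n (key q v) &
      n%:R / k n * mu (Up n (key q v) `\` Lo n (key q v)) <= s * 4 ^- q].
  by near: n.
have nk0 : 0 <= n%:R / k n by rewrite divr_ge0 ?(ltW k0).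
have [h1 h2 h3] := br q v qq Sv; have [h1' h2' h3'] := br q v' qq Sv'.
rewrite -kk in h1' h2' h3'.
have H (X Y : set (T -> R)) : CBorel X -> CBorel Y -> X `<=` Up n (key q v) ->
    Lo n (key q v) `<=` Y -> n%:R / k n * mu (X `\` Y) <= s * 4 ^- q.
  move=> cX cY XU LY; apply: le_trans h3; rewrite ler_wpM2l//.
  apply: (mu_le Hiid); try exact: CBorelD.
  by move=> f [/XU Uf nYf]; split => // /LY.
have a1 := H _ _ (cB n v) (cB n v') h2 h1'.
have a2 := H _ _ (cB n v') (cB n v) h2' h1.
by rewrite /sdiff mulrDr; lra.
Unshelve. all: by end_near. Qed.

(** After chaining down to level q only finitely many pairs of keys remain. A pair is compared only
    if it contains two indices within 4^-q for [r2v]; convergence of the normalised symmetric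
    differences is required at one representative pair each, hence holds for all of them from some n
    on. *)
Lemma equicontinuity e : 0 < e -> exists2 dl : R, 0 < dl & \forall n \near \oo,
  exists E : set Om, [/\ measurable E, pr P E <= e & forall om, ~ E om ->
    forall v v', S v -> S v' -> r2v v v' <= dl ->
    `|W n (B n v) om - W n (B n v') om| <= e].
Proof.
(* Two brackets of mass s 4^-q and a distance of at most 2 4^-q between the representatives add up
   to 2 (s + 1) 4^-q. *)
move=> e0; pose sg := s + 1.
have sg0 : 0 < sg by rewrite /sg; have := s0; lra.
have ssg : 0 < Num.sqrt sg by rewrite sqrtr_gt0.
have e3 : 0 < e / 3 by rewrite divr_gt0.
have ee : 0 < e / 3 / (4 * Num.sqrt sg) by rewrite divr_gt0// mulr_gt0.
have [qa Hqa] := sum_tail (fun q => ltW (w_gt0 q)) w_sum ee.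
have [qb Hqb] := chain e3.
have e6 : 0 < e / 6 by rewrite divr_gt0.
have [qc Hqc] : exists qb, forall q, (qb <= q)%N -> 2 * 2 ^- q <= e / 3.
  have : 2^-1 ^+ q @[q --> \oo] --> (0 : R).
    by apply: cvg_expr; rewrite ger0_norm ?invr_ge0// invf_lt1// ltr1n.
  move=> /(cvgr_lt _)/(_ _ e6)[qc _ Hqc]; exists qc => q /Hqc /=.
  by rewrite exprVn; lra.
pose q := maxn q1 (maxn qa (maxn qb qc)).
have : (q <= q)%N by []; rewrite {1}/q !geq_max.
move=> /andP[qq1 /andP[qqa /andP[qqb qqc]]].
have p0 : 0 < 4 ^- q :> R by rewrite invr_gt0 exprn_gt0.
exists (4 ^- q) => //.
pose rel (p : K q * K q) := exists v v',
  [/\ S v, S v', key q v = p.1, key q v' = p.2 & r2v v v' <= 4 ^- q].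
have rel_near : \forall n \near \oo, forall p, rel p ->
    n%:R / k n * sdiff P xi (Lo n p.1) (Lo n p.2) <= 2 * sg * 4 ^- q.
  apply: filter_forall => -[c c'].
  have [[v [v' [Sv Sv' /= kv kv' rv]]]|nr] := pselect (rel (c, c')); last first.
    by apply: nearW => n /nr.
  near=> n => _ /=.
  have [n0 k0] : (0 < n)%N /\ 0 < k n by near: n; exact: near_n_pos.
  have br : forall q v, (q1 <= q)%N -> S v ->
    [/\ Lo n (key q v) `<=` B n v, B n v `<=` Up n (key q v) &
      n%:R / k n * mu (Up n (key q v) `\` Lo n (key q v)) <= s * 4 ^- q].
    by near: n.
  have nk0 : 0 <= n%:R / k n by rewrite divr_ge0 ?(ltW k0).
  have loB u : S u -> n%:R / k n * sdiff P xi (Lo n (key q u)) (B n u) <= s * 4 ^- q.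
    move=> Su; have [h1 h2 h3] := br q u qq1 Su.
    rewrite sdiff_sub//; apply: le_trans h3; rewrite ler_wpM2l//.
    apply: (mu_le Hiid); try exact: CBorelD.
    by move=> f [/h2].
  have h0 : n%:R / k n * sdiff P xi (B n v) (B n v') <= 2 * 4 ^- q.
    by near: n; apply: (cvgr_le _ (Hr2 Sv Sv')); lra.
  rewrite -kv -kv'; have h1 := loB v Sv; have h2 := loB v' Sv'.
  have t1 := sdiff_tri (cLo n (key q v)) (cB n v) (cLo n (key q v')).
  have t2 := sdiff_tri (cB n v) (cB n v') (cLo n (key q v')).
  rewrite [sdiff _ _ (B n v') (Lo _ _)]sdiffC in t2.
  have t3 := ler_wpM2l nk0 (le_trans t1 (lerD (lexx _) t2)).
  rewrite [leRHS]mulrDr [X in _ <= _ + X]mulrDr in t3.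
  apply: le_trans t3 (le_trans (lerD h1 (lerD h0 h2)) _).
  by rewrite /sg; set y := 4 ^- q; lra.
near=> n.
have [n0 k0] : (0 < n)%N /\ 0 < k n by near: n; exact: near_n_pos.
have rn : forall p, rel p ->
    n%:R / k n * sdiff P xi (Lo n p.1) (Lo n p.2) <= 2 * sg * 4 ^- q by near: n.
have val : w q <= Num.sqrt sg * 4 ^- q * Num.sqrt (k n).
  rewrite mulrC -ler_pdivrMr; last by rewrite mulr_gt0.
  by near: n; exact: near_sqrtk.
have [E [mE pE HE]] : exists E : set Om, [/\ measurable E, pr P E <= e / 3 &
    forall om, ~ E om ->
    forall v, S v -> `|W n (B n v) om - W n (Lo n (key q v)) om| <= e / 3].
  by near: n; exact: Hqb.
have rn' c c' : rel (c, c') ->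
    n%:R / k n * sdiff P xi (Lo n c) (Lo n c') <= 2 * sg * 4 ^- q by exact: rn.
have [F [mF pF HF]] := pair_event (or_introl erefl) n0 k0 sg0 (@cLo q n) (@cLo q n) rn' val.
exists (E `|` F); split; first exact: measurableU.
  by apply: le_trans (prU P mE mF) _; have := Hqc q qqc; lra.
move=> om nEF v v' Sv Sv' rv.
have nE : ~ E om by move=> ?; apply: nEF; left.
have nF : ~ F om by move=> ?; apply: nEF; right.
have h1 := HE om nE v Sv; have h2 := HE om nE v' Sv'.
have h3 := HF om nF (key q v) (key q v') (ex_intro _ v (ex_intro _ v' (And5 Sv Sv' erefl erefl rv))).
have h4 : 4 * Num.sqrt sg * w q <= e / 3.
  have := Hqa q qqa q.+1; rewrite big_nat1.
  by rewrite ler_pdivlMr ?mulr_gt0// mulrC.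
move: h1 h2 h3; rewrite !ler_norml => /andP[a1 a2] /andP[b1 b2] /andP[d1 d2].
apply/andP; split; lra.
Unshelve. all: by end_near. Qed.

Variable M : R.
Hypothesis HM : \forall n \near \oo, forall v, S v -> n%:R / k n * mu (B n v) <= M.

(** Chaining reduces to the finitely many lower sets at one level, each compared by Bernstein with
    the empty set, where W_n vanishes. *)
Lemma tightness e : 0 < e -> exists2 C : R, 0 < C & \forall n \near \oo,
  exists E : set Om, [/\ measurable E, pr P E <= e & forall om, ~ E om ->
    forall v, S v -> `|W n (B n v) om| <= C].
Proof.
move=> e0; have e2 : 0 < e / 2 by rewrite divr_gt0.
have [q0 Hq0] := chain e2; pose q := maxn q0 q1.
have qq0 : (q0 <= q)%N by exact: leq_maxl.
have qq1 : (q1 <= q)%N by exact: leq_maxr.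
pose s2 := `|M| + 1.
have s20 : 0 < s2 by rewrite ltr_wpDl.
pose NK : R := #|K q|%:R.
(* C <= C^2 gives C^2 / (8 s2) >= 4 NK / e, and exp(y) >= 1 + y then pushes the union bound over
   [NK] keys below e / 2. *)
pose C := 1 + 8 * s2 * (4 * NK / e).
have x0 : 0 <= 4 * NK / e by rewrite divr_ge0 ?(ltW e0)// mulr_ge0.
have C1' : 1 <= C by rewrite /C lerDl mulr_ge0// mulr_ge0 ?(ltW s20).
have C0 : 0 < C by exact: lt_le_trans C1'.
exists (C + e) => [|]; first by rewrite addr_gt0.
near=> n.
have [n0 k0] : (0 < n)%N /\ 0 < k n by near: n; exact: near_n_pos.
have br : forall q v, (q1 <= q)%N -> S v ->
    [/\ Lo n (key q v) `<=` B n v, B n v `<=` Up n (key q v) &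
      n%:R / k n * mu (Up n (key q v) `\` Lo n (key q v)) <= s * 4 ^- q].
  by near: n.
have hM : forall v, S v -> n%:R / k n * mu (B n v) <= M by near: n.
have nk0 : 0 <= n%:R / k n by rewrite divr_ge0 ?(ltW k0).
have val : C <= 2 * s2 * Num.sqrt (k n).
  rewrite mulrC -ler_pdivrMr; last by rewrite mulr_gt0.
  by near: n; exact: near_sqrtk.
have [E [mE pE HE]] : exists E : set Om, [/\ measurable E, pr P E <= e / 2 &
    forall om, ~ E om ->
    forall v, S v -> `|W n (B n v) om - W n (Lo n (key q v)) om| <= e / 2].
  by near: n; exact: Hq0.
pose rel c := exists2 v, S v & key q v = c.
pose Ev c : set Om := if `[< rel c >]
  then [set om | C < `|W n (Lo n c) om - W n set0 om|] else set0.
have mEv c : measurable (Ev c).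
  rewrite /Ev; case: ifP => // _; apply: measurable_gt.
  have b1 := bm_Ws Hiid (k n) n (cLo n c); have b2 := bm_Ws Hiid (k n) n (@CBorel0 R T).
  exact: (bm_norm (bmB b1 b2)).1.
have exb : NK * (2 * expR (- (C ^+ 2 / (8 * s2)))) <= e / 2.
  have h1 : 4 * NK / e <= C ^+ 2 / (8 * s2).
    rewrite ler_pdivlMr ?mulr_gt0// [leLHS]mulrC.
    apply: (@le_trans _ _ C); first by rewrite /C lerDr.
    by rewrite expr2 ler_peMl// ltW.
  have h2 := expR_ge1Dx (C ^+ 2 / (8 * s2)).
  set X := C ^+ 2 / (8 * s2) in h1 h2 *.
  rewrite expRN; have X1 : 4 * NK / e <= expR X by lra.
  rewrite mulrA ler_pdivrMr ?expR_gt0// mulrC.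
  have := ler_wpM2l (ltW e2) X1.
  have -> : e / 2 * (4 * NK / e) = 2 * NK by field; rewrite gt_eqF.
  by rewrite mulrC.
have pEv c : pr P (Ev c) <= 2 * expR (- (C ^+ 2 / (8 * s2))).
  rewrite /Ev; case: asboolP => [[v Sv <-]|_]; last by rewrite pr_set0 mulr_ge0// expR_ge0.
  apply: Ws_bernstein => //; first exact: CBorel0.
  have [h1 _ _] := br q v qq1 Sv.
  rewrite sdiffC sdiff_sub// setD0; apply: (@le_trans _ _ M).
    apply: le_trans (hM v Sv); rewrite ler_wpM2l//.
    exact: (mu_le Hiid).
  by rewrite /s2; have := ler_norm M; lra.
exists (E `|` \big[setU/set0]_c Ev c); split.
- by apply: measurableU => //; exact: bigsetU_measurable.
- apply: le_trans (prU P mE _) _; first exact: bigsetU_measurable.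
  have h : pr P (\big[setU/set0]_c Ev c) <= e / 2.
    apply: le_trans (pr_bigU _ _ _ mEv) _.
    apply: le_trans (ler_sum _ (fun p _ => pEv p)) _.
    by rewrite sumr_const -[_ *+ _]mulr_natl.
  lra.
move=> om nEF v Sv.
have nE : ~ E om by move=> ?; apply: nEF; left.
have h1 := HE om nE v Sv.
have h2 : `|W n (Lo n (key q v)) om| <= C.
  rewrite leNgt; apply/negP => lt; apply: nEF; right.
  rewrite (bigD1 (key q v))//=; left; rewrite /Ev; case: asboolP => [_|nr].
    rewrite /= [W n set0 om](_ : _ = 0) ?subr0// /Ws big1 ?mulr0// => i _.
    by rewrite ind0// mu_set0 subrr.
  by case: nr; exists v.
have := ler_normD (W n (B n v) om - W n (Lo n (key q v)) om) (W n (Lo n (key q v)) om).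
rewrite subrK; lra.
Unshelve. all: by end_near. Qed.

End Chaining.

(** * Asymptotics of W_n over the index set *)

Section Empirical.
Context {R : realType} {T : topologicalType} {dO : measure_display}
  {Om : measurableType dO}.
Variables (P : probability Om R) (xi : nat -> Om -> T -> R) (k : nat -> R) (D : nat).
Hypotheses (Hiid : iid P xi) (HC1 : C1 P xi) (HC2 : C2 k) (HC3 : C3 P xi D)
  (D0 : (0 < D)%N).
Local Notation mu := (mu P xi).
Local Notation uf := (uf P xi).
Local Notation Rt := (Rtc P xi).
Local Notation Cov := (CovR P xi).

Definition kap (n : nat) : R := k n / n%:R.
Definition Wv (n : nat) (v : Vidx T) (w : Om) : R :=
  Ws P xi (k n) n (Bset P xi (kap n) v) w.

Lemma WempWv n m (t : 'I_m -> T) x w : (0 < n)%N ->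
  Wemp P xi k n t x w = Wv n (mkV t x) w.
Proof. by move=> n0; apply: WempE => //; case: HC2 => /(_ n n0) /andP[]. Qed.

Lemma kap_gt0 n : (0 < n)%N -> 0 < kap n.
Proof. by move=> n0; rewrite divr_gt0 ?ltr0n//; case: HC2 => /(_ n n0) /andP[]. Qed.

Lemma kap_at_right : kap n @[n --> \oo] --> (0 : R)^'+.
Proof.
move=> A [e /= e0 He].
case: HC2 => _ [_ /(cvgr_lt _)/(_ e e0) ke].
suff H : \forall n \near \oo, A (kap n) by exact: H.
near=> n.
have n0 : (0 < n)%N by near: n; exact: nbhs_infty_gt.
have kn := kap_gt0 n0; apply: He => //=.
rewrite sub0r normrN gtr0_norm//; near: n; exact: ke.
Unshelve. all: by end_near. Qed.

Lemma near_kap (e : R) : 0 < e -> \forall n \near \oo, 0 < kap n <= e.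
Proof.
move=> e0; have H : \forall s \near (0 : R)^'+, 0 < s <= e.
  near=> s; apply/andP; split; first by near: s; exact: nbhs_right_gt.
  by near: s; exact: nbhs_right_le.
exact: (kap_at_right H).
Unshelve. all: by end_near. Qed.

Lemma kapV n : (kap n)^-1 = n%:R / k n.
Proof. by rewrite /kap invf_div. Qed.

Lemma mu_DI A B : CBorel A -> CBorel B -> mu (A `\` B) = mu A - mu (A `&` B).
Proof.
move=> cA cB; have cI := CBorelI cA cB.
have -> : A `\` B = A `\` (A `&` B).
  apply/seteqP; split => f [Af nB]; split => //; first by move=> [].
  by move=> Bf; apply: nB.
apply/eqP; rewrite eq_le; apply/andP; split.
  by apply: (mu_setD Hiid) => // f [].
rewrite lerBlDr addrC; apply: (mu_subU Hiid) => //; first exact: CBorelD.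
by move=> f Af; have [h|h] := pselect ((A `&` B) f); [left|right].
Qed.

Lemma sdiffE A B : CBorel A -> CBorel B ->
  sdiff P xi A B = mu A + mu B - 2 * mu (A `&` B).
Proof.
move=> cA cB; rewrite /sdiff !mu_DI// [B `&` A]setIC; ring.
Qed.

(** R is defined through non-strict and E_n through strict inequalities; the two events differ
    within {U(t_j) = s x_j}, which are null since U(t_j) is uniform. *)
Lemma mu_At_strict m (t : 'I_m -> T) (x : 'I_m -> R) (s : R) :
  (forall j, 0 <= s * x j <= 1) ->
  mu (At P xi t x s) = mu [set f | forall j, uf (t j) f < s * x j].
Proof.
move=> sx; have cA : CBorel (At P xi t x s) by exact: (CBorel_At HC1).
have cS : CBorel [set f | forall j, uf (t j) f < s * x j].
  by apply: CBorel_fin_forallT => j; exact: (CBorel_uf_lt HC1).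
pose N j := [set f | uf (t j) f <= s * x j] `\` [set f | uf (t j) f < s * x j].
have N0 j : mu (N j) = 0.
  rewrite mu_DI; [|exact: (CBorel_uf_le HC1)|exact: (CBorel_uf_lt HC1)].
  rewrite setIidr => [|f /= /ltW//].
  by rewrite (mu_uf_le Hiid HC1) ?(mu_uf_lt Hiid HC1) ?subrr.
have cN j : CBorel (N j).
  by apply: CBorelD; [exact: (CBorel_uf_le HC1)|exact: (CBorel_uf_lt HC1)].
apply/eqP; rewrite eq_le; apply/andP; split; last first.
  by apply: (mu_le Hiid) => // f /= H j; exact: ltW.
have := @mu_lin _ _ _ _ P xi Hiid (option (option 'I_m))
    [:: None, Some None & [seq Some (Some j) | j <- index_enum 'I_m]]
    (fun i => if i is None then -1 else 1)
    (fun i => match i with None => At P xi t x s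
       | Some None => [set f | forall j, uf (t j) f < s * x j]
       | Some (Some j) => N j end).
rewrite !big_cons big_map /= => H.
have e : \sum_j 1 * mu (N j) = 0 by apply: big1 => j _; rewrite N0 mulr0.
rewrite e in H; rewrite -subr_ge0.
set a := mu (At _ _ _ _ _) in H *; set b := mu _ in H *.
suff : 0 <= -1 * a + (1 * b + 0) by lra.
apply: H => [[[j|]|]//|f]; rewrite !big_cons big_map /=.
have -> : \sum_j 1 * \1_(N j) f = \sum_j \1_(N j) f :> R.
  by apply: eq_bigr => j _; rewrite mul1r.
suff : \1_(At P xi t x s) f <= \1_[set f | forall j, uf (t j) f < s * x j] f +
   \sum_j \1_(N j) f :> R by lra.
apply: ind_bigD => Af /existsNP[j nj]; exists j; split => //=; exact: Af.
Qed.

Lemma CovR_diag m (t : 'I_m -> T) (x : 'I_m -> R) : (0 < m <= D)%N ->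
  Rt (catf t t) (catf x x) = Rt t x.
Proof.
move=> mD; have m1 : (0 < m <= 2 * D)%N by lia.
have m2 : (0 < m + m <= 2 * D)%N by lia.
have [_ c1] := tE_At Hiid HC1 HC3 D0 t x m1.
have [_ c2] := tE_At Hiid HC1 HC3 D0 (catf t t) (catf x x) m2.
have e : At P xi (catf t t) (catf x x) = At P xi t x.
  by apply/funext => s; rewrite At_cat setIid.
rewrite e in c2; exact: (cvg_unique _ c2 c1).
Qed.

(** For the limit process this is E (W(v) - W(v'))^2. Written in terms of R, it is available before
    W is given, as the limit of the normalised masses of symmetric differences. *)
Definition r2v (v v' : Vidx T) : R := Cov v v + Cov v' v' - 2 * Cov v v'.

Section Box.
Variable M : R.
Hypothesis M0 : 0 < M.
Local Notation S := (inV D M).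

Lemma Bset_cov (v v' : Vidx T) : S v -> S v' ->
  n%:R / k n * mu (Bset P xi (kap n) v `&` Bset P xi (kap n) v') @[n --> \oo] --> Cov v v'.
Proof.
case: v v' => [m [t x]] [m' [t' x']] [/= mD xM] [/= mD' xM'].
have m2 : (0 < m + m' <= 2 * D)%N by lia.
have [_ c] := tE_At Hiid HC1 HC3 D0 (catf t t') (catf x x') m2.
have := cvg_comp _ _ kap_at_right c; apply: cvg_trans; apply: near_eq_cvg.
near=> n => /=.
have /andP[k0 kM] : 0 < kap n <= M^-1.
  by near: n; apply: near_kap; rewrite invr_gt0.
rewrite (Ex_ind_xi Hiid 0 (CBorel_At HC1 _ _ _)) mu_At_strict; last first.
  have H (y : R) : 0 <= y <= M -> 0 <= kap n * y <= 1.
    move=> /andP[y0 yM]; rewrite mulr_ge0 ?(ltW k0)//=.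
    apply: (@le_trans _ _ (M^-1 * M)); last by rewrite mulVf// gt_eqF.
    by apply: ler_pM => //; exact: ltW.
  by move=> j; rewrite /catf; case: (fintype.split j) => i; apply: H.
rewrite kapV; congr (_ * mu _); apply/seteqP; split => f;
  by rewrite /Bset /= (catf_forall _ _ _ _ (fun t x => uf t f < kap n * x)).
Unshelve. all: by end_near. Qed.

Lemma Bset_mu (v : Vidx T) : S v ->
  n%:R / k n * mu (Bset P xi (kap n) v) @[n --> \oo] --> Cov v v.
Proof. by move=> Sv; have := Bset_cov Sv Sv; under eq_fun do rewrite setIid. Qed.

Lemma r2v_cvg (v v' : Vidx T) : S v -> S v' ->
  n%:R / k n * sdiff P xi (Bset P xi (kap n) v) (Bset P xi (kap n) v')
    @[n --> \oo] --> r2v v v'.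
Proof.
move=> Sv Sv'; have cB := @CBorel_Bset _ _ _ _ P xi HC1.
have -> : (fun n => n%:R / k n * sdiff P xi (Bset P xi (kap n) v) (Bset P xi (kap n) v'))
  = (fun n => n%:R / k n * mu (Bset P xi (kap n) v) +
              n%:R / k n * mu (Bset P xi (kap n) v') -
              2 * (n%:R / k n * mu (Bset P xi (kap n) v `&` Bset P xi (kap n) v'))).
  by apply/funext => n; rewrite sdiffE//; ring.
apply: cvgB; first by apply: cvgD; exact: Bset_mu.
by apply: cvgM; [exact: cvg_cst|exact: Bset_cov].
Qed.

Lemma Bset_mu_le : \forall n \near \oo, forall v, S v ->
  n%:R / k n * mu (Bset P xi (kap n) v) <= M.
Proof.
near=> n => -[m [t x]] [/= /andP[m0 mD] xM].
have /andP[k0 kM] : 0 < kap n <= M^-1.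
  by near: n; apply: near_kap; rewrite invr_gt0.
have /andP[x0 xM1] := xM (Ordinal m0).
rewrite -kapV ler_pdivrMl//; apply: (@le_trans _ _ (mu [set f | uf (t (Ordinal m0)) f < kap n * M])).
  apply: (mu_le Hiid); [exact: CBorel_Bset|exact: (CBorel_uf_lt HC1)|].
  by move=> f /= /(_ (Ordinal m0)) /= h; apply: lt_le_trans h _; rewrite ler_pM2l.
rewrite (mu_uf_lt Hiid HC1)//; rewrite mulr_ge0 ?(ltW k0) ?(ltW M0)//=.
by apply: le_trans (ler_wpM2r (ltW M0) kM) _; rewrite mulVf// gt_eqF.
Unshelve. all: by end_near. Qed.

(** The two oscillation statements over classes of keys serve to replace paths by finitely many
    coordinates; equicontinuity and tightness serve the rank expansion. *)
Lemma key_system : C4 P xi ->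
  exists (K : nat -> finType) (key : forall q, Vidx T -> K q),
  [/\ (forall e, 0 < e -> exists q0, forall q, (q0 <= q)%N -> \forall n \near \oo,
        exists E : set Om, [/\ measurable E, pr P E <= e & forall om, ~ E om ->
        forall v v', S v -> S v' -> key q v = key q v' -> `|Wv n v om - Wv n v' om| <= e]),
      (forall e, 0 < e -> exists q0, forall q, (q0 <= q)%N -> forall v v', S v -> S v' ->
        key q v = key q v' -> r2v v v' <= e),
      (forall e, 0 < e -> exists2 dl : R, 0 < dl & \forall n \near \oo,
        exists E : set Om, [/\ measurable E, pr P E <= e & forall om, ~ E om ->
        forall v v', S v -> S v' -> r2v v v' <= dl -> `|Wv n v om - Wv n v' om| <= e]) &
      (forall e, 0 < e -> exists2 C : R, 0 < C & \forall n \near \oo,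
        exists E : set Om, [/\ measurable E, pr P E <= e & forall om, ~ E om ->
        forall v, S v -> `|Wv n v om| <= C])].
Proof.
move=> /(C4_local_brackets Hiid HC1)[N [Tc [C [e1 [v0 [br int]]]]]].
have [eps [Heps [Cb HCb]]] := entropy_seq D0 int.
have [C0 e10 v00 _] := br.
pose bc : R := br_const D M C.
have bc0 : 0 < bc := br_const_gt0 D0 M0 br.
have [q1 Hq1] := eps_le_near Heps e10.
have [Cw HCw] := @wgt_sum R D M M0 N eps Cb HCb.
pose w := wgt D M N eps.
have MM : 0 < v0 / (M + 1) by rewrite divr_gt0//; have := M0; lra.
pose ky q := @key _ _ _ _ P xi D M N Tc C e1 v0 eps br Heps q.
pose LoF q n (c : Key D M N eps q) := lo_br P xi Tc (kap n) c.
pose UpF q n (c : Key D M N eps q) := up_br P xi Tc (kap n) c.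
pose BF n v := Bset P xi (kap n) v.
have Hbr : \forall n \near \oo, forall q v, (q1 <= q)%N -> S v ->
  [/\ LoF q n (ky q v) `<=` BF n v, BF n v `<=` UpF q n (ky q v) &
      n%:R / k n * mu (UpF q n (ky q v) `\` LoF q n (ky q v)) <= bc * 4 ^- q].
  near=> n => q v qq Sv.
  have /andP[k0 kM] : 0 < kap n <= v0 / (M + 1) by near: n; exact: near_kap.
  have kM' : kap n * (M + 1) <= v0 by rewrite -ler_pdivlMr//; have := M0; lra.
  split; [exact: lo_sub|exact: up_sub|].
  rewrite -kapV ler_pdivrMl//; apply: br_law => //; exact: Hq1.
have cB n v := @CBorel_Bset _ _ _ _ P xi HC1 (kap n) v.
have cLo q n c := @CBorel_lo _ _ _ _ P xi D M HC1 N Tc eps q (kap n) c.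
have cUp q n c := @CBorel_up _ _ _ _ P xi D M HC1 N Tc eps q (kap n) c.
have wge q : 2 ^- q <= w q := wgt_ge D M0 N eps q.
have wca := wgt_card D M0 N eps.
exists (Key D M N eps), ky; split.
- move=> e e0; have e2 : 0 < e / 2 by rewrite divr_gt0.
  have [q0 Hq0] := chain Hiid (B := BF) (key := ky) (Lo := LoF) (Up := UpF)
    cB cLo cUp HC2 bc0 Hbr wge HCw wca e2.
  exists q0 => q /Hq0; apply: filterS => n [E [mE pE HE]]; exists E; split => //; first lra.
  move=> om nE v v' Sv Sv' kk; have h1 := HE om nE v Sv; have h2 := HE om nE v' Sv'.
  rewrite kk in h1; move: h1 h2; rewrite !ler_norml -!/(Wv n _ _) => /andP[a1 a2] /andP[b1 b2].
  by apply/andP; split; lra.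
- move=> e e0; have : 4^-1 ^+ q @[q --> \oo] --> (0 : R).
    by apply: cvg_expr; rewrite ger0_norm ?invr_ge0// invf_lt1// ltr1n.
  have eb : 0 < e / (2 * bc) by rewrite divr_gt0// mulr_gt0.
  move=> /(cvgr_lt _)/(_ _ eb)[q2 _ Hq2]; exists (maxn q1 q2) => q.
  rewrite geq_max => /andP[qq1 qq2] v v' Sv Sv' kk.
  have := r2v_key Hiid (B := BF) (key := ky) (Lo := LoF) (Up := UpF)
    cB cLo cUp HC2 Hbr r2v_cvg qq1 Sv Sv' kk.
  move=> h; apply: le_trans h _; have := Hq2 q qq2; rewrite /= exprVn => h.
  have b2 : 0 < 2 * bc by rewrite mulr_gt0.
  have -> : 2 * bc * 4 ^- q = 4 ^- q * (2 * bc) by rewrite mulrC.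
  by apply: ltW; rewrite -ltr_pdivlMr.
- move=> e e0.
  exact: (equicontinuity Hiid (B := BF) (key := ky) (Lo := LoF) (Up := UpF)
    cB cLo cUp HC2 bc0 Hbr wge HCw wca r2v_cvg e0).
- move=> e e0.
  exact: (tightness Hiid (B := BF) (key := ky) (Lo := LoF) (Up := UpF)
    cB cLo cUp HC2 bc0 Hbr wge HCw wca Bset_mu_le e0).
Unshelve. all: by end_near. Qed.

End Box.
End Empirical.
(** * The rank process *)

Section RankExpansion.
Context {R : realType} {T : topologicalType} {dO : measure_display}
  {Om : measurableType dO}.
Variables (P : probability Om R) (xi : nat -> Om -> T -> R) (k : nat -> R) (D : nat).
Hypotheses (Hiid : iid P xi) (HC1 : C1 P xi) (HC2 : C2 k) (HC3 : C3 P xi D)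
  (D0 : (0 < D)%N).
Local Notation mu := (mu P xi).
Local Notation uf := (uf P xi).
Local Notation Rt := (Rtc P xi).
Local Notation Wv := (Wv P xi k).
Local Notation r2v := (r2v P xi).

Definition pt (t : T) (x : R) : Vidx T := mkV (fun _ : 'I_1 => t) (fun _ => x).

Lemma inV_pt M t x : 0 <= x <= M -> inV D M (pt t x).
Proof. by move=> xM; split. Qed.

Lemma r2v_same_t m (t : 'I_m -> T) (x y : 'I_m -> R) : (0 < m <= D)%N ->
  r2v (mkV t x) (mkV t y) <= 3 * \sum_j `|x j - y j|.
Proof.
move=> mD; rewrite /r2v /=.
have m1 : (0 < m <= 2 * D)%N by lia.
have m2 : (0 < m + m <= 2 * D)%N by lia.
rewrite !(CovR_diag Hiid HC1 HC3 D0)//.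
have h1 := R_lip Hiid HC1 HC3 D0 (catf t t) (catf x x) (catf x y) m2.
have h2 := R_lip Hiid HC1 HC3 D0 t y x m1.
rewrite (CovR_diag Hiid HC1 HC3 D0)// in h1.
have e : \sum_j `|catf x x j - catf x y j| = \sum_j `|x j - y j|.
  rewrite big_split_ord /= big1 ?add0r => [|j _]; last by rewrite !catf_l subrr normr0.
  by apply: eq_bigr => j _; rewrite !catf_r.
have e' : \sum_j `|y j - x j| = \sum_j `|x j - y j|.
  by apply: eq_bigr => j _; rewrite distrC.
rewrite e in h1; rewrite e' in h2; lra.
Qed.

Lemma r2v_pt_x t (x y : R) : r2v (pt t x) (pt t y) <= 3 * `|x - y|.
Proof.
have m1 : (0 < 1 <= D)%N by lia.
by have := r2v_same_t (fun _ : 'I_1 => t) (fun=> x) (fun=> y) m1; rewrite big_ord1.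
Qed.

Lemma r2v_pt_t s t (x : R) : 0 <= x -> r2v (pt s x) (pt t x) = 2 * x * rT P xi s t.
Proof.
move=> x0; rewrite /r2v /= /rT.
have m1 : (0 < 1 <= D)%N by lia.
have m2 : (0 < 1 + 1 <= 2 * D)%N by lia.
rewrite !(CovR_diag Hiid HC1 HC3 D0)// !(Rtc1_cvg Hiid HC1 _ _).2 max_l//.
have -> : catf (fun _ : 'I_1 => x) (fun _ : 'I_1 => x) = fun=> x * 1.
  by rewrite catf_cst mulr1.
rewrite (R_hom Hiid HC1 HC3 D0 _ (fun=> 1) m2 x0).
by ring.
Qed.

Lemma Wv_npos n (v : Vidx T) i om : (projT2 v).2 i <= 0 -> (0 < n)%N -> Wv n v om = 0.
Proof.
move=> xi0 n0; have -> : Wv n v om = Ws P xi (k n) n set0 om.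
  rewrite /Wv; congr (Ws _ _ _ _ _ _); apply/seteqP; split => f //= /(_ i).
  rewrite ltNge => /negP; apply; apply: (@le_trans _ _ 0); last exact: (uf_ge0 Hiid).
  by rewrite pmulr_rle0// (kap_gt0 HC2 n0).
by rewrite /Ws big1 ?mulr0// => j _; rewrite ind0// mu_set0 subrr.
Qed.

(** U is nonnegative, so the event defining E_n is empty for a negative coordinate: the extension by
    0 is automatic. *)
Lemma EextE n m (t : 'I_m -> T) (x : 'I_m -> R) : (0 < n)%N ->
  Eext P xi k n t x = Eemp P xi k n t x.
Proof.
move=> n0; rewrite /Eext; case: asboolP => // /existsNP[i /negP]; rewrite -ltNge => xi0.
rewrite /Eemp; have -> : [set w | forall j, Uf P xi 0 w (t j) < k n / n%:R * x j] = set0.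
  apply/seteqP; split => w //= /(_ i); rewrite ltNge => /negP; apply.
  apply: (@le_trans _ _ 0); last exact: (uf_ge0 Hiid).
  by rewrite pmulr_rle0 ?(ltW xi0)//; exact: (kap_gt0 HC2 n0).
by rewrite measure0 mulr0.
Qed.

Lemma RextE m (t : 'I_m -> T) (x : 'I_m -> R) : Rext P xi t x = Rt t x.
Proof.
rewrite /Rext; case: asboolP => // /existsNP[i /negP]; rewrite -ltNge => xi0.
by rewrite (Rtc_npos Hiid HC1 t (ltW xi0)).2.
Qed.

Lemma if_asbool_le (A B : Prop) : (A -> B) ->
  (if `[< A >] then 1 else 0) <= (if `[< B >] then 1 else 0) :> R.
Proof. by move=> AB; case: asboolP => [/AB/asboolT ->//|_]; case: ifP. Qed.

Section Ranks.
Variables (n : nat) (om : Om).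
Hypothesis n0 : (0 < n)%N.
Let k0 : 0 < k n. Proof. by case: HC2 => /(_ n n0) /andP[]. Qed.
Let sk0 : 0 < Num.sqrt (k n). Proof. by rewrite sqrtr_gt0. Qed.
Let skk : k n = Num.sqrt (k n) * Num.sqrt (k n).
Proof. by rewrite -expr2 sqr_sqrtr// ltW. Qed.
Let kn0 : 0 < kap k n := kap_gt0 HC2 n0.

Lemma above_count i t : n%:R - (rankn xi n i t om)%:R =
  \sum_(a < n) \1_[set f | xi i om t < f t] (xi a om) :> R.
Proof.
rewrite /rankn natr_sum -{1}[n]card_ord -sumr_const -sumrB.
apply: eq_bigr => a _; case: leP => h.
  by rewrite ind0 ?subrr//=; apply/negP; rewrite -leNgt.
by rewrite ind1// subr0.
Qed.

Lemma count_Wv t (s : R) : 0 <= s -> kap k n * s <= 1 ->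
  \sum_(a < n) \1_[set f | uf t f < kap k n * s] (xi a om) =
  k n * s + Num.sqrt (k n) * Wv n (pt t s) om.
Proof.
move=> s0 ks; rewrite /Wv /Ws.
have -> : Bset P xi (kap k n) (pt t s) = [set f | uf t f < kap k n * s].
  by apply/seteqP; split => f /=; [move=> /(_ ord0)|move=> h j].
have ks0 : 0 <= kap k n * s <= 1 by rewrite ks mulr_ge0 ?(ltW kn0).
rewrite (mu_uf_lt Hiid HC1 _ ks0) sumrB sumr_const card_ord -[_ *+ n]mulr_natl.
rewrite mulrA mulfV ?gt_eqF// mul1r /kap.
have n0' : n%:R != 0 :> R by rewrite pnatr_eq0 -lt0n.
by field.
Qed.

Variables (t : T) (x eta : R).
Let w := Wv n (pt t x) om.

(** If U_i were at least kap s, all points below the clipped level s^+ would lie strictly above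
    xi_i(t). Their number k s^+ + sqrt k W_n(t, s^+) exceeds k x, whereas the rank condition leaves
    fewer than k x - 1 points above. *)
Lemma rank_upper i (s : R) : s = x + (- w + eta) / Num.sqrt (k n) ->
  kap k n * Num.max s 0 <= 1 -> w - eta < Wv n (pt t (Num.max s 0)) om ->
  (rankn xi n i t om)%:R > n%:R - k n * x + 1 -> Uf P xi i om t < kap k n * s.
Proof.
move=> sE ks1 near rk; rewrite ltNge; apply/negP => Us.
have s'0 : 0 <= Num.max s 0 by rewrite le_max lexx orbT.
have cnt := count_Wv t s'0 ks1.
have le1 : \sum_(a < n) \1_[set f | uf t f < kap k n * Num.max s 0] (xi a om) <=
    \sum_(a < n) \1_[set f | xi i om t < f t] (xi a om) :> R.
  apply: ler_sum => a _; apply: ind_le => /= ua.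
  have ua' : uf t (xi a om) < Uf P xi i om t.
    move: ua; case: (leP s 0) => [s0|_ ua]; last exact: lt_le_trans Us.
    by rewrite mulr0 ltNge (uf_ge0 Hiid).
  rewrite ltNge; apply/negP => /(cdfF_mono Hiid t).
  by move: ua'; rewrite /uf /Uf; lra.
rewrite cnt -above_count in le1.
have s's : s <= Num.max s 0 by rewrite le_max lexx.
have h1 : k n * s <= k n * Num.max s 0 by rewrite ler_pM2l.
have h2 : k n * s = k n * x + Num.sqrt (k n) * (- w + eta).
  by rewrite sE mulrDr; congr (_ + _); rewrite {1}skk; field; rewrite gt_eqF.
have h3 : Num.sqrt (k n) * (w - eta) < Num.sqrt (k n) * Wv n (pt t (Num.max s 0)) om.
  by rewrite ltr_pM2l.
lra.
Qed.

(** The points above xi_i(t), together with i itself, lie below level s, and there are fewer than k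
    x of these. Counting i yields the unit that matches the +1 in the definition of the empirical
    tail copula. *)
Lemma rank_lower i (s : R) : s = x + (- w - eta) / Num.sqrt (k n) ->
  kap k n * Num.max s 0 <= 1 -> Wv n (pt t (Num.max s 0)) om < w + eta -> (i < n)%N ->
  Uf P xi i om t < kap k n * s ->
  (rankn xi n i t om)%:R > n%:R - k n * x + 1.
Proof.
move=> sE ks1 near iltn Us.
have s0 : 0 < s.
  have U0 : 0 <= Uf P xi i om t by exact: (uf_ge0 Hiid).
  by rewrite -(pmulr_rgt0 _ kn0); exact: le_lt_trans Us.
rewrite max_l ?(ltW s0)// in ks1 near.
have cnt := count_Wv t (ltW s0) ks1.
have le1 : 1 + \sum_(a < n) \1_[set f | xi i om t < f t] (xi a om) <=
    \sum_(a < n) \1_[set f | uf t f < kap k n * s] (xi a om) :> R.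
  rewrite (bigD1 (Ordinal iltn))//= ind0 ?add0r /=; last by rewrite ltxx.
  rewrite [leRHS](bigD1 (Ordinal iltn))//= (ind1 (x := xi i om))//.
  rewrite lerD2l; apply: ler_sum => a _; apply: ind_le => /= ia.
  apply: le_lt_trans Us; have := cdfF_mono Hiid t (ltW ia).
  by rewrite /uf /Uf; lra.
rewrite cnt -above_count in le1.
have h2 : k n * s = k n * x + Num.sqrt (k n) * (- w - eta).
  by rewrite sE mulrDr; congr (_ + _); rewrite {1}skk; field; rewrite gt_eqF.
have h3 : Num.sqrt (k n) * Wv n (pt t s) om < Num.sqrt (k n) * (w + eta).
  by rewrite ltr_pM2l.
lra.
Qed.

End Ranks.

Section Expansion.
Hypotheses (HC4 : C4 P xi) (HC6 : C6 P xi D) (HC7 : C7 P xi k D).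
Variable M : R.
Hypothesis M0 : 0 < M.

Let HTB : forall e : R, 0 < e -> exists (N : nat) (c : T -> nat),
  (forall t, (c t < N)%N) /\ forall s t, c s = c t -> rT P xi s t <= e.
Proof.
have [N [Tc [C [e1 [v0 [br _]]]]]] := C4_local_brackets Hiid HC1 HC4.
exact: (rT_totally_bounded Hiid HC1 HC3 D0 br).
Qed.

(** Off a small event the directions h = -W_n(t_j, x_j) +- eta meet the hypotheses of
    [deriv_uniform]: tightness bounds them by K; since W_n(t_j, 0) = 0, equicontinuity makes them
    small for small x_j; and two coordinates close in rT and in x have close values of W_n. *)
Lemma What_expansion e : 0 < e -> \forall n \near \oo, exists E : set Om,
  [/\ measurable E, pr P E <= e & forall om, ~ E om ->
   forall m (t : 'I_m -> T) (x : 'I_m -> R), (0 < m <= D)%N -> injective t ->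
   (forall i, 0 <= x i <= M) ->
   `|What P xi k n t x om - Wv n (mkV t x) om
     + \sum_(j < m) Rdot P xi t j x * Wv n (pt (t j) (x j)) om| <= e].
Proof.
move=> e0.
have A1 (x z K : R) : 0 <= x -> - K <= z -> z <= K -> 0 <= K -> `|x - Num.max (x + z) 0| <= K.
  move=> *; case: (leP (x + z) 0) => ?; rewrite ler_norml; apply/andP; split; lra.
have A2 (x y K N : R) : x <= N -> - K <= x - y -> K <= 1 -> y <= N + 1 by lra.
have A3 (w v h : R) : 0 < h -> `|w - v| <= h / 2 -> w - h < v by rewrite ler_norml; lra.
have A4 (w v h : R) : 0 < h -> `|w - v| <= h / 2 -> v < w + h by rewrite ler_norml; lra.
have A5 (x a b : R) : x <= a -> 3 * a <= b -> 3 * x <= b by lra.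
have A6 (w s h : R) : 0 < h -> w <= h / 2 -> s <= h -> w + s <= 2 * h by lra.
have A7 (x y z h : R) : x <= y + z -> y <= h / 2 -> z <= h / 2 -> 0 < h -> x <= 2 * h by lra.
have A8 (U Ws W Fs X S h B m E DD : R) : U <= Ws + Fs -> Ws - W <= h / 2 ->
    Fs - (- X + 1 * h * S) <= h + (2 + 6 * m) * (2 * h) -> h * S <= DD * h ->
    m * h <= DD * h -> (8 + 13 * DD) * h <= E -> 0 < h -> U - W + X <= E.
  by move=> *; lra.
have A9 (U Ws W Fs X S h B m E DD : R) : Ws + Fs <= U -> - (h / 2) <= Ws - W ->
    - (h + (2 + 6 * m) * (2 * h)) <= Fs - (- X + -1 * h * S) -> - (DD * h) <= h * - S ->
    m * h <= DD * h -> (8 + 13 * DD) * h <= E -> 0 < h -> - E <= U - W + X.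
  by move=> *; lra.
(* The shifted levels leave [0, M] by at most K / sqrt k <= 1, so W_n is controlled on the larger
   box. *)
have M10 : 0 < M + 1 by have := M0; lra.
have [K0 [ky [_ _ AEC TI]]] := key_system Hiid HC1 HC2 HC3 D0 M10 HC4.
have c0 : 0 < 8 + 13 * D%:R :> R by rewrite ltr_wpDr// mulr_ge0.
(* Each side loses eta/2 by equicontinuity, eta + (2 + 6m) 2 eta in the drift and D eta by the shift
   of h, in total less than (8 + 13 D) eta. The bound by e/2 keeps the exceptional probability below
   e. *)
pose eta := Num.min (e / 2) (e / (8 + 13 * D%:R)).
have eta0 : 0 < eta by rewrite lt_min; apply/andP; split; rewrite divr_gt0.
have eta1 : eta <= e / 2 by rewrite ge_min lexx.
have eta3 : eta <= e by lra.
have eta2 : (8 + 13 * D%:R) * eta <= e.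
  by rewrite mulrC -ler_pdivlMr// ge_min lexx orbT.
have eh : 0 < eta / 2 by rewrite divr_gt0.
have [dl dl0 Hdl] := AEC _ eh.
have [C C0 HC] := TI _ eh.
pose K := C + eta; have K0' : 0 < K by rewrite addr_gt0.
(* [r2v] is at most 3 |x - y| for equal t and equals 2 x rT for equal x; both stay below [dl]. *)
pose dl1 := Num.min (dl / 3) (dl / (2 * M)).
have M2 : 0 < 2 * M by have := M0; lra.
have dl10 : 0 < dl1 by rewrite lt_min; apply/andP; split; rewrite divr_gt0.
have dl1a : 3 * dl1 <= dl by rewrite mulrC -ler_pdivlMr// ge_min lexx.
have dl1b : 2 * M * dl1 <= dl by rewrite mulrC -ler_pdivlMr// ge_min lexx orbT.
have eta20 : 0 < 2 * eta by rewrite mulr_gt0.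
have nearD : \forall r \near (0 : R)^'+, forall i : 'I_D, forall (t : 'I_i.+1 -> T)
    (x h : 'I_i.+1 -> R), injective t ->
    (forall j, 0 <= x j <= M) -> (forall j, `|h j| <= K) ->
    (forall j, x j <= dl1 -> `|h j| <= 2 * eta) ->
    (forall j l, rT P xi (t j) (t l) <= dl1 -> `|x j - x l| <= dl1 ->
       `|h j - h l| <= 2 * eta) ->
    `|r^-1 * (Rt t (sh x h r) - Rt t x) - \sum_j Rdot P xi t j x * h j| <=
      (2 + 6 * i.+1%:R) * (2 * eta).
  apply: filter_forall => i; have mD : (0 < i.+1 <= D)%N by exact: ltn_ord.
  have [r0 r00 Hr] := deriv_uniform Hiid HC1 HC3 D0 HC6 HTB M mD (ltW K0') eta20 dl10.
  near=> r; apply: Hr; apply/andP; split; first by near: r; exact: nbhs_right_gt.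
  by near: r; exact: nbhs_right_le.
have skV : (Num.sqrt (k n))^-1 @[n --> \oo] --> (0 : R)^'+.
  move=> A [d /= d0 Hd]; suff H : \forall n \near \oo, A (Num.sqrt (k n))^-1 by exact: H.
  near=> n; have h : 2 / d <= Num.sqrt (k n) by near: n; exact: near_sqrtk.
  have d2 : 0 < 2 / d by rewrite divr_gt0.
  have s0 : 0 < Num.sqrt (k n) by exact: lt_le_trans h.
  apply: Hd => /=; last by rewrite invr_gt0.
  rewrite sub0r normrN gtr0_norm ?invr_gt0//.
  by rewrite invf_plt ?posrE//; apply: lt_le_trans h; rewrite ltr_pdivlMr// mulVf ?gt_eqF//; lra.
have near7 : \forall n \near \oo, forall i : 'I_D, forall (t : 'I_i.+1 -> T)
    (x h : 'I_i.+1 -> R),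
    (forall j, 0 <= x j <= M) -> (forall j, - K <= h j <= K) ->
    `|Num.sqrt (k n) * (Eext P xi k n t (fun j => x j + h j / Num.sqrt (k n)) -
        Eext P xi k n t x) - Num.sqrt (k n) * (Rext P xi t (fun j => x j + h j / Num.sqrt (k n))
        - Rext P xi t x)| <= eta.
  apply: filter_forall => i; have mD : (0 < i.+1 <= D)%N by exact: ltn_ord.
  exact: (HC7 mD K0' M0 eta0).
near=> n.
have [n0 k0] : (0 < n)%N /\ 0 < k n by near: n; exact: near_n_pos.
have [E1 [mE1 pE1 HE1]] : exists E : set Om, [/\ measurable E, pr P E <= eta / 2 &
   forall om, ~ E om -> forall v v', inV D (M + 1) v -> inV D (M + 1) v' ->
     r2v v v' <= dl -> `|Wv n v om - Wv n v' om| <= eta / 2] by near: n.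
have [E2 [mE2 pE2 HE2]] : exists E : set Om, [/\ measurable E, pr P E <= eta / 2 &
   forall om, ~ E om -> forall v, inV D (M + 1) v -> `|Wv n v om| <= C] by near: n.
have ap : \forall r \near (0 : R)^'+, True by exact: nearW.
have skD := skV _ nearD.
have der : forall i : 'I_D, forall (t : 'I_i.+1 -> T)
    (x h : 'I_i.+1 -> R), injective t ->
    (forall j, 0 <= x j <= M) -> (forall j, `|h j| <= K) ->
    (forall j, x j <= dl1 -> `|h j| <= 2 * eta) ->
    (forall j l, rT P xi (t j) (t l) <= dl1 -> `|x j - x l| <= dl1 ->
       `|h j - h l| <= 2 * eta) ->
    `|((Num.sqrt (k n))^-1)^-1 * (Rt t (sh x h (Num.sqrt (k n))^-1) - Rt t x) -
       \sum_j Rdot P xi t j x * h j| <= (2 + 6 * i.+1%:R) * (2 * eta).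
  by near: n; exact: (skV _ nearD).
have c7 : forall i : 'I_D, forall (t : 'I_i.+1 -> T)
    (x h : 'I_i.+1 -> R),
    (forall j, 0 <= x j <= M) -> (forall j, - K <= h j <= K) ->
    `|Num.sqrt (k n) * (Eext P xi k n t (fun j => x j + h j / Num.sqrt (k n)) -
        Eext P xi k n t x) - Num.sqrt (k n) * (Rext P xi t (fun j => x j + h j / Num.sqrt (k n))
        - Rext P xi t x)| <= eta by near: n.
have sk1 : K <= Num.sqrt (k n) by near: n; exact: near_sqrtk.
have sk2 : 3 * D%:R * K / dl <= Num.sqrt (k n) by near: n; exact: near_sqrtk.
have /andP[kn0 kn1] : 0 < kap k n <= (M + 1)^-1.
  by near: n; apply: near_kap => //; rewrite invr_gt0.
exists (E1 `|` E2); split; first exact: measurableU.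
  by apply: le_trans (prU P mE1 mE2) _; apply: le_trans (lerD pE1 pE2) _; rewrite -splitr.
move=> om nE [//|m'] t x mD it xM.
have {}HE1 := HE1 om (fun h => nE (or_introl h)).
have {}HE2 := HE2 om (fun h => nE (or_intror h)).
have sk0 : 0 < Num.sqrt (k n) by rewrite sqrtr_gt0.
have D1 : 1 <= D%:R :> R by rewrite ler1n.
have mDR : m'.+1%:R <= D%:R :> R by rewrite ler_nat; case/andP: mD.
pose w j := Wv n (pt (t j) (x j)) om.
have xV j : inV D (M + 1) (pt (t j) (x j)).
  by apply: inV_pt; have /andP[-> h] := xM j; apply: le_trans h _; rewrite lerDl.
have wC j : `|w j| <= C by exact: HE2.
(* sg = 1 and sg = -1 give the two sides of the rank sandwich *)
pose h (sg : R) j := - w j + sg * eta.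
pose s (sg : R) j := x j + h sg j / Num.sqrt (k n).
have hK sg j : `|sg| = 1 -> `|h sg j| <= K.
  move=> sg1; apply: le_trans (ler_normD _ _) _.
  by rewrite normrN (normrM sg) sg1 mul1r (gtr0_norm eta0) lerD.
have clipd sg j : `|sg| = 1 -> `|x j - Num.max (s sg j) 0| <= K / Num.sqrt (k n).
  move=> sg1; have /andP[x0 _] := xM j.
  have hk : `|h sg j / Num.sqrt (k n)| <= K / Num.sqrt (k n).
    rewrite normrM normfV (gtr0_norm sk0) ler_pM2r ?invr_gt0//; exact: hK.
  move: hk; rewrite ler_norml => /andP[z1 z2].
  by apply: A1 => //; rewrite divr_ge0// ltW.
have Ksk : K / Num.sqrt (k n) <= 1 by rewrite ler_pdivrMr// mul1r.
have clipM sg j : `|sg| = 1 -> 0 <= Num.max (s sg j) 0 <= M + 1.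
  move=> sg1; rewrite le_max lexx orbT /=.
  have /andP[_ x1] := xM j; have := clipd sg j sg1; rewrite ler_norml => /andP[a1 _].
  exact: A2 x1 a1 Ksk.
have kd : 3 * D%:R * (K / Num.sqrt (k n)) <= dl.
  rewrite ler_pdivrMr// in sk2.
  by rewrite mulrA ler_pdivrMr// [leRHS]mulrC.
have clipd3 sg j : `|sg| = 1 -> 3 * `|x j - Num.max (s sg j) 0| <= dl.
  move=> sg1; apply: le_trans kd; rewrite -mulrA ler_pM2l//.
  apply: le_trans (clipd sg j sg1) _; rewrite ler_peMl//.
  by rewrite divr_ge0// ltW.
have near1 sg j : `|sg| = 1 -> `|w j - Wv n (pt (t j) (Num.max (s sg j) 0)) om| <= eta / 2.
  move=> sg1; apply: HE1 => //; first by apply: inV_pt; exact: clipM.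
  by apply: le_trans (r2v_pt_x _ _ _) _; exact: clipd3.
have ks1 sg j : `|sg| = 1 -> kap k n * Num.max (s sg j) 0 <= 1.
  move=> sg1; have /andP[c1 c2] := clipM sg j sg1.
  apply: (@le_trans _ _ ((M + 1)^-1 * (M + 1))); last by rewrite mulVf ?gt_eqF.
  by apply: ler_pM => //; exact: ltW.
have n1 : `|1 : R| = 1 by rewrite normr1.
have n2 : `|-1 : R| = 1 by rewrite normrN1.
  have up : Rhat xi k n t x om <= Gemp P xi k n t (s 1) om.
    rewrite ler_pM2l ?invr_gt0//; apply: ler_sum => i _; apply: if_asbool_le => rk j.
    apply: (rank_upper n0 (eta := eta) _ _ _ (rk j)) => //.
    - by rewrite /s /h mul1r.
    - exact: ks1.
    - by have := near1 1 j n1; exact: A3.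
  have lo : Gemp P xi k n t (s (-1)) om <= Rhat xi k n t x om.
    rewrite ler_pM2l ?invr_gt0//; apply: ler_sum => i _; apply: if_asbool_le => rk j.
    apply: (rank_lower n0 (eta := eta) _ _ _ _ (rk j)) => //.
    - by rewrite /s /h mulN1r.
    - exact: ks1.
    - by have := near1 (-1) j n2; exact: A4.
  have WW sg : `|sg| = 1 -> `|Wemp P xi k n t (s sg) om - Wv n (mkV t x) om| <= eta / 2.
    move=> sg1; rewrite WempWv//.
    (* If a shifted level is nonpositive, W_n is 0 at both the clipped and the unclipped argument;
       the clipped one lies in the box. *)
    pose s' j := Num.max (s sg j) 0.
    have -> : Wv n (mkV t (s sg)) om = Wv n (mkV t s') om.
      have [[j sj]|nj] := pselect (exists j, s sg j <= 0).
        rewrite (Wv_npos (v := mkV t (s sg)) (i := j))//.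
        by rewrite (Wv_npos (v := mkV t s') (i := j))//= /s' max_r.
      congr (Wv n (mkV t _) om); apply: funext => j; rewrite /s' max_l// ltW// ltNge.
      by apply/negP => sj; apply: nj; exists j.
    rewrite distrC; apply: HE1.
    - split=> // j; have /andP[a b] := xM j; apply/andP; split => //.
      by apply: le_trans b _; rewrite lerDl.
    - by split=> // j; exact: clipM.
    - apply: le_trans (r2v_same_t _ _ _ mD) _; apply: le_trans kd.
      rewrite -mulrA ler_pM2l//.
      apply: (@le_trans _ _ (\sum_(j < m'.+1) K / Num.sqrt (k n))).
        by apply: ler_sum => j _; exact: clipd.
      rewrite sumr_const card_ord -[_ *+ _]mulr_natl ler_wpM2r//.
      by rewrite divr_ge0// ltW.
  have im : (m' < D)%N by case/andP: mD.
  have drift sg : `|sg| = 1 ->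
    `|Num.sqrt (k n) * (Eemp P xi k n t (s sg) - Eemp P xi k n t x) -
      \sum_j Rdot P xi t j x * h sg j| <= eta + (2 + 6 * m'.+1%:R) * (2 * eta).
    move=> sg1.
    have a1 := c7 (Ordinal im) t x (h sg) xM (fun j => ltac:(by rewrite -ler_norml hK)).
    have se : sh x (h sg) (Num.sqrt (k n))^-1 = s sg.
      by apply: funext => j; rewrite /sh /s mulrC.
    have a2 := der (Ordinal im) t x (h sg) it xM (fun j => hK sg j sg1).
    rewrite /= se invrK in a2; rewrite !EextE// !RextE -/(s sg) in a1.
    have sge : `|sg * eta| <= eta by rewrite normrM sg1 mul1r gtr0_norm.
    have H1 : forall j, x j <= dl1 -> `|h sg j| <= 2 * eta.
      move=> j xj; have /andP[xj0 xjM] := xM j.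
      have V0 : inV D (M + 1) (pt (t j) 0) by apply: inV_pt; rewrite lexx ltW.
      have d0 : r2v (pt (t j) (x j)) (pt (t j) 0) <= dl.
        by apply: le_trans (r2v_pt_x _ _ _) _; rewrite subr0 ger0_norm//; exact: A5 xj dl1a.
      have := HE1 _ _ (xV j) V0 d0.
      rewrite (Wv_npos (v := pt (t j) 0) (i := ord0))// subr0 -/(w j) => wj.
      apply: le_trans (ler_normD _ _) _; rewrite normrN; exact: A6.
    have H2 : forall j l, rT P xi (t j) (t l) <= dl1 -> `|x j - x l| <= dl1 ->
        `|h sg j - h sg l| <= 2 * eta.
      move=> j l tjl xjl; have /andP[xj0 xjM] := xM j.
      have V0 : inV D (M + 1) (pt (t l) (x j)) by apply: inV_pt; rewrite xj0; apply: le_trans xjM _; rewrite lerDl.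
      have d1 : r2v (pt (t j) (x j)) (pt (t l) (x j)) <= dl.
        rewrite r2v_pt_t//; apply: le_trans dl1b.
        have r0 := rT_ge0 Hiid HC1 HC3 D0 (t j) (t l).
        by apply: ler_pM => //; [rewrite mulr_ge0|rewrite ler_pM2l].
      have d2 : r2v (pt (t l) (x j)) (pt (t l) (x l)) <= dl.
        by apply: le_trans (r2v_pt_x _ _ _) _; exact: A5 xjl dl1a.
      have b1 := HE1 _ _ (xV j) V0 d1; have b2 := HE1 _ _ V0 (xV l) d2.
      have -> : h sg j - h sg l = - (w j - w l) by rewrite /h; ring.
      rewrite normrN; exact: A7 (ler_distD _ _ _) b1 b2 eta0.
    have {}a2 := a2 H1 H2.
    have := ler_normD (Num.sqrt (k n) * (Eemp P xi k n t (s sg) - Eemp P xi k n t x) -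
      Num.sqrt (k n) * (Rt t (s sg) - Rt t x))
      (Num.sqrt (k n) * (Rt t (s sg) - Rt t x) - \sum_j Rdot P xi t j x * h sg j).
    rewrite addrA subrK => a3.
    by apply: le_trans a3 _; exact: lerD.
  have sumh sg : \sum_j Rdot P xi t j x * h sg j =
      - \sum_j Rdot P xi t j x * w j + sg * eta * \sum_j Rdot P xi t j x.
    rewrite mulr_sumr -sumrN -big_split /=; apply: eq_bigr => j _; rewrite /h; ring.
  have m2D : (0 < m'.+1 <= 2 * D)%N by rewrite /= (leq_trans im)// leq_pmull.
  have sRb : `|\sum_j Rdot P xi t j x| <= m'.+1%:R.
    apply: le_trans (ler_norm_sum _ _ _) _.
    apply: (@le_trans _ _ (\sum_(j < m'.+1) 1)); last by rewrite sumr_const card_ord.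
    by apply: ler_sum => j _; exact: (Rdot_bound Hiid HC1 HC3 D0).
  have WG sg : Num.sqrt (k n) * (Gemp P xi k n t (s sg) om - Eemp P xi k n t x) =
     Wemp P xi k n t (s sg) om + Num.sqrt (k n) * (Eemp P xi k n t (s sg) - Eemp P xi k n t x).
    by rewrite /Wemp; ring.
  have u1 : What P xi k n t x om <=
      Num.sqrt (k n) * (Gemp P xi k n t (s 1) om - Eemp P xi k n t x).
    by rewrite /What ler_pM2l// lerD2r.
  have l1 : Num.sqrt (k n) * (Gemp P xi k n t (s (-1)) om - Eemp P xi k n t x) <=
      What P xi k n t x om.
    by rewrite /What ler_pM2l// lerD2r.
  rewrite !WG in u1 l1.
  have d1 := drift _ n1; have d2 := drift _ n2.
  rewrite sumh in d1; rewrite sumh in d2.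
  have w1 := WW _ n1; have w2 := WW _ n2.
  have me : `|\sum_j Rdot P xi t j x| * eta <= D%:R * eta.
    by rewrite ler_pM2r//; exact: le_trans mDR.
  have me2 : m'.+1%:R * eta <= D%:R * eta by rewrite ler_pM2r.
  have e' : eta * (\sum_j Rdot P xi t j x) <= D%:R * eta.
    by apply: le_trans me; rewrite mulrC ler_pM2r// ler_norm.
  have e'' : - (D%:R * eta) <= eta * - (\sum_j Rdot P xi t j x).
    by rewrite mulrN lerN2.
  rewrite -/(\sum_j Rdot P xi t j x * w j).
  move: d1 d2 w1 w2 u1 l1; rewrite !ler_norml => /andP[_ d1] /andP[d2 _] /andP[_ w1] /andP[w2 _] u1 l1.
  apply/andP; split; first exact: A9 l1 w2 d2 e'' me2 eta2 eta0.
  exact: A8 u1 w1 d1 e' me2 eta2 eta0.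
Unshelve. all: by end_near.
Qed.

End Expansion.
End RankExpansion.

(** * The expansion in outer probability *)

Section FirstClaim.
Context {R : realType} {T : topologicalType} {dO : measure_display}
  {Om : measurableType dO}.
Variables (P : probability Om R) (xi : nat -> Om -> T -> R) (k : nat -> R) (D : nat) (M : R).
Hypotheses (Hiid : iid P xi) (HC1 : C1 P xi) (HC2 : C2 k) (HC3 : C3 P xi D)
  (HC4 : C4 P xi) (HC6 : C6 P xi D) (HC7 : C7 P xi k D) (D0 : (0 < D)%N) (M0 : 0 < M).

Lemma outerP_ge0 (A : set Om) : (0 <= outerP P A)%E.
Proof. by apply: le_ereal_inf_tmp => _ [B _ <-]; exact: measure_ge0. Qed.

Lemma outerP_le (A B : set Om) : measurable B -> A `<=` B -> (outerP P A <= P B)%E.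
Proof. by move=> mB AB; apply: ereal_inf_lbound; exists B. Qed.

Lemma cvge0_le (f : nat -> \bar R) : (forall n, (0 <= f n)%E) ->
  (forall e : R, 0 < e -> \forall n \near \oo, (f n <= e%:E)%E) -> f n @[n --> \oo] --> 0%E.
Proof.
move=> f0 fle; apply/fine_cvgP; split.
  near=> n; rewrite ge0_fin_numE//.
  have h : (f n <= 1%:E)%E by near: n; exact: fle.
  exact: le_lt_trans h (ltry _).
apply/cvgr0Pnorm_le => e e0; near=> n.
have h : (f n <= e%:E)%E by near: n; exact: fle.
rewrite /= ger0_norm ?fine_ge0// -lee_fin fineK// ge0_fin_numE//.
exact: le_lt_trans h (ltry _).
Unshelve. all: by end_near.
Qed.

Lemma rank_expansion m : (0 < m <= D)%N -> forall e : R, 0 < e ->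
     outerP P [set w | (e%:E <
        ereal_sup [set (`| What P xi k n tx.1 tx.2 w - Wemp P xi k n tx.1 tx.2 w
           + \sum_(j < m) Rdot P xi tx.1 j tx.2 *
               Wemp P xi k n (fun _ : 'I_1 => tx.1 j) (fun _ => tx.2 j) w |)%:E
          | tx in [set tx : ('I_m -> T) * ('I_m -> R) |
                     injective tx.1 /\ forall i, (0 <= tx.2 i <= M)%R]])%E]
     @[n --> \oo] --> 0%E.
Proof.
move=> mD e e0; apply: cvge0_le => [n|e' e'0]; first exact: outerP_ge0.
have e20 : 0 < Num.min e e' by rewrite lt_min e0.
near=> n.
have [E [mE pE HE]] : exists E : set Om,
  [/\ measurable E, pr P E <= Num.min e e' & forall om, ~ E om ->
   forall m (t : 'I_m -> T) (x : 'I_m -> R), (0 < m <= D)%N -> injective t ->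
   (forall i, 0 <= x i <= M) ->
   `|What P xi k n t x om - Wv P xi k n (mkV t x) om
     + \sum_(j < m) Rdot P xi t j x * Wv P xi k n (pt (t j) (x j)) om| <= Num.min e e'].
  by near: n; exact: (What_expansion Hiid HC1 HC2 HC3 D0 HC4 HC6 HC7 M0 e20).
have n0 : (0 < n)%N by near: n; exact: nbhs_infty_gt.
apply: (@le_trans _ _ (P E)); last first.
  by rewrite (prE P mE) lee_fin; apply: le_trans pE _; rewrite ge_min lexx orbT.
apply: outerP_le => // om /= lts; apply: contrapT => nE; move: lts.
rewrite ltNge => /negP; apply; apply: ge_ereal_sup => _ [[t x] /= [it xM] <-].
rewrite lee_fin (WempWv P xi HC2)//.
under eq_bigr do rewrite (WempWv P xi HC2)//.
by apply: le_trans (HE om nE m t x mD it xM) _; rewrite ge_min lexx.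
Unshelve. all: by end_near.
Qed.

End FirstClaim.
(** * Finite-dimensional convergence *)

Section TrigApprox.
Context {R : realType}.
Variable p : nat.
Local Notation X := ('I_p -> R).
Implicit Types (a x y z : X) (f g : X -> R).

Inductive trig : (X -> R) -> Prop :=
| trig_cos a : trig (fun x => cos (\sum_i a i * x i))
| trig_sin a : trig (fun x => sin (\sum_i a i * x i))
| trigD f g : trig f -> trig g -> trig (fun x => f x + g x)
| trigZ c f : trig f -> trig (fun x => c * f x).

Lemma eq_trig f g : trig f -> f =1 g -> trig g.
Proof. by move=> tf /funext <-. Qed.

Lemma trig_cst c : trig (fun=> c).
Proof.
apply: eq_trig (trigZ c (trig_cos (fun=> 0))) _ => x.
by rewrite big1 ?cos0 ?mulr1// => i _; rewrite mul0r.
Qed.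

Lemma trigB f g : trig f -> trig g -> trig (fun x => f x - g x).
Proof.
by move=> tf tg; apply: eq_trig (trigD tf (trigZ (-1) tg)) _ => x; rewrite mulN1r.
Qed.

Let sumD a b x : \sum_i (a i + b i) * x i = \sum_i a i * x i + \sum_i b i * x i.
Proof. by rewrite -big_split; apply: eq_bigr => i _; rewrite mulrDl. Qed.

Let sumB a b x : \sum_i (a i - b i) * x i = \sum_i a i * x i - \sum_i b i * x i.
Proof. by rewrite -sumrB; apply: eq_bigr => i _; rewrite mulrBl. Qed.

Lemma trigM f g : trig f -> trig g -> trig (fun x => f x * g x).
Proof.
move=> tf; elim: tf g => [a|a|f1 f2 t1 IH1 t2 IH2|c f1 t1 IH1] g.
- elim=> [b|b|g1 g2 u1 J1 u2 J2|c g1 u1 J1].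
  + apply: eq_trig (trigZ 2^-1 (trigD (trig_cos (fun i => a i + b i)) (trig_cos (fun i => a i - b i)))) _ => x.
    by rewrite sumB sumD cosB cosD; field.
  + apply: eq_trig (trigZ 2^-1 (trigB (trig_sin (fun i => a i + b i)) (trig_sin (fun i => a i - b i)))) _ => x.
    by rewrite sumB sumD sinB sinD; field.
  + by apply: eq_trig (trigD J1 J2) _ => x; rewrite mulrDr.
  + by apply: eq_trig (trigZ c J1) _ => x; rewrite mulrCA.
- elim=> [b|b|g1 g2 u1 J1 u2 J2|c g1 u1 J1].
  + apply: eq_trig (trigZ 2^-1 (trigD (trig_sin (fun i => a i + b i)) (trig_sin (fun i => a i - b i)))) _ => x.
    by rewrite sumB sumD sinB sinD; field.
  + apply: eq_trig (trigZ 2^-1 (trigB (trig_cos (fun i => a i - b i)) (trig_cos (fun i => a i + b i)))) _ => x.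
    by rewrite sumB sumD cosB cosD; field.
  + by apply: eq_trig (trigD J1 J2) _ => x; rewrite mulrDr.
  + by apply: eq_trig (trigZ c J1) _ => x; rewrite mulrCA.
- by move=> tg; apply: eq_trig (trigD (IH1 _ tg) (IH2 _ tg)) _ => x; rewrite mulrDl.
- by move=> tg; apply: eq_trig (trigZ c (IH1 _ tg)) _ => x; rewrite mulrA.
Qed.

(* Expectation of [F] after a random walk from [z] whose successive steps, along
   the coordinates listed in [l], are [+b] and [-b] with probabilities (1+s_i)/2 and (1-s_i)/2. *)
Fixpoint walk (b : R) (s : X) (l : seq 'I_p) (F : X -> R) (z : X) : R :=
  if l is i :: l' then
    (1 + s i) / 2 * walk b s l' F (upd z i b) + (1 - s i) / 2 * walk b s l' F (upd z i (- b))
  else F z.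

(** The end points of the walk do not depend on x; only the step probabilities do, and they are
    affine in sin(x_i / B). The expectation is thus a polynomial in sines, and [trigM] makes it a
    trigonometric polynomial. *)
Lemma trig_walk b (l : seq 'I_p) (F : X -> R) z (B : R) :
  trig (fun x => walk b (fun i => sin (x i / B)) l F z).
Proof.
elim: l z => [|i l IH] z /=; first exact: trig_cst.
have ts : trig (fun x => sin (x i / B)).
  have := trig_sin (fun j => (i == j)%:R / B); congr (trig _); apply: funext => x.
  rewrite (bigD1 i)//= big1 ?addr0 => [|j ji]; last by rewrite eq_sym (negPf ji) !mul0r.
  by rewrite eqxx mul1r mulrC.
apply: trigD; apply: trigM => //; have t2 := trigZ 2^-1 ts; have t1 := trig_cst 2^-1.
- apply: eq_trig (trigD t1 t2) _ => x; ring.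
- apply: eq_trig (trigB t1 t2) _ => x; ring.
Qed.

Section WalkBounds.
Variables (b : R) (s : X).
Hypothesis s1 : forall i, `|s i| <= 1.

Let w0 i : 0 <= (1 + s i) / 2 /\ 0 <= (1 - s i) / 2.
Proof. by have := s1 i; rewrite ler_norml => /andP[? ?]; split; lra. Qed.

Lemma walk_le l (F G : X -> R) z : (forall y, F y <= G y) -> walk b s l F z <= walk b s l G z.
Proof.
move=> FG; elim: l z => [|i l IH] z //=; have [h1 h2] := w0 i.
by apply: lerD; rewrite ler_wpM2l.
Qed.

Lemma walk_cst l c z : walk b s l (fun=> c) z = c.
Proof. by elim: l z => [|i l IH] z //=; rewrite !IH; field. Qed.

Lemma walkD l (F G : X -> R) z :
  walk b s l (fun y => F y + G y) z = walk b s l F z + walk b s l G z.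
Proof. by elim: l z => [|i l IH] z //=; rewrite !IH; ring. Qed.

Lemma walkZ l c (F : X -> R) z : walk b s l (fun y => c * F y) z = c * walk b s l F z.
Proof. by elim: l z => [|i l IH] z //=; rewrite !IH; ring. Qed.

Lemma walk_sum l (I : Type) (r : seq I) (F : I -> X -> R) z :
  walk b s l (fun y => \sum_(i <- r) F i y) z = \sum_(i <- r) walk b s l (F i) z.
Proof.
elim: r => [|i r IH].
  rewrite big_nil -[RHS](walk_cst l 0 z); congr (walk _ _ _ _ _).
  by apply: funext => y; rewrite big_nil.
rewrite big_cons -IH -walkD; congr (walk _ _ _ _ _).
by apply: funext => y; rewrite big_cons.
Qed.

Lemma walk_dist l (F G : X -> R) z c : (forall y, `|F y - c| <= G y) ->
  `|walk b s l F z - c| <= walk b s l G z.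
Proof.
move=> FG; have Fl y : F y <= c + 1 * G y.
  by have := FG y; rewrite ler_norml => /andP[? ?]; lra.
have Fg y : c + -1 * G y <= F y.
  by have := FG y; rewrite ler_norml => /andP[? ?]; lra.
have := walk_le l z Fl; have := walk_le l z Fg; rewrite !walkD !walkZ !walk_cst => ? ?.
by rewrite ler_norml; apply/andP; split; lra.
Qed.

Lemma walk_sqr l i c z : walk b s l (fun y => (y i - c) ^+ 2) z =
  (z i + (count_mem i l)%:R * b * s i - c) ^+ 2 + (count_mem i l)%:R * b ^+ 2 * (1 - s i ^+ 2).
Proof.
elim: l z => [|j l IH] z /=; first by rewrite !mul0r !addr0.
rewrite !IH /upd natrD [i == j]eq_sym; case: eqVneq => [->|ji].
  by rewrite /=; field.
by rewrite add0r; field.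
Qed.

End WalkBounds.

Section Lipschitz.
Variables (F : X -> R) (L : R).
Hypotheses (L0 : 0 <= L) (FL : forall x y, `|F x - F y| <= L * \sum_i `|x i - y i|).

(* m ^ 2 steps of size B / m ^ 2 per coordinate: the walk ends within B / m of its mean
   (B sin (x_i / B))_i, itself within x_i ^ 2 / B of x. *)
Let ell m : seq 'I_p := flatten [seq nseq (m ^ 2) i | i <- enum 'I_p].

Let count_ell m i : count_mem i (ell m) = (m ^ 2)%N.
Proof.
rewrite /ell count_flatten -map_comp sumnE big_map big_enum /= (bigD1 i)//=.
rewrite count_nseq /= eqxx mul1n big1 ?addn0// => j ji.
by rewrite count_nseq /= (negPf ji) mul0n.
Qed.

Lemma trig_approx q : exists2 f, trig f & forall x,
  `|f x - F x| <= L / q.+1%:R * (p%:R + \sum_i x i ^+ 2).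
Proof.
(* With m = B^2 the standard deviation B / m of the walk is 1 / B, the same order as the error x_i^2
   / B of its mean. *)
pose m := (q.+1 ^ 2)%N; pose B : R := q.+1%:R; pose b := B / (m ^ 2)%:R.
have B0 : 0 < B by rewrite ltr0n.
have mE : m%:R = B ^+ 2 by rewrite /m natrX.
have B20 : 0 < B ^+ 2 by rewrite exprn_gt0.
exists (fun x => walk b (fun i => sin (x i / B)) (ell m) F (fun=> 0)); first exact: trig_walk.
move=> x; pose s i := sin (x i / B); pose y i := B * s i.
have s1 i : `|s i| <= 1 by rewrite ler_norml sin_geN1 sin_le1.
have d1 : `|walk b s (ell m) F (fun=> 0) - F y| <= L / B * p%:R.
  apply: le_trans (walk_dist b s1 (ell m) (fun=> 0) (fun z => FL z y)) _.
  rewrite walkZ walk_sum -mulrA ler_wpM2l// mulrC -[p in p%:R]card_ord mulr_natl -sumr_const.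
  apply: ler_sum => i _.
  (* Turns the variance, at most B^-2, into a bound 1/B for the first absolute moment. *)
  have h z : `|z i - y i| <= 2^-1 * B * (z i - y i) ^+ 2 + (2 * B)^-1.
    rewrite -(real_normK (num_real (z i - y i))); set u := `|_|.
    rewrite -subr_ge0; have -> : 2^-1 * B * u ^+ 2 + (2 * B)^-1 - u = B / 2 * (u - B^-1) ^+ 2.
      by field; rewrite gt_eqF.
    by rewrite mulr_ge0 ?sqr_ge0// divr_ge0// ltW.
  apply: le_trans (walk_le b s1 (ell m) (fun=> 0) h) _.
  rewrite walkD walk_cst walkZ walk_sqr count_ell.
  have e1 : (m ^ 2)%:R * b = B by rewrite mulrC divfK// natrX mE !expf_neq0// gt_eqF.
  rewrite e1 add0r subrr expr0n/= add0r.
  have -> : (m ^ 2)%:R * b ^+ 2 = B^-1 ^+ 2.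
    by rewrite expr2 mulrA e1 /b natrX mE; field; rewrite gt_eqF.
  have s2 : 0 <= s i ^+ 2 by exact: sqr_ge0.
  have -> : 2^-1 * B * (B^-1 ^+ 2 * (1 - s i ^+ 2)) = 2^-1 * B^-1 * (1 - s i ^+ 2).
    by field; rewrite gt_eqF.
  rewrite invfM; have Bi : 0 <= B^-1 by rewrite invr_ge0 ltW.
  move: Bi s2; move: (B^-1) (s i ^+ 2) => u v u0 v0.
  by have := mulr_ge0 u0 v0; nra.
have d2 : `|F y - F x| <= L / B * \sum_i x i ^+ 2.
  apply: le_trans (FL y x) _; rewrite -mulrA ler_wpM2l// mulr_sumr; apply: ler_sum => i _.
  have -> : y i - x i = B * (sin (x i / B) - x i / B).
    by rewrite /y /s mulrBr mulrCA mulfV ?mulr1// gt_eqF.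
  rewrite normrM (gtr0_norm B0).
  have -> : B^-1 * x i ^+ 2 = B * (x i / B) ^+ 2 by field; rewrite gt_eqF.
  by rewrite ler_pM2l//; exact: sin_sqr.
rewrite mulrDr; apply: le_trans (ler_distD (F y) _ _) _; exact: lerD.
Qed.

End Lipschitz.
End TrigApprox.

(** * Second moments from characteristic functions *)

Section SecondMoments.
Context {R : realType} {d : measure_display} {Om : measurableType d}.
Variable P : probability Om R.
Local Notation bm := (@bm R d Om).

Lemma measurable_lim (h : nat -> Om -> R) (f : Om -> R) :
  (forall n, measurable_fun setT (h n)) -> (forall w, h n w @[n --> \oo] --> f w) ->
  measurable_fun setT f.
Proof.
move=> mh hf; apply/measurable_EFinP.
apply: (emeasurable_fun_cvg (fun n w => (h n w)%:E)) => [n|w _].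
  exact/measurable_EFinP.
by apply/fine_cvgP; split; [exact: nearW|exact: hf].
Qed.

Lemma igD (f g : Om -> R) : ig P f -> ig P g -> ig P (fun w => f w + g w).
Proof. by move=> fi gi; exact: (integrableD measurableT fi gi). Qed.

Lemma igZ c (f : Om -> R) : ig P f -> ig P (fun w => c * f w).
Proof. by move=> fi; exact: (integrableZl measurableT c fi). Qed.

Lemma ig_sum (I : Type) (r : seq I) (f : I -> Om -> R) : (forall i, ig P (f i)) ->
  ig P (fun w => \sum_(i <- r) f i w) /\
  Ex P (fun w => \sum_(i <- r) f i w) = \sum_(i <- r) Ex P (f i).
Proof.
move=> fi; elim: r => [|i r [IH1 IH2]].
  under eq_fun do rewrite big_nil; rewrite big_nil Ex_cst; split=> //.
  by apply: bm_ig; exact: bm_cst.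
under eq_fun do rewrite big_cons; rewrite big_cons ExD// IH2; split=> //.
exact: igD.
Qed.

Lemma fatou_le (h : nat -> Om -> R) (f : Om -> R) C : (forall n, bm (h n)) ->
  (forall n w, 0 <= h n w) -> (forall w, h n w @[n --> \oo] --> f w) ->
  (forall n, Ex P (h n) <= C) -> ig P f /\ Ex P f <= C.
Proof.
move=> bh h0 hf hC.
have mf : measurable_fun setT f by apply: measurable_lim hf => n; case: (bh n).
have f0 w : 0 <= f w by apply: ler_cvg_to (cvg_cst 0) (hf w) _; exact: nearW.
have mh n : measurable_fun setT (fun w => (h n w)%:E) by apply/measurable_EFinP; case: (bh n).
have h0E n w : setT w -> (0 <= (h n w)%:E)%E by rewrite lee_fin.
have fat := fatou P measurableT mh h0E.
have le1 : (\int[P]_w (f w)%:E <= C%:E)%E.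
  rewrite (eq_integral (fun w => limn_einf (fun n => (h n w)%:E))); last first.
    move=> w _; have hw : (h n w)%:E @[n --> \oo] --> (f w)%:E.
      by apply/fine_cvgP; split; [exact: nearW|exact: hf].
    by rewrite (cvg_limn_einf_sup hw).1.
  apply: le_trans fat _.
  rewrite limn_einf_lim; apply: lime_le; first exact: is_cvg_einfs.
  apply: nearW => n; apply: ge_ereal_inf; exists (\int[P]_w (h n w)%:E)%E; first by exists n => /=.
  by have := hC n; rewrite -lee_fin -EP_Ex ?unlock//; exact: bm_ig.
have fi : ig P f.
  apply/integrableP; split; first exact/measurable_EFinP.
  apply: le_lt_trans (ltry C); apply: le_trans le1.
  by under eq_integral do rewrite /= ger0_norm ?f0//.
by split=> //; rewrite -lee_fin -EP_Ex// unlock.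
Qed.

(** Integrability of Z^2 has to be derived as well: 2 q^2 (1 - cos(Z/q)) is bounded, tends to Z^2,
    and has expectation 2 q^2 (1 - exp(-v/(2 q^2))) <= v, so Fatou applies. *)
Lemma char_second_moment (Z : Om -> R) v : measurable_fun setT Z -> 0 <= v ->
  (forall s : R, Ex P (fun w => cos (s * Z w)) = expR (- (s ^+ 2 * v) / 2)) ->
  ig P (fun w => Z w ^+ 2) /\ Ex P (fun w => Z w ^+ 2) <= v.
Proof.
move=> mZ v0 HZ.
have bc s : bm (fun w => cos (s * Z w)) by apply: bm_cos; exact: measurable_funM.
apply: (@fatou_le (fun n w => 2 * n.+1%:R ^+ 2 * (1 - cos (n.+1%:R^-1 * Z w)))).
- by move=> n; apply: bmZ; apply: bmB => //; exact: bm_cst.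
- by move=> n w; rewrite mulr_ge0 ?mulr_ge0 ?sqr_ge0// subr_ge0 cos_le1.
- move=> w; apply/cvgrPdist_le => e e0; near=> n.
  have q0 : 0 < n.+1%:R :> R by rewrite ltr0n.
  set q := n.+1%:R in q0 *; pose x := q^-1 * Z w.
  have -> : Z w ^+ 2 - 2 * q ^+ 2 * (1 - cos x) = 2 * q ^+ 2 * (cos x - (1 - x ^+ 2 / 2)).
    by rewrite /x; field; rewrite gt_eqF.
  rewrite normrM ger0_norm ?mulr_ge0 ?sqr_ge0//.
  apply: (@le_trans _ _ (2 * q ^+ 2 * `|x| ^+ 4)).
    by rewrite ler_pM2l ?mulr_gt0 ?exprn_gt0//; exact: cos_quad.
  have -> : 2 * q ^+ 2 * `|x| ^+ 4 = 2 * `|Z w| ^+ 4 / q ^+ 2.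
    by rewrite /x normrM gtr0_norm ?invr_gt0//; field; rewrite gt_eqF.
  rewrite ler_pdivrMr ?exprn_gt0//.
  have h : 2 * `|Z w| ^+ 4 / e <= n%:R by near: n; exact: nbhs_infty_ger.
  rewrite ler_pdivrMr// [leRHS]mulrC in h; apply: le_trans h _; rewrite ler_pM2l//.
  by rewrite /q -natrX ler_nat; lia.
- move=> n; have q0 : 0 < n.+1%:R :> R by rewrite ltr0n.
  rewrite ExZ; last by apply: bm_ig; apply: bmB => //; exact: bm_cst.
  rewrite ExB; [|apply: bm_ig..]; [|exact: bm_cst|exact: bc].
  rewrite Ex_cst HZ; set y := _ / 2; have := expR_ge1Dx y => hy.
  have -> : v = 2 * n.+1%:R ^+ 2 * - y by rewrite /y; field; rewrite gt_eqF.
  by rewrite ler_pM2l ?mulr_gt0 ?exprn_gt0//; lra.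
Unshelve. all: by end_near.
Qed.

End SecondMoments.

Section FiniteDimensional.
Context {R : realType}.

Lemma bm_trig {d : measure_display} {Om : measurableType d} p (f : ('I_p -> R) -> R)
  (Z : Om -> 'I_p -> R) : trig f -> (forall i, measurable_fun setT (fun w => Z w i)) ->
  bm (fun w => f (Z w)).
Proof.
move=> tf mZ; have ms a : measurable_fun setT (fun w => \sum_i a i * Z w i).
  by apply: measurable_sum => i; exact: measurable_funM.
elim: tf => [a|a|f1 f2 _ h1 _ h2|c f1 _ h1].
- exact: bm_cos.
- exact: bm_sin.
- exact: bmD.
- exact: bmZ.
Qed.

Section Lip.
Variables (p : nat) (F : ('I_p -> R) -> R) (L : R).
Hypotheses (L0 : 0 <= L) (FL : forall x y, `|F x - F y| <= L * \sum_i `|x i - y i|).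

(** F is a pointwise limit of trigonometric polynomials, whose composition with Z involves only
    linear combinations of the coordinates. *)
Lemma measurable_lipschitz {d : measure_display} {Om : measurableType d}
  (Z : Om -> 'I_p -> R) : (forall i, measurable_fun setT (fun w => Z w i)) ->
  measurable_fun setT (fun w => F (Z w)).
Proof.
move=> mZ; have [f hf] := choice (fun q => let: ex_intro2 f tf hf := trig_approx L0 FL q in
  ex_intro (fun f => trig f /\ forall x, `|f x - F x| <= L / q.+1%:R * (p%:R + \sum_i x i ^+ 2))
    f (conj tf hf)).
apply: (@measurable_lim _ _ _ (fun q w => f q (Z w))) => [q|w].
  by case: (bm_trig (hf q).1 mZ).
apply/cvgrPdist_le => e e0; near=> q; rewrite distrC; apply: le_trans ((hf q).2 _) _.
have h : L * (p%:R + \sum_i Z w i ^+ 2) / e <= q%:R by near: q; exact: nbhs_infty_ger.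
rewrite mulrAC ler_pdivrMr// -ler_pdivrMl// [leLHS]mulrC; apply: le_trans h _.
by rewrite ler_nat.
Unshelve. all: by end_near.
Qed.

(** Convergence of characteristic functions is convergence for every trigonometric polynomial; the
    approximation error K / (q+1) is uniform in n because second moments are bounded by C on both
    sides. *)
Lemma fdd_cvg {d : measure_display} {Om : measurableType d} (P : probability Om R)
  {d' : measure_display} {Om' : measurableType d'} (P' : probability Om' R)
  (Zn : nat -> Om -> 'I_p -> R) (Z : Om' -> 'I_p -> R) C :
  (exists B, forall x, `|F x| <= B) ->
  (forall n i, bm (fun w => Zn n w i)) -> (forall i, measurable_fun setT (fun w => Z w i)) ->
  (forall a, Ex P (fun w => cos (\sum_i a i * Zn n w i)) @[n --> \oo] -->
             Ex P' (fun w => cos (\sum_i a i * Z w i))) ->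
  (forall a, Ex P (fun w => sin (\sum_i a i * Zn n w i)) @[n --> \oo] -->
             Ex P' (fun w => sin (\sum_i a i * Z w i))) ->
  (\forall n \near \oo, forall i, Ex P (fun w => Zn n w i ^+ 2) <= C) ->
  (forall i, ig P' (fun w => Z w i ^+ 2) /\ Ex P' (fun w => Z w i ^+ 2) <= C) ->
  Ex P (fun w => F (Zn n w)) @[n --> \oo] --> Ex P' (fun w => F (Z w)).
Proof.
move=> [B FB] bZn mZ ccos csin Cn CZ.
have bF (d0 : measure_display) (O : measurableType d0) (Y : O -> 'I_p -> R) :
    (forall i, measurable_fun setT (fun w => Y w i)) -> bm (fun w => F (Y w)).
  by move=> mY; split; [exact: measurable_lipschitz|exists B].
have tc f : trig f -> Ex P (fun w => f (Zn n w)) @[n --> \oo] --> Ex P' (fun w => f (Z w)).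
  have bn g n : trig g -> ig P (fun w => g (Zn n w)).
    by move=> tg; apply: bm_ig; apply: bm_trig => // i; case: (bZn n i).
  have bZ g : trig g -> ig P' (fun w => g (Z w)) by move=> tg; apply: bm_ig; exact: bm_trig.
  elim=> [a|a|f1 f2 t1 h1 t2 h2|c f1 t1 h1] //.
    rewrite ExD; [|exact: bZ..]; under eq_fun do rewrite (ExD (bn _ _ t1) (bn _ _ t2)).
    exact: cvgD.
  rewrite ExZ; last exact: bZ.
  under eq_fun do rewrite (ExZ _ (bn _ _ t1)); by apply: cvgM => //; exact: cvg_cst.
pose K := L * (p%:R + p%:R * C).
have close (d0 : measure_display) (O : measurableType d0) (Q : probability O R)
    (Y : O -> 'I_p -> R) f q : trig f ->
    (forall x, `|f x - F x| <= L / q.+1%:R * (p%:R + \sum_i x i ^+ 2)) ->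
    (forall i, measurable_fun setT (fun w => Y w i)) ->
    (forall i, ig Q (fun w => Y w i ^+ 2) /\ Ex Q (fun w => Y w i ^+ 2) <= C) ->
    `|Ex Q (fun w => f (Y w)) - Ex Q (fun w => F (Y w))| <= K / q.+1%:R.
  move=> tf hf mY YC; have bf := bm_trig tf mY; have bFY := bF _ _ _ mY.
  apply: le_trans (Ex_normB Q bf bFY) _.
  have [iY EY] := ig_sum (index_enum 'I_p) (fun i => (YC i).1).
  have iP : ig Q (fun=> p%:R : R) by apply: bm_ig; exact: bm_cst.
  apply: (@le_trans _ _ (Ex Q (fun w => L / q.+1%:R * (p%:R + \sum_i Y w i ^+ 2)))).
    apply: Ex_le => [||w]; last exact: hf.
      by apply: bm_ig; apply: bm_norm; exact: bmB.
    by apply: igZ; exact: igD.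
  rewrite ExZ; last exact: igD.
  rewrite ExD// Ex_cst EY /K mulrAC ler_pM2r ?invr_gt0// ler_wpM2l// lerD2l.
  apply: (@le_trans _ _ (\sum_(i < p) C)); first by apply: ler_sum => i _; case: (YC i).
  by rewrite sumr_const card_ord mulr_natl.
apply/cvgrPdist_le => e e0; have e3 : 0 < e / 3 by rewrite divr_gt0.
have [q Kq] : exists q : nat, K / q.+1%:R <= e / 3.
  near \oo => q; exists q; rewrite ler_pdivrMr// mulrC -ler_pdivrMr//.
  have h : K / (e / 3) <= q%:R by near: q; exact: nbhs_infty_ger.
  by apply: le_trans h _; rewrite ler_nat.
have [f tf hf] := trig_approx L0 FL q.
near=> n.
have Cn' : forall i, Ex P (fun w => Zn n w i ^+ 2) <= C by near: n.
have h1 : `|Ex P' (fun w => f (Z w)) - Ex P (fun w => f (Zn n w))| <= e / 3.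
  by near: n; move/cvgrPdist_le: (tc f tf); apply.
have mZn i : measurable_fun setT (fun w => Zn n w i) by case: (bZn n i).
have ZnC i : ig P (fun w => Zn n w i ^+ 2) /\ Ex P (fun w => Zn n w i ^+ 2) <= C.
  split=> //; apply: bm_ig; under eq_fun do rewrite expr2; exact: bmM.
have h2 := close _ _ P _ f q tf hf mZn ZnC.
have h3 := close _ _ P' _ f q tf hf mZ CZ.
have h4 := ler_distD (Ex P' (fun w => f (Z w))) (Ex P' (fun w => F (Z w))) (Ex P (fun w => F (Zn n w))).
have h5 := ler_distD (Ex P (fun w => f (Zn n w))) (Ex P' (fun w => f (Z w))) (Ex P (fun w => F (Zn n w))).
rewrite distrC in h3; apply: le_trans h4 _.
have -> : e = e / 3 + (e / 3 + e / 3) by field.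
apply: lerD; first exact: le_trans h3 Kq.
by apply: le_trans h5 _; apply: lerD => //; exact: le_trans h2 Kq.
Unshelve. all: by end_near.
Qed.

End Lip.
End FiniteDimensional.

(** * Finite-dimensional laws of W_n and of W *)

Section GaussianLimit.
Context {R : realType} {T : topologicalType} {dO : measure_display}
  {Om : measurableType dO}.
Variables (P : probability Om R) (xi : nat -> Om -> T -> R) (k : nat -> R) (D : nat) (M : R).
Hypotheses (Hiid : iid P xi) (HC1 : C1 P xi) (HC2 : C2 k) (HC3 : C3 P xi D)
  (D0 : (0 < D)%N) (M0 : 0 < M).
Local Notation S := (inV D M).
Local Notation Cov := (CovR P xi).
Local Notation r2v := (r2v P xi).
Local Notation Bn n v := (Bset P xi (kap k n) v).
Local Notation mu := (mu P xi).

Let cov_cvg v v' (Sv : S v) (Sv' : S v') := Bset_cov Hiid HC1 HC2 HC3 D0 M0 Sv Sv'.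

(** Like the other properties of the limit covariance, symmetry is inherited from the normalised
    masses of sets of which it is the limit. *)
Lemma CovR_sym v v' : S v -> S v' -> Cov v v' = Cov v' v.
Proof.
move=> Sv Sv'; apply: cvg_unique (cov_cvg Sv Sv') _ => //.
by rewrite /=; under eq_fun do rewrite setIC; exact: cov_cvg.
Qed.

Lemma r2v_ge0 v v' : S v -> S v' -> 0 <= r2v v v'.
Proof.
move=> Sv Sv'; apply: ler_cvg_to (cvg_cst 0) (r2v_cvg Hiid HC1 HC2 HC3 D0 M0 Sv Sv') _.
near=> n; rewrite mulr_ge0 ?sdiff_ge0// divr_ge0//.
by have [_ /ltW] : (0 < n)%N /\ 0 < k n by near: n; exact: near_n_pos.
Unshelve. all: by end_near.
Qed.

Lemma CovR_diag_ge0 v : S v -> 0 <= Cov v v.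
Proof.
move=> Sv; apply: ler_cvg_to (cvg_cst 0) (cov_cvg Sv Sv) _.
near=> n; apply: mulr_ge0; last exact: mu_ge0.
apply: divr_ge0 => //.
by have [_ /ltW] : (0 < n)%N /\ 0 < k n by near: n; exact: near_n_pos.
Unshelve. all: by end_near.
Qed.

Lemma CovR_diag_le v : S v -> Cov v v <= M.
Proof.
move=> Sv; apply: ler_cvg_to (Bset_mu Hiid HC1 HC2 HC3 D0 M0 Sv) (cvg_cst M) _.
near=> n; have h : forall v, S v -> n%:R / k n * mu (Bn n v) <= M.
  by near: n; exact: (Bset_mu_le D Hiid HC1 HC2 M0).
exact: h.
Unshelve. all: by end_near.
Qed.

Lemma Bset_mu_cvg0 v : S v -> mu (Bn n v) @[n --> \oo] --> 0.
Proof.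
move=> Sv; have [_ [_ k0]] := HC2.
have := cvgM k0 (Bset_mu Hiid HC1 HC2 HC3 D0 M0 Sv); rewrite mul0r => h.
apply: cvg_trans; last exact: h.
apply: near_eq_cvg; near=> n.
have [n0 kn0] : (0 < n)%N /\ 0 < k n by near: n; exact: near_n_pos.
rewrite /= mulrA [_ / _ * _]mulrA divfK ?mulfV ?mul1r ?gt_eqF// ltr0n//.
Unshelve. all: by end_near.
Qed.

Lemma covn_cvg p (v : 'I_p -> Vidx T) (a : 'I_p -> R) : (forall i, S (v i)) ->
  covn P xi (fun i => Bn n (v i)) a (k n) n @[n --> \oo] -->
  \sum_(i < p) \sum_(j < p) a i * a j * Cov (v i) (v j).
Proof.
move=> Sv; have -> : (fun n => covn P xi (fun i => Bn n (v i)) a (k n) n) = (fun n =>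
    \sum_(i < p) \sum_(j < p) a i * a j * (n%:R / k n * mu (Bn n (v i) `&` Bn n (v j)) -
      n%:R / k n * mu (Bn n (v i)) * mu (Bn n (v j)))).
  apply: funext => n; rewrite /covn mulr_sumr; apply: eq_bigr => i _.
  rewrite mulr_sumr; apply: eq_bigr => j _; ring.
apply: cvg_sumr => i; apply: cvg_sumr => j; apply: cvgM; first exact: cvg_cst.
rewrite -[Cov _ _]subr0 -[in X in _ - X](mulr0 (Cov (v i) (v i))).
apply: cvgB; first exact: cov_cvg.
by apply: cvgM; [exact: (Bset_mu Hiid HC1 HC2 HC3 D0 M0)|exact: Bset_mu_cvg0].
Qed.

Let kV : (k n)^-1 @[n --> \oo] --> (0 : R).
Proof.
apply/cvgr0Pnorm_le => e e0; near=> n.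
have [n0 kn0] : (0 < n)%N /\ 0 < k n by near: n; exact: near_n_pos.
have h : e^-1 <= k n by near: n; case: HC2 => _ [/cvgryPge + _]; apply.
by rewrite gtr0_norm ?invr_gt0// invf_ple ?posrE.
Unshelve. all: by end_near.
Qed.

Let skV : (Num.sqrt (k n))^-1 @[n --> \oo] --> (0 : R).
Proof.
apply/cvgr0Pnorm_le => e e0; near=> n.
have [n0 kn0] : (0 < n)%N /\ 0 < k n by near: n; exact: near_n_pos.
have h : e^-1 <= Num.sqrt (k n) by near: n; exact: near_sqrtk.
by rewrite gtr0_norm ?invr_gt0 ?sqrtr_gt0// invf_ple ?posrE ?sqrtr_gt0.
Unshelve. all: by end_near.
Qed.

Lemma Wv_char_cvg p (v : 'I_p -> Vidx T) (a : 'I_p -> R) : (forall i, S (v i)) ->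
  Ex P (fun w => cos (\sum_(i < p) a i * Wv P xi k n (v i) w)) @[n --> \oo] -->
    expR (- (\sum_(i < p) \sum_(j < p) a i * a j * Cov (v i) (v j)) / 2) /\
  Ex P (fun w => sin (\sum_(i < p) a i * Wv P xi k n (v i) w)) @[n --> \oo] --> (0 : R).
Proof.
move=> Sv; have cv := covn_cvg (a := a) Sv; set V := \sum_(i < p) _ in cv *.
pose vn n := covn P xi (fun i => Bn n (v i)) a (k n) n.
pose Ga := \sum_(i < p) `|a i|.
pose e2 n := Ga ^+ 2 * vn n * (k n)^-1 + Ga * vn n * (Num.sqrt (k n))^-1.
have c2 : e2 n @[n --> \oo] --> (0 : R).
  rewrite -[0](addr0 0) -[in X in X + _](mulr0 (Ga ^+ 2 * V)) -[in X in _ + X](mulr0 (Ga * V)).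
  by apply: cvgD; apply: cvgM => //; apply: cvgM => //; exact: cvg_cst.
pose e1 n := vn n * vn n * n%:R^-1 + e2 n.
have nV : (n%:R : R)^-1 @[n --> \oo] --> (0 : R).
  by apply/gtr0_cvgV0; [near=> n; rewrite ltr0n; near: n; exact: nbhs_infty_gt|exact: cvgr_idn].
have c1 : e1 n @[n --> \oo] --> (0 : R).
  rewrite -[0](addr0 0) -[in X in X + _](mulr0 (V * V)).
  by apply: cvgD => //; apply: cvgM => //; exact: cvgM.
have clt : \forall n \near \oo,
    `|Ex P (fun w => cos (\sum_(i < p) a i * Wv P xi k n (v i) w)) - expR (- vn n / 2)| <= e1 n /\
    `|Ex P (fun w => sin (\sum_(i < p) a i * Wv P xi k n (v i) w))| <= e2 n.
  near=> n; have [n0 kn0] : (0 < n)%N /\ 0 < k n by near: n; exact: near_n_pos.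
  have := Ws_clt Hiid a (fun i => CBorel_Bset HC1 (kap k n) (v i)) kn0 n0.
  by rewrite /e1 /e2 -expr2 addrA.
split.
  have ce : expR (- vn n / 2) @[n --> \oo] --> expR (- V / 2).
    apply: continuous_cvg; first exact: continuous_expR.
    by apply: cvgM; [exact: cvgN|exact: cvg_cst].
  apply/cvgrPdist_le => e e0; have e2' : 0 < e / 2 by rewrite divr_gt0.
  near=> n; have [h1 _] : `|Ex P (fun w => cos (\sum_(i < p) a i * Wv P xi k n (v i) w)) -
       expR (- vn n / 2)| <= e1 n /\
    `|Ex P (fun w => sin (\sum_(i < p) a i * Wv P xi k n (v i) w))| <= e2 n by near: n.
  have h2 : `|expR (- V / 2) - expR (- vn n / 2)| <= e / 2.
    by near: n; move/cvgrPdist_le: ce; apply.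
  have h3 : e1 n <= e / 2 by near: n; apply: (cvgr_le _ c1).
  apply: le_trans (ler_distD (expR (- vn n / 2)) _ _) _; rewrite [e]splitr.
  by apply: lerD => //; rewrite distrC; exact: le_trans h3.
apply/cvgr0Pnorm_le => e e0; near=> n.
have [_ h1] : `|Ex P (fun w => cos (\sum_(i < p) a i * Wv P xi k n (v i) w)) -
       expR (- vn n / 2)| <= e1 n /\
    `|Ex P (fun w => sin (\sum_(i < p) a i * Wv P xi k n (v i) w))| <= e2 n by near: n.
by apply: le_trans h1 _; near: n; apply: (cvgr_le _ c2).
Unshelve. all: by end_near.
Qed.

Section Limit.
Context {dO' : measure_display} {Om' : measurableType dO'}.
Variables (P' : probability Om' R) (W : Om' -> @Vidx R T -> R).
Hypothesis GW : gaussian_process P' W Cov S.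

Lemma gauss_char p (v : 'I_p -> Vidx T) (a : 'I_p -> R) : (forall i, S (v i)) ->
  Ex P' (fun w => cos (\sum_(i < p) a i * W w (v i))) =
    expR (- (\sum_(i < p) \sum_(j < p) a i * a j * Cov (v i) (v j)) / 2) /\
  Ex P' (fun w => sin (\sum_(i < p) a i * W w (v i))) = 0.
Proof.
move=> Sv; have [mW /(_ p v a Sv)] := GW.
have ms : measurable_fun setT (fun w => \sum_(i < p) a i * W w (v i)).
  by apply: measurable_sum => i; apply: measurable_funM => //; exact: mW.
rewrite !EP_Ex; [|exact/bm_ig/bm_sin|exact/bm_ig/bm_cos].
by move=> [[->] [->]].
Qed.

Lemma gauss_sqr v : S v -> ig P' (fun w => W w v ^+ 2) /\ Ex P' (fun w => W w v ^+ 2) <= M.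
Proof.
move=> Sv; have h (s : R) : Ex P' (fun w => cos (s * W w v)) = expR (- (s ^+ 2 * Cov v v) / 2).
  have [+ _] := @gauss_char 1 (fun=> v) (fun=> s) (fun=> Sv).
  by rewrite !big_ord1 -expr2 => <-; apply: eq_Ex => w; rewrite big_ord1.
have [i1 i2] := char_second_moment (GW.1 v Sv) (CovR_diag_ge0 Sv) h.
by split=> //; apply: le_trans i2 (CovR_diag_le Sv).
Qed.

Lemma gauss_sub v v' : S v -> S v' -> ig P' (fun w => (W w v - W w v') ^+ 2) /\
  Ex P' (fun w => (W w v - W w v') ^+ 2) <= r2v v v'.
Proof.
move=> Sv Sv'; apply: char_second_moment; last 2 first.
- exact: r2v_ge0.
- move=> s; pose vv (i : 'I_2) := if i == ord0 then v else v'.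
  pose aa (i : 'I_2) := if i == ord0 then s else - s.
  have Svv i : S (vv i) by rewrite /vv; case: ifP.
  have [+ _] := gauss_char aa Svv.
  rewrite !big_ord_recl !big_ord0 /vv /aa /= (CovR_sym Sv' Sv).
  have -> : s * s * Cov v v + (s * - s * Cov v v' + 0) +
     (- s * s * Cov v v' + (- s * - s * Cov v' v' + 0) + 0) = s ^+ 2 * r2v v v'.
    by rewrite /r2v; ring.
  move=> <-; apply: eq_Ex => w; rewrite !big_ord_recl big_ord0 /vv /aa /=.
  by congr cos; ring.
- by apply: measurable_funB; exact: GW.1.
Qed.

(** Carries smallness of [r2v] on classes of keys over to rho_2, the semimetric in which the paths
    of W are uniformly continuous. *)
Lemma sd_le_r2v v v' : S v -> S v' -> sd_semimetric P' W v v' <= Num.sqrt (r2v v v').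
Proof.
move=> Sv Sv'; have [i1 i2] := gauss_sub Sv Sv'.
by rewrite /sd_semimetric EP_Ex//= ler_wsqrtr.
Qed.

Lemma Wv_fdd_cvg p (v : 'I_p -> Vidx T) (F : ('I_p -> R) -> R) (L B : R) :
  (forall i, S (v i)) -> 0 <= L -> (forall x y, `|F x - F y| <= L * \sum_i `|x i - y i|) ->
  (forall x, `|F x| <= B) ->
  Ex P (fun w => F (fun i => Wv P xi k n (v i) w)) @[n --> \oo] -->
  Ex P' (fun w => F (fun i => W w (v i))).
Proof.
move=> Sv L0 FL FB; pose C := 8 * expR (2 * M) + M.
apply: (@fdd_cvg _ _ _ _ L0 FL _ _ _ _ _ _ (fun n w i => Wv P xi k n (v i) w)
   (fun w i => W w (v i)) C).
- by exists B.
- by move=> n i; apply: bm_Ws => //; exact: CBorel_Bset.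
- by move=> i; exact: GW.1.
- by move=> a; rewrite (gauss_char a Sv).1; exact: (Wv_char_cvg a Sv).1.
- by move=> a; rewrite (gauss_char a Sv).2; exact: (Wv_char_cvg a Sv).2.
- near=> n => i; have [n0 kn0] : (0 < n)%N /\ 0 < k n by near: n; exact: near_n_pos.
  have h : forall v, S v -> n%:R / k n * mu (Bn n v) <= M.
    by near: n; exact: (Bset_mu_le D Hiid HC1 HC2 M0).
  have k4 : 4 <= k n by near: n; case: HC2 => _ [/cvgryPge + _]; apply.
  apply: le_trans (Ws_sqr Hiid kn0 (CBorel_Bset HC1 _ _) k4 (h _ (Sv i))) _.
  by rewrite lerDl ltW.
- move=> i; have [i1 i2] := gauss_sqr (Sv i); split=> //.
  by apply: le_trans i2 _; rewrite lerDr mulr_ge0 ?expR_ge0.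
Unshelve. all: by end_near.
Qed.

End Limit.
End GaussianLimit.
(** * Weak convergence *)

Section DominatedConvergence.
Context {R : realType} {d : measure_display} {Om : measurableType d}.
Variable P : probability Om R.

Lemma Ex_dominated (h : nat -> Om -> R) (f : Om -> R) C :
  (forall n, measurable_fun setT (h n)) -> (forall n w, `|h n w| <= C) ->
  (forall w, h n w @[n --> \oo] --> f w) ->
  bm f /\ Ex P (h n) @[n --> \oo] --> Ex P f.
Proof.
move=> mh hC hf; have mf := measurable_lim mh hf.
have fC w : `|f w| <= C.
  by apply: ler_cvg_to (cvg_norm (hf w)) (cvg_cst C) _; exact: nearW.
have bf : bm f by split=> //; exists C.
have bh n : bm (h n) by split=> //; exists C.
split=> //.
have h1 n : measurable_fun setT (EFin \o h n) by exact/measurable_EFinP.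
have h2 : {ae P, forall w, setT w -> (EFin \o h n) w @[n --> \oo] --> (EFin \o f) w}.
  by apply: aeW => w _; apply/fine_cvgP; split; [exact: nearW|exact: hf].
have h4 : {ae P, forall w n, setT w -> (`|(EFin \o h n) w| <= (EFin \o cst C) w)%E}.
  by apply: aeW => w n _ /=; rewrite lee_fin.
have h3 : P.-integrable setT (EFin \o cst C) by apply: bm_ig; exact: bm_cst.
have mfE : measurable_fun setT (EFin \o f) by exact/measurable_EFinP.
have [_ _ cv] := dominated_convergence measurableT h1 mfE h2 h3 h4.
have EE (g : Om -> R) : bm g -> (\int[P]_x (EFin \o g) x)%E = (Ex P g)%:E.
  by move=> bg; rewrite -EP_Ex ?unlock//; exact: bm_ig.
have {}cv : (Ex P (h n))%:E @[n --> \oo] --> (Ex P f)%:E.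
  by under eq_fun do rewrite -EE//; rewrite -EE.
exact: fine_cvg cv.
Qed.

End DominatedConvergence.

Section WeakConvergence.
Context {R : realType} {I : Type}.
Variable S : set I.
Implicit Types (f g : I -> R) (h : (I -> R) -> R).

Definition lipschitz_on h (m : R) := forall f g, bnd S f -> bnd S g -> forall r, 0 <= r ->
  (forall v, S v -> `|f v - g v| <= r) -> `|h f - h g| <= m * r.

Definition lsc h := forall f, bnd S f -> forall e : R, 0 < e -> exists2 dl : R, 0 < dl &
  forall g, bnd S g -> (supd S f g < dl%:E)%E -> h f - e <= h g.

(** [infconv] is the Pasch-Hausdorff envelope of h, the largest m-Lipschitz minorant for the sup
    distance when h is bounded; here [r] is any real bound on that distance. *)
Definition infconv_set h (m : R) f : set R := [set y | exists g r, [/\ bnd S g, 0 <= r,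
  forall v, S v -> `|f v - g v| <= r & y = h g + m * r]].

Definition infconv h (m : R) f : R := inf (infconv_set h m f).

Section Infconv.
Variables (h : (I -> R) -> R) (C : R).
Hypothesis hC : forall f, `|h f| <= C.

Let C0 : 0 <= C. Proof. exact: le_trans (normr_ge0 _) (hC (fun=> 0)). Qed.
Let hl f : - C <= h f. Proof. by have := hC f; rewrite ler_norml => /andP[]. Qed.
Let hu f : h f <= C. Proof. by have := hC f; rewrite ler_norml => /andP[]. Qed.

Lemma infconv_lb (m : R) f : 0 <= m -> lbound (infconv_set h m f) (- C).
Proof.
by move=> m0 _ [g [r [_ r0 _ ->]]]; apply: le_trans (hl g) _; rewrite lerDl mulr_ge0.
Qed.

Lemma infconv_mem (m : R) f : bnd S f -> infconv_set h m f (h f).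
Proof. by move=> bf; exists f, 0; split=> // [v _|]; rewrite ?subrr ?normr0 ?mulr0 ?addr0. Qed.

Lemma infconv_le (m : R) f : 0 <= m -> bnd S f -> infconv h m f <= h f.
Proof.
move=> m0 bf; apply: ge_inf; first by exists (- C); exact: infconv_lb.
exact: infconv_mem.
Qed.

Lemma infconv_norm (m : R) f : 0 <= m -> `|infconv h m f| <= C.
Proof.
(* For unbounded f there is no competitor and [inf] is 0 by default. *)
move=> m0; have [ne|/set0P/negP/negPn/eqP e] := pselect (infconv_set h m f !=set0); last first.
  by rewrite /infconv e inf0 normr0.
have bf : bnd S f.
  case: ne => _ [g [r [[B gB] r0 fg _]]]; exists (r + B) => v Sv.
  rewrite -[f v](subrK (g v)); apply: le_trans (ler_normD _ _) _; apply: lerD; [exact: fg|exact: gB].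
rewrite ler_norml (le_trans (infconv_le m0 bf) (hu f)) andbT.
by apply: lb_le_inf => //; exact: infconv_lb.
Qed.

Lemma infconv_lipschitz (m : R) : 0 <= m -> lipschitz_on (infconv h m) m.
Proof.
move=> m0; have half f g : bnd S f -> bnd S g -> forall r, 0 <= r ->
    (forall v, S v -> `|f v - g v| <= r) -> infconv h m f - m * r <= infconv h m g.
  move=> bf bg r r0 fg; apply: lb_le_inf; first by exists (h g); exact: infconv_mem.
  move=> _ [g' [r' [bg' r'0 gg' ->]]]; rewrite lerBlDr -addrA -mulrDr.
  apply: ge_inf; first by exists (- C); exact: infconv_lb.
  exists g', (r' + r); split=> // [|v Sv]; first exact: addr_ge0.
  by apply: le_trans (ler_distD (g v) _ _) _; rewrite addrC; apply: lerD; [exact: gg'|exact: fg].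
move=> f g bf bg r r0 fg; have gf v : S v -> `|g v - f v| <= r by rewrite distrC; exact: fg.
have := half f g bf bg r r0 fg; have := half g f bg bf r r0 gf.
by rewrite ler_norml => ? ?; apply/andP; split; lra.
Qed.

(** Competitors nearer than [dl] lose at most [e] by semicontinuity; those farther away pay n dl >=
    2C, more than any gain of a function bounded by C. *)
Lemma infconv_cvg f : bnd S f -> lsc h -> infconv h n%:R f @[n --> \oo] --> h f.
Proof.
move=> bf lh; apply/cvgrPdist_le => e e0; have [dl dl0 Hdl] := lh f bf e e0.
near=> n; rewrite ger0_norm ?subr_ge0 ?infconv_le// lerBlDr -lerBlDl.
apply: lb_le_inf; first by exists (h f); exact: infconv_mem.
move=> _ [g [r [bg r0 fg ->]]]; have [rd|rd] := ltP r dl.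
  apply: le_trans (Hdl g bg _) _; last by rewrite lerDl mulr_ge0.
  apply: (@le_lt_trans _ _ r%:E); last by rewrite lte_fin.
  by apply: ge_ereal_sup => _ [v Sv <-]; rewrite lee_fin; exact: fg.
have nC : 2 * C / dl <= n%:R by near: n; exact: nbhs_infty_ger.
rewrite ler_pdivrMr// in nC.
have nr : n%:R * dl <= n%:R * r by rewrite ler_wpM2l.
by have := hu f; have := hl g; lra.
Unshelve. all: by end_near.
Qed.

End Infconv.

Section Limits.
Context {d : measure_display} {Om : measurableType d} {d' : measure_display}
  {Om' : measurableType d'}.
Variables (P : probability Om R) (P' : probability Om' R)
  (Xn : nat -> Om -> I -> R) (X : Om' -> I -> R).
Hypotheses (bX : forall w, bnd S (X w)) (bXn : \forall n \near \oo, forall w, bnd S (Xn n w)).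
Hypothesis lipX : forall h C m, 0 <= m -> (forall f, `|h f| <= C) -> lipschitz_on h m ->
  measurable_fun setT (fun w => h (X w)) /\
  forall e : R, 0 < e -> \forall n \near \oo,
    ((Ex P' (fun w => h (X w)) - e)%:E <= outerE P (fun w => h (Xn n w)) /\
     outerE P (fun w => h (Xn n w)) <= (Ex P' (fun w => h (X w)) + e)%:E)%E.

Lemma outerE_mono (f g : Om -> R) : (forall w, f w <= g w) -> (outerE P f <= outerE P g)%E.
Proof.
move=> fg; apply: le_ereal_inf => _ [u [mu [bu gu]] <-]; exists u => //; split=> //; split=> // w.
exact: le_trans (fg w) (gu w).
Qed.

Let mlip h C (n : nat) : (forall f, `|h f| <= C) ->
  measurable_fun setT (fun w => infconv h n%:R (X w)).
Proof.
move=> hC; apply: (lipX (C := C) (ler0n R n) _ (infconv_lipschitz hC (ler0n _ n))).1 => f.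
exact: infconv_norm.
Qed.

Lemma lsc_cvg h C : (forall f, `|h f| <= C) -> lsc h ->
  bm (fun w => h (X w)) /\
  Ex P' (fun w => infconv h n%:R (X w)) @[n --> \oo] --> Ex P' (fun w => h (X w)).
Proof.
move=> hC lh; apply: (@Ex_dominated _ _ _ _ (fun n w => infconv h n%:R (X w)) _ C).
- by move=> n; exact: mlip hC.
- by move=> n w; exact: infconv_norm.
- by move=> w; exact: (infconv_cvg hC (bX w) lh).
Qed.

(** Envelopes are used twice. The indicator of an open set is lower semicontinuous, hence along X a
    limit of measurable functions, which gives Borel measurability. For h bounded and continuous,
    both h and -h are lower semicontinuous; their envelopes enclose h between Lipschitz functionals,
    and outer expectation is monotone. *)
Lemma weak_conv_of_lipschitz : weak_conv P Xn P' X S.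
Proof.
split=> [A oA|h [[C hC] ch]].
  have lA : lsc (\1_A : (I -> R) -> R).
    move=> f bf e e0; have [Af|nAf] := pselect (A f).
      have [dl dl0 Hdl] := oA f Af bf; exists dl => // g bg fg.
      by rewrite !ind1//; [lra|exact: Hdl].
    by exists 1 => // g _ _; rewrite ind0//; have := @ind_ge0 R _ A g; lra.
  have bA f : `|\1_A f : R| <= 1 by rewrite ger0_norm ?ind_ge0 ?ind_le1.
  have [[mA _] _] := lsc_cvg bA lA.
  have -> : [set w | bnd S (X w) /\ A (X w)] = [set w | 2^-1 < \1_A (X w) :> R].
    apply/seteqP; split => [w [_ Aw]|w h] /=; first by rewrite ind1//; lra.
    split=> //; apply: contrapT => nA; move: h => /=; rewrite ind0//; lra.
  by have := @measurable_gt _ _ _ _ 2^-1 mA.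
have lh : lsc h.
  move=> f bf e e0; have [dl dl0 Hdl] := ch f bf e e0; exists dl => // g bg fg.
  by have := Hdl g bg fg; rewrite ltr_norml => /andP[_ ?]; lra.
pose h' f := - h f; have h'C f : `|h' f| <= C by rewrite normrN.
have lh' : lsc h'.
  move=> f bf e e0; have [dl dl0 Hdl] := ch f bf e e0; exists dl => // g bg fg.
  by have := Hdl g bg fg; rewrite /h' ltr_norml => /andP[? _]; lra.
have [bh c1] := lsc_cvg hC lh; have [_ c2] := lsc_cvg h'C lh'.
rewrite EP_Ex; last exact: bm_ig.
set L := Ex P' _ in c1 *.
have EN : Ex P' (fun w => h' (X w)) = - L.
  have -> : - L = -1 * L by rewrite mulN1r.
  by rewrite -ExZ ?(bm_ig _ bh)//; apply: eq_Ex => w; rewrite mulN1r.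
rewrite EN in c2.
suff close e : 0 < e -> \forall n \near \oo,
    ((L - e)%:E <= outerE P (fun w => h (Xn n w)) /\
     outerE P (fun w => h (Xn n w)) <= (L + e)%:E)%E.
  apply/fine_cvgP; split.
    near=> n; have [h1 h2] : ((L - 1)%:E <= outerE P (fun w => h (Xn n w)) /\
      outerE P (fun w => h (Xn n w)) <= (L + 1)%:E)%E by near: n; exact: close.
    by rewrite fin_real// (lt_le_trans (ltNyr _) h1) (le_lt_trans h2 (ltry _)).
  apply/cvgrPdist_le => e e0; near=> n.
  have [h1 h2] : ((L - e)%:E <= outerE P (fun w => h (Xn n w)) /\
      outerE P (fun w => h (Xn n w)) <= (L + e)%:E)%E by near: n; exact: close.
  move: h1 h2 => /=; case: (outerE P _) => [y| |] /=; rewrite ?lee_fin ?leye_eq ?leeNy_eq//.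
  by move=> h1 h2; rewrite ler_norml; apply/andP; split; lra.
move=> e0; have e2 : 0 < e / 2 by rewrite divr_gt0.
have [q [q1 q2]] : exists q : nat, L - e / 2 <= Ex P' (fun w => infconv h q%:R (X w)) /\
    Ex P' (fun w => - infconv h' q%:R (X w)) <= L + e / 2.
  near \oo => q; exists q; split.
    have : `|L - Ex P' (fun w => infconv h q%:R (X w))| <= e / 2.
      by near: q; move/cvgrPdist_le: c1; apply.
    by rewrite ler_norml => /andP[? ?]; lra.
  have : `|- L - Ex P' (fun w => infconv h' q%:R (X w))| <= e / 2.
    by near: q; move/cvgrPdist_le: c2; apply.
  have -> : Ex P' (fun w => - infconv h' q%:R (X w)) = -1 * Ex P' (fun w => infconv h' q%:R (X w)).
    rewrite -ExZ; first by apply: eq_Ex => w; rewrite mulN1r.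
    apply: bm_ig; split; first exact: mlip h'C.
    by exists C => w; exact: infconv_norm.
  by rewrite ler_norml => /andP[? ?]; lra.
have q0 : 0 <= q%:R :> R by [].
have l2 : lipschitz_on (fun f => - infconv h' q%:R f) q%:R.
  by move=> f g bf bg r r0 fg; rewrite -opprD normrN; exact: infconv_lipschitz.
have [_ /(_ _ e2) n1] := lipX q0 (fun f => infconv_norm hC f q0) (infconv_lipschitz hC q0).
have bN f : `|- infconv h' q%:R f| <= C by rewrite normrN infconv_norm.
have [_ /(_ _ e2) n2] := lipX q0 bN l2.
near=> n.
have bn : forall w, bnd S (Xn n w) by near: n.
have [a1 _] : ((Ex P' (fun w => infconv h q%:R (X w)) - e / 2)%:E <=
      outerE P (fun w => infconv h q%:R (Xn n w)) /\
     outerE P (fun w => infconv h q%:R (Xn n w)) <=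
      (Ex P' (fun w => infconv h q%:R (X w)) + e / 2)%:E)%E by near: n.
have [_ a2] : ((Ex P' (fun w => (- infconv h' q%:R (X w))%R) - e / 2)%:E <=
      outerE P (fun w => (- infconv h' q%:R (Xn n w))%R) /\
     outerE P (fun w => (- infconv h' q%:R (Xn n w))%R) <=
      (Ex P' (fun w => (- infconv h' q%:R (X w))%R) + e / 2)%:E)%E by near: n.
split.
- apply: (@le_trans _ _ (outerE P (fun w => infconv h q%:R (Xn n w)))).
    by apply: le_trans a1; rewrite lee_fin; lra.
  by apply: outerE_mono => w; exact: (infconv_le hC q0 (bn w)).
- apply: (@le_trans _ _ (outerE P (fun w => (- infconv h' q%:R (Xn n w))%R))).
    by apply: outerE_mono => w; rewrite lerNr; exact: (infconv_le h'C q0 (bn w)).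
  by apply: le_trans a2 _; rewrite lee_fin; lra.
Unshelve. all: by end_near.
Qed.

End Limits.
End WeakConvergence.

(** * Weak convergence of the rank process *)

Lemma key_representatives (V : Type) (S : set V) (K : finType) (key : V -> K) :
  exists (p : nat) (u : 'I_p -> V) (sel : V -> option 'I_p), (forall i, S (u i)) /\
    forall v, S v -> exists2 i, sel v = Some i & key (u i) = key v.
Proof.
pose G := [set c | `[< exists2 v, S v & key v = c >]]%SET.
have HG (i : 'I_#|G|) : exists v, S v /\ key v = enum_val i.
  by have := enum_valP i; rewrite inE => /asboolP[v Sv kv]; exists v.
have [u Hu] := choice HG.
exists #|G|, u, (fun v => [pick i | key (u i) == key v]); split=> [i|v Sv]; first by case: (Hu i).
have vG : key v \in G by rewrite inE; apply/asboolP; exists v.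
case: pickP => [i /eqP e|/(_ (enum_rank_in vG (key v)))]; first by exists i.
by rewrite (Hu _).2 enum_rankK_in// eqxx.
Qed.

Section Process.
Context {R : realType} {T : topologicalType} {dO : measure_display}
  {Om : measurableType dO}.
Variables (P : probability Om R) (xi : nat -> Om -> T -> R) (k : nat -> R) (D : nat) (M : R).
Hypotheses (Hiid : iid P xi) (HC1 : C1 P xi) (HC2 : C2 k) (HC3 : C3 P xi D)
  (HC4 : C4 P xi) (HC6 : C6 P xi D) (HC7 : C7 P xi k D) (D0 : (0 < D)%N) (M0 : 0 < M).
Local Notation V := (@Vidx R T).
Local Notation S := (@inV R T D M).
Local Notation S' := (@inV' R T D M).
Local Notation r2v := (r2v P xi).

(** The map from W to hat W, applied to W_n and to the limit alike. Since |Rdot| <= 1, it is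
    Lipschitz with constant 1 + D for the sup norm over the index set. *)
Definition Op (f : V -> R) (v : V) : R :=
  match v with existT m (t, x) =>
    f (mkV t x) - \sum_(j < m) Rdot P xi t j x * f (pt (t j) (x j)) end.

Lemma Op_dist (f g : V -> R) v r : S v -> (forall u, S u -> `|f u - g u| <= r) ->
  `|Op f v - Op g v| <= (1 + D%:R) * r.
Proof.
case: v => m [t x] Sv fg; have [/= mD xM] := Sv.
have m2 : (0 < m <= 2 * D)%N by lia.
have r0 : 0 <= r by exact: le_trans (normr_ge0 _) (fg _ Sv).
have mDR : m%:R <= D%:R :> R by rewrite ler_nat; case/andP: mD.
set a := \sum_(j < m) _; set b := \sum_(j < m) _.
have -> : f (mkV t x) - a - (g (mkV t x) - b) = (f (mkV t x) - g (mkV t x)) - (a - b) by ring.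
apply: le_trans (ler_normB _ _) _; rewrite mulrDl mul1r; apply: lerD; first exact: fg.
rewrite /a /b -sumrB; apply: le_trans (ler_norm_sum _ _ _) _.
apply: (@le_trans _ _ (\sum_(j < m) r)); last first.
  by rewrite sumr_const card_ord -[_ *+ _]mulr_natl ler_wpM2r.
apply: ler_sum => j _; rewrite -mulrBr normrM -[leRHS]mul1r; apply: ler_pM => //.
  exact: (Rdot_bound Hiid HC1 HC3 D0).
by apply: fg; exact: inV_pt.
Qed.

Lemma Op_bnd (f : V -> R) r : (forall u, S u -> `|f u| <= r) ->
  forall v, S v -> `|Op f v| <= (1 + D%:R) * r.
Proof.
move=> fr v Sv; have O0 : Op (fun=> 0) v = 0.
  by case: v Sv => m [t x] _ /=; rewrite big1 ?subr0// => j _; rewrite mulr0.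
rewrite -[Op f v]subr0 -O0; apply: Op_dist => // u Su; rewrite subr0; exact: fr.
Qed.

Lemma WhatV_bnd n : (0 < n)%N -> forall w, bnd S' (WhatV P xi k n w).
Proof.
move=> n0 w; have k0 : 0 < k n by case: HC2 => /(_ n n0) /andP[].
exists (Num.sqrt (k n) * (n%:R / k n + n%:R / k n)) => -[m [t x]] _ /=.
rewrite /What normrM ger0_norm ?sqrtr_ge0// ler_wpM2l ?sqrtr_ge0//.
apply: le_trans (ler_normB _ _) _; apply: lerD.
  rewrite /Rhat normrM gtr0_norm ?invr_gt0// mulrC ler_pM2r ?invr_gt0//.
  apply: le_trans (ler_norm_sum _ _ _) _.
  apply: (@le_trans _ _ (\sum_(i < n) 1)); last by rewrite sumr_const card_ord.
  by apply: ler_sum => i _; case: ifP; rewrite ?normr1 ?normr0.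
have nk : 0 <= n%:R / k n by rewrite divr_ge0// ltW.
rewrite /Eemp normrM ger0_norm// -[leRHS]mulr1 ler_wpM2l//.
rewrite ger0_norm ?fine_ge0//.
have mA : measurable [set w | forall j, Uf P xi 0 w (t j) < k n / n%:R * x j].
  exact: (measurable_xi Hiid 0 (CBorel_Bset HC1 (kap k n) (mkV t x))).
exact: pr_le1.
Qed.

Section Limit.
Context {dO' : measure_display} {Om' : measurableType dO'}.
Variables (P' : probability Om' R) (W : Om' -> V -> R).
Hypotheses (GW : gaussian_process P' W (CovR P xi) S)
  (UW : forall w, unif_cont S (sd_semimetric P' W) (W w)).

Lemma WhatLimE w : WhatLim P xi W w = Op (W w).
Proof. by apply: funext => -[m [t x]]. Qed.

Section Keys.
Variables (K : nat -> finType) (key : forall q, V -> K q).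
Hypothesis keyr : forall e : R, 0 < e -> exists q0, forall q, (q0 <= q)%N ->
  forall v v', S v -> S v' -> key q v = key q v' -> r2v v v' <= e.

(** A common key at a fine level means small [r2v], hence small rho_2, and the path is uniformly
    rho_2-continuous. *)
Lemma limit_osc w (e : R) : 0 < e -> exists q0, forall q, (q0 <= q)%N ->
  forall v v', S v -> S v' -> key q v = key q v' -> `|W w v - W w v'| <= e.
Proof.
move=> e0; have [dl dl0 Hdl] := UW w e0.
have d2 : 0 < (dl / 2) ^+ 2 by rewrite exprn_gt0// divr_gt0.
have [q0 Hq] := keyr d2; exists q0 => q qq v v' Sv Sv' kv.
apply: ltW; apply: Hdl => //.
apply: le_lt_trans (sd_le_r2v Hiid HC1 HC2 HC3 D0 M0 GW Sv Sv') _.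
apply: (@le_lt_trans _ _ (dl / 2)); last by rewrite ltr_pdivrMr//; lra.
rewrite -[leRHS]ger0_norm ?divr_ge0 ?(ltW dl0)// -sqrtr_sqr ler_wsqrtr//.
exact: Hq qq v v' Sv Sv' kv.
Qed.

Lemma limit_bnd w : bnd S (W w).
Proof.
have [q /(_ _ (leqnn _)) Hq] := limit_osc w ltr01.
have [p [u [sel [Su Hsel]]]] := key_representatives S (key q).
exists (1 + \sum_i `|W w (u i)|) => v Sv; have [i _ ku] := Hsel v Sv.
rewrite -[W w v](subrK (W w (u i))); apply: le_trans (ler_normD _ _) _.
apply: lerD; first exact: Hq.
by rewrite (bigD1 i)//= lerDl sumr_ge0.
Qed.

End Keys.

(** The step function on the index set that is constant on the selected classes of keys and 0 where
    nothing is selected. *)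
Definition ext p (sel : V -> option 'I_p) (z : 'I_p -> R) (v : V) : R := oapp z 0 (sel v).

Lemma ext_le p (sel : V -> option 'I_p) z v : `|ext sel z v| <= \sum_i `|z i|.
Proof.
rewrite /ext; case: (sel v) => [i|] /=; last by rewrite normr0 sumr_ge0.
by rewrite (bigD1 i)//= lerDl sumr_ge0.
Qed.

Lemma ext_dist p (sel : V -> option 'I_p) z y v :
  `|ext sel z v - ext sel y v| <= \sum_i `|z i - y i|.
Proof.
have -> : ext sel z v - ext sel y v = ext sel (fun i => z i - y i) v.
  by rewrite /ext; case: (sel v) => //=; rewrite subr0.
exact: ext_le.
Qed.

Lemma Op_ext_bnd p (sel : V -> option 'I_p) z : bnd S' (Op (ext sel z)).
Proof.
exists ((1 + D%:R) * \sum_i `|z i|) => v [Sv _]; apply: Op_bnd => // u _; exact: ext_le.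
Qed.

Section LipschitzFunctional.
Variables (h : (V -> R) -> R) (C m : R).
Hypotheses (m0 : 0 <= m) (hC : forall f, `|h f| <= C) (hm : lipschitz_on S' h m).

Lemma Op_ext_lipschitz p (sel : V -> option 'I_p) z y :
  `|h (Op (ext sel z)) - h (Op (ext sel y))| <= m * (1 + D%:R) * \sum_i `|z i - y i|.
Proof.
rewrite -mulrA; apply: hm; [exact: Op_ext_bnd|exact: Op_ext_bnd| |].
  by rewrite mulr_ge0 ?addr_ge0 ?sumr_ge0.
by move=> v [Sv _]; apply: Op_dist => // u _; exact: ext_dist.
Qed.

Lemma Op_key_approx p (u : 'I_p -> V) (sel : V -> option 'I_p) (K : finType) (key : V -> K)
  (g : V -> R) (e : R) : (forall i, S (u i)) ->
  (forall v, S v -> exists2 i, sel v = Some i & key (u i) = key v) ->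
  (forall v v', S v -> S v' -> key v = key v' -> `|g v - g v'| <= e) ->
  forall v, S v -> `|Op g v - Op (ext sel (fun i => g (u i))) v| <= (1 + D%:R) * e.
Proof.
move=> Su Hsel osc v Sv; apply: Op_dist => // v' Sv'.
have [i si ki] := Hsel v' Sv'; rewrite /ext si /=.
exact: osc.
Qed.

(** [F q] is h evaluated at the image of a step function over level-q keys, a Lipschitz function of
    finitely many coordinates. For the limit, the steps converge along every path and dominated
    convergence applies. For finite n, expansion and oscillation errors are small off an event [E],
    and the measurable functions A n - B and A n + B enclose the functional of the rank process,
    which handles the outer expectation. *)
Lemma WhatV_lipschitz_cvg :
  measurable_fun setT (fun w => h (WhatLim P xi W w)) /\
  forall e : R, 0 < e -> \forall n \near \oo,
    ((Ex P' (fun w => h (WhatLim P xi W w)) - e)%:E <=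
       outerE P (fun w => h (WhatV P xi k n w)) /\
     outerE P (fun w => h (WhatV P xi k n w)) <=
       (Ex P' (fun w => h (WhatLim P xi W w)) + e)%:E)%E.
Proof.
have [K [key [k1 k2 _ _]]] := key_system Hiid HC1 HC2 HC3 D0 M0 HC4.
have C0 : 0 <= C by exact: le_trans (normr_ge0 _) (hC (fun=> 0)).
have DD0 : 0 <= 1 + D%:R :> R by rewrite addr_ge0.
have reps q : exists r : {p & (('I_p -> V) * (V -> option 'I_p))%type},
    (forall i, S ((projT2 r).1 i)) /\ forall v, S v ->
      exists2 i, (projT2 r).2 v = Some i & key q ((projT2 r).1 i) = key q v.
  have [p [u [sel [Su Hsel]]]] := key_representatives S (key q).
  by exists (existT _ p (u, sel)).
have {reps}[r Hr] := choice reps.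
pose p q := projT1 (r q).
pose u q : 'I_(p q) -> V := (projT2 (r q)).1.
pose sel q : V -> option 'I_(p q) := (projT2 (r q)).2.
have Su q i : S (u q i) by exact: (Hr q).1.
have Hsel q v : S v -> exists2 i, sel q v = Some i & key q (u q i) = key q v.
  exact: (Hr q).2.
pose F q (z : 'I_(p q) -> R) := h (Op (ext (sel q) z)).
have L0 : 0 <= m * (1 + D%:R) by rewrite mulr_ge0.
have FL q z y : `|F q z - F q y| <= m * (1 + D%:R) * \sum_i `|z i - y i|.
  exact: Op_ext_lipschitz.
have FC q z : `|F q z| <= C by exact: hC.
have bL w : bnd S' (Op (W w)).
  have [B HB] := limit_bnd k2 w; exists ((1 + D%:R) * B) => v [Sv _]; exact: Op_bnd.
have [[mh _] cF] : bm (fun w => h (WhatLim P xi W w)) /\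
    Ex P' (fun w => F q (fun i => W w (u q i))) @[q --> \oo] -->
    Ex P' (fun w => h (WhatLim P xi W w)).
  apply: (@Ex_dominated _ _ _ _ (fun q w => F q (fun i => W w (u q i))) _ C) => //.
    move=> q; apply: (measurable_lipschitz L0 (FL q)) => i.
    exact: (GW.1 _ (Su q i)).
  move=> w; apply/cvgrPdist_le => e e0.
  pose c := m * (1 + D%:R) + 1; have c0 : 0 < c by rewrite ltr_wpDl.
  have ec : 0 < e / c by rewrite divr_gt0.
  have [q0 Hq] := limit_osc k2 w ec.
  near=> q; have qq : (q0 <= q)%N by near: q; exact: nbhs_infty_ge.
  rewrite WhatLimE; apply: (@le_trans _ _ (m * ((1 + D%:R) * (e / c)))).
    apply: hm => //; first exact: Op_ext_bnd.
      by rewrite mulr_ge0// ltW.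
    move=> v [Sv _]; apply: (Op_key_approx (Su q) (Hsel q) _ Sv).
    exact: Hq.
  rewrite mulrA [leLHS]mulrA ler_pdivrMr// [leLHS]mulrA [leRHS]mulrC ler_pM2r//.
  by rewrite lerDl.
split=> // e e0.
(* Off [E] the expansion costs m e1 and the step function m (1 + D) e1; on [E], of probability at
   most 2 e1, the two values of h differ by at most 2C. *)
pose c := m * (2 + D%:R) + 4 * C + 1.
have cc : 0 <= m * (2 + D%:R) + 4 * C by rewrite addr_ge0 ?mulr_ge0 ?addr_ge0.
have c0 : 0 < c by rewrite ltr_wpDl.
pose e1 := e / 2 / c; have e10 : 0 < e1 by rewrite !divr_gt0.
have e1c : (m * (2 + D%:R) + 4 * C) * e1 <= e / 2.
  rewrite /e1 mulrA ler_pdivrMr// mulrC ler_wpM2l ?divr_ge0 ?(ltW e0)//.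
  by rewrite lerDl.
have e4 : 0 < e / 4 by rewrite divr_gt0.
have [q0 Hq0] := k1 _ e10.
have [q [qq Fh]] : exists q, (q0 <= q)%N /\
    `|Ex P' (fun w => h (WhatLim P xi W w)) - Ex P' (fun w => F q (fun i => W w (u q i)))| <= e / 4.
  near \oo => q; exists q; split; first by near: q; exact: nbhs_infty_ge.
  by near: q; move/cvgrPdist_le: cF; apply.
pose A n w := F q (fun i => Wv P xi k n (u q i) w).
have cA := Wv_fdd_cvg Hiid HC1 HC2 HC3 D0 M0 GW (Su q) L0 (FL q) (FC q).
have oscn := Hq0 q qq.
have expn := What_expansion Hiid HC1 HC2 HC3 D0 HC4 HC6 HC7 M0 e10.
near=> n.
have n0 : (0 < n)%N by near: n; exact: nbhs_infty_gt.
have [E1 [mE1 pE1 HE1]] : exists E : set Om, [/\ measurable E, pr P E <= e1 &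
   forall om, ~ E om -> forall v v', S v -> S v' -> key q v = key q v' ->
     `|Wv P xi k n v om - Wv P xi k n v' om| <= e1] by near: n.
have [E2 [mE2 pE2 HE2]] : exists E : set Om,
  [/\ measurable E, pr P E <= e1 & forall om, ~ E om ->
   forall m (t : 'I_m -> T) (x : 'I_m -> R), (0 < m <= D)%N -> injective t ->
   (forall i, 0 <= x i <= M) ->
   `|What P xi k n t x om - Wv P xi k n (mkV t x) om
     + \sum_(j < m) Rdot P xi t j x * Wv P xi k n (pt (t j) (x j)) om| <= e1] by near: n.
have An : `|Ex P' (fun w => F q (fun i => W w (u q i))) - Ex P (A n)| <= e / 4.
  by near: n; move/cvgrPdist_le: cA; apply.
pose E := E1 `|` E2; have mE : measurable E by exact: measurableU.
have pE : pr P E <= 2 * e1.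
  by apply: le_trans (prU P mE1 mE2) _; rewrite mulr_natl mulr2n lerD.
have bA : bm (A n).
  split; last by exists C => w; exact: FC.
  apply: (measurable_lipschitz L0 (FL q) (Z := fun w i => Wv P xi k n (u q i) w)) => i.
  by case: (bm_Ws Hiid (k n) n (CBorel_Bset HC1 (kap k n) (u q i))).
pose B w := m * (2 + D%:R) * e1 + 2 * C * \1_E w.
have bB : bm B.
  by apply: bmD; [exact: bm_cst|apply: bmZ; exact: bm_ind].
have EB : Ex P B <= e / 2.
  rewrite /B ExD; [|exact/bm_ig/bm_cst|exact/bm_ig/bmZ/bm_ind].
  rewrite Ex_cst ExZ ?Ex_ind//; last exact/bm_ig/bm_ind.
  apply: le_trans e1c; rewrite [leRHS]mulrDl lerD2l.
  have -> : 4 * C * e1 = 2 * C * (2 * e1) by ring.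
  by rewrite ler_wpM2l// mulr_ge0.
have hA w : `|h (WhatV P xi k n w) - A n w| <= B w.
  have [Ew|nEw] := pselect (E w).
    rewrite /B ind1// mulr1; apply: (@le_trans _ _ (2 * C)); last first.
      by rewrite lerDr; apply: mulr_ge0; [rewrite mulr_ge0 ?addr_ge0|exact: ltW].
    by apply: le_trans (ler_normB _ _) _; rewrite mulr_natl mulr2n; apply: lerD; exact: hC.
  rewrite /B ind0// mulr0 addr0 -mulrA; apply: hm.
  - exact: WhatV_bnd.
  - exact: Op_ext_bnd.
  - by rewrite mulr_ge0 ?addr_ge0// ltW.
  move=> v [Sv iv].
  have h1 : `|WhatV P xi k n w v - Op (Wv P xi k n ^~ w) v| <= e1.
    case: v Sv iv => m' [t x] [/= mD xM] it.
    rewrite opprB addrC addrAC -addrA addrC.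
    have := HE2 w (fun z => nEw (or_intror z)) m' t x mD it xM.
    by congr (`|_| <= _); ring.
  have h2 := Op_key_approx (g := Wv P xi k n ^~ w) (Su q) (Hsel q)
    (HE1 w (fun z => nEw (or_introl z))) Sv.
  apply: le_trans (ler_distD (Op (Wv P xi k n ^~ w) v) _ _) _.
  have -> : (2 + D%:R) * e1 = e1 + (1 + D%:R) * e1 by ring.
  exact: lerD h1 h2.
have hl w : A n w - B w <= h (WhatV P xi k n w).
  by have := hA w; rewrite ler_norml => /andP[? ?]; lra.
have hu w : h (WhatV P xi k n w) <= A n w + B w.
  by have := hA w; rewrite ler_norml => /andP[? ?]; lra.
move: An Fh EB; set a := Ex P (A n); set b := Ex P' (fun w => F q _); set l := Ex P' _.
rewrite !ler_norml => /andP[a1 a2] /andP[b1 b2] EB; split.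
- apply: le_ereal_inf_tmp => _ [g [mg [[Cg gC] hg]] <-].
  have bg : bm g by split=> //; exists Cg.
  rewrite EP_Ex; last exact: bm_ig.
  rewrite lee_fin; apply: (@le_trans _ _ (a - Ex P B)); first lra.
  rewrite -ExB; [|exact: bm_ig..].
  apply: Ex_le => [||w]; [exact/bm_ig/bmB|exact: bm_ig|exact: le_trans (hl w) (hg w)].
- have up : (outerE P (fun w => h (WhatV P xi k n w)) <= (Ex P (A n) + Ex P B)%:E)%E.
    rewrite -ExD; [|exact: bm_ig..]; rewrite -EP_Ex; last exact/bm_ig/bmD.
    apply: ereal_inf_lbound; exists (fun w => A n w + B w) => //.
    by have [mAB bAB] := bmD bA bB; split.
  by apply: le_trans up _; rewrite lee_fin -/a; lra.
Unshelve. all: by end_near.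
Qed.

End LipschitzFunctional.

Lemma WhatV_weak_conv : weak_conv P (WhatV P xi k) P' (WhatLim P xi W) S'.
Proof.
have [K [key [_ k2 _ _]]] := key_system Hiid HC1 HC2 HC3 D0 M0 HC4.
apply: weak_conv_of_lipschitz.
- move=> w; rewrite WhatLimE; have [B HB] := limit_bnd k2 w.
  exists ((1 + D%:R) * B) => v [Sv _]; exact: Op_bnd.
- by near=> n; apply: WhatV_bnd; near: n; exact: nbhs_infty_gt.
- by move=> h C m m0 hC hm; exact: (WhatV_lipschitz_cvg m0 hC hm).
Unshelve. all: by end_near.
Qed.

End Limit.
End Process.
(** * Almost sure uniform continuity of the limit *)

Section SquareIntegrable.
Context {R : realType} {d : measure_display} {Om : measurableType d}.
Variable P : probability Om R.
Implicit Types X Y : Om -> R.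

Definition sqi X := measurable_fun setT X /\ ig P (fun w => X w ^+ 2).

Lemma sqiZ c X : sqi X -> sqi (fun w => c * X w).
Proof.
move=> [mX iX]; split; first exact: measurable_funM.
by under eq_fun do rewrite exprMn; exact: igZ.
Qed.

Lemma sqiD X Y : sqi X -> sqi Y -> sqi (fun w => X w + Y w).
Proof.
move=> [mX iX] [mY iY]; have mXY := measurable_funD mX mY; split=> //.
have i2 : ig P (fun w => 2 * X w ^+ 2 + 2 * Y w ^+ 2) by apply: igD; exact: igZ.
apply: (le_integrable measurableT _ _ i2).
  by apply/measurable_EFinP; exact: measurable_funX.
move=> w _; rewrite /= lee_fin !ger0_norm ?sqr_ge0//; last first.
  by rewrite addr_ge0// mulr_ge0// sqr_ge0.
by have := sqr_ge0 (X w - Y w); nra.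
Qed.

Lemma sqi_sum (I : Type) (r : seq I) (X : I -> Om -> R) : (forall i, sqi (X i)) ->
  sqi (fun w => \sum_(i <- r) X i w).
Proof.
move=> sX; elim: r => [|i r IH].
  under eq_fun do rewrite big_nil; split; first exact: measurable_cst.
  by apply: bm_ig; exact: bm_cst.
by under eq_fun do rewrite big_cons; exact: sqiD.
Qed.

Lemma sqiB X Y : sqi X -> sqi Y -> sqi (fun w => X w - Y w).
Proof.
move=> sX sY; have := sqiD sX (sqiZ (-1) sY).
by under [in X in _ -> X]eq_fun do rewrite -mulN1r.
Qed.

Lemma chebyshev_sqi X (e : R) : sqi X -> 0 < e ->
  measurable [set w | e < `|X w|] /\
  pr P [set w | e < `|X w|] <= Ex P (fun w => X w ^+ 2) / e ^+ 2.
Proof.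
move=> [mX iX] e0; have mA : measurable [set w | e < `|X w|].
  by apply: measurable_gt; exact: measurableT_comp.
split=> //; rewrite ler_pdivlMr ?exprn_gt0// mulrC -Ex_ind//.
rewrite -ExZ; last exact/bm_ig/bm_ind.
apply: Ex_le => //; first by apply: igZ; exact/bm_ig/bm_ind.
move=> w; have [h|h] := pselect (e < `|X w|); last by rewrite ind0// mulr0 sqr_ge0.
by rewrite ind1// mulr1 -(real_normK (num_real (X w))) ler_pXn2r ?nnegrE// ltW.
Qed.

End SquareIntegrable.

(* Two indices in the same cell give uniformly close values of the process, and only finitely many
   pairs of cells occur at each level: a pair either is separated by [rho], or contains index
   pairs at arbitrarily small standard deviation, along which the process almost surely comes
   arbitrarily close to itself. *)
Section AlmostSureUniformContinuity.
Context {R : realType} {d : measure_display} {Om : measurableType d}.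
Variables (P : probability Om R) (I : Type) (S : set I) (Z : Om -> I -> R).
Variables (C : nat -> finType) (c : forall n, I -> C n).
Hypothesis sZ : forall v, S v -> sqi P (fun w => Z w v).
Hypothesis oscZ : forall w (e : R), 0 < e -> exists n, forall v v', S v -> S v' ->
  c n v = c n v' -> `|Z w v - Z w v'| <= e.
Local Notation sd := (sd_semimetric P Z).

Let touch n (a b : C n) := forall j : nat, exists v v',
  [/\ S v, S v', c n v = a, c n v' = b & sd v v' < 2 ^- j].

Let sd_sqr v v' (e : R) : S v -> S v' -> sd v v' < e ->
  Ex P (fun w => (Z w v - Z w v') ^+ 2) <= e ^+ 2.
Proof.
move=> Sv Sv'; have [_ i2] := sqiB (sZ Sv) (sZ Sv').
rewrite /sd_semimetric EP_Ex//= => h.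
have E0 : 0 <= Ex P (fun w => (Z w v - Z w v') ^+ 2) by apply: Ex_ge0 => w; exact: sqr_ge0.
rewrite -(sqr_sqrtr E0) ler_pXn2r ?nnegrE ?sqrtr_ge0// ?ltW//.
exact: le_lt_trans (sqrtr_ge0 _) h.
Qed.

Let touch_ae n (a b : C n) : touch a b -> {ae P, forall w, forall j : nat, exists v v',
  [/\ S v, S v', c n v = a, c n v' = b & `|Z w v - Z w v'| <= 2 ^- j]}.
Proof.
move=> tab; apply: ae_foralln => j.
have e0 : 0 < 2 ^- j :> R by rewrite invr_gt0 exprn_gt0.
have Hvv (i : nat) : exists vv : I * I, [/\ S vv.1, S vv.2, c n vv.1 = a, c n vv.2 = b &
    sd vv.1 vv.2 < 2 ^- i] by have [v [v' h]] := tab i; exists (v, v').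
have [vv Hv] := choice Hvv.
pose A i := [set w | 2 ^- j < `|Z w (vv i).1 - Z w (vv i).2|].
have HA i : measurable (A i) /\ pr P (A i) <= (2 ^- i) ^+ 2 / (2 ^- j) ^+ 2.
  have [S1 S2 _ _ sdi] := Hv i; have [mA pA] := chebyshev_sqi (sqiB (sZ S1) (sZ S2)) e0.
  split=> //; apply: le_trans pA _; rewrite ler_pM2r ?invr_gt0 ?exprn_gt0//.
  exact: sd_sqr.
(* Off [N] some pair of the sequence has increment at most 2^-j, and [N] is null since P(A i) tends
   to 0 by Chebyshev. *)
pose N := \bigcap_i A i.
have mN : measurable N by apply: bigcap_measurable => // i _; case: (HA i).
exists N; split=> //.
  apply: etrans (prE P mN) _; congr EFin; apply/eqP; rewrite eq_le pr_ge0 andbT.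
  apply/ler_addgt0Pl => e e1; rewrite addr0.
  near \oo => i; apply: (@le_trans _ _ (pr P (A i))).
    by apply: pr_le => //; [case: (HA i)|move=> w; exact].
  apply: le_trans (HA i).2 _; rewrite ler_pdivrMr ?exprn_gt0//.
  have d0 : 0 < e * (2 ^- j) ^+ 2 by rewrite mulr_gt0 ?exprn_gt0.
  set dd := e * _ in d0 *; have h : dd^-1 <= i%:R by near: i; exact: nbhs_infty_ger.
  have h2 : i%:R <= 2 ^+ i :> R by rewrite -natrX ler_nat ltnW// ltn_expl.
  have p1 : 2 ^- i <= 1 :> R by rewrite invf_le1 ?exprn_gt0// exprn_ege1// ler1n.
  have p0 : 0 <= 2 ^- i :> R by rewrite invr_ge0 exprn_ge0.
  apply: (@le_trans _ _ (2 ^- i)); first by rewrite expr2 ler_piMl.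
  rewrite invf_ple ?posrE ?exprn_gt0//; exact: le_trans h h2.
move=> w nw i _; apply: contrapT => nA; apply: nw.
have [S1 S2 c1 c2 _] := Hv i; exists (vv i).1, (vv i).2; split=> //.
by rewrite leNgt; apply/negP.
Unshelve. all: by end_near.
Qed.

Lemma ae_unif_cont : {ae P, forall w, unif_cont S sd (Z w)}.
Proof.
have H : {ae P, forall w, forall n, forall ab : C n * C n, touch ab.1 ab.2 ->
   forall j : nat, exists v v',
  [/\ S v, S v', c n v = ab.1, c n v' = ab.2 & `|Z w v - Z w v'| <= 2 ^- j]}.
  apply: ae_foralln => n; apply: filter_forall => -[a b] /=.
  have [tab|ntab] := pselect (touch a b); last by apply: aeW => w /ntab.
  by apply: filterS (touch_ae tab) => w h _.
apply: filterS H => w Hw e e0.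
have e8 : 0 < e / 8 by rewrite divr_gt0.
have [n Hn] := oscZ w e8.
have sep (ab : C n * C n) : exists j : nat, ~ touch ab.1 ab.2 ->
    forall v v', S v -> S v' -> c n v = ab.1 -> c n v' = ab.2 -> 2 ^- j <= sd v v'.
  have [t|/existsNP[j Hj]] := pselect (touch ab.1 ab.2); first by exists 0%N.
  exists j => _ v v' Sv Sv' cv cv'; rewrite leNgt; apply/negP => h; apply: Hj.
  by exists v, v'.
have [jj Hjj] := choice sep.
(* 2^-J lies below the separation of every non-touching pair, so indices closer than 2^-J are in
   touching cells. *)
pose J := \max_(ab : C n * C n) jj ab.
exists (2 ^- J); first by rewrite invr_gt0 exprn_gt0.
move=> v v' Sv Sv' sdv.
have tt : touch (c n v) (c n v').
  apply: contrapT => nt; have := Hjj (c n v, c n v') nt v v' Sv Sv' erefl erefl.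
  apply/negP; rewrite -ltNge; apply: lt_le_trans sdv _.
  rewrite lef_pV2 ?posrE ?exprn_gt0// ler_eXn2l ?ltr1n//.
  exact: (leq_bigmax (c n v, c n v')).
have [j ej] : exists j : nat, 2 ^- j <= e / 8.
  near \oo => j; exists j; rewrite invf_ple ?posrE ?exprn_gt0//.
  have h : (e / 8)^-1 <= j%:R by near: j; exact: nbhs_infty_ger.
  by apply: le_trans h _; rewrite -natrX ler_nat ltnW// ltn_expl.
have [u [u' [Su Su' cu cu' uu']]] := Hw n (c n v, c n v') tt j.
have h1 := Hn v u Sv Su (esym cu); have h2 := Hn u' v' Su' Sv' cu'.
have h3 := ler_distD (Z w u) (Z w v) (Z w v').
have h4 := ler_distD (Z w u') (Z w u) (Z w v').
by lra.
Unshelve. all: by end_near.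
Qed.

End AlmostSureUniformContinuity.

(** * Cells of small oscillation for hat W *)

Section LimitContinuity.
Context {R : realType} {T : topologicalType} {dO : measure_display}
  {Om : measurableType dO}.
Variables (P : probability Om R) (xi : nat -> Om -> T -> R) (k : nat -> R) (D : nat) (M : R).
Hypotheses (Hiid : iid P xi) (HC1 : C1 P xi) (HC2 : C2 k) (HC3 : C3 P xi D)
  (HC4 : C4 P xi) (D0 : (0 < D)%N) (M0 : 0 < M).
Local Notation V := (@Vidx R T).
Local Notation S := (@inV R T D M).
Local Notation S' := (@inV' R T D M).

(* Indexing the coordinates by nat makes vectors of different dimensions comparable. *)
Let rdv (v : V) (i : nat) : R :=
  match v with existT m (t, x) =>
    oapp (fun j : 'I_m => Rdot P xi t j x) 0 (insub i) end.

Let ptv (v : V) (i : nat) : V :=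
  match v with existT m (t, x) =>
    oapp (fun j : 'I_m => pt (t j) (x j)) (mkV t x) (insub i) end.

Let OpE f v : S v -> Op P xi f v = f v - \sum_(i < D) rdv v i * f (ptv v i).
Proof.
case: v => m [t x] [/= /andP[_ mD] _]; congr (_ - _).
rewrite (eq_bigr (fun j : 'I_m => rdv (mkV t x) j * f (ptv (mkV t x) j))); last first.
  by move=> j _; rewrite /= !valK.
rewrite (big_ord_widen D (fun j => rdv (mkV t x) j * f (ptv (mkV t x) j)))// big_mkcond /=.
by apply: eq_bigr => i _; case: ifPn => // mi; rewrite !insubN// mul0r.
Qed.

Let rdv_le v i : S v -> `|rdv v i| <= 1.
Proof.
case: v => m [t x] [/= mD _]; have m2 : (0 < m <= 2 * D)%N by lia.
case: insubP => [j _ _|_] /=; last by rewrite normr0.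
exact: (Rdot_bound Hiid HC1 HC3 D0).
Qed.

Let ptvS v i : S v -> S (ptv v i).
Proof.
case: v => m [t x] Sv; rewrite /=; case: insubP => [j _ _|_] //=.
by apply: inV_pt; case: Sv.
Qed.

(** The coefficients Rdot may vary discontinuously with the index, so their values themselves are
    sorted into bins of width 1/(n+1) covering [-1, 1]. *)
Let bin n (r : R) : 'I_(2 * n.+1).+1 := inord (Num.truncn ((r + 1) * n.+1%:R)).

Let bin_dist n (r r' : R) : `|r| <= 1 -> `|r'| <= 1 -> bin n r = bin n r' ->
  `|r - r'| <= n.+1%:R^-1.
Proof.
have n0 : 0 < n.+1%:R :> R by rewrite ltr0n.
have tr (s : R) : `|s| <= 1 -> let m := Num.truncn ((s + 1) * n.+1%:R) in
    (m < (2 * n.+1).+1)%N /\ m%:R <= (s + 1) * n.+1%:R < m.+1%:R.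
  rewrite ler_norml => /andP[s1 s2] m.
  have p : 0 <= (s + 1) * n.+1%:R by rewrite mulr_ge0 ?(ltW n0)//; lra.
  have /andP[h1 h2] := truncn_itv p; rewrite h1 h2; split=> //.
  rewrite ltnS -(ler_nat R); apply: le_trans h1 _.
  by rewrite natrM ler_pM2r//; lra.
move=> /tr[m1 /andP[h1 h2]] /tr[m2 /andP[h3 h4]] /(congr1 val).
rewrite /= !inordK// => e; rewrite e in h1 h2.
rewrite -(ler_pM2r n0) mulVf ?gt_eqF// -{1}(gtr0_norm n0) -normrM mulrBl ler_norml.
move: h1 h2 h3 h4; rewrite !mulrDl !mul1r -natr1; set a := r * _; set b := r' * _.
by move=> *; apply/andP; split; lra.
Qed.

Context {dO' : measure_display} {Om' : measurableType dO'}.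
Variables (P' : probability Om' R) (W : Om' -> V -> R).
Hypotheses (GW : gaussian_process P' W (CovR P xi) S)
  (UW : forall w, unif_cont S (sd_semimetric P' W) (W w)).

Lemma WhatLim_ae_unif_cont : {ae P', forall w, unif_cont S'
  (sd_semimetric P' (WhatLim P xi W)) (WhatLim P xi W w)}.
Proof.
have [K [key [_ k2 _ _]]] := key_system Hiid HC1 HC2 HC3 D0 M0 HC4.
(* Within a cell W varies little both at v and at each single-coordinate index, and the coefficients
   differ by at most 1/(n+1); as W is bounded along a path, hat W varies little too. *)
pose cell n v : K n * {ffun 'I_D -> K n * 'I_(2 * n.+1).+1} :=
  (key n v, [ffun i : 'I_D => (key n (ptv v i), bin n (rdv v i))]).
apply: (ae_unif_cont (c := cell)).
  move=> v [Sv _]; have sW u : S u -> sqi P' (fun w => W w u).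
    by move=> Su; split; [exact: GW.1|exact: (gauss_sqr Hiid HC1 HC2 HC3 D0 M0 GW Su).1].
  under eq_fun do rewrite WhatLimE OpE//; apply: sqiB; first exact: sW.
  by apply: sqi_sum => i; apply: sqiZ; apply: sW; exact: ptvS.
move=> w e e0; have c0 : 0 < 2 + D%:R :> R by rewrite ltr_pwDl.
pose e1 := e / (2 + D%:R); have e10 : 0 < e1 by rewrite divr_gt0.
have [q0 Hq] := limit_osc Hiid HC1 HC2 HC3 D0 M0 GW UW k2 w e10.
have [B HB] := limit_bnd Hiid HC1 HC2 HC3 D0 M0 GW UW k2 w.
have [n [qn Bn]] : exists n, (q0 <= n)%N /\ D%:R * (n.+1%:R^-1 * B) <= e1.
  near \oo => n; exists n; split; first by near: n; exact: nbhs_infty_ge.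
  rewrite mulrA mulrAC ler_pdivrMr// [leRHS]mulrC -ler_pdivrMr//.
  have h : D%:R * B / e1 <= n%:R by near: n; exact: nbhs_infty_ger.
  by apply: le_trans h _; rewrite ler_nat.
exists n => v v' [Sv _] [Sv' _] [kv /ffunP fv].
rewrite WhatLimE !OpE// -[in leRHS](divfK (lt0r_neq0 c0) e) -/e1.
set a := \sum_(i < D) _; set b := \sum_(i < D) _.
have -> : W w v - a - (W w v' - b) = (W w v - W w v') - (a - b) by ring.
apply: le_trans (ler_normB _ _) _.
have -> : e1 * (2 + D%:R) = e1 + (D%:R * e1 + e1) by ring.
apply: lerD; first exact: (Hq n qn v v' Sv Sv' kv).
rewrite /a /b -sumrB; apply: le_trans (ler_norm_sum _ _ _) _.
apply: (@le_trans _ _ (\sum_(i < D) (e1 + n.+1%:R^-1 * B))); last first.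
  by rewrite sumr_const card_ord -[_ *+ _]mulr_natl mulrDr lerD2l.
apply: ler_sum => i _; have := fv i; rewrite !ffunE => -[kp bp].
have Sp := ptvS i Sv; have Sp' := ptvS i Sv'.
set r := rdv v i in bp *; set r' := rdv v' i in bp *.
have -> : r * W w (ptv v i) - r' * W w (ptv v' i) =
   r * (W w (ptv v i) - W w (ptv v' i)) + (r - r') * W w (ptv v' i) by ring.
apply: le_trans (ler_normD _ _) _; rewrite !normrM; apply: lerD.
  rewrite -[leRHS]mul1r; apply: ler_pM => //; first exact: rdv_le.
  exact: (Hq n qn _ _ Sp Sp' kp).
apply: ler_pM => //; last exact: HB.
by apply: bin_dist => //; exact: rdv_le.
Unshelve. all: by end_near.
Qed.

End LimitContinuity.
Theorem theorem2 (R : realType) (T : pseudoMetricType R)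
  (dO : measure_display) (Om : measurableType dO) (P : probability Om R)
  (xi : nat -> Om -> T -> R) (k : nat -> R) (D : nat) (M : R) :
  hausdorff_space T -> compact [set: T] ->
  iid P xi -> C1 P xi -> C2 k -> C3 P xi D -> C4 P xi -> C6 P xi D ->
  C7 P xi k D ->
  (0 < D)%N -> 0 < M ->
  (forall m, (0 < m <= D)%N -> forall e : R, 0 < e ->
     outerP P [set w | (e%:E <
        ereal_sup [set (`| What P xi k n tx.1 tx.2 w - Wemp P xi k n tx.1 tx.2 w
           + \sum_(j < m) Rdot P xi tx.1 j tx.2 *
               Wemp P xi k n (fun _ : 'I_1 => tx.1 j) (fun _ => tx.2 j) w |)%:E
          | tx in [set tx : ('I_m -> T) * ('I_m -> R) |
                     injective tx.1 /\ forall i, (0 <= tx.2 i <= M)%R]])%E]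
     @[n --> \oo] --> 0%E)
  /\
  (forall (dO' : measure_display) (Om' : measurableType dO')
     (P' : probability Om' R) (W : Om' -> Vidx T -> R),
     gaussian_process P' W (CovR P xi) (inV D M) ->
     (forall w, unif_cont (inV D M) (sd_semimetric P' W) (W w)) ->
     weak_conv P (WhatV P xi k) P' (WhatLim P xi W) (inV' D M)
     /\ {ae P', forall w, unif_cont (inV' D M)
                  (sd_semimetric P' (WhatLim P xi W)) (WhatLim P xi W w)}).
Proof.
move=> _ _ Hiid HC1 HC2 HC3 HC4 HC6 HC7 D0 M0; split.
  by move=> m mD e e0; exact: (rank_expansion Hiid HC1 HC2 HC3 HC4 HC6 HC7 D0 M0 mD e0).
move=> dO' Om' P' W GW UW; split.
  exact: (WhatV_weak_conv Hiid HC1 HC2 HC3 HC4 HC6 HC7 D0 M0 GW UW).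
exact: (WhatLim_ae_unif_cont Hiid HC1 HC2 HC3 HC4 D0 M0 GW UW).
Qed.
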